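(* Let $k\ge 1$ and let $f:\mathbf{P}^k\rightarrow \mathbf{P}^k$ be a holomorphic map of algebraic degree $d>1$. If $f$ is $k$-critically finite, then the Fatou set for $f$ is empty.
   Context: $\mathbf{P}^k$ is complex projective space of dimension $k$. The Fatou set of $f$ is the largest open subset of $\mathbf{P}^k$ on which the family of iterates $\{f^n\}_{n\ge 1}$ is normal. Definitions. The critical set is $C_1=\{p\in\mathbf{P}^k : \operatorname{rank}(df(p))<k\}$. Put $D_1=\bigcup_{j=1}^{\infty}f^j(C_1)$ and $E_1=\bigcap_{j=1}^{\infty}f^j(\overline{D_1})$. The map $f$ is critically finite of order 1 (or just critically finite) if $D_1$ (hence $E_1$) is an algebraic set. Inductively, if $1<n\le k$ and $f$ is critically finite of order $n-1$, put $C_n=C_1\cap E_{n-1}$, $D_n=\bigcup_{j=1}^{\infty}f^j(C_n)$, $E_n=\bigcap_{j=1}^{\infty}f^j(\overline{D_n})$; then $f$ is critically finite of order $n$ if $D_n$ (hence $E_n$) is an algebraic set. If $f$ is critically finite of order $n$, a periodic irreducible component $L$ of $E_n$ is said to be in a critical cycle if at least one of the forward images of $L$ under $f$ is contained in $C_1$, and $F_n$ denotes the union of those irreducible components of $E_n$ (of codimension less than or equal to $n$) which are in a critical cycle. The map $f$ is $1$-critically finite if it is critically finite of order 1 and $C_1$ and $E_1$ have no common irreducible component, i.e. $F_1=\emptyset$. For $1<n\le k$, $f$ is $n$-critically finite if it is $(n-1)$-critically finite, critically finite of order $n$, and $E_n$ has no irreducible component contained in $C_1$, i.e. $F_n=\emptyset$.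 *)

(* Defs.v *)
From HB Require Import structures.
From mathcomp Require Import all_boot all_order all_algebra.
From mathcomp Require Import all_classical all_reals all_analysis.
From mathcomp Require Import complex.
(* Not imported: its notations clash with those of mathcomp-analysis. *)
From mathcomp Require mpoly.

Set Implicit Arguments.
Unset Strict Implicit.
Unset Printing Implicit Defensive.

Import Order.TTheory GRing.Theory Num.Theory.
Import numFieldNormedType.Exports.

Local Open Scope classical_set_scope.
Local Open Scope quotient_scope.
Local Open Scope ring_scope.

(* C is meant to be R[i] with R : realType; for an abstract numClosedFieldType
   the topology and the normed-module structures are inferred. *)
Section ProjectiveSpace.
Variables (C : numClosedFieldType) (k : nat).

Definition collinear (u v : {v : 'rV[C]_k.+1 | v != 0}) : bool :=
  `[< exists2 a : C, a != 0 & val u = a *: val v >].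

Lemma collinear_refl : reflexive collinear.
Proof. by move=> u; apply/asboolP; exists 1; rewrite ?oner_eq0 ?scale1r. Qed.

Lemma collinear_sym : symmetric collinear.
Proof.
suff H u v : collinear u v -> collinear v u by move=> u v; apply/idP/idP => /H.
move=> /asboolP[a a0 uv]; apply/asboolP; exists a^-1; first by rewrite invr_eq0.
by rewrite uv scalerA mulVf// scale1r.
Qed.

Lemma collinear_trans : transitive collinear.
Proof.
move=> v u w /asboolP[a a0 uv] /asboolP[b b0 vw]; apply/asboolP.
by exists (a * b); rewrite ?mulf_neq0// uv vw scalerA.
Qed.

Canonical collinear_equiv :=
  EquivRel collinear collinear_refl collinear_sym collinear_trans.

Definition proj_quot := {eq_quot collinear_equiv}.
HB.instance Definition _ := Choice.on proj_quot.
HB.instance Definition _ := Quotient.on proj_quot.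

Definition hcoord (p : proj_quot) : 'rV[C]_k.+1 := val (repr p).

(* Matrix of the orthogonal projection (acting on row vectors) onto C v. *)
Definition orthoproj (v : 'rV[C]_k.+1) : 'M[C]_k.+1 :=
  \matrix_(i, j) ((v 0 i)^* * v 0 j / \sum_l `|v 0 l| ^+ 2).

(* The topology and the uniformity are induced by the embedding of lines as
   orthogonal projections; by open_proj_spaceE below this is the quotient
   topology, and P^k being compact Hausdorff, its compatible uniformity is
   unique. *)
Definition proj_space : Type :=
  initial_topology (fun p : proj_quot => orthoproj (hcoord p)).
HB.instance Definition _ := Choice.on proj_space.
HB.instance Definition _ := Uniform.on proj_space.

Definition line (v : 'rV[C]_k.+1) (v0 : v != 0) : proj_space :=
  \pi_proj_quot (exist _ v v0).

Lemma hcoord_neq0 (p : proj_space) : hcoord p != 0.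
Proof. exact: valP (repr p). Qed.

Lemma hcoordK (p : proj_space) : line (hcoord_neq0 p) = p.
Proof.
rewrite /line -[RHS]reprK; congr (\pi _).
by apply/val_inj.
Qed.

Lemma line_eq (u v : 'rV[C]_k.+1) (u0 : u != 0) (v0 : v != 0) :
  line u0 = line v0 <-> exists2 a : C, a != 0 & u = a *: v.
Proof.
split=> [/eqP|h]; first by rewrite eqmodE => /asboolP.
by apply/eqP; rewrite eqmodE; apply/asboolP.
Qed.

Lemma orthoprojZ (a : C) (v : 'rV[C]_k.+1) :
  a != 0 -> orthoproj (a *: v) = orthoproj v.
Proof.
move=> a0; apply/matrixP => i j; rewrite !mxE.
rewrite (eq_bigr (fun l => `|a| ^+ 2 * `|v 0 l| ^+ 2)); last first.
  by move=> l _; rewrite mxE normrM exprMn.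
rewrite -mulr_sumr rmorphM /= mulrACA (mulrC a^*) -normCK invfM.
by rewrite mulrACA divff ?mul1r// expf_neq0// normr_eq0.
Qed.

Lemma orthoproj_line (v : 'rV[C]_k.+1) (v0 : v != 0) :
  orthoproj (hcoord (line v0)) = orthoproj v.
Proof.
have := hcoordK (line v0) => /line_eq[a a0 ->].
exact: orthoprojZ.
Qed.

Lemma sum_normsq_neq0 (v : 'rV[C]_k.+1) :
  v != 0 -> \sum_l `|v 0 l| ^+ 2 != 0.
Proof.
apply: contra => /eqP v0; apply/eqP/rowP => i; rewrite mxE.
have /(_ i isT)/eqP := psumr_eq0P (fun l _ => exprn_ge0 2 (normr_ge0 (v 0 l))) v0.
by rewrite expf_eq0 normr_eq0 => /eqP.
Qed.

Lemma mulmx_orthoproj (u v : 'rV[C]_k.+1) :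
  u *m orthoproj v =
  ((\sum_i u 0 i * (v 0 i)^*) / \sum_l `|v 0 l| ^+ 2) *: v.
Proof.
apply/rowP => j; rewrite !mxE mulrAC mulr_suml mulr_suml.
by apply: eq_bigr => i _; rewrite mxE !mulrA.
Qed.

Lemma mulmx_orthoproj_id (v : 'rV[C]_k.+1) : v != 0 -> v *m orthoproj v = v.
Proof.
move=> v0; rewrite mulmx_orthoproj.
under eq_bigr => i _ do rewrite -normCK.
by rewrite divff ?scale1r// sum_normsq_neq0.
Qed.

Lemma cvg_mx (T : topologicalType) (m n : nat) (f : T -> 'M[C]_(m, n)) (x : T) :
  (forall i j, (fun y => f y i j) @ x --> f x i j) -> f @ x --> f x.
Proof.
move=> fx A [P nP PA]; rewrite /= nbhs_filterE /=.
have : \forall y \near x, forall ij : 'I_m * 'I_n, P ij.1 ij.2 (f y ij.1 ij.2).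
  by apply: filter_forall => -[i j] /=; exact: fx (nP i j).
by apply: filterS => y Py; apply: PA => i j; exact: (Py (i, j)).
Qed.

Lemma cvg_sumr (T : topologicalType) n (f : 'I_n -> T -> C) (x : T) :
  (forall i, f i @ x --> f i x) ->
  (fun y => \sum_i f i y) @ x --> \sum_i f i x.
Proof.
move=> fx; apply: (@cvg_big _ _ +%R) => [|i _]; last exact: fx.
exact: add_continuous.
Qed.

Lemma orthoproj_continuous (v : 'rV[C]_k.+1) :
  v != 0 -> orthoproj @ v --> orthoproj v.
Proof.
move=> v0; apply: cvg_mx => i j.
have cc l : (fun u : 'rV[C]_k.+1 => u 0 l) @ v --> v 0 l by exact: coord_continuous.
have cJ (a : C) : (fun z : C => z^*) @ a --> a^*.
  move=> A /nbhs_ballP[e e0 eA]; apply/nbhs_ballP; exists e => // z.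
  rewrite -ball_normE /= => az; apply: eA.
  by rewrite -ball_normE /= -rmorphB norm_conjC.
under eq_fun do rewrite mxE.
rewrite mxE.
have cN : (fun u : 'rV[C]_k.+1 => \sum_l `|u 0 l| ^+ 2) @ v
    --> \sum_l `|v 0 l| ^+ 2.
  apply: (@cvg_sumr _ _ (fun l (u : 'rV[C]_k.+1) => `|u 0 l| ^+ 2)) => l.
  have cn : (fun u : 'rV[C]_k.+1 => `|u 0 l|) @ v --> `|v 0 l|.
    exact: cvg_norm (cc l).
  exact: (cvgM cn cn).
exact: (cvgM (cvgM (cvg_comp _ _ (cc i) (cJ _)) (cc j))
             (cvgV (sum_normsq_neq0 v0) cN)).
Qed.

Lemma open_proj_spaceE (U : set proj_space) :
  open U <-> open [set v : 'rV[C]_k.+1 | exists v0 : v != 0, U (line v0)].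
Proof.
split=> [[W oW <-]|oV].
  rewrite openE => v [v0 /= Wv]; rewrite orthoproj_line in Wv.
  have nz : \forall w \near v, w != 0.
    have o0 : open [set~ (0 : 'rV[C]_k.+1)].
      exact/closed_openC/accessible_closed_set1/hausdorff_accessible/norm_hausdorff.
    apply: (filterS _ (open_nbhs_nbhs (conj o0 _))) => [w /eqP//|].
    exact/eqP.
  have nW : \forall w \near v, W (orthoproj w).
    by apply: orthoproj_continuous v0 _ _; exact: open_nbhs_nbhs.
  rewrite /interior; near=> w.
  have w0 : w != 0 by near: w.
  by exists w0; rewrite /= orthoproj_line; near: w.
rewrite openE => p Up; set x := hcoord p.
set V := [set v | _] in oV.
have Vx : V (x *m orthoproj x).
  rewrite mulmx_orthoproj_id ?hcoord_neq0//; exists (hcoord_neq0 p).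
  by rewrite hcoordK.
have cg : (fun M : 'M[C]_k.+1 => x *m M) @ orthoproj x --> x *m orthoproj x.
  apply: cvg_mx => i j; under eq_fun do rewrite mxE.
  rewrite mxE; apply: (@cvg_sumr _ _ (fun l (M : 'M[C]_k.+1) => x i l * M l j)) => l.
  exact: (cvgM (cvg_cst _) (@coord_continuous _ _ _ l j (orthoproj x))).
have /cg nV : nbhs (x *m orthoproj x) V by exact: open_nbhs_nbhs.
have ci : continuous (fun q : proj_space => orthoproj (hcoord q)).
  exact: (@initial_continuous proj_quot _ (fun p => orthoproj (hcoord p))).
have nU : nbhs p [set q : proj_space | V (x *m orthoproj (hcoord q))].
  exact: ci p _ nV.
apply: (filterS _ nU) => q [xq0].
have [] := eqVneq (\sum_i x 0 i * (hcoord q 0 i)^*) 0.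
  move=> s0 _; case/eqP: (xq0).
  by rewrite mulmx_orthoproj s0 mul0r scale0r.
move=> s0; suff -> : line xq0 = q by [].
rewrite -[RHS]hcoordK; apply/line_eq.
exists ((\sum_i x 0 i * (hcoord q 0 i)^*) / \sum_l `|hcoord q 0 l| ^+ 2).
  by rewrite mulf_neq0// invr_eq0 sum_normsq_neq0// hcoord_neq0.
exact: mulmx_orthoproj.
Unshelve. all: by end_near. Qed.

End ProjectiveSpace.

Section AlgebraicSets.
Variables (C : numClosedFieldType) (k : nat).
Local Notation P := (proj_space C k).
Implicit Types (A L : set P).

Definition heval (d : nat) (q : mpoly.dhomog k.+1 C d) (v : 'rV[C]_k.+1) : C :=
  mpoly.meval (v 0) (mpoly.mpoly_of_dhomog q).

Definition algebraic A :=
  exists (m : nat) (d : 'I_m -> nat)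
         (q : forall i, mpoly.dhomog k.+1 C (d i)),
    A = [set p | forall i, heval (q i) (hcoord p) = 0].

Definition irreducible A :=
  [/\ algebraic A, A !=set0 &
      forall A1 A2, algebraic A1 -> algebraic A2 ->
        A `<=` A1 `|` A2 -> A `<=` A1 \/ A `<=` A2].

Definition irr_component L A :=
  [/\ irreducible L, L `<=` A &
      forall L', irreducible L' -> L' `<=` A -> L `<=` L' -> L' = L].

End AlgebraicSets.

Section HolomorphicMaps.
Variables (C : numClosedFieldType) (k : nat).
Local Notation P := (proj_space C k).
Implicit Types (f : P -> P) (i j : 'I_k.+1) (p : P).

Definition chart_dom i : set P := [set p | hcoord p 0 i != 0].

Definition chart i p : 'rV[C]_k :=
  \row_j (hcoord p 0 (lift i j) / hcoord p 0 i).

Definition chart_inv_vec i (z : 'rV[C]_k) : 'rV[C]_k.+1 :=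
  \row_j oapp (z 0) 1 (unlift i j).

Lemma chart_inv_vec_neq0 i (z : 'rV[C]_k) : chart_inv_vec i z != 0.
Proof.
apply/eqP => /rowP/(_ i); rewrite !mxE unlift_none /=.
by apply/eqP; rewrite oner_eq0.
Qed.

Definition chart_inv i (z : 'rV[C]_k) : P := line (chart_inv_vec_neq0 i z).

Definition in_charts i j f : 'rV[C]_k -> 'rV[C]_k :=
  chart j \o f \o chart_inv i.

Definition holomorphic f :=
  continuous f /\
  forall i j p, chart_dom i p -> chart_dom j (f p) ->
    differentiable (in_charts i j f) (chart i p).

(* f = [F_0 : ... : F_k] with F_i homogeneous of degree d and without common
   zero in C^(k+1) \ {0}. *)
Definition has_algebraic_degree f (d : nat) :=
  exists F : 'I_k.+1 -> mpoly.dhomog k.+1 C d,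
    forall (v : 'rV[C]_k.+1) (v0 : v != 0),
      exists Fv0 : \row_i heval (F i) v != 0, f (line v0) = line Fv0.

(* For holomorphic f the rank does not depend on the charts i around p and j
   around f p. *)
Definition critical_set f : set P :=
  [set p | exists i j, [/\ chart_dom i p, chart_dom j (f p) &
     (\rank (jacobian (in_charts i j f) (chart i p)) < k)%N]].

End HolomorphicMaps.

Section FatouSet.
Variables (C : numClosedFieldType) (k : nat).
Local Notation P := (proj_space C k).

Definition normal_on (U : set P) (F : set (P -> P)) :=
  forall s : nat -> P -> P, (forall n, F (s n)) ->
    exists2 phi : nat -> nat, {homo phi : m n / (m < n)%N} &
    exists g : P -> P, forall K : set P, compact K -> K `<=` U ->
      {uniform K, (fun n => s (phi n)) @ \oo --> g}.

Definition iterates (f : P -> P) : set (P -> P) :=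
  [set iter n f | n in [set n | (0 < n)%N]].

(* Normality being local, this union is the largest open set on which the
   iterates are normal. *)
Definition fatou_set (f : P -> P) : set P :=
  \bigcup_(U in [set U : set P | open U /\ normal_on U (iterates f)]) U.

End FatouSet.

Section CriticallyFinite.
Variables (C : numClosedFieldType) (k : nat).
Local Notation P := (proj_space C k).
Variable f : P -> P.

Definition post_orbit (A : set P) : set P :=
  \bigcup_(j in [set j | (0 < j)%N]) (iter j f @` A).

Definition omega_limit (A : set P) : set P :=
  \bigcap_(j in [set j | (0 < j)%N]) (iter j f @` closure (post_orbit A)).

(* C_n, D_n and E_n for n >= 1; the convention E_0 = P^k gives
   C_1 = critical_set f. *)
Fixpoint E_ (n : nat) : set P :=
  if n is m.+1 then omega_limit (critical_set f `&` E_ m) else setT.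
Definition C_ (n : nat) : set P := critical_set f `&` E_ n.-1.
Definition D_ (n : nat) : set P := post_orbit (C_ n).

Fixpoint crit_finite (n : nat) : Prop :=
  if n is m.+1 then crit_finite m /\ algebraic (D_ n) else True.

Fixpoint n_crit_finite (n : nat) : Prop :=
  match n with
  | 0 => True
  | 1 => crit_finite 1 /\
         ~ exists L, irr_component L (C_ 1) /\ irr_component L (E_ 1)
  | m.+1 => [/\ n_crit_finite m, crit_finite n &
         ~ exists L, irr_component L (E_ n) /\ L `<=` critical_set f]
  end.

End CriticallyFinite.

(* Main.v *)
(* Let F be the homogeneous lift of f to C^(k+1) and J the determinant of its
   differential, so that the critical set is J = 0.

   Critical finiteness: codimension grows along the C_n, so that no point of E_k is
   critical; every orbit therefore meets the critical set a bounded number N of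
   times, and there are a critical point c and a form P with P(c) <> 0 that vanishes
   on the forward images of the critical set. All iterates F^n are then proper maps,
   unramified over P <> 0, with fibres bounded uniformly in n and Lojasiewicz
   exponents at most D^N.

   Uniform preimages: given y and a small cone of lines through y along which P and
   J do not vanish, the points of F^(-n) over the cone are labelled by the points of
   F^(-n)(y) to which they converge, at a speed that does not depend on n. Traces of
   polynomials split accordingly, with Taylor coefficients controlled on the cone,
   and a trace argument shows that each point of F^(-n)(y'), for y' near y, is close
   to a point of F^(-n)(q), with q in the cone independent of n.

   If p is a Fatou point, choose y as a limit of normalised images F^(n_j)(p) and
   lift the line from q to c by F^(n_j), starting near p. Near p the maps F^(n_i)
   and F^(n_j) are projectively close, so the images g of the lifts by F^(n_i) are
   projectively close to the line itself, first near q and then, by the three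
   circles principle, up to c. There 1/J(g) is holomorphic, bounded on a circle
   around c on which J has no zero, and huge at the centre because J(c) = 0: this
   contradicts the maximum principle. *)
Require Import Defs.
From mathcomp Require Import all_boot all_order all_algebra.
From mathcomp Require Import all_classical all_reals all_analysis.
From mathcomp Require Import complex ring lra.
From mathcomp Require Import -(notations) mpoly.

Set Implicit Arguments.
Unset Strict Implicit.
Unset Printing Implicit Defensive.

Import Order.TTheory GRing.Theory Num.Theory.

Local Open Scope ring_scope.
Local Notation Re := complex.Re.
Local Notation Im := complex.Im.

(** * Norms and convergence in C^n *)

Section Modulus.
Variable R : realType.
Local Notation C := R[i].
Implicit Types (z w : C) (n : nat).

(** The number of sheets of the [n]-th iterate of the lift and all its Lipschitz constants are out
    of control as [n] grows. Three things are uniform: the linear bound on fibres, the cone of lines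
    on which nothing vanishes, and the exponent with which the fibre over [y] is approached. The
    proof must therefore measure everything by these three. In the trace argument the number of
    sheets survives as a factor, but it is beaten by powers of 1/2 whose exponents may depend on
    [n], while the width of the cone and the admissible perturbation of [y] involve uniform data
    only. Dimension theory is replaced by the growth of Hilbert functions, for which it is enough
    that forms multiply and that irreducible sets have no zero divisors. The sets [D_n] are
    countable unions of images, so that bounding their codimension requires placing an irreducible
    set inside a single image; this is where the uncountability of the field enters, through a
    Nullstellensatz with countably many inequations. *)

Definition nc z : R := ComplexField.Normc.normc z.

Lemma ncE z : `|z| = (nc z)%:C%C. Proof. by []. Qed.

Lemma nc_ge0 z : 0 <= nc z.
Proof. by rewrite -lecR -ncE normr_ge0. Qed.

Lemma nc0 : nc 0 = 0. Proof. by apply: complexI; rewrite -ncE normr0. Qed.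

Lemma nc1 : nc 1 = 1. Proof. by apply: complexI; rewrite -ncE normr1. Qed.

Lemma nc_eq0 z : (nc z == 0) = (z == 0).
Proof. by rewrite -(inj_eq (@complexI R)) -ncE normr_eq0. Qed.

Lemma nc_gt0 z : (0 < nc z) = (z != 0).
Proof. by rewrite lt_def nc_eq0 nc_ge0 andbT. Qed.

Lemma ncM z w : nc (z * w) = nc z * nc w.
Proof. by apply: complexI; rewrite rmorphM /= -!ncE normrM. Qed.

Lemma ncN z : nc (- z) = nc z.
Proof. by apply: complexI; rewrite -!ncE normrN. Qed.

Lemma ncD z w : nc (z + w) <= nc z + nc w.
Proof. by rewrite -lecR rmorphD /= -!ncE ler_normD. Qed.

Lemma ncB z w : nc (z - w) <= nc z + nc w.
Proof. by rewrite (le_trans (ncD _ _))// ncN. Qed.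

Lemma ncBC z w : nc (z - w) = nc (w - z). Proof. by rewrite -ncN opprB. Qed.

Lemma ncX z n : nc (z ^+ n) = nc z ^+ n.
Proof. by elim: n => [|n IH]; rewrite ?expr0 ?nc1// !exprS ncM IH. Qed.

Lemma ncV z : nc z^-1 = (nc z)^-1.
Proof. by apply: complexI; rewrite fmorphV -!ncE normfV. Qed.

Lemma ncR (a : R) : nc a%:C%C = `|a|.
Proof. by apply: complexI; rewrite -ncE normc_def /= expr0n addr0 sqrtr_sqr. Qed.

Lemma nc_nat n : nc n%:R = n%:R.
Proof. by apply: complexI; rewrite -ncE normr_nat rmorph_nat. Qed.

Lemma nc_sum (I : Type) (r : seq I) (P : pred I) (F : I -> C) :
  nc (\sum_(i <- r | P i) F i) <= \sum_(i <- r | P i) nc (F i).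
Proof.
elim/big_ind2: _ => [|z x w y zx wy|//]; first by rewrite nc0.
by rewrite (le_trans (ncD _ _))// lerD.
Qed.

Lemma nc_prod (I : Type) (r : seq I) (P : pred I) (F : I -> C) :
  nc (\prod_(i <- r | P i) F i) = \prod_(i <- r | P i) nc (F i).
Proof. by elim/big_ind2: _ => [|z x w y <- <-|//]; rewrite ?nc1 ?ncM. Qed.

Lemma ncB_ge z w : nc z - nc w <= nc (z - w).
Proof. by rewrite lerBlDr -{1}(subrK w z) ncD. Qed.

Lemma nc_Re_le z : `|Re z| <= nc z.
Proof. by rewrite -lecR -ncE normc_ge_Re. Qed.

Lemma nc_Im_le z : `|Im z| <= nc z.
Proof.
case: z => a b; rewrite /nc /ComplexField.Normc.normc /= -sqrtr_sqr.
by rewrite ler_sqrt ?addr_ge0 ?sqr_ge0// lerDr sqr_ge0.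
Qed.

Lemma nc_le_ReIm z : nc z <= `|Re z| + `|Im z|.
Proof.
rewrite {1}(complexE z) (le_trans (ncD _ _))// ncM !ncR lerD2l.
have -> : nc 'i%C = 1; last by rewrite mul1r.
by rewrite /nc /ComplexField.Normc.normc /= expr0n expr1n add0r sqrtr1.
Qed.

Lemma nc_sqr z : nc z ^+ 2 = Re z ^+ 2 + Im z ^+ 2.
Proof.
by apply: complexI; rewrite rmorphXn /= -ncE -add_Re2_Im2.
Qed.

End Modulus.

Section VectorNorm.
Variable R : realType.
Local Notation C := R[i].

Definition nm m n (A : 'M[C]_(m, n)) : R := \sum_i \sum_j nc (A i j).

Lemma nm_ge0 m n (A : 'M[C]_(m, n)) : 0 <= nm A.
Proof. by apply: sumr_ge0 => i _; apply: sumr_ge0 => j _; exact: nc_ge0. Qed.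

Lemma nm_coord m n (A : 'M[C]_(m, n)) i j : nc (A i j) <= nm A.
Proof.
rewrite /nm (bigD1 i)//= (bigD1 j)//= -addrA lerDl addr_ge0//.
  by apply: sumr_ge0 => ? _; exact: nc_ge0.
by apply: sumr_ge0 => ? _; apply: sumr_ge0 => ? _; exact: nc_ge0.
Qed.

Lemma nm0 m n : nm (0 : 'M[C]_(m, n)) = 0.
Proof. by rewrite /nm big1// => i _; rewrite big1// => j _; rewrite mxE nc0. Qed.

Lemma nm_eq0 m n (A : 'M[C]_(m, n)) : (nm A == 0) = (A == 0).
Proof.
apply/eqP/eqP => [A0|->]; last exact: nm0.
apply/matrixP => i j; rewrite mxE; apply/eqP; rewrite -nc_eq0.
by rewrite eq_le nc_ge0 -A0 nm_coord.
Qed.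

Lemma nm_gt0 m n (A : 'M[C]_(m, n)) : (0 < nm A) = (A != 0).
Proof. by rewrite lt_def nm_eq0 nm_ge0 andbT. Qed.

Lemma nmN m n (A : 'M[C]_(m, n)) : nm (- A) = nm A.
Proof.
by apply: eq_bigr => i _; apply: eq_bigr => j _; rewrite mxE ncN.
Qed.

Lemma nmBC m n (A B : 'M[C]_(m, n)) : nm (A - B) = nm (B - A).
Proof. by rewrite -nmN opprB. Qed.

Lemma nmD m n (A B : 'M[C]_(m, n)) : nm (A + B) <= nm A + nm B.
Proof.
rewrite -big_split/=; apply: ler_sum => i _; rewrite -big_split/=.
by apply: ler_sum => j _; rewrite mxE ncD.
Qed.

Lemma nmB m n (A B : 'M[C]_(m, n)) : nm (A - B) <= nm A + nm B.
Proof. by rewrite (le_trans (nmD _ _))// nmN. Qed.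

Lemma nmB_ge m n (A B : 'M[C]_(m, n)) : nm A - nm B <= nm (A - B).
Proof. by rewrite lerBlDr -{1}(subrK B A) nmD. Qed.

Lemma nm_tri m n (B A D : 'M[C]_(m, n)) : nm (A - D) <= nm (A - B) + nm (B - D).
Proof. by rewrite -{1}(subrK B A) -addrA nmD. Qed.

Lemma nmZ m n a (A : 'M[C]_(m, n)) : nm (a *: A) = nc a * nm A.
Proof.
rewrite /nm mulr_sumr; apply: eq_bigr => i _.
by rewrite mulr_sumr; apply: eq_bigr => j _; rewrite mxE ncM.
Qed.

Lemma nm_mul m n p (A : 'M[C]_(m, n)) (B : 'M[C]_(n, p)) :
  nm (A *m B) <= nm A * nm B.
Proof.
rewrite /nm mulr_suml; apply: ler_sum => i _.
apply: (@le_trans _ _ (\sum_k \sum_j nc (A i j) * nc (B j k))).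
  apply: ler_sum => k _; rewrite mxE (le_trans (nc_sum _ _ _))//.
  by apply: ler_sum => j _; rewrite ncM.
rewrite exchange_big/= mulr_suml; apply: ler_sum => j _.
rewrite -mulr_sumr ler_wpM2l ?nc_ge0// (bigD1 j)//= lerDl.
by apply: sumr_ge0 => ? _; apply: sumr_ge0 => ? _; exact: nc_ge0.
Qed.

Lemma nm_lt_coord n (v : 'rV[C]_n) (e : R) : 0 < e ->
  (forall i, nc (v 0 i) < e) -> nm v <= n%:R * e.
Proof.
move=> e0 ve; rewrite /nm big_ord_recl big_ord0 addr0.
apply: (@le_trans _ _ (\sum_(i < n) e)).
  by apply: ler_sum => i _; exact: ltW.
by rewrite sumr_const card_ord mulr_natl.
Qed.

End VectorNorm.

Section Sequences.
Variable R : realType.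
Local Notation C := R[i].

Lemma extraction (Q : nat -> nat -> Prop) :
  (forall k N, exists2 n, (N <= n)%N & Q k n) ->
  exists2 phi : nat -> nat, {homo phi : i j / (i < j)%N} & forall k, Q k (phi k).
Proof.
move=> H; pose g k N := sval (cid2 (H k N)).
have gP k N : (N <= g k N)%N /\ Q k (g k N) by rewrite /g; case: cid2.
pose phi := fix phi k := if k is k'.+1 then g k (phi k').+1 else g 0%N 0%N.
exists phi; last by case=> [|k]; [case: (gP 0%N 0%N)|case: (gP k.+1 (phi k).+1)].
apply: homo_ltn => [|k]; first exact: ltn_trans.
by case: (gP k.+1 (phi k).+1).
Qed.

Lemma homo_ge (phi : nat -> nat) : {homo phi : i j / (i < j)%N} ->
  forall n, (n <= phi n)%N.
Proof. by move=> h; elim=> // n IH; rewrite (leq_ltn_trans IH)// h. Qed.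

Definition cvr (u : nat -> R) (l : R) :=
  forall e, 0 < e -> exists N, forall n, (N <= n)%N -> `|u n - l| < e.

Lemma cvr_sub u l phi : cvr u l -> {homo phi : i j / (i < j)%N} ->
  cvr (u \o phi) l.
Proof.
move=> ul hp e /ul[N HN]; exists N => n Nn; apply: HN.
exact: leq_trans Nn (homo_ge hp n).
Qed.

Lemma archi_inv (e : R) : 0 < e -> exists N : nat, N.+1%:R^-1 < e.
Proof.
move=> e0; have e1 : 0 <= e^-1 by rewrite invr_ge0 ltW.
exists (Num.Def.archi_bound e^-1).
rewrite -[ltRHS]invrK ltf_pV2 ?posrE ?invr_gt0//.
rewrite (lt_trans (archi_boundP e1))// ltr_nat//.
Qed.

Lemma inv_nat_le (i j : nat) : (i <= j)%N -> j.+1%:R^-1 <= i.+1%:R^-1 :> R.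
Proof. by move=> ij; rewrite lef_pV2 ?posrE ?ltr0n// ler_nat. Qed.

(** The limit is the upper limit of [u], obtained as the supremum of the reals that [u] reaches or
    exceeds at arbitrarily large indices. *)
Lemma bw_real (u : nat -> R) (M : R) : (forall n, `|u n| <= M) ->
  exists phi, {homo phi : i j / (i < j)%N} /\ exists l, cvr (u \o phi) l.
Proof.
move=> uM; pose S : set R := fun x : R => forall N, exists2 n, (N <= n)%N & x <= u n.
have hS : has_sup S.
  split; first by exists (- M) => N; exists N => //; rewrite lerNl (le_trans _ (uM N))// -normrN ler_norm.
  exists M => x /(_ 0%N)[n _ xu]; apply: le_trans xu (le_trans (ler_norm _) (uM n)).
set l := sup S.
have cl k N : exists2 n, (N <= n)%N & `|u n - l| < k.+1%:R^-1.
  have e0 : 0 < k.+1%:R^-1 :> R by rewrite invr_gt0 ltr0n.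
  set e := k.+1%:R^-1 in e0 *.
  have /existsNP[N1 HN1] : ~ S (l + e).
    by move=> /(ub_le_sup hS.2); rewrite -/l gerDl leNgt e0.
  have [x Sx xl] := sup_adherent e0 hS.
  have [n nN xu] := Sx (maxn N N1).
  exists n; first exact: leq_trans (leq_maxl _ _) nN.
  have un : u n < l + e.
    rewrite ltNge; apply/negP => ?; apply: HN1; exists n => //.
    exact: leq_trans (leq_maxr _ _) nN.
  by rewrite ltr_norml; apply/andP; split; move: un xu xl; rewrite -/l; lra.
have [phi hp H] := extraction cl.
exists phi; split=> //; exists l => e /archi_inv[N Ne]; exists N => n Nn /=.
exact: lt_trans (lt_le_trans (H n) (inv_nat_le Nn)) Ne.
Qed.

Lemma bw_family (I : eqType) (u : I -> nat -> R) (M : R) (s : seq I) :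
  (forall i n, `|u i n| <= M) ->
  exists phi, {homo phi : i j / (i < j)%N} /\
    forall i, i \in s -> exists l, cvr (u i \o phi) l.
Proof.
move=> uM; elim: s => [|i s [phi [hp H]]]; first by exists id; split.
have [|psi [hq [l Hl]]] := @bw_real (u i \o phi) M; first by move=> n; exact: uM.
exists (phi \o psi); split=> [a b /hq /hp//|j].
rewrite inE => /orP[/eqP->|/H[l' Hl']]; first by exists l.
by exists l'; exact: (cvr_sub Hl').
Qed.

Definition cvs m n (u : nat -> 'M[C]_(m, n)) (l : 'M[C]_(m, n)) :=
  forall e, 0 < e -> exists N, forall k, (N <= k)%N -> nm (u k - l) < e.

Lemma cvs_sub m n (u : nat -> 'M[C]_(m, n)) l phi :
  cvs u l -> {homo phi : i j / (i < j)%N} -> cvs (u \o phi) l.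
Proof.
move=> ul hp e /ul[N HN]; exists N => k Nk; apply: HN.
exact: leq_trans Nk (homo_ge hp k).
Qed.

Lemma eventually_forall (I : finType) (P : I -> nat -> Prop) :
  (forall i, exists N, forall k, (N <= k)%N -> P i k) ->
  exists N, forall k, (N <= k)%N -> forall i, P i k.
Proof.
move=> /choice[N HN]; exists (\max_i N i) => k Nk i; apply: HN.
exact: leq_trans (leq_bigmax i) Nk.
Qed.

Lemma bw m n (u : nat -> 'M[C]_(m, n)) (M : R) : (forall k, nm (u k) <= M) ->
  exists phi, {homo phi : i j / (i < j)%N} /\ exists l, cvs (u \o phi) l.
Proof.
move=> uM; pose w (i : ('I_m * 'I_n) * bool) k :=
  if i.2 then Re (u k i.1.1 i.1.2) else Im (u k i.1.1 i.1.2).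
have wM i k : `|w i k| <= M.
  apply: (le_trans _ (le_trans (nm_coord (u k) i.1.1 i.1.2) (uM k))).
  by rewrite /w; case: i.2; rewrite ?nc_Re_le ?nc_Im_le.
have [phi [hp H]] := bw_family (enum {: ('I_m * 'I_n) * bool}) wM.
exists phi; split=> //.
have {}H i : exists l, cvr (w i \o phi) l by apply: H; rewrite mem_enum.
have [l Hl] := choice H.
exists (\matrix_(i, j) (l ((i, j), true) +i* l ((i, j), false))%C) => e e0.
pose d : R := e / (2 * (m * n).+1%:R).
have d0 : 0 < d by rewrite divr_gt0// mulr_gt0// ltr0n.
have [N HN] := eventually_forall (fun i => Hl i d d0).
exists N => k /HN {}HN.
apply: (@le_lt_trans _ _ (\sum_(i < m) \sum_(j < n) (d + d))).
  apply: ler_sum => i _; apply: ler_sum => j _.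
  apply: le_trans (nc_le_ReIm _) _; apply: lerD; apply: ltW.
    by have := HN ((i, j), true); rewrite /w /= !mxE; case: (u (phi k) i j).
  by have := HN ((i, j), false); rewrite /w /= !mxE; case: (u (phi k) i j).
under eq_bigr do rewrite sumr_const card_ord.
rewrite sumr_const card_ord -mulrnA mulnC -mulr_natr.
have -> : d + d = e / (m * n).+1%:R.
  have : (m * n).+1%:R != 0 :> R by rewrite pnatr_eq0.
  by rewrite /d; move: _%:R => x x0; field.
rewrite mulrAC -mulrA gtr_pMr// ltr_pdivrMr ?mul1r ?ltr_nat ?ltr0n//.
Qed.

Lemma cvs_bounded m n (u : nat -> 'M[C]_(m, n)) l : cvs u l ->
  exists M, forall k, nm (u k) <= M.
Proof.
move=> /(_ 1 ltr01)[N HN].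
exists (nm l + 1 + \sum_(k < N) nm (u k)) => k.
have S0 : 0 <= \sum_(k < N) nm (u k) by apply: sumr_ge0 => ? _; exact: nm_ge0.
case: (ltnP k N) => [kN|/HN]; last by have := nmB_ge (u k) l; lra.
rewrite (bigD1 (Ordinal kN))//= addrCA lerDl addr_ge0//.
  by rewrite addr_ge0// nm_ge0.
by apply: sumr_ge0 => ? _; exact: nm_ge0.
Qed.

End Sequences.

(** * Compactness and polynomial maps *)

Section Compactness.
Variable R : realType.
Local Notation C := R[i].
Variables (m n : nat).
Local Notation V := 'M[C]_(m, n).

Definition seq_closed (K : V -> Prop) :=
  forall u l, cvs u l -> (forall k, K (u k)) -> K l.

Definition cpt (K : V -> Prop) :=
  (exists M : R, forall x, K x -> nm x <= M) /\ seq_closed K.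

Definition scont (K : V -> Prop) (psi : V -> R) :=
  forall u l, K l -> (forall k, K (u k)) -> cvs u l -> cvr (psi \o u) (psi l).

Lemma cpt_subseq K (u : nat -> V) : cpt K -> (forall k, K (u k)) ->
  exists phi, {homo phi : i j / (i < j)%N} /\ exists2 l, K l & cvs (u \o phi) l.
Proof.
move=> [[M KM] cK] Ku; have [|phi [hp [l Hl]]] := @bw _ _ _ u M.
  by move=> k; exact: KM.
by exists phi; split=> //; exists l => //; apply: cK Hl _ => k; exact: Ku.
Qed.

Lemma evt K psi : cpt K -> (exists x, K x) -> scont K psi ->
  exists2 x, K x & forall y, K y -> psi y <= psi x.
Proof.
move=> cK [x0 Kx0] cpsi.
have [B HB] : exists B, forall x, K x -> psi x <= B.
  apply/not_existsP => H.
  have /choice[u Hu] (k : nat) : exists x, K x /\ k%:R < psi x.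
    have /existsNP[x /not_implyP[Kx /negP]] := H k%:R.
    by rewrite -ltNge => ?; exists x.
  have [phi [hp [l Kl cl]]] := cpt_subseq cK (fun k => (Hu k).1).
  have [|N HN] := cpsi _ _ Kl _ cl 1 ltr01; first by move=> k; exact: (Hu _).1.
  have [k kN] : exists k : nat, psi l + 1 < k%:R.
    exists (Num.Def.archi_bound `|psi l + 1|).
    exact: le_lt_trans (ler_norm _) (archi_boundP (normr_ge0 _)).
  have := HN (maxn N k) (leq_maxl _ _); rewrite /= ltr_norml => /andP[_].
  apply/negP; rewrite -leNgt lerBrDl; apply: le_trans (ltW kN) _.
  apply: le_trans (ltW (Hu _).2); rewrite ler_nat.
  exact: leq_trans (leq_maxr N k) (homo_ge hp _).
pose S : set R := fun r => exists2 x, K x & r = psi x.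
have hS : has_sup S by split; [exists (psi x0), x0|exists B => _ [x Kx ->]; exact: HB].
have /choice[u Hu] (k : nat) : exists x, K x /\ sup S - k.+1%:R^-1 < psi x.
  have [|_ [x Kx ->] ?] := @sup_adherent _ S k.+1%:R^-1 _ hS; last by exists x.
  by rewrite invr_gt0 ltr0n.
have [phi [hp [l Kl cl]]] := cpt_subseq cK (fun k => (Hu k).1).
exists l => // y Ky; apply: (@le_trans _ _ (sup S)).
  by apply: ub_le_sup hS.2 _ _; exists y.
apply/ler_addgt0Pr => e e0.
have e2 : 0 < e / 2 by lra.
have [|N HN] := cpsi _ _ Kl _ cl (e / 2) e2; first by move=> k; exact: (Hu _).1.
have [N' HN'] := archi_inv e2.
have := HN (maxn N N') (leq_maxl _ _); rewrite /= ltr_norml => /andP[_ H1].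
have := (Hu (phi (maxn N N'))).2.
have := inv_nat_le R (leq_trans (leq_maxr N N') (homo_ge hp (maxn N N'))).
move: HN' H1; set a := N'.+1%:R^-1; set b := (phi _).+1%:R^-1.
set x := psi (u _); move: a b x => a b x; lra.
Qed.

End Compactness.

(** * Polynomial functions and their divided differences *)

Section PolyFun.
Variable R : realType.
Local Notation C := R[i].
Local Notation V n := 'rV[C]_n.

Definition polyfun n (q : V n -> C) :=
  exists p : mpoly n C, forall v, q v = meval (v 0) p.

Lemma pf_cst n c : polyfun (fun _ : V n => c).
Proof. by exists (mpolyC n c) => v; rewrite mevalC. Qed.

Lemma pf_coord n i : polyfun (fun v : V n => v 0 i).
Proof. by exists (mpolyX C (mnm1 i)) => v; rewrite mevalXU. Qed.

Lemma pfD n (p q : V n -> C) : polyfun p -> polyfun q -> polyfun (fun v => p v + q v).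
Proof. by move=> [a Ha] [b Hb]; exists (a + b) => v; rewrite mevalD Ha Hb. Qed.

Lemma pfM n (p q : V n -> C) : polyfun p -> polyfun q -> polyfun (fun v => p v * q v).
Proof. by move=> [a Ha] [b Hb]; exists (a * b) => v; rewrite mevalM Ha Hb. Qed.

Lemma pfN n (p : V n -> C) : polyfun p -> polyfun (fun v => - p v).
Proof. by move=> [a Ha]; exists (- a) => v; rewrite mevalN Ha. Qed.

Lemma pfB n (p q : V n -> C) : polyfun p -> polyfun q -> polyfun (fun v => p v - q v).
Proof. by move=> hp hq; apply: pfD => //; exact: pfN. Qed.

Lemma pf_ext n (p q : V n -> C) : polyfun p -> (forall v, q v = p v) -> polyfun q.
Proof. by move=> [a Ha] H; exists a => v; rewrite H. Qed.

Lemma pf_sum n (I : Type) (r : seq I) (P : pred I) (F : I -> V n -> C) :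
  (forall i, P i -> polyfun (F i)) -> polyfun (fun v => \sum_(i <- r | P i) F i v).
Proof.
move=> HF; elim: r => [|i r IH].
  by apply: pf_ext (pf_cst n 0) _ => v; rewrite big_nil.
case: (boolP (P i)) => Pi; last by apply: pf_ext IH _ => v; rewrite big_cons (negbTE Pi).
by apply: pf_ext (pfD (HF _ Pi) IH) _ => v; rewrite big_cons Pi.
Qed.

Lemma pf_prod n (I : Type) (r : seq I) (P : pred I) (F : I -> V n -> C) :
  (forall i, P i -> polyfun (F i)) -> polyfun (fun v => \prod_(i <- r | P i) F i v).
Proof.
move=> HF; elim: r => [|i r IH].
  by apply: pf_ext (pf_cst n 1) _ => v; rewrite big_nil.
case: (boolP (P i)) => Pi; last by apply: pf_ext IH _ => v; rewrite big_cons (negbTE Pi).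
by apply: pf_ext (pfM (HF _ Pi) IH) _ => v; rewrite big_cons Pi.
Qed.

Lemma pfX n (p : V n -> C) k : polyfun p -> polyfun (fun v => p v ^+ k).
Proof. by move=> [a Ha]; exists (a ^+ k) => v; rewrite rmorphXn /= Ha. Qed.

(** Polynomials are generated by constants and coordinates under sums and products; the
    extensionality case transports a property between pointwise equal functions. Local Lipschitz
    bounds, growth, expansions and restrictions to lines all follow by this induction. *)
Lemma pf_ind n (P : (V n -> C) -> Prop) :
  (forall p q, P p -> (forall v, q v = p v) -> P q) ->
  (forall c, P (fun=> c)) -> (forall i, P (fun v => v 0 i)) ->
  (forall p q, P p -> P q -> P (fun v => p v + q v)) ->
  (forall p q, P p -> P q -> P (fun v => p v * q v)) ->
  forall q, polyfun q -> P q.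
Proof.
move=> Pext Pc Px PD PM q [p Hp]; refine (Pext _ _ _ Hp).
apply: ((Pext) (fun v => \sum_(m <- msupp p) mcoeff m p * \prod_i v 0 i ^+ m i)); last first.
  by move=> v; rewrite mevalE.
have PX f k : P f -> P (fun v => f v ^+ k).
  move=> Pf; elim: k => [|k IH]; first by apply: ((Pext) _ _ (Pc 1) _) => v; rewrite expr0.
  by apply: ((Pext) _ _ (PM _ _ Pf IH) _) => v; rewrite exprS.
elim: (msupp p) => [|m s IH]; first by apply: ((Pext) _ _ (Pc 0) _) => v; rewrite big_nil.
apply: ((Pext) _ _ (PD _ _ (PM _ _ (Pc (mcoeff m p)) _) IH) _).
  2: by move=> v; rewrite big_cons.
elim: (index_enum _) => [|i r IHr]; first by apply: ((Pext) _ _ (Pc 1) _) => v; rewrite big_nil.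
by apply: ((Pext) _ _ (PM _ _ (PX _ (m i) (Px i)) IHr) _) => v; rewrite big_cons.
Qed.

Definition pmap n m (G : V n -> V m) := forall j, polyfun (fun x => G x 0 j).

Lemma pf_comp n m (q : V m -> C) (G : V n -> V m) :
  pmap G -> polyfun q -> polyfun (fun x => q (G x)).
Proof.
move=> pG; elim/pf_ind => [p r Hp H|c|i|p r|p r].
- by apply: pf_ext Hp _ => v; rewrite H.
- exact: pf_cst.
- exact: pG.
- exact: pfD.
- exact: pfM.
Qed.

Lemma pf_lip n (q : V n -> C) (M : R) : polyfun q ->
  exists2 L, 0 <= L & forall x y, nm x <= M -> nm y <= M ->
    nc (q x - q y) <= L * nm (x - y) /\ nc (q x) <= L.
Proof.
elim/pf_ind => [p r [L L0 HL] H|c|i|p r [L1 L10 H1] [L2 L20 H2]|p r [L1 L10 H1] [L2 L20 H2]].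
- by exists L => // x y; rewrite !H; exact: HL.
- exists (nc c); first exact: nc_ge0.
  by move=> x y _ _; rewrite subrr nc0 mulr_ge0 ?nc_ge0 ?nm_ge0.
- exists (1 + `|M|); first by rewrite addr_ge0.
  move=> x y xM yM; split.
    rewrite mulrDl mul1r; have -> : x 0 i - y 0 i = (x - y) 0 i by rewrite !mxE.
    by rewrite (le_trans (nm_coord _ _ _))// lerDl mulr_ge0 ?nm_ge0.
  rewrite (le_trans (nm_coord _ _ _))// (le_trans xM)//.
  by rewrite (le_trans (ler_norm _))// lerDr.
- exists (L1 + L2); first exact: addr_ge0.
  move=> x y xM yM; have [a1 b1] := H1 _ _ xM yM; have [a2 b2] := H2 _ _ xM yM.
  split; last by rewrite (le_trans (ncD _ _))// lerD.
  by rewrite opprD addrACA mulrDl (le_trans (ncD _ _))// lerD.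
- exists (2 * L1 * L2 + L1 * L2); first by rewrite addr_ge0 ?mulr_ge0.
  move=> x y xM yM; have [a1 b1] := H1 _ _ xM yM; have [a2 b2] := H2 _ _ xM yM.
  have [_ b3] := H1 _ _ yM xM.
  split; last by rewrite ncM (le_trans (ler_pM _ _ b1 b2)) ?nc_ge0// lerDr !mulr_ge0.
  have -> : p x * r x - p y * r y = (p x - p y) * r x + p y * (r x - r y) by ring.
  rewrite (le_trans (ncD _ _))// !ncM.
  have h1 := ler_pM (nc_ge0 _) (nc_ge0 _) a1 b2.
  have h2 := ler_pM (nc_ge0 _) (nc_ge0 _) b3 a2.
  have h3 : 0 <= L1 * L2 * nm (x - y) by rewrite !mulr_ge0 ?nm_ge0.
  apply: le_trans (lerD h1 h2) _.
  have -> : L1 * nm (x - y) * L2 + L1 * (L2 * nm (x - y)) =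
    2 * (L1 * L2 * nm (x - y)) by ring.
  have -> : (2 * L1 * L2 + L1 * L2) * nm (x - y) = 3 * (L1 * L2 * nm (x - y)) by ring.
  lra.
Qed.

Lemma pf_growth n (q : V n -> C) : polyfun q ->
  exists K a, 0 <= K /\ forall x, nc (q x) <= K * (1 + nm x) ^+ a.
Proof.
have h1 (x : V n) : 1 <= 1 + nm x by rewrite lerDl nm_ge0.
elim/pf_ind => [p r [K [a [K0 HK]]] H|c|i|p r [K [a [K0 HK]]] [L [b [L0 HL]]]|
  p r [K [a [K0 HK]]] [L [b [L0 HL]]]].
- by exists K, a; split=> // x; rewrite H.
- by exists (nc c), 0%N; split=> [|x]; rewrite ?nc_ge0// expr0 mulr1.
- exists 1, 1%N; split=> // x; rewrite expr1 mul1r.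
  by rewrite (le_trans (nm_coord _ _ _))// lerDr.
- exists (K + L), (maxn a b); split=> [|x]; first exact: addr_ge0.
  rewrite (le_trans (ncD _ _))// mulrDl lerD//.
    by rewrite (le_trans (HK x))// ler_wpM2l// ler_weXn2l// leq_maxl.
  by rewrite (le_trans (HL x))// ler_wpM2l// ler_weXn2l// leq_maxr.
- exists (K * L), (a + b)%N; split=> [|x]; first exact: mulr_ge0.
  by rewrite ncM exprD mulrACA ler_pM ?nc_ge0.
Qed.

Lemma pf_line n (q : V n -> C) y v : polyfun q ->
  exists p : {poly C}, forall t, q (y + t *: v) = p.[t].
Proof.
elim/pf_ind => [p r [a Ha] H|c|i|p r [a Ha] [b Hb]|p r [a Ha] [b Hb]].
- by exists a => t; rewrite H.
- by exists c%:P => t; rewrite hornerC.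
- by exists ((y 0 i)%:P + v 0 i *: 'X) => t; rewrite !hornerE !mxE mulrC.
- by exists (a + b) => t; rewrite hornerD Ha Hb.
- by exists (a * b) => t; rewrite hornerM Ha Hb.
Qed.

Lemma pf_plane n (q : V n -> C) y v u : polyfun q ->
  exists p : {poly {poly C}}, forall t s, q (y + t *: v + s *: u) = p.[t%:P].[s].
Proof.
elim/pf_ind => [p r [a Ha] H|c|i|p r [a Ha] [b Hb]|p r [a Ha] [b Hb]].
- by exists a => t s; rewrite H.
- by exists c%:P%:P => t s; rewrite !hornerC.
- exists (((y 0 i)%:P + u 0 i *: 'X)%:P + (v 0 i)%:P *: 'X) => t s.
  by rewrite !hornerE !mxE; ring.
- by exists (a + b) => t s; rewrite !hornerD Ha Hb.
- by exists (a * b) => t s; rewrite !hornerM Ha Hb.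
Qed.

Definition polyfun2 n (b : V n -> V n -> C) :=
  polyfun (fun w : V (n + n) => b (lsubmx w) (rsubmx w)).

Lemma pf2_row n (b : V n -> V n -> C) m (f g : V m -> V n) :
  polyfun2 b -> pmap f -> pmap g -> polyfun (fun x => b (f x) (g x)).
Proof.
move=> hb hf hg; pose h x := row_mx (f x) (g x).
apply: (@pf_ext _ (fun x => b (lsubmx (h x)) (rsubmx (h x)))); last first.
  by move=> x; rewrite row_mxKl row_mxKr.
apply: (pf_comp (q := fun w => b (lsubmx w) (rsubmx w)) _ hb) => j.
case: (splitP j) => k kj.
  have -> : j = lshift n k by apply: val_inj.
  by apply: pf_ext (hf k) _ => x; rewrite row_mxEl.
have -> : j = rshift n k by apply: val_inj.
by apply: pf_ext (hg k) _ => x; rewrite row_mxEr.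
Qed.

Lemma pmap_cst n m (y : V m) : pmap (fun _ : V n => y).
Proof. by move=> j; exact: pf_cst. Qed.

Lemma pmap_id n : pmap (fun x : V n => x).
Proof. by move=> j; exact: pf_coord. Qed.

Lemma pmap_lsub n : pmap (fun w : V (n + n) => lsubmx w).
Proof. by move=> j; apply: pf_ext (pf_coord (lshift n j)) _ => w; rewrite mxE. Qed.

Lemma pmap_rsub n : pmap (fun w : V (n + n) => rsubmx w).
Proof. by move=> j; apply: pf_ext (pf_coord (rshift n j)) _ => w; rewrite mxE. Qed.

(** Leibniz rule for divided differences: [p x * r x - p y * r y = (p x - p y) * r x + p y * (r x -
    r y)]. The induction carries polynomiality of [q] along, since the factors [r x] and [p y] enter
    the quotients of a product. *)
Lemma bezoutian n (q : V n -> C) : polyfun q ->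
  exists B : 'I_n -> V n -> V n -> C, (forall i, polyfun2 (B i)) /\
    forall x y, q x - q y = \sum_i (x 0 i - y 0 i) * B i x y.
Proof.
move=> pq; apply: (proj2 (A := polyfun q)).
elim/pf_ind: q / pq => [p r [pp [B [B0 HB]]] H|c|j|p r [pp [A [A0 HA]]] [pr [B [B0 HB]]]|
   p r [pp [A [A0 HA]]] [pr [B [B0 HB]]]].
- by split; [exact: pf_ext pp H|exists B; split=> // x y; rewrite !H].
- split; first exact: pf_cst.
  exists (fun _ _ _ => 0); split=> [i|x y]; first exact: pf_cst.
  by rewrite subrr big1// => i _; rewrite mulr0.
- split; first exact: pf_coord.
  exists (fun i _ _ => (i == j)%:R); split=> [i|x y]; first exact: pf_cst.
  by rewrite (bigD1 j)//= eqxx mulr1 big1 ?addr0// => i /negbTE ->; rewrite mulr0.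
- split; first exact: pfD.
  exists (fun i x y => A i x y + B i x y); split=> [i|x y]; first by apply: pfD; [exact: A0|exact: B0].
  by rewrite opprD addrACA HA HB -big_split; apply: eq_bigr => i _; rewrite mulrDr.
- split; first exact: pfM.
  exists (fun i x y => A i x y * r x + p y * B i x y); split=> [i|x y].
    apply: pfD; apply: pfM; first exact: A0.
    - exact: (pf_comp (@pmap_lsub n) pr).
    - exact: (pf_comp (@pmap_rsub n) pp).
    - exact: B0.
  have -> : p x * r x - p y * r y = (p x - p y) * r x + p y * (r x - r y) by ring.
  rewrite HA HB mulr_suml mulr_sumr -big_split; apply: eq_bigr => i _ /=; ring.
Qed.

End PolyFun.

(** * A quantitative inverse function theorem for polynomial maps *)

Section InverseFunction.
Variable R : realType.
Local Notation C := R[i].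
Local Notation V n := 'rV[C]_n.

Lemma pf_cv n (q : V n -> C) u l : polyfun q -> cvs u l ->
  forall e, 0 < e -> exists N, forall k, (N <= k)%N -> nc (q (u k) - q l) < e.
Proof.
move=> pq ul e e0; have [M HM] := cvs_bounded ul.
have [L L0 HL] := pf_lip (M + nm l) pq.
have [|N HN] := ul (e / (L + 1)); first by rewrite divr_gt0// ltr_wpDl.
have M0 : 0 <= M by apply: le_trans (nm_ge0 _) (HM 0%N).
exists N => k /HN Hk.
have [|| + _] := HL (u k) l; first by rewrite (le_trans (HM k))// lerDl nm_ge0.
  by rewrite lerDr.
move=> /le_lt_trans; apply; rewrite ltr_pdivlMr ?ltr_wpDl// in Hk.
by apply: le_lt_trans Hk; rewrite mulrC ler_wpM2l ?nm_ge0// lerDl.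
Qed.

Lemma pmap_cv n m (G : V n -> V m) u l : pmap G -> cvs u l -> cvs (G \o u) (G l).
Proof.
move=> pG ul e e0; have d0 : 0 < e / m.+1%:R by rewrite divr_gt0 ?ltr0n.
have [N HN] := eventually_forall (fun j => pf_cv (pG j) ul d0).
exists N => k /HN {}HN; apply: (@le_lt_trans _ _ (m%:R * (e / m.+1%:R))).
  by apply: nm_lt_coord => // j; rewrite !mxE; exact: HN.
by rewrite mulrCA gtr_pMr// ltr_pdivrMr ?mul1r ?ltr_nat ?ltr0n.
Qed.

Lemma nm_cv m n (u : nat -> 'M[C]_(m, n)) l : cvs u l -> cvr (fun k => nm (u k)) (nm l).
Proof.
move=> ul e /ul[N HN]; exists N => k /HN; apply: le_lt_trans.
by rewrite ler_norml nmB_ge andbT lerNl opprB nmBC nmB_ge.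
Qed.

Lemma cvsB m n (u : nat -> 'M[C]_(m, n)) l a : cvs u l -> cvs (fun k => u k - a) (l - a).
Proof. by move=> ul e /ul[N HN]; exists N => k /HN; rewrite opprB addrA subrK. Qed.

Lemma cvs_unique m n (u : nat -> 'M[C]_(m, n)) l l' : cvs u l -> cvs u l' -> l = l'.
Proof.
move=> ul ul'; apply/eqP; rewrite -subr_eq0 -nm_eq0 eq_le nm_ge0 andbT.
apply/ler_addgt0Pr => e e0; rewrite add0r; have e2 : 0 < e / 2 by lra.
have [N HN] := ul _ e2; have [N' HN'] := ul' _ e2.
have := HN _ (leq_maxl N N'); have := HN' _ (leq_maxr N N').
by have := nm_tri (u (maxn N N')) l l'; rewrite (nmBC l (u _)); lra.
Qed.

Lemma cvr_le u (l M : R) : cvr u l -> (forall k, u k <= M) -> l <= M.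
Proof.
move=> ul uM; rewrite leNgt; apply/negP => Ml.
have [|N HN] := ul (l - M); first by rewrite subr_gt0.
have := HN N (leqnn N); have := uM N; rewrite ltr_norml => h /andP[h' _].
by move: h h'; set x := u N; move: x => x; lra.
Qed.

Lemma cpt_ball m n (z : 'M[C]_(m, n)) r : cpt (fun x => nm (x - z) <= r).
Proof.
split.
  exists (r + nm z) => x xr; rewrite -(subrK z x).
  by rewrite (le_trans (nmD _ _))// lerD2r.
by move=> u l ul ur; exact: cvr_le (nm_cv (cvsB z ul)) ur.
Qed.

Lemma pf2_lip n (b : V n -> V n -> C) (M : R) : polyfun2 b ->
  exists2 L, 0 <= L & forall x y x' y', nm x <= M -> nm y <= M -> nm x' <= M ->
    nm y' <= M -> nc (b x y - b x' y') <= L * (nm (x - x') + nm (y - y')) /\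
    nc (b x y) <= L.
Proof.
move=> pb; have nrow (x y : V n) : nm (row_mx x y) = nm x + nm y.
  rewrite /nm !big_ord_recl !big_ord0 !addr0 big_split_ord/=.
  by congr (_ + _); apply: eq_bigr => j _; rewrite ?row_mxEl ?row_mxEr.
have [L L0 HL] := pf_lip (M + M) pb; exists L => // x y x' y' xM yM x'M y'M.
have [] := HL (row_mx x y) (row_mx x' y'); rewrite ?nrow ?lerD//.
by rewrite !row_mxKl !row_mxKr opp_row_mx add_row_mx nrow.
Qed.

Definition pm2 n m l (M : V n -> V n -> 'M[C]_(m, l)) :=
  forall i j, polyfun2 (fun x y => M x y i j).

Lemma pm2_lip n m l (M : V n -> V n -> 'M[C]_(m, l)) (r : R) : pm2 M ->
  exists2 L, 0 <= L & forall x y x' y', nm x <= r -> nm y <= r -> nm x' <= r ->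
    nm y' <= r -> nm (M x y - M x' y') <= L * (nm (x - x') + nm (y - y')) /\
    nm (M x y) <= L.
Proof.
move=> pM; have /choice[L HL] (ij : 'I_m * 'I_l) : exists L, 0 <= L /\
    forall x y x' y', nm x <= r -> nm y <= r -> nm x' <= r -> nm y' <= r ->
    nc (M x y ij.1 ij.2 - M x' y' ij.1 ij.2) <= L * (nm (x - x') + nm (y - y')) /\
    nc (M x y ij.1 ij.2) <= L.
  by have [L L0 HL] := pf2_lip r (pM ij.1 ij.2); exists L.
exists (\sum_i \sum_j L (i, j)).
  by apply: sumr_ge0 => i _; apply: sumr_ge0 => j _; exact: (HL (i, j)).1.
move=> x y x' y' h1 h2 h3 h4; split.
  rewrite mulr_suml; apply: ler_sum => i _; rewrite mulr_suml; apply: ler_sum => j _.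
  by rewrite !mxE; exact: ((HL (i, j)).2 _ _ _ _ h1 h2 h3 h4).1.
apply: ler_sum => i _; apply: ler_sum => j _.
exact: ((HL (i, j)).2 _ _ _ _ h1 h2 h3 h4).2.
Qed.

Lemma pf_det k n (A : V n -> 'M[C]_k) :
  (forall i j, polyfun (fun x => A x i j)) -> polyfun (fun x => \det (A x)).
Proof.
move=> pA; apply: pf_sum => s _; apply: pfM; first exact: pf_cst.
by apply: pf_prod => i _; exact: pA.
Qed.

Lemma pf_adj k n (A : V n -> 'M[C]_k) :
  (forall i j, polyfun (fun x => A x i j)) -> forall i j, polyfun (fun x => (\adj (A x)) i j).
Proof.
move=> pA i j; apply: (@pf_ext _ _ (fun x => (-1) ^+ (j + i) * \det (row' j (col' i (A x))))).
  apply: pfM; first exact: pf_cst.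
  by apply: pf_det => a b; apply: pf_ext (pA (lift j a) (lift i b)) _ => x; rewrite !mxE.
by move=> x; rewrite mxE.
Qed.

(* The diagonal value [M z z] is the transposed Jacobian matrix of [G] at [z]. *)
Definition bez n m (G : V n -> V m) (M : V n -> V n -> 'M[C]_(n, m)) :=
  pm2 M /\ forall x y, G x - G y = (x - y) *m M x y.

Lemma bez_exists n m (G : V n -> V m) : pmap G -> exists M, bez G M.
Proof.
move=> pG; have /choice[B HB] j := bezoutian (pG j).
exists (fun x y => \matrix_(i, j) B j i x y); split.
  by move=> i j; apply: pf_ext ((HB j).1 i) _ => w; rewrite mxE.
move=> x y; apply/rowP => j; rewrite !mxE (HB j).2.
by apply: eq_bigr => i _; rewrite !mxE.
Qed.

Lemma bez_comp n m l (G : V n -> V m) (H : V m -> V l) M N : pmap G ->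
  bez G M -> bez H N -> bez (H \o G) (fun x y => M x y *m N (G x) (G y)).
Proof.
move=> pG [pM GM] [pN HN]; split=> [i j|x y]; last by rewrite /= HN GM mulmxA.
apply: (@pf_ext _ _ (fun w : V (n + n) => \sum_k M (lsubmx w) (rsubmx w) i k *
   N (G (lsubmx w)) (G (rsubmx w)) k j)).
  apply: pf_sum => k _; apply: pfM; first exact: pM.
  apply: (pf2_row (pN k j)) => a.
    by apply: (pf_comp _ (pG a)); exact: pmap_lsub.
  by apply: (pf_comp _ (pG a)); exact: pmap_rsub.
by move=> w; rewrite mxE.
Qed.

Lemma pm2_fix n m l (M : V n -> V n -> 'M[C]_(m, l)) y : pm2 M ->
  forall i j, polyfun (fun x => M x y i j).
Proof.
by move=> pM i j; apply: (pf2_row (pM i j)); [exact: pmap_id|exact: pmap_cst].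
Qed.

Lemma pm2_diag n m l (M : V n -> V n -> 'M[C]_(m, l)) : pm2 M ->
  forall i j, polyfun (fun x => M x x i j).
Proof. by move=> pM i j; apply: (pf2_row (pM i j)); exact: pmap_id. Qed.

Variables (n : nat) (G : V n -> V n) (M : V n -> V n -> 'M[C]_n).
Hypothesis (pG : pmap G) (GM : bez G M).

(** Cramer's rule for the divided Jacobian. It bounds [x - y] by [G x - G y] where the determinant
    is away from 0, and it shows that [\det (M x y)] vanishes whenever [x] and [y] are distinct
    points of one fibre; the trace argument lives on the second fact. *)
Lemma bez_adj x y : \det (M x y) *: (x - y) = (G x - G y) *m \adj (M x y).
Proof. by rewrite GM.2 -mulmxA mul_mx_adj mul_mx_scalar. Qed.

Lemma pf_bez_det : polyfun2 (fun x y => \det (M x y)).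
Proof. by apply: (pf_det (A := fun w => M (lsubmx w) (rsubmx w))) => i j; exact: GM.1. Qed.

Lemma pm2_bez_adj : pm2 (fun x y => \adj (M x y)).
Proof.
by move=> i j; apply: (pf_adj (A := fun w => M (lsubmx w) (rsubmx w))) => a b; exact: GM.1.
Qed.

(** On the compact set the Jacobian determinant has a positive minimum [c]; by its Lipschitz bound
    the two-point determinant stays above [c / 2] near the diagonal, and [bez_adj] turns this into a
    Lipschitz inverse. The radius is the same at all points of [K]. *)
Lemma ift_inj (K : V n -> Prop) : cpt K -> (forall z, K z -> \det (M z z) != 0) ->
  exists r B, [/\ 0 < r, 0 < B & forall z0 z z', K z0 -> nm (z - z0) < r ->
    nm (z' - z0) < r -> \det (M z z') != 0 /\ nm (z - z') <= B * nm (G z - G z')].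
Proof.
move=> cK dK.
case: (pselect (exists z, K z)) => [K0|K0]; last first.
  by exists 1, 1; split=> // z0 z z' Kz; case: K0; exists z0.
have [[m0 Km] clK] := cK.
have pd : polyfun (fun z => \det (M z z)) by apply: pf_det => i j; exact: (pm2_diag GM.1).
have [|zm Kzm Hmin] := @evt _ _ _ K (fun z => - nc (\det (M z z))) cK K0.
  move=> u l _ _ ul e e0; have [N HN] := pf_cv pd ul e0.
  exists N => k /HN; apply: le_lt_trans; rewrite /= opprK addrC ler_norml.
  by apply/andP; split; [rewrite lerNl opprB ncB_ge|rewrite ncBC ncB_ge].
set c := nc (\det (M zm zm)); have c0 : 0 < c by rewrite nc_gt0 dK.
have cmin z : K z -> c <= nc (\det (M z z)) by move=> /Hmin; rewrite lerN2.
have [L L0 HL] := pf2_lip (m0 + 1) pf_bez_det.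
have [A A0 HA] := pm2_lip (m0 + 1) pm2_bez_adj.
pose r := Num.min 1 (c / (4 * (L + 1))).
have r0 : 0 < r by rewrite lt_min ltr01 divr_gt0// mulr_gt0// ltr_wpDl.
have r1 : r <= 1 by rewrite ge_min lexx.
have rc : L * r <= c / 4.
  apply: (@le_trans _ _ (L * (c / (4 * (L + 1))))); first by rewrite ler_wpM2l// ge_min lexx orbT.
  rewrite mulrA ler_pdivrMr ?mulr_gt0 ?ltr_wpDl//.
  have -> : c / 4 * (4 * (L + 1)) = c * (L + 1) by field.
  by rewrite mulrC ler_pM2l// lerDl.
exists r, (2 * A / c + 1); split=> // [|z0 z z' Kz0 zr z'r].
  by rewrite ltr_wpDl// divr_ge0 ?mulr_ge0// ltW.
have bd x : nm (x - z0) < r -> nm x <= m0 + 1.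
  move=> xr; rewrite -(subrK z0 x) addrC (le_trans (nmD _ _))// lerD ?Km//.
  exact: le_trans (ltW xr) r1.
have z0b : nm z0 <= m0 + 1 by apply: bd; rewrite subrr nm0.
have dge : c / 2 <= nc (\det (M z z')).
  have [H _] := HL z z' z0 z0 (bd _ zr) (bd _ z'r) z0b z0b.
  have H1 : L * (nm (z - z0) + nm (z' - z0)) <= L * (r + r).
    by rewrite ler_wpM2l// lerD// ltW.
  have := ncB_ge (\det (M z0 z0)) (\det (M z z')); rewrite ncBC.
  have := cmin _ Kz0; rewrite mulrDr in H1; lra.
have d0 : 0 < nc (\det (M z z')) by apply: lt_le_trans dge; lra.
split; first by rewrite -nc_gt0.
have [_ HA'] := HA z z' z0 z0 (bd _ zr) (bd _ z'r) z0b z0b.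
have : c / 2 * nm (z - z') <= nm (G z - G z') * A.
  apply: (@le_trans _ _ (nc (\det (M z z')) * nm (z - z'))).
    by rewrite ler_wpM2r ?nm_ge0.
  by rewrite -nmZ bez_adj (le_trans (nm_mul _ _))// ler_wpM2l ?nm_ge0.
move=> H; rewrite mulrDl mul1r; apply: ler_wpDr; first exact: nm_ge0.
rewrite [2 * A / c * _]mulrAC ler_pdivlMr//.
have := nm_ge0 (z - z'); move: H; set a := nm (z - z'); set b := nm (G z - G z'); nra.
Qed.

(** For surjectivity the distance from [G z] to [w] is minimised over the closed ball of radius
    [r / 2]. With [eta = r / (8 * B)] the minimiser is within [r / 4] of the centre, so there is
    room for a small Newton step, which would decrease a positive minimum. *)
Lemma ift (K : V n -> Prop) : cpt K -> (forall z, K z -> \det (M z z) != 0) ->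
  exists r B eta, [/\ 0 < r, 0 < B, 0 < eta,
    (forall z0 z z', K z0 -> nm (z - z0) < r -> nm (z' - z0) < r ->
       nm (z - z') <= B * nm (G z - G z')) &
    (forall z0 w, K z0 -> nm (w - G z0) < eta -> exists2 z, nm (z - z0) < r & G z = w)].
Proof.
move=> cK dK; have [r [B [r0 B0 H]]] := ift_inj cK dK.
have B8 : 0 < 8 * B by rewrite mulr_gt0.
exists r, B, (r / (8 * B)); split=> //; first by rewrite divr_gt0.
  by move=> z0 z z' Kz0 zr z'r; exact: (H z0 _ _ Kz0 zr z'r).2.
move=> z0 w Kz0 wr.
have [||zm zmb Hmin] := @evt _ _ _ _ (fun z => - nm (G z - w)) (cpt_ball z0 (r / 2)).
- by exists z0; rewrite subrr nm0; lra.
- move=> u l _ _ ul e e0; have [N HN] := nm_cv (cvsB w (pmap_cv pG ul)) e0.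
  by exists N => k /HN {}HN; rewrite /= opprK addrC distrC.
have zmr : nm (zm - z0) < r by lra.
have z0r : nm (z0 - z0) < r by rewrite subrr nm0.
have rho0 : nm (G zm - w) <= nm (w - G z0).
  by rewrite (nmBC w) -lerN2; apply: Hmin; rewrite subrr nm0; lra.
have zm4 : nm (zm - z0) <= r / 4.
  apply: le_trans (H _ _ _ Kz0 zmr z0r).2 _.
  have h : nm (G zm - G z0) <= 2 * (r / (8 * B)).
    by have := nm_tri w (G zm) (G z0); lra.
  apply: le_trans (ler_wpM2l (ltW B0) h) _.
  by rewrite le_eqVlt; apply/orP; left; apply/eqP; field; rewrite gt_eqF.
exists zm => //; apply/eqP; rewrite -subr_eq0 -nm_eq0; apply: contraT => rhon.
set rho := nm (G zm - w) in rho0 rhon *.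
have rhop : 0 < rho by rewrite lt_def rhon nm_ge0.
have [dm _] := H _ _ _ Kz0 zmr zmr.
(* The Newton direction: up to second order, a step [s] along [xi] multiplies [G zm - w] by
   [1 - s]. *)
pose xi := (w - G zm) *m invmx (M zm zm).
have [L L0 HL] := pm2_lip (nm zm + nm xi) GM.1.
pose Kq := nm xi * (L * nm xi) + 1.
have Kq0 : 0 < Kq by rewrite ltr_wpDl// !mulr_ge0 ?nm_ge0.
pose s := Num.min 1 (Num.min (rho / (2 * Kq)) (r / (4 * (nm xi + 1)))).
have xi1 : 0 < nm xi + 1 by rewrite ltr_wpDl ?nm_ge0.
have s0 : 0 < s by rewrite !lt_min ltr01 !divr_gt0// mulr_gt0.
have s1 : s <= 1 by rewrite ge_min lexx.
have sq : s * (2 * Kq) <= rho.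
  by rewrite -ler_pdivlMr ?mulr_gt0// !ge_min lexx orbT.
have sx : s * (4 * (nm xi + 1)) <= r.
  by rewrite -ler_pdivlMr ?mulr_gt0// !ge_min lexx !orbT.
pose sc : C := (s%:C)%C.
have ncs : nc sc = s by rewrite ncR ger0_norm// ltW.
have nsx : nm (sc *: xi) = s * nm xi by rewrite nmZ ncs.
have bx : nm (zm + sc *: xi) <= nm zm + nm xi.
  by rewrite (le_trans (nmD _ _))// lerD2l nsx ler_piMl ?nm_ge0.
have bz : nm zm <= nm zm + nm xi by rewrite lerDl nm_ge0.
have E : G (zm + sc *: xi) - w =
    (1 - sc) *: (G zm - w) + sc *: (xi *m (M (zm + sc *: xi) zm - M zm zm)).
  have -> : G (zm + sc *: xi) - w = (G (zm + sc *: xi) - G zm) + (G zm - w).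
    by rewrite addrA subrK.
  have X : xi *m M zm zm = - (G zm - w).
    by rewrite /xi mulmxKV ?opprB// unitmxE unitfE.
  rewrite GM.2 addrAC subrr add0r mulmxBr X -scalemxAl opprK; move: (G zm - w) => D.
  rewrite scalerDr scalerBl scale1r; set a := sc *: (xi *m _).
  by rewrite [LHS]addrC [a + _]addrC addrA subrK.
have hb : nm (zm + sc *: xi - z0) <= r / 2.
  rewrite addrAC (le_trans (nmD _ _))// nsx; have := nm_ge0 xi; nra.
have := Hmin _ hb; rewrite lerN2 -/rho E; apply: contraTT => _; rewrite -ltNge.
apply: le_lt_trans (nmD _ _) _; rewrite !nmZ -/rho.
have -> : nc (1 - sc) = 1 - s.
  have -> : 1 - sc = ((1 - s)%:C)%C by rewrite rmorphB.
  by rewrite ncR ger0_norm// subr_ge0.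
rewrite ncs.
have [HL1 _] := HL _ _ _ _ bx bz bz bz.
have : nm (xi *m (M (zm + sc *: xi) zm - M zm zm)) <= s * Kq.
  apply: le_trans (nm_mul _ _) _.
  apply: le_trans (ler_wpM2l (nm_ge0 _) HL1) _.
  rewrite addrAC subrr add0r nm0 addr0 nsx /Kq mulrDr mulr1.
  have -> : nm xi * (L * (s * nm xi)) = s * (nm xi * (L * nm xi)) by ring.
  by rewrite lerDl ltW.
set t := nm (_ *m _) => tK; have := nm_ge0 (xi *m (M (zm + sc *: xi) zm - M zm zm)); rewrite -/t.
nra.
Qed.

End InverseFunction.

(** * Maximum principles *)

Section Expansions.
Variable R : realType.
Local Notation C := R[i].
Local Notation V n := 'rV[C]_n.
Implicit Types (u : C -> C) (p q : {poly C}) (k : nat).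

(* Finite Taylor expansions at every point replace holomorphy throughout: no
   complex derivative or contour integral is used. *)
Definition expn_at k u p := exists K d : R, 0 < d /\
  forall h, nc h < d -> nc (u h - p.[h]) <= K * nc h ^+ k.

Definition expn k u := exists p, expn_at k u p.

Lemma expn_atW k u p : expn_at k u p -> exists K d : R, [/\ 0 <= K, 0 < d, d <= 1 &
  forall h, nc h < d -> nc (u h - p.[h]) <= K * nc h ^+ k].
Proof.
move=> [K [d [d0 H]]]; exists `|K|, (Num.min d 1); split=> //.
- by rewrite lt_min d0 ltr01.
- by rewrite ge_min lexx orbT.
- move=> h; rewrite lt_min => /andP[/H hd _]; apply: le_trans hd _.
  by rewrite ler_wpM2r ?exprn_ge0 ?nc_ge0// ler_norm.
Qed.

Lemma poly_bound p : exists2 B, 0 <= B & forall h, nc h <= 1 -> nc p.[h] <= B.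
Proof.
exists (\sum_(i < size p) nc p`_i); first by apply: sumr_ge0 => i _; exact: nc_ge0.
move=> h h1; rewrite horner_coef (le_trans (nc_sum _ _ _))//; apply: ler_sum => i _.
by rewrite ncM ler_piMr ?nc_ge0// ncX exprn_ile1// nc_ge0.
Qed.

Lemma expn_ext k u (v : C -> C) p : expn_at k u p ->
  (exists2 d, 0 < d & forall h, nc h < d -> v h = u h) -> expn_at k v p.
Proof.
move=> [K [d [d0 H]]] [e e0 uv]; exists K, (Num.min d e); split.
  by rewrite lt_min d0 e0.
by move=> h; rewrite lt_min => /andP[hd /uv ->]; exact: H.
Qed.

Lemma expn_poly k p : expn_at k (horner p) p.
Proof. by exists 0, 1; split=> // h _; rewrite subrr nc0 mul0r. Qed.

Lemma expnD k u (v : C -> C) p q : expn_at k u p -> expn_at k v q -> expn_at k (fun h => u h + v h) (p + q).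
Proof.
move=> /expn_atW[K [d [K0 d0 d1 H]]] /expn_atW[L [e [L0 e0 e1 H']]].
exists (K + L), (Num.min d e); split; first by rewrite lt_min d0 e0.
move=> h; rewrite lt_min => /andP[/H hd /H' he].
by rewrite hornerD opprD addrACA mulrDl (le_trans (ncD _ _))// lerD.
Qed.

Lemma expnM k u (v : C -> C) p q : expn_at k u p -> expn_at k v q -> expn_at k (fun h => u h * v h) (p * q).
Proof.
move=> /expn_atW[K [d [K0 d0 d1 H]]] /expn_atW[L [e [L0 e0 e1 H']]].
have [P P0 HP] := poly_bound p; have [Q Q0 HQ] := poly_bound q.
exists (K * (L + Q) + P * L), (Num.min d e); split; first by rewrite lt_min d0 e0.
move=> h; rewrite lt_min => /andP[hd he].
have h1 : nc h <= 1 by rewrite (le_trans (ltW hd)).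
have vh : nc (v h) <= L + Q.
  rewrite -(subrK q.[h] (v h)) (le_trans (ncD _ _))// lerD ?HQ// (le_trans (H' _ he))//.
  by rewrite ler_piMr// exprn_ile1 ?nc_ge0.
rewrite hornerM.
have -> : u h * v h - p.[h] * q.[h] = (u h - p.[h]) * v h + p.[h] * (v h - q.[h]) by ring.
rewrite (le_trans (ncD _ _))// !ncM mulrDl lerD//.
  by rewrite mulrAC ler_pM ?nc_ge0 ?H.
by rewrite -mulrA ler_pM ?nc_ge0 ?H' ?HP.
Qed.

Lemma expnX k u p n : expn_at k u p -> expn_at k (fun h => u h ^+ n) (p ^+ n).
Proof.
move=> up; elim: n => [|n IH].
  rewrite expr0; apply: expn_ext (expn_poly k 1) _; exists 1 => // h _.
  by rewrite hornerC expr0.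
rewrite exprS; apply: expn_ext (expnM up IH) _.
by exists 1 => // h _; rewrite exprS.
Qed.

Lemma expn_cst k c : expn_at k (fun=> c) c%:P.
Proof. by apply: expn_ext (expn_poly k c%:P) _; exists 1 => // h _; rewrite hornerC. Qed.

Lemma expn_pf n (q : V n -> C) k (z : C -> V n) : polyfun q ->
  (forall i, expn k (fun h => z h 0 i)) -> expn k (fun h => q (z h)).
Proof.
move=> pq ez; elim/pf_ind: q / pq => [p r [a Ha] H|c|i|p r [a Ha] [b Hb]|p r [a Ha] [b Hb]].
- by exists a; apply: expn_ext Ha _; exists 1 => // h _; rewrite H.
- by exists c%:P; exact: expn_cst.
- exact: ez.
- by exists (a + b); exact: expnD.
- by exists (a * b); exact: expnM.
Qed.

Lemma expn_at0 k u p : (0 < k)%N -> expn_at k u p -> u 0 = p.[0].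
Proof.
case: k => // k _ [K [d [d0 H]]]; apply/eqP; rewrite -subr_eq0 -nc_eq0.
by rewrite eq_le nc_ge0 andbT (le_trans (H 0 _)) ?nc0// expr0n mulr0.
Qed.

Lemma expn_cont k u : (0 < k)%N -> expn k u -> forall e, 0 < e ->
  exists2 d, 0 < d & forall h, nc h < d -> nc (u h - u 0) < e.
Proof.
case: k => // k _ [p up] e e0; rewrite (expn_at0 _ up)//.
have [K [d [K0 d0 d1 H]]] := expn_atW up.
have [q pq] : exists q, p = q * 'X + (p.[0])%:P.
  have /factor_theorem[q Hq] : root (p - (p.[0])%:P) 0 by rewrite /root !hornerE subrr.
  by exists q; move: Hq; rewrite subr0 => <-; rewrite subrK.
have [Q Q0 HQ] := poly_bound q.
have KQ : 0 < K + Q + 1 by rewrite ltr_wpDl ?addr_ge0.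
exists (Num.min d (e / (K + Q + 1))); first by rewrite lt_min d0 divr_gt0.
move=> h; rewrite lt_min ltr_pdivlMr// => /andP[hd he].
have h1 : nc h <= 1 by rewrite (le_trans (ltW hd)).
rewrite -(subrK p.[h] (u h)) -addrA; apply: le_lt_trans (ncD _ _) _.
have -> : p.[h] - p.[0] = q.[h] * h by rewrite {1}pq !hornerE addrK.
rewrite ncM; apply: le_lt_trans he.
rewrite [leRHS]mulrC mulrDl mulrDl mul1r; apply: ler_wpDr; first exact: nc_ge0.
apply: lerD; last by rewrite ler_wpM2r ?nc_ge0 ?HQ.
apply: le_trans (H _ hd) _; rewrite ler_wpM2l// exprS ler_piMr ?nc_ge0//.
by rewrite exprn_ile1 ?nc_ge0.
Qed.

(** A nonzero constant term makes [p] coprime to ['X^k]; the Bezout coefficient [a] of [p] is its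
    inverse modulo ['X^k], hence the expansion of the inverse function. *)
Lemma expn_inv k u : (0 < k)%N -> expn k u -> u 0 != 0 -> expn k (fun h => (u h)^-1).
Proof.
move=> k0 eu u0; have [p up] := eu.
have p0 : p.[0] != 0 by rewrite -(expn_at0 k0 up).
have cop : coprimep p 'X^k.
  by apply: coprimep_expr; rewrite coprimep_sym -['X]subr0 -polyC0 coprimep_sym coprimep_XsubC.
have /Bezout_eq1_coprimepP[[a b] /= ab] := cop.
exists a; have [d d0 Hd] := expn_cont k0 eu (e := nc (u 0) / 2) ltac:(by rewrite divr_gt0 ?nc_gt0).
have [K [e [e0 H]]] : expn_at k (fun h => u h * a.[h] - 1) (p * a - 1).
  by apply: expnD (expnM up (expn_poly k a)) _; rewrite -polyCN; exact: expn_cst.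
have [B B0 HB] := poly_bound b.
exists ((`|K| + B) * (2 / nc (u 0))), (Num.min 1 (Num.min d e)); split; first by rewrite !lt_min ltr01 d0.
move=> h; rewrite !lt_min => /andP[h1 /andP[hd he]].
have uh : nc (u 0) / 2 <= nc (u h).
  by have := Hd _ hd; have := ncB_ge (u 0) (u h); rewrite ncBC; lra.
have n0 : 0 < nc (u 0) by rewrite nc_gt0.
have uh0 : u h != 0 by rewrite -nc_gt0; lra.
have -> : (u h)^-1 - a.[h] = - (u h * a.[h] - 1) / u h by field.
have E : nc (u h * a.[h] - 1) <= (`|K| + B) * nc h ^+ k.
  rewrite -(subrK (p * a - 1).[h] (_ - 1)) mulrDl (le_trans (ncD _ _))// lerD//.
    by rewrite (le_trans (H _ he))// ler_wpM2r ?exprn_ge0 ?nc_ge0 ?ler_norm.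
  have -> : p * a - 1 = - (b * 'X^k) by rewrite -ab mulrC opprD addrA subrr add0r.
  by rewrite !hornerE ncN ncM ncX ler_wpM2r ?exprn_ge0 ?nc_ge0 ?HB// ltW.
rewrite ncM ncN ncV mulrAC; apply: ler_pM E _; rewrite ?nc_ge0 ?invr_ge0 ?nc_ge0//.
by rewrite -[leRHS]invrK invf_div lef_pV2 ?posrE ?nc_gt0// divr_gt0.
Qed.

(** Bootstrap: [bez_adj] expresses [z h - z 0] as [h] times a rational function of [z h], so an
    expansion of order [k] of [z] on the right gives one of order [k + 1] on the left. The Lipschitz
    bound starts the induction at order 1. *)
Lemma lift_expn n (G : V n -> V n) M (z : C -> V n) (w v : V n) (d B : R) :
  bez G M -> 0 < d -> (forall h, nc h < d -> G (z h) = w + h *: v) ->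
  (forall h, nc h < d -> nm (z h - z 0) <= B * nc h) -> \det (M (z 0) (z 0)) != 0 ->
  forall k i, expn k.+1 (fun h => z h 0 i).
Proof.
move=> GM d0 Gz zB det0.
have pdet : polyfun (fun x => \det (M x (z 0))).
  by apply: pf_det => i j; exact: (pm2_fix _ GM.1).
have padj i j : polyfun (fun x => (\adj (M x (z 0))) i j).
  by apply: (pf_adj (A := fun x => M x (z 0))) => a b; exact: (pm2_fix _ GM.1).
elim=> [|k IH] i.
  exists (z 0 0 i)%:P, B, d; split=> // h hd; rewrite hornerC expr1.
  apply: le_trans (zB _ hd); have -> : z h 0 i - z 0 0 i = (z h - z 0) 0 i by rewrite !mxE.
  exact: nm_coord.
have edet := expn_pf pdet IH.
have [q Hq] := expn_inv (ltn0Sn k) edet det0.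
have [e e0 He] := expn_cont (ltn0Sn k) edet (e := nc (\det (M (z 0) (z 0)))) ltac:(by rewrite nc_gt0).
have [r [K [c [c0 Hr]]]] : expn k.+1 (fun h => (\sum_j v 0 j * (\adj (M (z h) (z 0))) j i) / \det (M (z h) (z 0))).
  have [s Hs] : expn k.+1 (fun h => \sum_j v 0 j * (\adj (M (z h) (z 0))) j i).
    apply: (expn_pf (q := fun x => \sum_j v 0 j * (\adj (M x (z 0))) j i)) => //.
    by apply: pf_sum => j _; apply: pfM => //; exact: pf_cst.
  by exists (s * q); exact: expnM.
exists ((z 0 0 i)%:P + 'X * r), K, (Num.min c (Num.min e d)); split.
  by rewrite !lt_min c0 e0.
move=> h; rewrite !lt_min => /andP[hc /andP[he hd]].
have deth : \det (M (z h) (z 0)) != 0.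
  apply/eqP => D0; have := He _ he; rewrite D0 sub0r ncN ltxx//.
have /rowP/(_ i) := bez_adj GM (z h) (z 0).
rewrite (Gz h hd) (Gz 0) ?nc0// scale0r addr0 addrAC subrr add0r !mxE => E.
have -> : z h 0 i - ((z 0 0 i)%:P + 'X * r).[h] =
   h * ((\sum_j v 0 j * (\adj (M (z h) (z 0))) j i) / \det (M (z h) (z 0)) - r.[h]).
  rewrite !hornerE mulrBr mulrA mulr_sumr.
  have -> : \sum_j h * (v 0 j * (\adj (M (z h) (z 0))) j i) =
      \sum_j (h *: v) 0 j * (\adj (M (z h) (z 0))) j i.
    by apply: eq_bigr => j _; rewrite [(h *: v) 0 j]mxE mulrA.
  by rewrite -E [_ * (_ - _) / _]mulrAC divff// mul1r opprD addrA.
by rewrite ncM exprS mulrCA ler_wpM2l ?nc_ge0 ?Hr.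
Qed.

(** Parseval over the four directions [1, -1, i, -i]: the cross terms of a quadratic polynomial
    cancel. This finite mean replaces the integral over a circle. *)
Lemma four_points (a b c : C) (e : R) : let h := (e%:C)%C in
  nc (a + b * h + c * h ^+ 2) ^+ 2 + nc (a + b * (- h) + c * (- h) ^+ 2) ^+ 2 +
  (nc (a + b * ('i%C * h) + c * ('i%C * h) ^+ 2) ^+ 2 +
   nc (a + b * (- ('i%C * h)) + c * (- ('i%C * h)) ^+ 2) ^+ 2) =
  4 * (nc a ^+ 2 + nc b ^+ 2 * e ^+ 2 + nc c ^+ 2 * e ^+ 4).
Proof.
move=> h; rewrite !nc_sqr; case: a b c => a a' [b b'] [c c'].
rewrite /h !expr2 /=; ring.
Qed.

(** By [four_points] the mean of the sum of squares over four points at distance [x] exceeds the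
    central value by at least [b1 * x ^+ 2], [b1] coming from the nonzero linear coefficient. The
    terms of order 3 and higher cost only [O(x ^+ 3)]. *)
Lemma no_local_max (I : finType) (u : I -> C -> C) (p : I -> {poly C}) :
  (forall i, expn_at 3 (u i) (p i)) -> (exists i, (p i)`_1 != 0) ->
  forall d, 0 < d -> exists2 h, nc h < d &
    \sum_i nc (u i 0) ^+ 2 < \sum_i nc (u i h) ^+ 2.
Proof.
move=> up [i0 pi0] d d0.
have key i : exists K e, [/\ 0 <= K, 0 < e, e <= 1 & forall h, nc h < e ->
   nc ((p i)`_0 + (p i)`_1 * h + (p i)`_2 * h ^+ 2) ^+ 2 - K * nc h ^+ 3 <= nc (u i h) ^+ 2].
  have [K [e [K0 e0 e1 H]]] := expn_atW (up i).
  pose q := drop_poly 3 (p i); have [Q Q0 HQ] := poly_bound q.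
  pose t : {poly C} := take_poly 3 (p i); have [T T0 HT] := poly_bound t.
  have tE h : t.[h] = (p i)`_0 + (p i)`_1 * h + (p i)`_2 * h ^+ 2.
    rewrite /t /take_poly horner_poly !big_ord_recr big_ord0 /= add0r expr0 mulr1 expr1.
    by [].
  exists (2 * T * (K + Q)), e; split=> // [|h he]; first by rewrite !mulr_ge0 ?addr_ge0.
  rewrite -tE; have h1 : nc h <= 1 by rewrite (le_trans (ltW he)).
  have ut : nc (u i h - t.[h]) <= (K + Q) * nc h ^+ 3.
    have pE : (p i).[h] = t.[h] + q.[h] * h ^+ 3.
      by rewrite -[in LHS](poly_take_drop 3 (p i)) !hornerE.
    have -> : u i h - t.[h] = (u i h - (p i).[h]) + q.[h] * h ^+ 3 by rewrite pE; ring.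
    rewrite (le_trans (ncD _ _))// mulrDl lerD ?H// ncM ncX.
    by rewrite ler_wpM2r ?exprn_ge0 ?nc_ge0 ?HQ.
  have tu : nc t.[h] - nc (u i h) <= (K + Q) * nc h ^+ 3.
    by rewrite (le_trans (ncB_ge _ _))// ncBC.
  set x := nc h ^+ 3 in tu *; have x0 : 0 <= x by rewrite exprn_ge0 ?nc_ge0.
  have Tb := HT _ h1; have tn := nc_ge0 t.[h]; have un := nc_ge0 (u i h).
  set a := nc t.[h] in tu Tb tn *; set b := nc (u i h) in tu un *.
  have KQ : 0 <= (K + Q) * x by rewrite mulr_ge0 ?addr_ge0.
  set y := (K + Q) * x in tu KQ *.
  have -> : 2 * T * (K + Q) * x = 2 * T * y by rewrite /y; ring.
  case: (lerP a y) => ay.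
    have : a ^+ 2 <= T * y by rewrite expr2 ler_pM.
    have := sqr_ge0 b; have : 0 <= T * y by rewrite mulr_ge0.
    by lra.
  have : (a - y) ^+ 2 <= b ^+ 2 by rewrite ler_sqr ?nnegrE ?subr_ge0 ?(ltW ay)//; lra.
  have : 0 <= y ^+ 2 by rewrite sqr_ge0.
  have : a * y <= T * y by rewrite ler_wpM2r.
  rewrite !expr2; lra.
have /choice[K /choice[e He]] := key.
pose Ks := \sum_i K i; have Ks0 : 0 <= Ks by apply: sumr_ge0 => i _; case: (He i).
pose b1 := nc (p i0)`_1 ^+ 2; have b0 : 0 < b1 by rewrite exprn_gt0 ?nc_gt0.
have [em [em0 Hem]] : exists em, 0 < em /\ forall i, em <= e i.
  exists (\big[Num.min/1]_i e i); split.
    by elim/big_ind: _ => // [x y x0 y0|i _]; [rewrite lt_min x0|case: (He i)].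
  by move=> i; exact: bigmin_le_cond.
(* The last entry makes the cubic error smaller than the quadratic gain; the factor 1/2 makes the
   three bounds strict. *)
pose x := Num.min (Num.min em d) (b1 / (Ks + 1)) / 2.
have Ks1 : 0 < Ks + 1 by rewrite ltr_wpDl.
have x0 : 0 < x by rewrite divr_gt0// !lt_min em0 d0 divr_gt0.
have x2 : x * 2 = Num.min (Num.min em d) (b1 / (Ks + 1)) by rewrite /x; field.
have xem : x < em.
  apply: (@lt_le_trans _ _ (x * 2)); first by rewrite mulr_natr mulr2n ltrDl.
  by rewrite x2 !ge_min lexx.
have xd : x < d.
  apply: (@lt_le_trans _ _ (x * 2)); first by rewrite mulr_natr mulr2n ltrDl.
  by rewrite x2 !ge_min lexx orbT.
have xK : x * (Ks + 1) < b1.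
  rewrite -ltr_pdivlMr//; apply: (@lt_le_trans _ _ (x * 2)); first by rewrite mulr_natr mulr2n ltrDl.
  by rewrite x2 !ge_min lexx orbT.
pose h := (x%:C)%C : C.
have nh : nc h = x by rewrite ncR ger0_norm// ltW.
have nih : nc ('i%C * h) = x.
  rewrite ncM nh; suff -> : nc ('i%C : C) = 1 by rewrite mul1r.
  by rewrite /nc /ComplexField.Normc.normc /= expr0n expr1n add0r sqrtr1.
apply: contrapT => Hn.
have up0 t : nc t = x -> \sum_i nc (u i t) ^+ 2 <= \sum_i nc (p i)`_0 ^+ 2.
  move=> tx; rewrite leNgt; apply/negP => lt; apply: Hn; exists t; first by rewrite tx.
  by under eq_bigr do rewrite (expn_at0 _ (up _))// horner_coef0.
have lo t : nc t = x ->
   \sum_i nc ((p i)`_0 + (p i)`_1 * t + (p i)`_2 * t ^+ 2) ^+ 2 - Ks * x ^+ 3 <= \sum_i nc (p i)`_0 ^+ 2.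
  move=> tx; apply: le_trans (up0 t tx).
  rewrite mulr_suml -sumrB; apply: ler_sum => i _; have [_ _ _ H] := He i.
  by rewrite -tx H// tx (lt_le_trans xem).
have L1 := lo h nh; have L2 := lo (- h) ltac:(by rewrite ncN).
have L3 := lo ('i%C * h) nih; have L4 := lo (- ('i%C * h)) ltac:(by rewrite ncN).
have := lerD (lerD L1 L2) (lerD L3 L4).
set S0 := \sum_i nc (p i)`_0 ^+ 2.
suff : 4 * S0 + 4 * (b1 * x ^+ 2) <=
  \sum_i nc ((p i)`_0 + (p i)`_1 * h + (p i)`_2 * h ^+ 2) ^+ 2 +
  \sum_i nc ((p i)`_0 + (p i)`_1 * (- h) + (p i)`_2 * (- h) ^+ 2) ^+ 2 +
  (\sum_i nc ((p i)`_0 + (p i)`_1 * ('i%C * h) + (p i)`_2 * ('i%C * h) ^+ 2) ^+ 2 +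
  \sum_i nc ((p i)`_0 + (p i)`_1 * (- ('i%C * h)) + (p i)`_2 * (- ('i%C * h)) ^+ 2) ^+ 2).
  have : x * (Ks + 1) * x ^+ 2 < b1 * x ^+ 2 by rewrite ltr_pM2r ?exprn_gt0.
  have -> : x * (Ks + 1) * x ^+ 2 = Ks * x ^+ 3 + x ^+ 3 by ring.
  have : 0 < x ^+ 3 by rewrite exprn_gt0.
  set A1 := \sum_i _; set A2 := \sum_i _; set A3 := \sum_i _; set A4 := \sum_i _.
  lra.
rewrite -!big_split /=; under [leRHS]eq_bigr do rewrite four_points.
rewrite -mulr_sumr -mulrDr ler_wpM2l//; rewrite /S0.
apply: (@le_trans _ _ (\sum_i (nc (p i)`_0 ^+ 2 + nc (p i)`_1 ^+ 2 * x ^+ 2))).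
  rewrite big_split/= lerD2l (bigD1 i0)//= lerDl.
  by apply: sumr_ge0 => i _; rewrite mulr_ge0 ?exprn_ge0 ?nc_ge0// ltW.
apply: ler_sum => i _; rewrite lerDl mulr_ge0 ?exprn_ge0 ?nc_ge0// ltW//.
Qed.

End Expansions.

(** * Maximum principle for multivalued functions *)

Section MaximumPrinciple.
Variable R : realType.
Local Notation C := R[i].
Implicit Types (T Bd : C -> Prop) (s : C -> seq C) (w : {poly C}).

Definition ccpt T := cpt (fun x : 'M[C]_1 => T (x 0 0)).

Lemma nm_scal (x : 'M[C]_1) : nm x = nc (x 0 0).
Proof. by rewrite /nm !big_ord_recl !big_ord0 !addr0 ord1. Qed.

Lemma ccptP T : (exists M, forall t, T t -> nc t <= M) ->
  (forall t, (forall e, 0 < e -> exists2 t', T t' & nc (t' - t) < e) -> T t) -> ccpt T.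
Proof.
move=> [M TM] cT; split; first by exists M => x /TM; rewrite nm_scal.
move=> u l ul Tu; apply: cT => e /ul[N HN]; exists (u N 0 0) => //.
by have := HN N (leqnn _); rewrite nm_scal !mxE.
Qed.

Lemma ccpt_bound T : ccpt T -> exists2 M, 0 <= M & forall t, T t -> nc t <= M.
Proof.
move=> [[M HM] _]; exists `|M| => // t Tt.
have := HM (t%:M); rewrite nm_scal mxE eqxx mulr1n => /(_ Tt) tM.
exact: le_trans tM (ler_norm _).
Qed.

Lemma evtC T (psi : C -> R) : ccpt T -> (exists t, T t) ->
  (forall t, T t -> forall e, 0 < e -> exists2 d, 0 < d &
     forall t', T t' -> nc (t' - t) < d -> `|psi t' - psi t| < e) ->
  exists2 t, T t & forall t', T t' -> psi t' <= psi t.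
Proof.
move=> cT [t0 Tt0] cpsi.
have [||x Tx Hx] := @evt _ _ _ _ (fun x : 'M[C]_1 => psi (x 0 0)) cT.
- by exists (t0%:M); rewrite mxE eqxx mulr1n.
- move=> u l Tl Tu ul e e0; have [d d0 Hd] := cpsi _ Tl _ e0.
  have [N HN] := ul _ d0; exists N => k /HN.
  by rewrite nm_scal !mxE => /(Hd _ (Tu k)).
exists (x 0 0) => // t' Tt'; have := Hx (t'%:M).
by rewrite mxE eqxx mulr1n; exact.
Qed.

Lemma fin_delta (I : finType) (P : I -> C -> Prop) :
  (forall i, exists2 d : R, 0 < d & forall h, nc h < d -> P i h) ->
  exists2 d : R, 0 < d & forall h, nc h < d -> forall i, P i h.
Proof.
move=> H; have /choice[d Hd] i : exists d : R, 0 < d /\ forall h, nc h < d -> P i h.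
  by have [d] := H i; exists d.
exists (\big[Num.min/1]_i d i).
  by elim/big_ind: _ => // [x y x0 y0|i _]; [rewrite lt_min x0|exact: (Hd i).1].
move=> h hd i; apply: (Hd i).2; apply: lt_le_trans hd _; exact: bigmin_le_cond.
Qed.

Lemma expn_sum_cont (I : finType) (u : I -> C -> C) : (forall i, expn 3 (u i)) ->
  forall e, 0 < e -> exists2 d, 0 < d & forall h, nc h < d ->
    `|\sum_i nc (u i h) ^+ 2 - \sum_i nc (u i 0) ^+ 2| < e.
Proof.
move=> eu e e0; pose N : R := #|I|.+1%:R.
have N0 : 0 < N by rewrite ltr0n.
have [i|d d0 Hd] := @fin_delta I (fun i h => `|nc (u i h) ^+ 2 - nc (u i 0) ^+ 2| <= e / N).
  set y := nc (u i 0); have y1 : 0 < 2 * y + 1 by rewrite ltr_wpDl ?mulr_ge0 ?nc_ge0.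
  have [|d d0 Hd] := expn_cont (isT : (0 < 3)%N) (eu i) (e := Num.min 1 (e / N / (2 * y + 1))).
    by rewrite lt_min ltr01 !divr_gt0.
  exists d => // h /Hd; rewrite lt_min ltr_pdivlMr// => /andP[h1 h2].
  rewrite subr_sqr normrM (le_trans _ (ltW h2))// ler_pM//.
    rewrite ler_norml ncB_ge andbT lerNl opprB; have := ncB_ge (u i 0) (u i h).
    by rewrite ncBC.
  rewrite ger0_norm ?addr_ge0 ?nc_ge0//; have := ncB_ge (u i h) (u i 0); rewrite -/y; lra.
exists d => // h /Hd {}Hd; rewrite -sumrB; apply: le_lt_trans (ler_norm_sum _ _ _) _.
apply: (@le_lt_trans _ _ (\sum_(i : I) e / N)); first by apply: ler_sum => i _; exact: Hd.
rewrite sumr_const -[_ *+ _]mulr_natl mulrCA gtr_pMr// ltr_pdivrMr// mul1r ltr_nat ltnS.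
exact: leqnn.
Qed.

(** Only unordered lists of values are compared, so the branches need no global numbering and
    monodromy around the roots of [w] is harmless. *)
Definition repr_at T s t := exists (n : nat) (g : 'I_n -> C -> C),
  (forall i, expn 3 (g i)) /\ exists2 d : R, 0 < d & forall h, nc h < d -> T (t + h) ->
    perm_eq (s (t + h)) [seq g i h | i <- enum 'I_n].

(** By Bernoulli's inequality the powers of [x / K] would grow at least linearly if [x] exceeded
    [K]. The factor [c] disappears in the limit, which is how constants depending on the number of
    branches are removed. *)
Lemma pow_le_bound (x K c : R) : 0 <= x -> 0 < K -> 
  (forall p : nat, x ^+ p <= c * K ^+ p) -> x <= K.
Proof.
move=> x0 K0 H; rewrite leNgt; apply/negP => Kx.
pose a := x / K - 1; have a0 : 0 < a by rewrite subr_gt0 ltr_pdivlMr// mul1r.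
have B (p : nat) : 1 + p%:R * a <= (1 + a) ^+ p.
  elim: p => [|p IH]; first by rewrite mul0r addr0 expr0.
  rewrite exprS; apply: le_trans (ler_wpM2l _ IH); last by rewrite addr_ge0 ?ltW.
  rewrite -natr1; have : 0 <= p%:R * a * a by rewrite !mulr_ge0 ?ler0n ?ltW.
  lra.
have c0 (p : nat) : p%:R * a <= c.
  have -> : p%:R * a = (1 + p%:R * a) - 1 by ring.
  have /le_trans h := B p; suff : (1 + a) ^+ p <= c by move/h; lra.
  have -> : 1 + a = x / K by rewrite /a; ring.
  by rewrite expr_div_n ler_pdivrMr ?exprn_gt0.
have := c0 (Num.Def.archi_bound (c / a)); apply/negP; rewrite -ltNge -ltr_pdivrMr//.
apply: archi_boundP; rewrite divr_ge0 ?ltW//.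
by have := c0 1%N; rewrite mul1r; lra.
Qed.

(* [s] is a multivalued function; its singularities, at the roots of [w], are
   removed by applying the maximum principle to the sum of the |b^p w|^2 over the
   branches [b] and letting [p] go to infinity. *)
Lemma mmp T Bd s w (K Kb : R) (D : nat) : ccpt T ->
  (forall t, T t -> ~ Bd t -> exists2 d : R, 0 < d & forall h, nc h < d -> T (t + h)) ->
  (forall t, T t -> w.[t] != 0 -> repr_at T s t) ->
  (forall t, T t -> w.[t] != 0 -> (size (s t) <= D)%N /\ forall b, b \in s t -> nc b <= Kb) ->
  (forall t, T t -> Bd t -> w.[t] != 0 -> forall b, b \in s t -> nc b <= K) ->
  0 <= K -> forall t, T t -> w.[t] != 0 -> forall b, b \in s t -> nc b <= K.
Proof.
move=> cT intT sR sb sBd K0 t1 Tt1 wt1 b1 b1s.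
(* [K] may be 0, whereas [pow_le_bound] requires a positive bound. *)
apply/ler_addgt0Pr => e e0; set K1 := K + e; have K10 : 0 < K1 by rewrite ltr_wpDl.
have [M M0 TM] := ccpt_bound cT.
(* The additional branch [a * t] has a nonzero linear coefficient at every point, so that
   [no_local_max] always applies; [a] is sent to 0 afterwards. *)
pose psi (p : nat) (a : R) t := \sum_(b <- s t) nc (b ^+ p * w.[t]) ^+ 2 + nc (a%:C%C * t) ^+ 2.
pose u p (a : R) t n (g : 'I_n -> C -> C) (o : 'I_n.+1) h :=
  if unlift ord0 o is Some i then g i h ^+ p * w.[t + h] else a%:C%C * (t + h).
have wt t : exists q, expn_at 3 (fun h => w.[t + h]) q.
  exists (w \Po (t%:P + 'X)); apply: expn_ext (expn_poly 3 _) _.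
  by exists 1 => // h _; rewrite horner_comp !hornerE.
have ua (a : R) t : expn_at 3 (fun h => a%:C%C * (t + h)) (a%:C%C *: (t%:P + 'X)).
  by apply: expn_ext (expn_poly 3 _) _; exists 1 => // h _; rewrite !hornerE.
have up p a t n (g : 'I_n -> C -> C) o : (forall i, expn 3 (g i)) -> expn 3 (u p a t n g o).
  move=> eg; rewrite /u; case: (unlift ord0 o) => [i|]; last by eexists; exact: ua.
  by have [q Hq] := eg i; have [r Hr] := wt t; exists (q ^+ p * r); apply: expnM => //; exact: expnX.
have psiE p a t n (g : 'I_n -> C -> C) h : perm_eq (s (t + h)) [seq g i h | i <- enum 'I_n] ->
    psi p a (t + h) = \sum_o nc (u p a t n g o h) ^+ 2.
  move=> pe; rewrite /psi (perm_big _ pe)/= big_map big_enum/= big_ord_recl addrC.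
  rewrite {1}/u unlift_none; congr (_ + _); apply: eq_bigr => i _.
  by rewrite /u liftK.
have S0 p t : T t -> w.[t] != 0 -> forall L, 0 <= L -> (forall b, b \in s t -> nc b <= L) ->
    \sum_(b <- s t) nc (b ^+ p * w.[t]) ^+ 2 <= D%:R * (L ^+ p * nc w.[t]) ^+ 2.
  move=> Tt wn L L0 HL; apply: (@le_trans _ _ (\sum_(b <- s t) (L ^+ p * nc w.[t]) ^+ 2)).
    rewrite !big_seq; apply: ler_sum => b bs; rewrite ler_sqr ?nnegrE ?mulr_ge0 ?exprn_ge0 ?nc_ge0//.
    by rewrite ncM ncX ler_wpM2r ?nc_ge0// lerXn2r ?nnegrE ?nc_ge0// HL.
  rewrite big_const_seq count_predT iter_addr_0 -[_ *+ _]mulr_natl.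
  by rewrite ler_wpM2r ?sqr_ge0// ler_nat (sb _ Tt wn).1.
have [W W0 HW] : exists2 W, 0 <= W & forall t, T t -> nc w.[t] <= W.
  exists (\sum_(i < size w) nc w`_i * M ^+ i).
    by apply: sumr_ge0 => i _; rewrite mulr_ge0 ?exprn_ge0 ?nc_ge0.
  move=> t Tt; rewrite horner_coef (le_trans (nc_sum _ _ _))//; apply: ler_sum => i _.
  by rewrite ncM ncX ler_wpM2l ?nc_ge0// lerXn2r ?nnegrE ?nc_ge0// TM.
(* At a root of [w] continuity comes from the a priori bounds: at most [D] branches, each bounded by
   [Kb], are multiplied by the small factor [w]. *)
have cpsi p a t : T t -> forall e, 0 < e -> exists2 d, 0 < d &
     forall t', T t' -> nc (t' - t) < d -> `|psi p a t' - psi p a t| < e.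
  move=> Tt e' e'0; have [wt0|wn] := eqVneq w.[t] 0.
    have psit : psi p a t = nc (a%:C%C * (t + 0)) ^+ 2.
      rewrite /psi wt0 big1 ?add0r ?addr0// => b _.
      by rewrite mulr0 nc0 expr0n.
    have [e2 e2E] : exists e2, e2 = e' / 2 by exists (e' / 2).
    have e20 : 0 < e2 by rewrite e2E divr_gt0.
    have [i||d d0 Hd] := @expn_sum_cont _ (fun (_ : 'I_1) h => a%:C%C * (t + h)) _ e2.
    - by eexists; exact: ua.
    - by [].
    have [q Hq] := wt t; pose L := `|Kb| ^+ p; have L0 : 0 <= L by exact: exprn_ge0.
    have den : 0 < D%:R * L ^+ 2 + 1 by rewrite ltr_wpDl// mulr_ge0 ?ler0n ?sqr_ge0.
    have [|d' d'0 Hd'] := expn_cont (isT : (0 < 3)%N) (ex_intro _ q Hq)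
      (e := Num.min 1 (e2 / (D%:R * L ^+ 2 + 1))); first by rewrite lt_min ltr01 !divr_gt0.
    exists (Num.min d d'); first by rewrite lt_min d0.
    move=> t' Tt'; rewrite lt_min => /andP[/Hd + /Hd'].
    rewrite !big_ord1 [t + (t' - t)]addrC subrK addr0 wt0 subr0 lt_min ltr_pdivlMr// psit addr0.
    move=> H1 /andP[H2 H3]; rewrite /psi -addrA; apply: le_lt_trans (ler_normD _ _) _.
    rewrite ger0_norm; last by apply: sumr_ge0 => b _; exact: sqr_ge0.
    suff : \sum_(b <- s t') nc (b ^+ p * w.[t']) ^+ 2 <= nc w.[t'] * (D%:R * L ^+ 2 + 1).
      by move=> HS; apply: le_lt_trans (lerD HS (ltW H1)) _; move: H3; rewrite e2E; lra.
    have [wt'0|wn'] := eqVneq w.[t'] 0.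
      by rewrite wt'0 nc0 mul0r big1// => b _; rewrite mulr0 nc0 expr0n.
    apply: le_trans (S0 p _ Tt' wn' `|Kb| (normr_ge0 _) _) _; rewrite -?/L.
      by move=> b bs; apply: le_trans (ler_norm _); exact: (sb _ Tt' wn').2.
    have -> : D%:R * (L * nc w.[t']) ^+ 2 = nc w.[t'] ^+ 2 * (D%:R * L ^+ 2) by ring.
    apply: ler_pM; rewrite ?sqr_ge0 ?mulr_ge0 ?ler0n ?sqr_ge0//; last by rewrite lerDl.
    by rewrite expr2 ler_piMl ?nc_ge0// ltW.
  have [n [g [eg [d d0 Hd]]]] := sR _ Tt wn.
  have [d' d'0 Hd'] := expn_sum_cont (fun o => up p a t n g o eg) e'0.
  exists (Num.min d d'); first by rewrite lt_min d0.
  move=> t' Tt'; rewrite lt_min => /andP[hd /Hd' H].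
  have := psiE p a t n g (t' - t); have := psiE p a t n g 0.
  rewrite [t + (t' - t)]addrC subrK addr0 => -> .
    by move=> -> //; have := Hd _ hd; rewrite addrC subrK; exact.
  by have := Hd 0; rewrite nc0 addr0; exact.
have main p (a : R) : 0 < a -> nc (b1 ^+ p * w.[t1]) ^+ 2 <=
    D%:R * (K1 ^+ p * W) ^+ 2 + (a * M) ^+ 2.
  move=> a0; have [|tm Ttm Hm] := evtC cT _ (cpsi p a); first by exists t1.
  apply: (@le_trans _ _ (psi p a t1)).
    rewrite /psi (big_rem _ b1s)/= -addrA lerDl addr_ge0 ?sqr_ge0//.
    by apply: sumr_ge0 => b _; exact: sqr_ge0.
  apply: le_trans (Hm _ Tt1) _; rewrite /psi.
  have A2 : nc (a%:C%C * tm) ^+ 2 <= (a * M) ^+ 2.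
    rewrite ler_sqr ?nnegrE ?nc_ge0 ?mulr_ge0 ?(ltW a0)// ncM ncR gtr0_norm//.
    by rewrite ler_wpM2l ?TM// ltW.
  rewrite lerD//; have [wtm|wn] := eqVneq w.[tm] 0.
    rewrite wtm big1 => [|b _]; last by rewrite mulr0 nc0 expr0n.
    by rewrite mulr_ge0 ?ler0n ?sqr_ge0.
  case: (pselect (Bd tm)) => Btm.
    apply: le_trans (S0 p _ Ttm wn K1 (ltW K10) _) _.
      by move=> b bs; apply: le_trans (sBd _ Ttm Btm wn _ bs) _; rewrite lerDl ltW.
    rewrite ler_wpM2l ?ler0n// ler_sqr ?nnegrE ?mulr_ge0 ?exprn_ge0 ?nc_ge0 ?(ltW K10)//.
    by rewrite ler_wpM2l ?exprn_ge0 ?(ltW K10)// HW.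
  exfalso; have [n [g [eg [d d0 Hd]]]] := sR _ Ttm wn.
  have [d' d'0 Hd'] := intT _ Ttm Btm.
  have /choice[q Hq] o : exists q, expn_at 3 (u p a tm n g o) q.
    by have [q] := up p a tm n g o eg; exists q.
  pose q' o := if o == ord0 then a%:C%C *: (tm%:P + 'X) else q o.
  have Hq' o : expn_at 3 (u p a tm n g o) (q' o).
    rewrite /q'; case: eqP => [->|_]; last exact: Hq.
    by apply: expn_ext (ua a tm) _; exists 1 => // h _; rewrite /u unlift_none.
  have [||h] := no_local_max Hq' _ (d := Num.min d d').
  - exists ord0; rewrite /q' eqxx coefZ coefD coefC coefX /= add0r mulr1.
    by rewrite -nc_eq0 ncR normr_eq0 gt_eqF.
  - by rewrite lt_min d0.
  rewrite lt_min => /andP[hd hd'].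
  rewrite -(psiE p a tm n g h (Hd h hd (Hd' h hd'))).
  rewrite -(psiE p a tm n g 0); last by have := Hd 0; rewrite nc0 addr0; exact.
  by rewrite addr0 ltNge Hm//; exact: Hd'.
have main2 p : nc b1 ^+ p * nc w.[t1] <= (D.+1%:R * W) * K1 ^+ p.
  have nn : 0 <= D.+1%:R * W * K1 ^+ p by rewrite !mulr_ge0 ?exprn_ge0// ltW.
  have nn' : 0 <= nc b1 ^+ p * nc w.[t1] by rewrite mulr_ge0 ?exprn_ge0 ?nc_ge0.
  rewrite -ler_sqr// -ncX -ncM; apply: (@le_trans _ _ (D%:R * (K1 ^+ p * W) ^+ 2)).
    apply/ler_addgt0Pr => e' e'0.
    pose a := Num.min 1 (e' / (M ^+ 2 + 1)).
    have m0 : 0 < M ^+ 2 + 1 by rewrite ltr_wpDl ?sqr_ge0.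
    have a0 : 0 < a by rewrite lt_min ltr01 divr_gt0.
    apply: le_trans (main p a a0) _; rewrite lerD2l exprMn.
    have a1 : a <= 1 by rewrite ge_min lexx.
    have : a * (M ^+ 2 + 1) <= e' by rewrite -ler_pdivlMr// ge_min lexx orbT.
    have : a ^+ 2 * M ^+ 2 <= a * M ^+ 2.
      by rewrite ler_wpM2r ?sqr_ge0// expr2 ler_piMl// ltW.
    rewrite mulrDr mulr1; lra.
  have -> : (D.+1%:R * W * K1 ^+ p) ^+ 2 = D.+1%:R ^+ 2 * (K1 ^+ p * W) ^+ 2 by ring.
  by rewrite ler_wpM2r ?sqr_ge0// -natrX ler_nat (leq_trans (leqnSn D))// leq_pmulr.
have wp : 0 < nc w.[t1] by rewrite nc_gt0.
have H k : nc b1 ^+ k <= D.+1%:R * W / nc w.[t1] * K1 ^+ k.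
  by rewrite [leRHS]mulrAC ler_pdivlMr// main2.
exact: pow_le_bound (nc_ge0 b1) K10 H.
Qed.

End MaximumPrinciple.

(** * One complex variable: Schwarz, Cauchy, Liouville and three circles *)

Section OneVariable.
Variable R : realType.
Local Notation C := R[i].
Implicit Types (u v : C -> C) (w : {poly C}).

(** Order 3 is what [no_local_max] consumes: the linear and quadratic terms exactly, and an error
    below the quadratic gain. *)
Definition nice u t := expn 3 (fun h => u (t + h)).

Lemma nice_ext u v t : nice u t -> (exists2 d : R, 0 < d & forall t', nc (t' - t) < d -> v t' = u t') ->
  nice v t.
Proof.
move=> [p Hp] [d d0 H]; exists p; apply: expn_ext Hp _; exists d => // h hd.
by rewrite H// addrC addKr.
Qed.

Lemma niceD u v t : nice u t -> nice v t -> nice (fun t => u t + v t) t.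
Proof. by move=> [p Hp] [q Hq]; exists (p + q); exact: expnD. Qed.

Lemma niceM u v t : nice u t -> nice v t -> nice (fun t => u t * v t) t.
Proof. by move=> [p Hp] [q Hq]; exists (p * q); exact: expnM. Qed.

Lemma niceX u k t : nice u t -> nice (fun t => u t ^+ k) t.
Proof. by move=> [p Hp]; exists (p ^+ k); exact: expnX. Qed.

Lemma nice_poly w t : nice (horner w) t.
Proof.
exists (w \Po (t%:P + 'X)); apply: expn_ext (expn_poly 3 _) _.
by exists 1 => // h _; rewrite horner_comp !hornerE.
Qed.

Lemma nice_cst c t : nice (fun=> c) t.
Proof. by apply: nice_ext (nice_poly c%:P t) _; exists 1 => // t' _; rewrite hornerC. Qed.

Lemma nice_id t : nice (fun t => t) t.
Proof. by apply: nice_ext (nice_poly 'X t) _; exists 1 => // t' _; rewrite hornerX. Qed.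

Lemma nice_inv u t : nice u t -> u t != 0 -> nice (fun t => (u t)^-1) t.
Proof. by move=> un u0; apply: expn_inv => //; rewrite addr0. Qed.

Lemma nice_sum (I : Type) (r : seq I) (F : I -> C -> C) t :
  (forall i, nice (F i) t) -> nice (fun t => \sum_(i <- r) F i t) t.
Proof.
move=> HF; elim: r => [|i r IH].
  by apply: nice_ext (nice_cst 0 t) _; exists 1 => // t' _; rewrite big_nil.
by apply: nice_ext (niceD (HF i) IH) _; exists 1 => // t' _; rewrite big_cons.
Qed.

Lemma nice_prod (I : Type) (r : seq I) (F : I -> C -> C) t :
  (forall i, nice (F i) t) -> nice (fun t => \prod_(i <- r) F i t) t.
Proof.
move=> HF; elim: r => [|i r IH].
  by apply: nice_ext (nice_cst 1 t) _; exists 1 => // t' _; rewrite big_nil.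
by apply: nice_ext (niceM (HF i) IH) _; exists 1 => // t' _; rewrite big_cons.
Qed.

Lemma nice_pf n (q : 'rV[C]_n -> C) (z : C -> 'rV[C]_n) t : polyfun q ->
  (forall i, nice (fun t => z t 0 i) t) -> nice (fun t => q (z t)) t.
Proof. by move=> pq nz; apply: expn_pf. Qed.

Lemma nice_lip u t : nice u t -> exists L d : R, [/\ 0 <= L, 0 < d &
  forall t', nc (t' - t) < d -> nc (u t' - u t) <= L * nc (t' - t)].
Proof.
move=> [p up]; have u0 := expn_at0 (isT : (0 < 3)%N) up.
have [K [d [K0 d0 d1 H]]] := expn_atW up.
have [q pq] : exists q, p = q * 'X + (p.[0])%:P.
  have /factor_theorem[q Hq] : root (p - (p.[0])%:P) 0 by rewrite /root !hornerE subrr.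
  by exists q; move: Hq; rewrite subr0 => <-; rewrite subrK.
have [Q Q0 HQ] := poly_bound q.
exists (K + Q), d; split; rewrite ?addr_ge0// => t' td.
have := H _ td; rewrite addr0 in u0; rewrite u0 [t + _]addrC subrK => H'.
have h1 : nc (t' - t) <= 1 by rewrite (le_trans (ltW td)).
rewrite -(subrK p.[t' - t] (u t')) -addrA; apply: le_trans (ncD _ _) _.
have -> : p.[t' - t] - p.[0] = q.[t' - t] * (t' - t) by rewrite {1}pq !hornerE addrK.
rewrite ncM mulrDl lerD ?ler_wpM2r ?nc_ge0 ?HQ// (le_trans H')// ler_wpM2l//.
by rewrite exprS ler_piMr ?nc_ge0 ?exprn_ile1 ?nc_ge0.
Qed.

Lemma repr1 T u t : nice u t -> repr_at T (fun t => [:: u t]) t.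
Proof.
move=> nu; exists 1%N, (fun _ h => u (t + h)); split=> //; exists 1 => // h _ _.
by rewrite enum_ordSl (size0nil (size_enum_ord 0))//= perm_refl.
Qed.

Lemma ccpt_annulus (r1 r2 : R) : ccpt (fun t : C => r1 <= nc t <= r2).
Proof.
apply: ccptP; first by exists r2 => t /andP[].
move=> t H; apply/andP; split; apply/ler_addgt0Pr => e /H[t' /andP[h1 h2] tt].
  by have := ncB_ge t' t; lra.
by have := ncB_ge t t'; rewrite ncBC; lra.
Qed.

Lemma annulus_mp u (w : {poly C}) (r1 r2 K Kb : R) : 0 <= K ->
  (forall t, r1 <= nc t <= r2 -> w.[t] != 0 -> nice u t /\ nc (u t) <= Kb) ->
  (forall t, nc t = r1 \/ nc t = r2 -> w.[t] != 0 -> nc (u t) <= K) ->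
  forall t, r1 <= nc t <= r2 -> w.[t] != 0 -> nc (u t) <= K.
Proof.
move=> K0 H HB t tr wt.
apply: (@mmp _ (fun t => r1 <= nc t <= r2) (fun t => nc t = r1 \/ nc t = r2)
   (fun t => [:: u t]) w K Kb 1 (ccpt_annulus r1 r2)) tr wt _ _ => //.
- move=> t' /andP[h1 h2] /not_orP[/eqP n1 /eqP n2].
  have {h1 n1} h1 : r1 < nc t' by rewrite lt_neqAle eq_sym n1.
  have {h2 n2} h2 : nc t' < r2 by rewrite lt_neqAle n2.
  exists (Num.min (nc t' - r1) (r2 - nc t')); first by rewrite lt_min !subr_gt0 h1 h2.
  move=> h; rewrite lt_min => /andP[a b].
  by have := ncD t' h; have := ncB_ge t' (- h); rewrite ncN opprK => *; apply/andP; split; lra.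
- by move=> t' tr' wt'; apply: repr1; exact: (H t' tr' wt').1.
- by move=> t' tr' wt'; split=> // b; rewrite inE => /eqP->; exact: (H t' tr' wt').2.
- by move=> t' tr' tb wt' b; rewrite inE => /eqP->; exact: HB.
- by rewrite inE.
Qed.

Lemma disc_mp u (w : {poly C}) (r K Kb : R) : 0 <= K ->
  (forall t, nc t <= r -> w.[t] != 0 -> nice u t /\ nc (u t) <= Kb) ->
  (forall t, nc t = r -> w.[t] != 0 -> nc (u t) <= K) ->
  forall t, nc t <= r -> w.[t] != 0 -> nc (u t) <= K.
Proof.
(* With inner radius -1 the inner circle is empty and the annulus is the disc. *)
move=> K0 H HB t tr wt; apply: (@annulus_mp u w (-1) r K Kb) => //.
- by move=> t' /andP[_]; exact: H.
- by move=> t' [t1|]; [have := nc_ge0 t'; rewrite t1; lra|exact: HB].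
- by rewrite tr andbT (le_trans _ (nc_ge0 t))//; lra.
Qed.

(** Maximum principle for [u t / t], with the singularity at 0 removed by taking ['X] for the
    exceptional polynomial. The constant [L] of the local bound does not appear in the
    conclusion. *)
Lemma schwarz_div u (r K : R) : 0 < r -> 0 <= K ->
  (forall t, 0 < nc t <= r -> nice u t /\ nc (u t) <= K) ->
  (exists L d : R, 0 < d /\ forall t, 0 < nc t < d -> nc (u t) <= L * nc t) ->
  forall t, 0 < nc t <= r -> nc (u t) <= K / r * nc t.
Proof.
move=> r0 K0 H [L [d [d0 HL]]] t /andP[t0 tr].
suff : nc (u t / t) <= K / r by rewrite ncM ncV ler_pdivrMr.
apply: (@disc_mp (fun t => u t / t) 'X r (K / r) (`|L| + K / d)) => //.
- by rewrite divr_ge0 ?(ltW r0).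
- move=> {t0 tr}t tr; rewrite hornerX -nc_gt0 => t0; have [|nu uK] := H t; first by rewrite t0 tr.
  split; first by apply: niceM => //; apply: nice_inv; rewrite -?nc_gt0//; exact: nice_id.
  rewrite ncM ncV ler_pdivrMr// mulrDl; case: (ltP (nc t) d) => td.
    apply: le_trans (HL _ _) _; first by rewrite t0 td.
    apply: ler_wpDr; first by rewrite !mulr_ge0 ?invr_ge0 ?nc_ge0 ?(ltW d0).
    by rewrite ler_wpM2r ?nc_ge0// ler_norm.
  apply: ler_wpDl; first by rewrite mulr_ge0 ?nc_ge0.
  by apply: le_trans uK _; rewrite mulrAC ler_pdivlMr// ler_wpM2l.
- move=> {t0 tr}t tr; rewrite hornerX -nc_gt0 => t0.
  rewrite ncM ncV tr ler_wpM2r ?invr_ge0 ?(ltW r0)//.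
  by apply: (H t _).2; rewrite t0 tr lexx.
- by rewrite hornerX -nc_gt0.
Qed.

Lemma nc_tri (b a c : C) : nc (a - c) <= nc (a - b) + nc (b - c).
Proof. by rewrite -{1}(subrK b a) -addrA ncD. Qed.

Lemma cauchy_coef0 (A : C -> C) (B : {poly C}) (r K : R) : 0 < r ->
  (forall t, 0 < nc t <= r -> nc (A t) <= K) ->
  (exists c d : R, 0 < d /\ forall t, 0 < nc t < d -> nc (A t - B.[t]) <= c * nc t) ->
  nc B`_0 <= K.
Proof.
move=> r0 HA [c [d [d0 HB]]]; rewrite -horner_coef0; apply/ler_addgt0Pr => e e0.
have [M [d' [M0 d'0 HM]]] := nice_lip (nice_poly B 0).
pose x := Num.min r (Num.min (Num.min d d' / 2) (e / (`|c| + M + 1))).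
have cM : 0 < `|c| + M + 1 by rewrite ltr_wpDl ?addr_ge0.
have x0 : 0 < x by rewrite !lt_min r0 !divr_gt0// !lt_min d0 d'0.
have xm : x < Num.min d d'.
  have m0 : 0 < Num.min d d' by rewrite !lt_min d0.
  have : x <= Num.min d d' / 2 by rewrite 2!ge_min lexx orbT.
  lra.
move: xm; rewrite !lt_min => /andP[xd xd'].
have nx : nc (x%:C)%C = x by rewrite ncR gtr0_norm.
have AK := HA (x%:C)%C; rewrite nx x0 ge_min lexx in AK; have {}AK := AK isT.
have AB := HB (x%:C)%C; rewrite nx x0 xd in AB; have {}AB := AB isT.
have BB := HM (x%:C)%C; rewrite subr0 nx in BB; have {}BB := BB xd'.
have xe : x * (`|c| + M + 1) <= e by rewrite -ler_pdivlMr// !ge_min lexx !orbT.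
have cx : c * x <= `|c| * x by rewrite ler_pM2r// ler_norm.
have := ncB_ge B.[0] (A (x%:C)%C); rewrite ncBC.
have := nc_tri B.[(x%:C)%C] (A (x%:C)%C) B.[0].
rewrite !mulrDr mulr1 in xe; rewrite mulrC in BB; rewrite mulrC (mulrC `|c|) in cx; rewrite mulrC in AB; lra.
Qed.

(** Cauchy estimates for a function that agrees with [B] at 0 to order [L + 1] only. Each step
    subtracts the constant term, which doubles the bound, and divides by [t] through [schwarz_div];
    hence [2 / r] in place of [1 / r]. *)
Lemma cauchy_coef (A : C -> C) (B : {poly C}) (L : nat) (r K : R) : 0 < r ->
  (forall t, 0 < nc t <= r -> nice A t /\ nc (A t) <= K) ->
  (exists c d : R, 0 < d /\ forall t, 0 < nc t < d -> nc (A t - B.[t]) <= c * nc t ^+ L.+1) ->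
  forall l, (l <= L)%N -> nc B`_l <= K * (2 / r) ^+ l.
Proof.
move=> r0 + + l.
have lin L' (A' : C -> C) (B' : {poly C}) :
    (exists c d : R, 0 < d /\ forall t, 0 < nc t < d -> nc (A' t - B'.[t]) <= c * nc t ^+ L'.+1) ->
    exists c d : R, [/\ 0 <= c, 0 < d & forall t, 0 < nc t < d -> nc (A' t - B'.[t]) <= c * nc t].
  move=> [c [d [d0 H]]]; exists `|c|, (Num.min d 1); split=> //; first by rewrite lt_min d0 ltr01.
  move=> t /andP[t0]; rewrite lt_min => /andP[td t1].
  apply: le_trans (H t _) _; first by rewrite t0.
  apply: (@le_trans _ _ (`|c| * nc t ^+ L'.+1)); first by rewrite ler_wpM2r ?exprn_ge0 ?nc_ge0 ?ler_norm.
  by rewrite ler_wpM2l// exprS ler_piMr ?nc_ge0// exprn_ile1 ?nc_ge0// ltW.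
elim: l A B L K => [|l IH] A B L K HA HB lL.
  rewrite expr0 mulr1; apply: (cauchy_coef0 r0 (fun t tr => (HA t tr).2)).
  by have [c [d [c0 d0 H]]] := lin _ _ _ HB; exists c, d.
case: L lL HB => // L lL HB.
have K0 : 0 <= K.
  have [|_] := HA (r%:C)%C; first by rewrite ncR gtr0_norm// r0 lexx.
  exact: le_trans (nc_ge0 _).
have b0 : nc B`_0 <= K.
  apply: (cauchy_coef0 r0 (fun t tr => (HA t tr).2)).
  by have [c [d [c0 d0 H]]] := lin _ _ _ HB; exists c, d.
pose B' := drop_poly 1 B; have BE t : B.[t] = B`_0 + B'.[t] * t.
  rewrite -[in LHS](poly_take_drop 1 B) !hornerE ?expr1 /take_poly horner_poly big_ord1.
  by rewrite expr0 mulr1.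
have -> : B`_l.+1 = B'`_l by rewrite coef_drop_poly addn1.
have -> : K * (2 / r) ^+ l.+1 = (2 * K / r) * (2 / r) ^+ l by rewrite exprS; ring.
have t0n (t : C) : 0 < nc t -> t != 0 by rewrite nc_gt0.
apply: (IH (fun t => (A t - B`_0) / t) B' L) => //.
- move=> t tr; have [nA AK] := HA t tr; have /andP[t0 tr'] := tr; have tn := t0n t t0.
  split.
    apply: niceM; last by apply: nice_inv => //; exact: nice_id.
    by apply: niceD => //; exact: nice_cst.
  rewrite ncM ncV ler_pdivrMr//.
  apply: (@schwarz_div (fun t => A t - B`_0) r (2 * K)) => //; first by rewrite mulr_ge0.
    move=> t' tr2; have [nA' AK'] := HA t' tr2; split.
      by apply: niceD => //; exact: nice_cst.
    by have := ncB (A t') B`_0; lra.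
  have [c [d [c0 d0 H]]] := lin _ _ _ HB.
  have [M [d' [M0 d'0 HM]]] := nice_lip (nice_poly B 0).
  exists (c + M), (Num.min d d'); split; first by rewrite lt_min d0.
  move=> t' /andP[t'0]; rewrite lt_min => /andP[td td'].
  apply: le_trans (nc_tri B.[t'] _ _) _; rewrite mulrDl lerD ?H ?t'0//.
  by have := HM t'; rewrite subr0 horner_coef0; exact.
- have [c [d [d0 H]]] := HB; exists c, d; split=> // t /andP[t0 td].
  have tn := t0n t t0; have -> : (A t - B`_0) / t - B'.[t] = (A t - B.[t]) / t by rewrite BE; field.
  rewrite ncM ncV ler_pdivrMr// -mulrA -exprSr; apply: H.
  by rewrite t0.
Qed.

Lemma nonroot_near w t0 (d : R) : w != 0 -> 0 < d ->
  exists t, [/\ 0 < nc (t - t0), nc (t - t0) < d & w.[t] != 0].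
Proof.
move=> w0 d0; apply: contrapT => H.
pose x (j : nat) : C := t0 + ((d / j.+2%:R)%:C)%C.
have xd j : nc (x j - t0) = d / j.+2%:R.
  by rewrite /x addrC addKr ncR ger0_norm// divr_ge0 ?ler0n// ltW.
have xi : injective x.
  move=> i j ij; have := xd i; rewrite ij xd => /(mulfI (lt0r_neq0 d0)) /invr_inj/eqP.
  by rewrite eqr_nat => /eqP [].
pose rs := [seq x j | j <- iota 0 (size w)].
suff ar : all (root w) rs.
  have := max_poly_roots w0 ar; rewrite map_inj_uniq ?iota_uniq// => /(_ isT).
  by rewrite size_map size_iota ltnn.
apply/allP => _ /mapP[j _ ->]; apply: contrapT => wj; apply: H; exists (x j).
rewrite xd divr_gt0 ?ltr0n//; split=> //; last exact/negP.
by rewrite ltr_pdivrMr ?ltr0n// ltr_pMr// ltr1n.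
Qed.

(** Passing to the difference quotient at a point [t0] with [w.[t0] != 0] lowers the growth exponent
    by one and adds [t0] to the exceptional roots. In the base case the quotient tends to 0 at
    infinity, so the maximum principle on large discs makes it vanish. *)
Lemma liouville u (w : {poly C}) (a : nat) : w != 0 ->
  (forall t, w.[t] != 0 -> nice u t) ->
  (exists K : R, forall t, w.[t] != 0 -> nc (u t) <= K * (1 + nc t) ^+ a) ->
  exists p : {poly C}, (size p <= a.+1)%N /\ forall t, w.[t] != 0 -> u t = p.[t].
Proof.
have main (u' : C -> C) (w' : {poly C}) b : w' != 0 ->
  (forall t, w'.[t] != 0 -> nice u' t) ->
  (exists K : R, forall t, w'.[t] != 0 -> nc (u' t) <= K * (1 + nc t) ^+ b) ->
  exists t0, w'.[t0] != 0 /\ let w1 := w' * ('X - t0%:P) in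
   [/\ w1 != 0, (forall t, w1.[t] != 0 -> nice (fun t => (u' t - u' t0) / (t - t0)) t) &
   exists K1 : R, 0 <= K1 /\ forall t, w1.[t] != 0 -> nc ((u' t - u' t0) / (t - t0)) * (1 + nc t) <= K1 * (1 + nc t) ^+ b].
  move=> w0 nu [K HK]; have [t0 [_ _ wt0]] := nonroot_near 0 w0 ltr01.
  exists t0; split=> // w1.
  have w1E t : (w1.[t] != 0) = (w'.[t] != 0) && (t - t0 != 0).
    by rewrite /w1 hornerM mulf_eq0 negb_or !hornerE.
  split; first by rewrite mulf_neq0// polyXsubC_eq0.
    move=> t; rewrite w1E => /andP[wt tt]; apply: niceM.
      by apply: niceD; [exact: nu|exact: nice_cst].
    by apply: nice_inv => //; apply: niceD; [exact: nice_id|exact: nice_cst].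
  have [L [d [L0 d0 HL]]] := nice_lip (nu _ wt0).
  have t00 := nc_ge0 t0; have u00 := nc_ge0 (u' t0).
  have dd : 0 <= 1 + nc t0 + d by lra.
  have KK : 0 <= `|K| + nc (u' t0) by rewrite addr_ge0.
  pose c := (1 + nc t0 + d) / d; have c0 : 0 <= c by rewrite divr_ge0// ltW.
  have Kc : 0 <= (`|K| + nc (u' t0)) * c by rewrite mulr_ge0.
  have Ld : 0 <= L * (1 + nc t0 + d) by rewrite mulr_ge0.
  exists (L * (1 + nc t0 + d) + (`|K| + nc (u' t0)) * c); split.
    exact: addr_ge0.
  move=> t; rewrite w1E => /andP[wt tt]; have tt0 : 0 < nc (t - t0) by rewrite nc_gt0.
  have b1 : 1 <= (1 + nc t) ^+ b by rewrite exprn_ege1// lerDl nc_ge0.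
  have t1 : 1 + nc t <= 1 + nc t0 + nc (t - t0).
    by have := ncD t0 (t - t0); rewrite addrC subrK => ?; lra.
  rewrite ncM ncV mulrAC ler_pdivrMr//.
  case: (ltP (nc (t - t0)) d) => td.
    apply: (@le_trans _ _ (L * nc (t - t0) * (1 + nc t0 + d))).
      apply: ler_pM; rewrite ?nc_ge0 ?addr_ge0 ?nc_ge0// ?HL//.
      by apply: le_trans t1 _; rewrite lerD2l ltW.
    rewrite mulrAC ler_wpM2r ?nc_ge0//.
    apply: (@le_trans _ _ (L * (1 + nc t0 + d) + (`|K| + nc (u' t0)) * c)).
      by rewrite lerDl.
    by rewrite ler_peMr// addr_ge0.
  have h1 : nc (u' t - u' t0) <= (`|K| + nc (u' t0)) * (1 + nc t) ^+ b.
    apply: le_trans (ncB _ _) _; rewrite mulrDl lerD//.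
      apply: le_trans (HK _ wt) _; rewrite ler_wpM2r ?ler_norm// exprn_ge0 ?addr_ge0 ?nc_ge0//.
    by rewrite ler_peMr ?nc_ge0.
  have h2 : 1 + nc t <= c * nc (t - t0).
    apply: le_trans t1 _; rewrite /c mulrAC ler_pdivlMr// [leRHS]mulrDl [leLHS]mulrDl.
    rewrite [_ * d]mulrC [nc (t - t0) * d]mulrC lerD2r mulrC ler_wpM2l// addr_ge0//.
  apply: le_trans (ler_pM (nc_ge0 _) _ h1 h2) _; first by rewrite addr_ge0 ?nc_ge0.
  have bb : 0 <= (1 + nc t) ^+ b by rewrite (le_trans ler01).
  have -> : (`|K| + nc (u' t0)) * (1 + nc t) ^+ b * (c * nc (t - t0)) =
     (`|K| + nc (u' t0)) * c * (1 + nc t) ^+ b * nc (t - t0) by ring.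
  by rewrite ler_wpM2r ?nc_ge0// ler_wpM2r// lerDr.
elim: a u w => [|a IH] u w w0 nu hK; have [t0 [wt0 [w10 nu1 [K1 [K10 HK1]]]]] := main _ _ _ w0 nu hK.
  exists (u t0)%:P; split; first by rewrite size_polyC; case: eqP.
  move=> t wt; rewrite hornerC; have [->//|tt] := eqVneq t t0.
  have tn : t - t0 != 0 by rewrite subr_eq0.
  set w1 := w * _ in w10 nu1 HK1; have w1t : w1.[t] != 0 by rewrite hornerM mulf_neq0 ?hornerE.
  suff : (u t - u t0) / (t - t0) = 0.
    by move/eqP; rewrite mulf_eq0 invr_eq0 (negbTE tn) orbF subr_eq0 => /eqP.
  apply/eqP; rewrite -nc_eq0 eq_le nc_ge0 andbT; apply/ler_addgt0Pr => e e0; rewrite add0r.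
  (* On the circle of this radius the quotient is at most [K1 / (1 + r)], hence at most [e]. *)
  pose r := nc t + K1 / e; have r0 : 0 <= r by rewrite addr_ge0 ?nc_ge0 ?divr_ge0// ltW.
  apply: (@disc_mp (fun t => (u t - u t0) / (t - t0)) w1 r e K1) => //.
  - exact: ltW.
  - move=> t' tr wt'; split; first exact: nu1.
    have := HK1 _ wt'; rewrite expr0 mulr1 => /(le_trans _); apply.
    by rewrite ler_peMr ?nc_ge0// lerDl nc_ge0.
  - move=> t' tr wt'; have := HK1 _ wt'; rewrite expr0 mulr1 -ler_pdivlMr; last first.
      by rewrite tr ltr_pwDl.
    move/le_trans; apply; rewrite tr ler_pdivrMr ?ltr_pwDl// mulrC -ler_pdivrMr//.
    by rewrite /r; have := nc_ge0 t; lra.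
  - by rewrite /r lerDl divr_ge0// ltW.
set w1 := w * _ in w10 nu1 HK1.
have [|p [sp Hp]] := IH _ _ w10 nu1.
  exists K1 => t wt; have := HK1 _ wt; rewrite exprSr mulrA ler_pM2r//.
  by rewrite ltr_pwDl ?nc_ge0.
exists (p * ('X - t0%:P) + (u t0)%:P); split.
  apply: leq_trans (size_polyD _ _) _; rewrite geq_max (leq_trans (size_polyMleq _ _)) ?size_XsubC ?addn2//=.
  by rewrite size_polyC; case: eqP.
move=> t wt; rewrite !hornerE; have [->|tt] := eqVneq t t0; first by rewrite subrr mulr0 add0r.
have tn : t - t0 != 0 by rewrite subr_eq0.
by rewrite -Hp; [field|rewrite hornerM mulf_neq0 ?hornerE].
Qed.

(** A three circles principle, by the maximum principle for [u t / t ^+ b] between the radii [s] and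
    [r]: a large [b] makes the outer contribution [K * (r' / r) ^+ b] small, then [e] is fixed
    against the inner one. The smallness [e] is chosen before [u]. *)
Lemma propagation (s r' r K om : R) : 0 < s -> 0 <= r' < r -> 0 <= K -> 0 < om ->
  exists e : R, 0 < e /\ forall u,
   (forall t, nc t <= r -> nice u t /\ nc (u t) <= K) ->
   (forall t, nc t <= s -> nc (u t) <= e) -> forall t, nc t <= r' -> nc (u t) <= om.
Proof.
move=> s0 /andP[r'0 r'r] K0 om0; have r0 : 0 < r by apply: le_lt_trans r'r.
have [b Hb] : exists b : nat, K * (r' / r) ^+ b <= om.
  apply: contrapT => /forallNP H.
  have H1 b : om < K * (r' / r) ^+ b by rewrite ltNge; apply/negP.
  have KP : 0 < K by have := H1 0%N; rewrite expr0; lra.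
  have : 1 <= r' / r; last by rewrite ler_pdivlMr// mul1r leNgt r'r.
  have q0 : 0 <= r' / r by rewrite divr_ge0// ltW.
  have qn0 : r' / r != 0.
    by apply/eqP => q1; have := H1 1%N; rewrite q1 expr0n mulr0; lra.
  have qp : 0 < r' / r by rewrite lt_def qn0.
  rewrite -invr_le1 ?unitfE//.
  apply: (@pow_le_bound _ _ _ (K / om)); rewrite ?invr_ge0// => p.
  rewrite expr1n mulr1 exprVn ler_pdivlMr// mulrC ler_pdivrMr ?exprn_gt0//.
  exact: ltW.
exists (Num.min om (om / ((r / s) ^+ b + 1))); split.
  by rewrite lt_min om0 divr_gt0// ltr_wpDl// exprn_ge0// divr_ge0// ltW.
move=> u Hu us t tr.
case: (leP (nc t) s) => ts; first by apply: le_trans (us _ ts) _; rewrite ge_min lexx.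
set e := Num.min _ _ in us.
have den : 0 < (r / s) ^+ b + 1 by rewrite ltr_wpDl// exprn_ge0// divr_ge0// ltW.
have e00 : 0 <= e by rewrite /e le_min (ltW om0) divr_ge0// ltW.
have ee : e * (r' / s) ^+ b <= om.
  have h1 : e * ((r / s) ^+ b + 1) <= om.
    rewrite -ler_pdivlMr; first by rewrite ge_min lexx orbT.
    by rewrite ltr_wpDl// exprn_ge0// divr_ge0// ltW.
  apply: le_trans _ h1; rewrite ler_wpM2l//.
  apply: ler_wpDr => //; rewrite lerXn2r ?nnegrE ?divr_ge0 ?(ltW r0) ?(ltW s0) ?r'0//.
    by rewrite ler_pM2r ?invr_gt0 ?(ltW r'r).
have t0 : 0 < nc t by apply: lt_trans ts.
have bd0 : 0 <= Num.max (e / s ^+ b) (K / r ^+ b).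
  by rewrite le_max orbC divr_ge0// exprn_ge0// ltW.
have H : nc (u t / t ^+ b) <= Num.max (e / s ^+ b) (K / r ^+ b).
  apply: (@annulus_mp (fun t => u t / t ^+ b) 1 s r _ (K / s ^+ b)) => //.
  - move=> t' /andP[ts' tr'] _; have t'0 : 0 < nc t' by apply: lt_le_trans ts'.
    have t'n : t' != 0 by rewrite -nc_gt0.
    have [nu uK] := Hu _ tr'; split.
      apply: niceM => //; apply: nice_inv; last by rewrite expf_neq0.
      by apply: niceX; exact: nice_id.
    rewrite ncM ncV ncX ler_pM ?invr_ge0 ?exprn_ge0 ?nc_ge0//.
    by rewrite lef_pV2 ?posrE ?exprn_gt0// lerXn2r ?nnegrE ?nc_ge0// ltW.
  - move=> t' tb _; rewrite ncM ncV ncX le_max; case: tb => tb; rewrite tb.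
      by rewrite ler_wpM2r ?us ?tb ?invr_ge0 ?exprn_ge0 ?(ltW s0).
    by rewrite [X in _ || X]ler_wpM2r ?orbT ?invr_ge0 ?exprn_ge0 ?(ltW r0)//; apply: (Hu _ _).2; rewrite tb.
  - by rewrite (ltW ts) (le_trans tr)// ltW.
  - by rewrite hornerC oner_neq0.
rewrite ncM ncV ncX ler_pdivrMr ?exprn_gt0// in H; apply: le_trans H _.
have tb : nc t ^+ b <= r' ^+ b by rewrite lerXn2r ?nnegrE ?nc_ge0.
apply: le_trans (ler_wpM2l bd0 tb) _; rewrite maxr_pMl ?exprn_ge0// ge_max.
apply/andP; split.
  by apply: le_trans ee; rewrite expr_div_n mulrA mulrAC.
by apply: le_trans Hb; rewrite expr_div_n mulrA mulrAC.
Qed.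

End OneVariable.

(** * Proper polynomial maps as ramified coverings *)

Section Paths.
Variable R : realType.
Local Notation C := R[i].

Lemma pow_small (q K om : R) : 0 <= q < 1 -> 0 < om -> exists b : nat, K * q ^+ b <= om.
Proof.
move=> /andP[q0 q1] om0; apply: contrapT => /forallNP H.
have H1 b : om < K * q ^+ b by rewrite ltNge; apply/negP.
have KP : 0 < K by have := H1 0%N; rewrite expr0; lra.
have qn0 : q != 0 by apply/eqP => q2; have := H1 1%N; rewrite q2 expr0n mulr0; lra.
have qp : 0 < q by rewrite lt_def qn0.
suff : q^-1 <= 1 by rewrite invf_le1// leNgt q1.
apply: (@pow_le_bound _ _ _ (K / om)); rewrite ?invr_ge0// => p.
rewrite expr1n mulr1 exprVn ler_pdivlMr// mulrC ler_pdivrMr ?exprn_gt0//.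
exact: ltW.
Qed.

Lemma seg_ind (Q : R -> Prop) :
  (forall s, 0 <= s <= 1 -> exists2 d, 0 < d & forall s' s'', 0 <= s' <= 1 -> 0 <= s'' <= 1 ->
     `|s' - s| < d -> `|s'' - s| < d -> Q s' -> Q s'') -> Q 0 -> Q 1.
Proof.
move=> H Q0; pose S : set R := fun s => 0 <= s <= 1 /\ Q s.
have hS : has_sup S.
  by split; [exists 0; split=> //; rewrite lexx ler01|exists 1 => s [/andP[]]].
set b := sup S; have b01 : 0 <= b <= 1.
  apply/andP; split; last by apply: sup_le_ub hS.1 _ => s [/andP[]].
  by apply: ub_le_sup hS.2 _ _; split=> //; rewrite lexx ler01.
have [d d0 Hd] := H _ b01.
have [s [s01 Qs] bs] := sup_adherent d0 hS; rewrite -/b in bs.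
have sb : s <= b by apply: ub_le_sup hS.2 _ _.
have sd : `|s - b| < d by rewrite ler0_norm ?subr_le0// opprB; lra.
pose c := Num.min 1 (b + d / 2).
have bc : b <= c by rewrite le_min (andP b01).2; lra.
have cd : `|c - b| < d.
  rewrite ger0_norm ?subr_ge0//; have : c <= b + d / 2 by rewrite ge_min lexx orbT.
  lra.
have c01 : 0 <= c <= 1 by rewrite (le_trans (andP b01).1 bc) ge_min lexx.
have Qc := Hd s c s01 c01 sd cd Qs.
have cb : c <= b by apply: ub_le_sup hS.2 _ _.
suff <- : c = 1 by [].
have : c = 1 \/ c = b + d / 2 by rewrite /c /Num.min; case: ifP; [left|right].
by case=> // cE; move: cb; rewrite cE; lra.
Qed.

(** A root other than 0 lies on at most one of the lines of slope [j] through 0, and there are more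
    slopes than roots. *)
Lemma ray_avoid (w : {poly C}) : w.[0] != 0 ->
  exists j : nat, forall s : R, w.[(s +i* (s * j%:R))%C] != 0.
Proof.
move=> w0; have wn : w != 0 by apply: contraNneq w0 => ->; rewrite horner0.
apply: contrapT => /forallNP H.
have /choice[s Hs] (j : nat) : exists s : R, w.[(s +i* (s * j%:R))%C] = 0.
  by apply: contrapT => /forallNP Hj; apply: (H j) => s; apply/eqP.
pose x j : C := (s j +i* (s j * j%:R))%C.
have xi : injective x.
  move=> i j [sij]; rewrite sij; have [sj0|sj] := eqVneq (s j) 0.
    by have := Hs j; rewrite sj0 mul0r => E; move/eqP: w0.
  by move/(mulfI sj)/eqP; rewrite eqr_nat => /eqP.
pose rs := [seq x j | j <- iota 0 (size w)].
have ar : all (root w) rs by apply/allP => _ /mapP[j _ ->]; apply/eqP; exact: Hs.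
have := max_poly_roots wn ar; rewrite map_inj_uniq ?iota_uniq// => /(_ isT).
by rewrite size_map size_iota ltnn.
Qed.

(** The plane minus finitely many points is connected. The path runs from 0 to [c], of real part
    1/2, along a line avoiding the roots, and on to 1; reflected by [t |-> 1 - t^*], the second leg
    is the first one, so the slope must also avoid the roots of the reflected polynomial [w2]. *)
Lemma path_ind (w : {poly C}) (Q : C -> Prop) : w.[0] != 0 -> w.[1] != 0 ->
  (forall t, w.[t] != 0 -> exists2 d : R, 0 < d & forall t' t'', nc (t' - t) < d ->
     nc (t'' - t) < d -> Q t' -> Q t'') -> Q 0 -> Q 1.
Proof.
move=> w0 w1 H Q0; pose w2 := map_poly conjc (w \Po (1 - 'X)).
have w2E t : w2.[t] = (w.[1 - t^*])^*%C.
  by rewrite /w2 -{1}(conjcK t) horner_map /= horner_comp !hornerE.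
have [j Hj] : exists j : nat, forall s : R, (w * w2).[(s +i* (s * j%:R))%C] != 0.
  by apply: ray_avoid; rewrite hornerM mulf_neq0// w2E conjC0 subr0 conjc_eq0.
pose c : C := (1 / 2 +i* (1 / 2 * j%:R))%C.
have seg (a b : C) : (forall s : R, 0 <= s <= 1 -> w.[a + s%:C%C * (b - a)] != 0) -> Q a -> Q b.
  move=> wab Qa; have -> : b = a + (1%:C)%C * (b - a) by rewrite mul1r addrC subrK.
  apply: (seg_ind (Q := fun s => Q (a + s%:C%C * (b - a)))); last by rewrite mul0r addr0.
  move=> s s01; have [d d0 Hd] := H _ (wab s s01).
  have n0 : 0 < nc (b - a) + 1 by rewrite ltr_wpDl ?nc_ge0.
  exists (d / (nc (b - a) + 1)); first by rewrite divr_gt0.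
  have cl s' : `|s' - s| < d / (nc (b - a) + 1) ->
     nc (a + s'%:C%C * (b - a) - (a + s%:C%C * (b - a))) < d.
    rewrite ltr_pdivlMr// => sd.
    have -> : a + s'%:C%C * (b - a) - (a + s%:C%C * (b - a)) = ((s' - s)%:C)%C * (b - a).
      by rewrite rmorphB /=; ring.
    rewrite ncM ncR; apply: le_lt_trans sd; rewrite ler_wpM2l//; lra.
  by move=> s' s'' _ _ /cl h1 /cl h2; exact: Hd.
have wnz s : w.[(s +i* (s * j%:R))%C] != 0 /\ w2.[(s +i* (s * j%:R))%C] != 0.
  by have := Hj s; rewrite hornerM mulf_eq0 negb_or => /andP.
apply: (seg c); last apply: (seg 0 c) => //.
  move=> s s01; have := (wnz ((1 - s) / 2)).2; rewrite w2E conjc_eq0.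
  suff -> : 1 - (((1 - s) / 2) +i* ((1 - s) / 2 * j%:R))%C^* = c + s%:C%C * (1 - c) by [].
  by rewrite /c; apply/eqP; rewrite eq_complex /=; apply/andP; split; apply/eqP; field.
move=> s s01; have := (wnz (s / 2)).1.
suff -> : ((s / 2) +i* (s / 2 * j%:R))%C = 0 + s%:C%C * (c - 0) by [].
by rewrite /c; apply/eqP; rewrite eq_complex /=; apply/andP; split; apply/eqP; field.
Qed.

End Paths.

(** * Fibres over regular values and their symmetric functions along lines *)

Section Covering.
Variable R : realType.
Local Notation C := R[i].
Variable n : nat.
Local Notation V := 'rV[C]_n.

(** A proper polynomial map unramified over [P <> 0]. Properness is stated as a linear bound with
    explicit constant because one constant has to serve all iterates. *)
Definition cover_map (G : V -> V) (M : V -> V -> 'M[C]_n) (P : V -> C) (c : R) :=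
  [/\ pmap G, bez G M, (forall z, nm z <= c * (1 + nm (G z))), polyfun P &
      forall z, P (G z) != 0 -> \det (M z z) != 0].

Variables (G : V -> V) (M : V -> V -> 'M[C]_n) (P : V -> C) (cp : R).
Hypothesis cov : cover_map G M P cp.

Let pG : pmap G. Proof. by case: cov. Qed.
Let GM : bez G M. Proof. by case: cov. Qed.
Let Gp z : nm z <= cp * (1 + nm (G z)). Proof. by case: cov. Qed.
Let pP : polyfun P. Proof. by case: cov. Qed.
Let regP z : P (G z) != 0 -> \det (M z z) != 0. Proof. by case: cov => _ _ _ _; exact. Qed.

Lemma proper_bound (r : R) : exists2 B, 0 <= B & forall z, nm (G z) <= r -> nm z <= B.
Proof.
exists (`|cp| * (1 + `|r|)); first by rewrite mulr_ge0 ?addr_ge0.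
move=> z zr; apply: le_trans (Gp z) _; apply: (@le_trans _ _ (`|cp| * (1 + nm (G z)))).
  by rewrite ler_wpM2r ?ler_norm// addr_ge0 ?nm_ge0.
by rewrite ler_wpM2l// lerD2l (le_trans zr)// ler_norm.
Qed.

Lemma cpt_over y v (T : C -> Prop) : ccpt T -> cpt (fun z => exists2 t, T t & G z = y + t *: v).
Proof.
move=> cT; have [m m0 Tm] := ccpt_bound cT; split.
  have [B B0 HB] := proper_bound (nm y + m * nm v).
  exists B => z [t /Tm tm Gz]; apply: HB; rewrite Gz (le_trans (nmD _ _))// lerD2l nmZ.
  by rewrite ler_wpM2r ?nm_ge0.
move=> u l ul Hu; have /choice[t Ht] k : exists t, T t /\ G (u k) = y + t *: v.
  by have [t] := Hu k; exists t.
have [k|phi [hp [x Tx cx]]] := @cpt_subseq _ _ _ _ (fun k => (t k)%:M) cT.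
  by rewrite mxE eqxx mulr1n; exact: (Ht k).1.
exists (x 0 0) => //; apply: (cvs_unique (pmap_cv pG (cvs_sub ul hp))) => e e0.
have v0 : 0 < nm v + 1 by rewrite ltr_wpDl ?nm_ge0.
have [N HN] := cx (e / (nm v + 1)) ltac:(by rewrite divr_gt0).
exists N => k /HN; rewrite /= (Ht _).2 opprD addrACA subrr add0r -scalerBl nmZ.
rewrite nm_scal !mxE eqxx mulr1n ltr_pdivlMr// => h; apply: le_lt_trans h.
by rewrite ler_wpM2l ?nc_ge0//; lra.
Qed.

(** Uniform local inverses along a line: [r] is the radius of uniqueness, [eta] the length over
    which every point lifts. The bound [B * eta <= r / 4] keeps a lift, and the comparison of two
    neighbouring lifts, inside the uniqueness radius. *)
Definition sheets y v (T : C -> Prop) (r B eta : R) :=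
  [/\ 0 < r, 0 < B, 0 < eta & B * eta <= r / 4] /\
  (forall z0 t0 z t z' t', T t0 -> G z0 = y + t0 *: v -> G z = y + t *: v ->
     G z' = y + t' *: v -> nm (z - z0) < r -> nm (z' - z0) < r ->
     nm (z - z') <= B * nc (t - t')) /\
  (forall z0 t0 t, T t0 -> G z0 = y + t0 *: v -> nc (t - t0) < eta ->
     exists z, G z = y + t *: v /\ nm (z - z0) <= B * nc (t - t0)).

Lemma sheets_exist y v (T : C -> Prop) : ccpt T -> (forall t, T t -> P (y + t *: v) != 0) ->
  forall rmax : R, 0 < rmax -> exists r B eta, sheets y v T r B eta /\ B * eta <= rmax.
Proof.
move=> cT Treg rmax rmax0.
have [|r [B [eta [r0 B0 eta0 Hinj Hsur]]]] := ift pG GM (cpt_over y v cT).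
  by move=> z [t Tt Gz]; apply: regP; rewrite Gz Treg.
have v0 : 0 < nm v + 1 by rewrite ltr_wpDl ?nm_ge0.
pose B' := B * (nm v + 1); have B'0 : 0 < B' by rewrite mulr_gt0.
pose e := Num.min (eta / (nm v + 1)) (Num.min (r / 4 / B') (rmax / B')).
have e0 : 0 < e by rewrite !lt_min !divr_gt0.
have eB : B' * e <= r / 4 by rewrite mulrC -ler_pdivlMr// !ge_min lexx !orbT.
have eR : B' * e <= rmax by rewrite mulrC -ler_pdivlMr// !ge_min lexx !orbT.
have diff t t' : y + t *: v - (y + t' *: v) = (t - t') *: v.
  by rewrite opprD addrACA subrr add0r -scalerBl.
have inj z0 t0 z t z' t' : T t0 -> G z0 = y + t0 *: v -> G z = y + t *: v ->
     G z' = y + t' *: v -> nm (z - z0) < r -> nm (z' - z0) < r ->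
     nm (z - z') <= B' * nc (t - t').
  move=> Tt0 Gz0 Gz Gz' zr z'r; have := Hinj z0 z z' (ex_intro2 _ _ _ Tt0 Gz0) zr z'r.
  rewrite Gz Gz' diff nmZ => /le_trans; apply.
  rewrite /B' -mulrA ler_wpM2l ?(ltW B0)// mulrC ler_wpM2r ?nc_ge0//; lra.
exists r, B', e; split=> //; split=> //; split=> // z0 t0 t Tt0 Gz0 td.
have [|z zr Gz] := Hsur z0 (y + t *: v) (ex_intro2 _ _ _ Tt0 Gz0).
  rewrite Gz0 diff nmZ; have td' : nc (t - t0) < eta / (nm v + 1).
    by apply: lt_le_trans td _; rewrite ge_min lexx.
  rewrite ltr_pdivlMr// in td'; apply: le_lt_trans td'.
  by rewrite ler_wpM2l ?nc_ge0//; lra.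
exists z; split=> //; apply: (inj z0 t0) => //; by rewrite subrr nm0.
Qed.

Lemma nice_sheet (g : C -> V) y v t0 (d B : R) : 0 < d ->
  (forall t, nc (t - t0) < d -> G (g t) = y + t *: v /\ nm (g t - g t0) <= B * nc (t - t0)) ->
  P (y + t0 *: v) != 0 -> forall i, nice (fun t => g t 0 i) t0.
Proof.
move=> d0 Hg Pt i.
apply: (@lift_expn _ _ G M (fun h => g (t0 + h)) (y + t0 *: v) v d B GM d0).
- move=> h hd; rewrite (Hg _ _).1; last by rewrite addrC addKr.
  by rewrite scalerDl addrA.
- move=> h hd; rewrite addr0; have := (Hg (t0 + h) _).2; rewrite [t0 + h - t0]addrC addKr.
  exact.
- by rewrite addr0; apply: regP; rewrite (Hg _ _).1// subrr nc0.
Qed.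

Lemma finite_of_separated (K : V -> Prop) (r : R) : cpt K -> 0 < r ->
  (forall z z', K z -> K z' -> nm (z - z') < r -> z = z') ->
  exists s : seq V, uniq s /\ forall z, z \in s <-> K z.
Proof.
move=> cK r0 sep; apply: contrapT => /forallNP H.
have H' (s : seq V) : uniq s /\ (forall z, z \in s -> K z) -> exists z, K z /\ z \notin s.
  move=> [us sK]; apply: contrapT => /forallNP H1; apply: (H s); split=> // z; split; first exact: sK.
  by move=> Kz; apply: contrapT => /negP zs; apply: (H1 z).
pose pick s : V := if pselect (uniq s /\ (forall z, z \in s -> K z)) is left h then sval (cid (H' s h)) else 0.
pose L := fix L k := if k is k'.+1 then pick (L k') :: L k' else [::].
have pickP s : uniq s /\ (forall z, z \in s -> K z) -> K (pick s) /\ pick s \notin s.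
  by move=> h; rewrite /pick; case: pselect => // h'; case: cid.
have LP k : uniq (L k) /\ (forall z, z \in L k -> K z).
  elim: k => [|k IH] //=; have [Kp nps] := pickP _ IH; split; first by rewrite nps IH.1.
  by move=> z; rewrite inE => /orP[/eqP->//|]; exact: IH.2.
have Lin i j : (i < j)%N -> pick (L i) \in L j.
  elim: j => // j IH; rewrite ltnS leq_eqVlt => /orP[/eqP->|/IH]; rewrite /= inE ?eqxx//.
  by move=> ->; rewrite orbT.
have [phi [hp [l Kl cl]]] := cpt_subseq cK (fun k => (pickP _ (LP k)).1).
have [N HN] := cl (r / 2) ltac:(by rewrite divr_gt0).
have := HN N (leqnn N); have := HN N.+1 (leqnSn N).
have ltp : (phi N < phi N.+1)%N by apply: hp.
rewrite /= (nmBC _ l) => h1 h2.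
have : pick (L (phi N)) = pick (L (phi N.+1)).
  apply: sep; [exact: (pickP _ (LP _)).1|exact: (pickP _ (LP _)).1|].
  by have := nm_tri l (pick (L (phi N))) (pick (L (phi N.+1))); lra.
by move=> E; have := (pickP _ (LP (phi N.+1))).2; rewrite -E Lin.
Qed.

Definition fib y : seq V := xget [::] (fun s => uniq s /\ forall z, z \in s <-> G z = y).

Lemma fibP y : P y != 0 -> uniq (fib y) /\ forall z, z \in fib y <-> G z = y.
Proof.
move=> Py; have [s Hs] : exists s : seq V, uniq s /\ forall z, z \in s <-> G z = y.
  have cK : cpt (fun z => G z = y).
    have [[m Hm] cl] := cpt_over y 0 (ccpt_annulus 0 0 : ccpt (fun t : C => 0 <= nc t <= 0)).
    have eqv z : G z = y <-> exists2 t : C, 0 <= nc t <= 0 & G z = y + t *: 0.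
      split=> [->|[t _ ->]]; last by rewrite scaler0 addr0.
      by exists 0; rewrite ?nc0 ?lexx// scaler0 addr0.
    split; first by exists m => z /eqv; exact: Hm.
    by move=> u l ul Hu; apply/eqv; apply: cl ul _ => k; apply/eqv.
  have [|r [B [r0 B0 Hr]]] := ift_inj GM cK; first by move=> z Gz; apply: regP; rewrite Gz.
  apply: (finite_of_separated cK r0) => z z' Gz Gz' zz; apply/eqP.
  rewrite -subr_eq0 -nm_eq0 eq_le nm_ge0 andbT.
  have := (Hr z' z z' Gz' zz _).2; rewrite subrr nm0 => /(_ r0).
  by rewrite Gz Gz' subrr nm0 mulr0.
rewrite /fib; case: xgetP => [s' _ //|/(_ s)].
by case.
Qed.

Lemma reg_near y v t0 : P (y + t0 *: v) != 0 ->
  exists2 d : R, 0 < d & forall t, nc (t - t0) <= d -> P (y + t *: v) != 0.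
Proof.
move=> P0; have [p Hp] := pf_line y v pP.
have [L [d [L0 d0 HL]]] := nice_lip (nice_poly p t0).
rewrite Hp in P0; have p0 : 0 < nc p.[t0] by rewrite nc_gt0.
have L1 : 0 < L + 1 by rewrite ltr_wpDl.
exists (Num.min (d / 2) (nc p.[t0] / (2 * (L + 1)))).
  by rewrite lt_min !divr_gt0// mulr_gt0.
move=> t; rewrite le_min => /andP[td tp]; rewrite Hp -nc_gt0.
have tdd : nc (t - t0) < d by lra.
have := HL t tdd; have := ncB_ge p.[t0] p.[t]; rewrite ncBC.
rewrite ler_pdivlMr ?mulr_gt0// in tp; have := nc_ge0 (t - t0); nra.
Qed.

Lemma ccpt_disc (a : C) (r : R) : ccpt (fun t : C => nc (t - a) <= r).
Proof.
apply: ccptP; first by exists (r + nc a) => t ta; have := ncB_ge t a; lra.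
move=> t H; apply/ler_addgt0Pr => e /H[t' h1 h2].
by have := nc_tri t' t a; rewrite (ncBC t t'); lra.
Qed.

(** The points over [t0] are continued by [sheets]. They stay distinct by uniqueness, and they
    exhaust the fibre over [t] because each of its points can be lifted back to [t0]. *)
Lemma fib_local y v t0 : P (y + t0 *: v) != 0 ->
  exists (D : nat) (g : 'I_D -> C -> V) (d : R), 0 < d /\
   [/\ forall t, nc (t - t0) < d -> P (y + t *: v) != 0,
       forall i t, nc (t - t0) < d -> G (g i t) = y + t *: v,
       (exists B : R, forall i t, nc (t - t0) < d -> nm (g i t - g i t0) <= B * nc (t - t0)),
       forall i j, nice (fun t => g i t 0 j) t0 &
       forall t, nc (t - t0) < d -> perm_eq (fib (y + t *: v)) [seq g i t | i <- enum 'I_D]].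
Proof.
move=> P0; have [d d0 Hd] := reg_near P0.
have [r [B [eta [[[r0 B0 eta0 Be] [inj lift]] _]]]] := sheets_exist (ccpt_disc t0 d) Hd (ltr01).
have T0 : nc (t0 - t0) <= d by rewrite subrr nc0 ltW.
have [us sP] := fibP P0; set s := fib (y + t0 *: v) in us sP.
have inT t : nc (t - t0) < Num.min d eta -> nc (t - t0) <= d.
  by rewrite lt_min => /andP[/ltW].
have inE t : nc (t - t0) < Num.min d eta -> nc (t - t0) < eta.
  by rewrite lt_min => /andP[].
have Gs (i : 'I_(size s)) : G s`_i = y + t0 *: v by apply/sP; rewrite mem_nth.
have /choice[g Hg] (i : 'I_(size s)) : exists g : C -> V, forall t,
    nc (t - t0) < Num.min d eta -> G (g t) = y + t *: v /\ nm (g t - s`_i) <= B * nc (t - t0).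
  suff /choice : forall t, exists z, nc (t - t0) < Num.min d eta ->
     G z = y + t *: v /\ nm (z - s`_i) <= B * nc (t - t0) by move=> [f Hf]; exists f.
  move=> t; case: (pselect (nc (t - t0) < Num.min d eta)) => h; last by exists 0.
  by have [z Hz] := lift _ _ _ T0 (Gs i) (inE _ h); exists z.
have g0 i : g i t0 = s`_i.
  have [|_] := Hg i t0; first by rewrite subrr nc0 lt_min d0.
  by rewrite subrr nc0 mulr0 => h; apply/eqP; rewrite -subr_eq0 -nm_eq0 eq_le h nm_ge0.
have Br t : nc (t - t0) < Num.min d eta -> B * nc (t - t0) < r / 2.
  by move=> /inE h; apply: le_lt_trans (ler_wpM2l (ltW B0) (ltW h)) _; lra.
exists (size s), g, (Num.min d eta); split; first by rewrite lt_min d0.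
split.
- by move=> t /inT; exact: Hd.
- by move=> i t h; case: (Hg i t h).
- by exists B => i t h; rewrite g0; case: (Hg i t h).
- move=> i; apply: (@nice_sheet _ y v t0 (Num.min d eta) B) => //; first by rewrite lt_min d0.
  by move=> t h; rewrite g0; exact: Hg.
move=> t h; have [ut tP] := fibP (Hd _ (inT _ h)).
apply: uniq_perm => //.
  rewrite map_inj_in_uniq ?enum_uniq// => i j _ _ gij.
  have [_ h1] := Hg i t h; have [_ h2] := Hg j t h; have h3 := Br _ h.
  have : nm (s`_i - s`_j) <= B * nc (t0 - t0).
    apply: (inj s`_i t0) => //; first by rewrite subrr nm0.
    by rewrite -gij nmBC in h2; have := nm_tri (g i t) s`_j s`_i; lra.
  rewrite subrr nc0 mulr0 => h4.
  have : s`_i == s`_j by rewrite -subr_eq0 -nm_eq0 eq_le h4 nm_ge0.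
  by rewrite nth_uniq// => /eqP/val_inj.
move=> z; apply/idP/mapP => [/tP Gz|[i _ ->]]; last by apply/tP; case: (Hg i t h).
have [z0 [Gz0 zz0]] := lift _ _ t0 (inT _ h) Gz ltac:(by rewrite ncBC; exact: inE).
have /(nthP 0)[i si si0] : z0 \in s by apply/sP.
exists (Ordinal si); rewrite ?mem_enum//.
have [Gg gs] := Hg (Ordinal si) t h; rewrite /= si0 in gs.
rewrite ncBC in zz0; have h3 := Br _ h.
have : nm (z - g (Ordinal si) t) <= B * nc (t - t).
  apply: (inj z0 t0) => //; [rewrite nmBC|]; lra.
rewrite subrr nc0 mulr0 => h4.
by apply/eqP; rewrite -subr_eq0 -nm_eq0 eq_le h4 nm_ge0.
Qed.

(** The number of points is locally constant on the complex line through [y1] and [y2], which stays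
    connected after removal of the zeros of [P]. *)
Lemma size_fib y1 y2 : P y1 != 0 -> P y2 != 0 -> size (fib y1) = size (fib y2).
Proof.
move=> P1 P2; have [w Hw] := pf_line y1 (y2 - y1) pP.
have e1 : y1 = y1 + 0 *: (y2 - y1) by rewrite scale0r addr0.
have e2 : y2 = y1 + 1 *: (y2 - y1) by rewrite scale1r addrC subrK.
rewrite [y2 in RHS]e2.
apply: (@path_ind _ w (fun t => size (fib y1) = size (fib (y1 + t *: (y2 - y1))))).
- by rewrite -Hw -e1.
- by rewrite -Hw -e2.
- move=> t; rewrite -Hw => Pt.
  have [D [g [d [d0 [_ _ _ _ Hp]]]]] := fib_local Pt.
  exists d => // t' t'' /Hp /perm_size + /Hp /perm_size.
  by rewrite !size_map => -> ->.
- by rewrite -e1.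
Qed.

(** What the passage to polynomials needs of a function of the fibre: invariance under reordering,
    regularity along regular branches, and polynomial growth with an exponent fixed by the number of
    points. Sums give traces and products give norms. *)
Definition symfun (F : seq V -> C) :=
  [/\ forall s s', perm_eq s s' -> F s = F s',
      forall D (g : 'I_D -> C -> V) t, (forall i j, nice (fun t => g i t 0 j) t) ->
        nice (fun t => F [seq g i t | i <- enum 'I_D]) t &
      forall D, exists K a, 0 <= K /\ forall s (r : R), size s = D -> 0 <= r ->
        (forall z, z \in s -> nm z <= r) -> nc (F s) <= K * (1 + r) ^+ a].

Lemma symfun_sum q : polyfun q -> symfun (fun s => \sum_(z <- s) q z).
Proof.
move=> pq; split=> [s s' ss'|D g t ng|D]; first exact: perm_big.
  apply: nice_ext (nice_sum (enum 'I_D) (F := fun i t => q (g i t)) _) _.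
    by move=> i; apply: nice_pf.
  by exists 1 => // t' _; rewrite big_map.
have [K [a [K0 HK]]] := pf_growth pq; exists (D%:R * K), a; split; first by rewrite mulr_ge0.
move=> s r sD r0 sr; apply: le_trans (nc_sum _ _ _) _.
apply: (@le_trans _ _ (\sum_(z <- s) K * (1 + r) ^+ a)).
  rewrite !big_seq; apply: ler_sum => z zs; apply: le_trans (HK z) _.
  by rewrite ler_wpM2l// lerXn2r ?nnegrE ?addr_ge0 ?nm_ge0// lerD2l sr.
by rewrite big_const_seq count_predT iter_addr_0 sD -mulrA mulr_natl.
Qed.

Lemma symfun_prod q : polyfun q -> symfun (fun s => \prod_(z <- s) q z).
Proof.
move=> pq; split=> [s s' ss'|D g t ng|D]; first exact: perm_big.
  apply: nice_ext (nice_prod (enum 'I_D) (F := fun i t => q (g i t)) _) _.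
    by move=> i; apply: nice_pf.
  by exists 1 => // t' _; rewrite big_map.
have [K [a [K0 HK]]] := pf_growth pq; exists (K ^+ D), (a * D)%N; split; first exact: exprn_ge0.
move=> s r sD r0 sr; rewrite nc_prod.
apply: (@le_trans _ _ (\prod_(z <- s) (K * (1 + r) ^+ a))).
  rewrite !big_seq; apply: ler_prod => z zs; rewrite nc_ge0/=; apply: le_trans (HK z) _.
  by rewrite ler_wpM2l// lerXn2r ?nnegrE ?addr_ge0 ?nm_ge0// lerD2l sr.
by rewrite big_const_seq count_predT iter_mulr_1 sD exprMn exprM.
Qed.

(** Along a line the function is regular off the zeros of [P] and of polynomial growth, so
    [liouville] applies. The degree bound [a] depends on the number of sheets alone and not on the
    line. *)
Lemma sym_line (F : seq V -> C) : symfun F -> (exists y, P y != 0) -> exists a : nat, forall y v,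
  (exists t, P (y + t *: v) != 0) -> exists p : {poly C}, (size p <= a.+1)%N /\
    forall t, P (y + t *: v) != 0 -> F (fib (y + t *: v)) = p.[t].
Proof.
move=> [Fperm Fnice Fgr] [y0 Py0]; have [K [a [K0 HK]]] := Fgr (size (fib y0)).
exists a => y v [t0 Pt0]; have [w Hw] := pf_line y v pP.
have w0 : w != 0 by apply: contraNneq Pt0 => w0; rewrite Hw w0 horner0.
have [||p [sp Hp]] := @liouville _ (fun t => F (fib (y + t *: v))) w a w0.
- move=> t; rewrite -Hw => Pt; have [D [g [d [d0 [_ _ _ ng Hp]]]]] := fib_local Pt.
  apply: nice_ext (Fnice D g t ng) _; exists d => // t' /Hp; exact: Fperm.
- pose c := `|cp| * (1 + nm y + nm v); have c0 : 0 <= c by rewrite mulr_ge0 ?addr_ge0 ?nm_ge0.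
  exists (K * (1 + c) ^+ a) => t; rewrite -Hw => Pt; have [us sP] := fibP Pt.
  have t0' := nc_ge0 t; have v0 := nm_ge0 v; have yy0 := nm_ge0 y.
  apply: le_trans (HK _ (c * (1 + nc t)) _ _ _) _.
  - exact: size_fib.
  - by rewrite mulr_ge0// addr_ge0.
  - move=> z /sP Gz; apply: le_trans (Gp z) _; rewrite Gz.
    apply: (@le_trans _ _ (`|cp| * (1 + nm (y + t *: v)))).
      by rewrite ler_wpM2r ?ler_norm// addr_ge0 ?nm_ge0.
    rewrite /c -mulrA ler_wpM2l//; have := nmD y (t *: v); rewrite nmZ; nra.
  clearbody c; rewrite -[leRHS]mulrA ler_wpM2l// -exprMn lerXn2r// ?nnegrE.
  - by rewrite addr_ge0// mulr_ge0// addr_ge0.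
  - by rewrite mulr_ge0// addr_ge0.
  nra.
by exists p; split=> // t; rewrite Hw; exact: Hp.
Qed.

End Covering.

(** * From polynomials on lines to polynomials in several variables *)

Section SymmetricFunctions.
Variable R : realType.
Local Notation C := R[i].

Lemma lagrange_interp N (x : 'I_N -> C) : injective x -> exists L : 'I_N -> {poly C},
  forall p : {poly C}, (size p <= N)%N -> forall t, p.[t] = \sum_k p.[x k] * (L k).[t].
Proof.
move=> xi; pose c k := \prod_(l | l != k) (x k - x l).
have c0 k : c k != 0.
  by apply/prodf_neq0 => l lk; rewrite subr_eq0 (inj_eq xi) eq_sym.
pose L k : {poly C} := (c k)^-1 *: \prod_(l | l != k) ('X - (x l)%:P).
have Lx k j : (L k).[x j] = (k == j)%:R.
  rewrite hornerZ horner_prod; case: eqP => [<-|/eqP kj].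
    rewrite (eq_bigr (fun l => x k - x l)) => [|l _]; last by rewrite !hornerE.
    by rewrite mulVf.
  rewrite eq_sym in kj; rewrite (bigD1 j kj)/= hornerXsubC subrr mul0r mulr0.
  by [].
have sL k : (size (L k) <= N)%N.
  rewrite (leq_trans (size_scale_leq _ _))//.
  rewrite (eq_bigl (fun l => l \in predC1 k))// -big_enum size_prod_XsubC.
  by rewrite -cardE cardC1 card_ord prednK// (leq_ltn_trans (leq0n k)).
clearbody L; exists L => p sp t; apply/eqP; rewrite -subr_eq0; apply/eqP.
pose q := p - \sum_k (p.[x k])%:P * L k.
have -> : p.[t] - \sum_k p.[x k] * (L k).[t] = q.[t].
  by rewrite /q !hornerE horner_sum; congr (_ - _); apply: eq_bigr => k _; rewrite !hornerE.
suff -> : q = 0 by rewrite horner0.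
apply: contrapT => /eqP q0.
have sq : (size q <= N)%N.
  rewrite (leq_trans (size_polyD _ _))// geq_max sp size_polyN.
  apply: leq_trans (size_sum _ _ _) _; apply/bigmax_leqP => k _.
  by rewrite mul_polyC (leq_trans (size_scale_leq _ _)).
have ar : all (root q) [seq x k | k <- enum 'I_N].
  apply/allP => _ /mapP[k _ ->]; rewrite /root /q !hornerE horner_sum (bigD1 k)//=.
  rewrite !hornerE Lx eqxx mulr1 big1 ?addr0 ?subrr// => l lk.
  by rewrite !hornerE Lx (negbTE lk) mulr0.
have := max_poly_roots q0 ar; rewrite map_inj_uniq ?enum_uniq// => /(_ isT).
by rewrite size_map size_enum_ord ltnNge sq.
Qed.

Lemma poly_eq_near (p q : {poly C}) (d : R) : 0 < d ->
  (forall t, nc t < d -> p.[t] = q.[t]) -> p = q.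
Proof.
move=> d0 H; apply/eqP; rewrite -subr_eq0; apply: contraT => pq.
have [t [_ + /eqP]] := nonroot_near 0 pq d0; rewrite subr0 => /H; rewrite !hornerE => ->.
by rewrite subrr.
Qed.

Variable n : nat.
Local Notation V := 'rV[C]_n.

(** In a small polydisc around [y0] where [P] has no zero, Lagrange interpolation with [a + 1] nodes
    is applied to one coordinate after the other. Any [y] with [P y <> 0] is then reached on the
    line from [y0], where two polynomials agreeing near [y0] are equal. *)
Lemma polyfun_of_lines (P T : V -> C) (a : nat) : polyfun P -> (exists y, P y != 0) ->
  (forall y v, (exists t, P (y + t *: v) != 0) -> exists p : {poly C}, (size p <= a.+1)%N /\
    forall t, P (y + t *: v) != 0 -> T (y + t *: v) = p.[t]) ->
  exists2 q, polyfun q & forall y, P y != 0 -> T y = q y.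
Proof.
move=> pP [y0 Py0] HT.
have [rho rho0 Hrho] : exists2 rho : R, 0 < rho &
    forall y : V, (forall j, nc (y 0 j) <= rho) -> P (y0 + y) != 0.
  have [L L0 HL] := pf_lip (nm y0 + n.+1%:R) pP.
  pose c := nc (P y0); have c0 : 0 < c by rewrite nc_gt0.
  have N0 : 0 < n.+1%:R :> R by rewrite ltr0n.
  have L1 : 0 < (L + 1) * n.+1%:R by rewrite mulr_gt0// ltr_wpDl.
  exists (Num.min 1 (c / 2 / ((L + 1) * n.+1%:R))); first by rewrite lt_min ltr01 !divr_gt0.
  move=> y Hy; have ny : nm y <= n.+1%:R * Num.min 1 (c / 2 / ((L + 1) * n.+1%:R)).
    rewrite /nm big_ord_recl big_ord0 addr0 (le_trans (ler_sum _ (fun j _ => Hy j)))//.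
    rewrite sumr_const card_ord -[_ *+ n]mulr_natl ler_wpM2r ?ler_nat//.
    by rewrite le_min ler01 !divr_ge0 ?ltW.
  set m := Num.min _ _ in ny; have m1 : m <= 1 by rewrite ge_min lexx.
  have m2 : m * ((L + 1) * n.+1%:R) <= c / 2 by rewrite -ler_pdivlMr// ge_min lexx orbT.
  have yb : nm (y0 + y) <= nm y0 + n.+1%:R.
    by rewrite (le_trans (nmD _ _))// lerD2l (le_trans ny)// ler_piMr// ltW.
  have y0b : nm y0 <= nm y0 + n.+1%:R by rewrite lerDl ltW.
  have [h _] := HL _ _ yb y0b; rewrite [y0 + y - y0]addrC addKr in h.
  have h2 : L * nm y <= c / 2.
    apply: le_trans m2; rewrite mulrC [(L + 1) * _]mulrC mulrA.
    apply: ler_pM; rewrite ?nm_ge0//; last by lra.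
    by rewrite [m * _]mulrC.
  by rewrite -nc_gt0; have := ncB_ge (P y0) (P (y0 + y)); rewrite ncBC -/c; lra.
pose x (k : 'I_a.+1) : C := ((rho * (k%:R / a.+1%:R))%:C)%C.
have xrho k : nc (x k) <= rho.
  have q0 : 0 <= k%:R / a.+1%:R :> R by rewrite divr_ge0.
  rewrite /x ncR normrM (gtr0_norm rho0) (ger0_norm q0) ler_piMr ?(ltW rho0)//.
  by rewrite ler_pdivrMr ?ltr0n// mul1r ler_nat ltnW.
have xi : injective x.
  move=> k l [/(mulfI (lt0r_neq0 rho0))/(mulIf _)].
  rewrite invr_eq0 pnatr_eq0 => /(_ isT)/eqP; rewrite eqr_nat => /eqP; exact: val_inj.
have [L HL] := lagrange_interp xi.
(* The first [j] coordinates are variable, the others are frozen at those of [w]; the induction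
   frees one coordinate at a time. *)
pose mix (j : nat) (y w : V) : V := \row_(i < n) if (i < j)%N then y 0 i else w 0 i.
pose box (y : V) := forall j, nc (y 0 j) <= rho.
have mixbox j y w : box y -> box w -> box (mix j y w).
  by move=> by_ bw i; rewrite mxE; case: ifP.
have main j : (j <= n)%N -> forall w, box w -> exists2 q, polyfun q &
    forall y, box y -> T (y0 + mix j y w) = q y.
  elim: j => [_ w bw|j IH jn w bw].
    exists (fun=> T (y0 + w)); first exact: pf_cst.
    by move=> y _; congr (T (y0 + _)); apply/rowP => i; rewrite mxE.
  pose jo := Ordinal jn; pose upd (w : V) c : V := \row_i if i == jo then c else w 0 i.
  have bupd k : box (upd w (x k)) by move=> i; rewrite mxE; case: eqP.
  have /choice[q Hq] k : exists q, polyfun q /\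
      forall y, box y -> T (y0 + mix j y (upd w (x k))) = q y.
    by have [q] := IH (ltnW jn) _ (bupd k); exists q.
  exists (fun y => \sum_k q k y * (L k).[y 0 jo]).
    apply: pf_sum => k _; apply: pfM; first exact: (Hq k).1.
    have pX : polyfun (fun y : V => y 0 jo) by exact: pf_coord.
    apply: (@pf_ext _ _ (fun y => \sum_(i < size (L k)) (L k)`_i * y 0 jo ^+ i)).
      by apply: pf_sum => i _; apply: pfM; [exact: pf_cst|exact: pfX].
    by move=> y; rewrite horner_coef.
  move=> y by_; pose z := y0 + mix j y (upd w 0); pose v : V := delta_mx 0 jo.
  have zE c : z + c *: v = y0 + mix j y (upd w c).
    rewrite /z -addrA; congr (_ + _); apply/rowP => i; rewrite !mxE eqxx /=.
    case: (eqVneq i jo) => [->|ij]; first by rewrite ltnn add0r mulr1.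
    by rewrite mulr0 addr0.
  have reg c : nc c <= rho -> P (z + c *: v) != 0.
    move=> cr; rewrite zE; apply: Hrho; apply: mixbox => // i.
    by rewrite mxE; case: eqP.
  have [|p [sp Hp]] := HT z v; first by exists 0; apply: reg; rewrite nc0 ltW.
  have -> : y0 + mix j.+1 y w = z + y 0 jo *: v.
    rewrite zE; congr (_ + _); apply/rowP => i; rewrite !mxE ltnS leq_eqVlt.
    case: (eqVneq i jo) => [->|ij]; first by rewrite eqxx ltnn.
    by have /negbTE -> : nat_of_ord i != j by [].
  rewrite Hp ?reg// HL//; apply: eq_bigr => k _.
  by rewrite -Hp ?reg// zE (Hq k).2.
have b0 : box 0 by move=> i; rewrite mxE nc0 ltW.
have [q pq Hq] := main n (leqnn n) 0 b0.
have {}Hq y : box y -> T (y0 + y) = q y.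
  move=> by_; rewrite -Hq//; congr (T (_ + _)); apply/rowP => i.
  by rewrite mxE ltn_ord.
have pq' : polyfun (fun y => q (y - y0)).
  apply: (pf_comp (G := fun y => y - y0)) => // j.
  by apply: (@pf_ext _ _ (fun y => y 0 j - y0 0 j)) => [|y]; [apply: pfB;
    [exact: pf_coord|exact: pf_cst]|rewrite !mxE].
exists (fun y => q (y - y0)) => // y Py.
have e1 : y = y0 + 1 *: (y - y0) by rewrite scale1r addrC subrK.
have [|p [_ Hp]] := HT y0 (y - y0); first by exists 1; rewrite -e1.
have [p' Hp'] := pf_line y0 (y - y0) pq'.
have pp' : p = p'.
  apply: (@poly_eq_near _ _ (rho / (nm (y - y0) + 1))).
    by rewrite divr_gt0// ltr_wpDl ?nm_ge0.
  move=> t; rewrite ltr_pdivlMr ?ltr_wpDl ?nm_ge0// => td.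
  have bt : box (t *: (y - y0)).
    move=> i; rewrite mxE ncM; apply: le_trans (ltW td); rewrite ler_wpM2l ?nc_ge0//.
    by apply: le_trans (nm_coord _ _ _) _; lra.
  by rewrite -Hp ?Hrho// Hq// -Hp' [y0 + _]addrC addrK.
by rewrite [in LHS]e1 Hp -?e1// pp' -Hp' -e1.
Qed.

End SymmetricFunctions.

(** * Fibres over arbitrary values and a Lojasiewicz inequality *)

Section Fibers.
Variable R : realType.
Local Notation C := R[i].
Variable n : nat.
Local Notation V := 'rV[C]_n.
Variables (G : V -> V) (M : V -> V -> 'M[C]_n) (P : V -> C) (cp : R).
Hypothesis cov : cover_map G M P cp.

Let pG : pmap G. Proof. by case: cov. Qed.
Let GM : bez G M. Proof. by case: cov. Qed.
Let Gp z : nm z <= cp * (1 + nm (G z)). Proof. by case: cov. Qed.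
Let pP : polyfun P. Proof. by case: cov. Qed.

Lemma sym_polyfun (F : seq V -> C) : symfun F -> (exists y, P y != 0) ->
  exists2 q, polyfun q & forall y, P y != 0 -> F (fib G y) = q y.
Proof.
move=> sF hP; have [a Ha] := sym_line cov sF hP.
exact: (polyfun_of_lines pP hP Ha).
Qed.

Lemma pf_dense (Q : V -> C) : polyfun Q -> (exists y, Q y != 0) -> forall y (e : R), 0 < e ->
  exists2 y', nm (y' - y) < e & Q y' != 0.
Proof.
move=> pQ [y0 Qy0] y e e0; have [p Hp] := pf_line y (y0 - y) pQ.
have p0 : p != 0.
  by apply: contraNneq Qy0 => p0; have := Hp 1; rewrite scale1r addrC subrK p0 horner0 => ->.
have v0 : 0 < nm (y0 - y) + 1 by rewrite ltr_wpDl ?nm_ge0.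
have [|t [_ + pt]] := nonroot_near 0 p0 (d := e / (nm (y0 - y) + 1)); first by rewrite divr_gt0.
rewrite subr0 ltr_pdivlMr// => td; exists (y + t *: (y0 - y)); last by rewrite Hp.
rewrite addrC addKr nmZ; apply: le_lt_trans td; rewrite ler_wpM2l ?nc_ge0//; lra.
Qed.

Lemma pf_dense_seq (Q : V -> C) : polyfun Q -> (exists y, Q y != 0) -> forall y,
  exists u, cvs u y /\ forall k, Q (u k) != 0.
Proof.
move=> pQ hQ y; have /choice[u Hu] (k : nat) : exists y', nm (y' - y) < k.+1%:R^-1 /\ Q y' != 0.
  by have [|y'] := pf_dense pQ hQ y (e := k.+1%:R^-1); [rewrite invr_gt0 ltr0n|exists y'].
exists u; split=> [e /archi_inv[N Ne]|k]; last exact: (Hu k).2.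
exists N => k Nk; apply: lt_trans (Hu k).1 _.
exact: le_lt_trans (inv_nat_le R Nk) Ne.
Qed.

Hypotheses (hP : exists y, P y != 0) (hM : exists z, \det (M z z) != 0).

(** Near a point with nonzero Jacobian the image of [G] is open, and the nonzero set of [P] is
    dense. *)
Lemma reg_image : exists z, P (G z) != 0.
Proof.
have [z0 Mz0] := hM.
have cK : cpt (fun z => z = z0).
  split; first by exists (nm z0) => z ->.
  move=> u l ul Hu; apply: (cvs_unique ul) => e e0; exists 0%N => k _.
  by rewrite Hu subrr nm0.
have [|r [B [eta [r0 B0 eta0 _ Hs]]]] := ift pG GM cK; first by move=> z ->.
have [y' y'e Py'] := pf_dense pP hP (G z0) eta0.
by have [z _ Gz] := Hs z0 y' erefl y'e; exists z; rewrite Gz.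
Qed.

Lemma pPG : polyfun (fun z => P (G z)). Proof. exact: pf_comp. Qed.

Lemma size_fib_gt0 y : P y != 0 -> (0 < size (fib G y))%N.
Proof.
move=> Py; have [z Pz] := reg_image; rewrite (size_fib cov Py Pz) -has_predT.
by apply/hasP; exists z => //; apply/(fibP cov Pz).2.
Qed.

Lemma cv_const_unique (u : nat -> C) a b :
  (forall e : R, 0 < e -> exists N, forall k, (N <= k)%N -> nc (u k - a) < e) ->
  (forall e : R, 0 < e -> exists N, forall k, (N <= k)%N -> nc (u k - b) < e) -> a = b.
Proof.
move=> ua ub; apply/eqP; rewrite -subr_eq0 -nc_eq0 eq_le nc_ge0 andbT.
apply/ler_addgt0Pr => e e0; rewrite add0r; have e2 : 0 < e / 2 by lra.
have [N HN] := ua _ e2; have [N' HN'] := ub _ e2.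
have := HN _ (leq_maxl N N'); have := HN' _ (leq_maxr N N').
by have := nc_tri (u (maxn N N')) a b; rewrite (ncBC a (u _)); lra.
Qed.

(** Linear forms are taken on the moment curve [(1, t, t^2, ...)]: on each vector such a form is a
    nonzero polynomial in [t]. *)
Lemma generic_linear (s : seq V) : (forall z, z \in s -> z != 0) ->
  exists l : V, forall z, z \in s -> \sum_i z 0 i * l 0 i != 0.
Proof.
move=> s0; pose p (z : V) : {poly C} := \poly_(i < n) (if insub i is Some j then z 0 j else 0).
have pE z t : (p z).[t] = \sum_i z 0 i * t ^+ i.
  by rewrite horner_poly; apply: eq_bigr => i _; rewrite insubT//= => ?; congr (z 0 _ * _); exact: val_inj.
have p0 z : z \in s -> p z != 0.
  move=> /s0; apply: contra => /eqP pz; apply/eqP/rowP => i; rewrite mxE.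
  have := coef_poly n (fun i => if insub i is Some j then z 0 j else 0) i.
  rewrite -/(p z) pz coef0 ltn_ord insubT//= => lt h.
  by rewrite [RHS]h; congr (z 0 _); exact: val_inj.
have : \prod_(z <- s) p z != 0 by rewrite prodf_seq_neq0; apply/allP => z zs; rewrite p0.
move=> /(nonroot_near 0) /(_ ltr01)[t [_ _ tn]].
exists (\row_i t ^+ i) => z zs; under eq_bigr do rewrite [(\row__ _) _ _]mxE.
rewrite -pE; apply: contraNneq tn => pzt; rewrite horner_prod (big_rem z)//= pzt mul0r.
by [].
Qed.

(** [zs] is a limit of regular fibres, hence lists the fibre over [y] with multiplicities, and norms
    pass to the limit. A point [w] over [y] missing from [zs] is impossible: let [q] be affine, zero
    at [w] and nonzero on [zs]. Its norm is nonzero at [y] by the limit, yet it is also a limit of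
    products one factor of which is the value of [q] at points tending to [w]. *)
Lemma fiber_limit y : exists zs : seq V,
  [/\ (0 < size zs)%N, forall y', P y' != 0 -> size zs = size (fib G y'),
  forall z, G z = y <-> z \in zs &
  forall q N, polyfun q -> polyfun N -> (forall y', P y' != 0 -> \prod_(z <- fib G y') q z = N y') ->
    N y = \prod_(z <- zs) q z].
Proof.
have [u [uy Pu]] := pf_dense_seq pP hP y.
set D := size (fib G (u 0%N)).
have sD k : size (fib G (u k)) = D by exact: (size_fib cov (Pu k) (Pu 0%N)).
have [m Hm] := cvs_bounded uy; have [B B0 HB] := proper_bound cov m.
pose A k : 'M[C]_(D, n) := \matrix_i (fib G (u k))`_i.
have fk k i : (i < D)%N -> G (fib G (u k))`_i = u k.
  by move=> iD; apply/(fibP cov (Pu k)).2; rewrite mem_nth// sD.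
have [|phi [hp [l cl]]] := @bw _ _ _ A (D%:R * B).
  move=> k; rewrite /nm; apply: (@le_trans _ _ (\sum_(i < D) B)); last by rewrite sumr_const card_ord -[_ *+ _]mulr_natl.
  apply: ler_sum => i _; apply: le_trans (HB (fib G (u k))`_i _); last by rewrite fk.
  by rewrite /nm big_ord_recl big_ord0 addr0; apply: ler_sum => j _; rewrite mxE.
pose z_ (i : 'I_D) := row i l.
have cz (i : 'I_D) : cvs (fun k => (fib G (u (phi k)))`_(i : nat)) (z_ i).
  move=> e /cl[N HN]; exists N => k /HN; apply: le_lt_trans.
  rewrite {2}/nm (bigD1 i)//=; apply: ler_wpDr.
    by apply: sumr_ge0 => ? _; apply: sumr_ge0 => ? _; exact: nc_ge0.
  by rewrite /nm big_ord_recl big_ord0 addr0; apply: ler_sum => j _; rewrite !mxE.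
have Gz i : G (z_ i) = y.
  apply: (cvs_unique (pmap_cv pG (cz i))) => e e0.
  have [N HN] := cvs_sub uy hp e0; exists N => k /HN; by rewrite /= fk.
have prodE q N : polyfun q -> polyfun N ->
    (forall y', P y' != 0 -> \prod_(z <- fib G y') q z = N y') ->
    N y = \prod_(i < D) q (z_ i).
  move=> pq pN HN; apply: (cv_const_unique (u := fun k => N (u (phi k)))).
    by move=> e e0; exact: (pf_cv pN (cvs_sub uy hp) e0).
  pose Q (w : 'rV[C]_(D * n)) := \prod_(i < D) q (row i (vec_mx w)).
  have pQ : polyfun Q.
    apply: pf_prod => i _; apply: (pf_comp (G := fun w => row i (vec_mx w))) => // j.
    by apply: (@pf_ext _ _ (fun w => w 0 (mxvec_index i j))) => [|w]; [exact: pf_coord|rewrite !mxE].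
  have cA : cvs (fun k => mxvec (A (phi k))) (mxvec l).
    move=> e /cl[N' HN']; exists N' => k /HN'; rewrite -linearB /=; apply: le_lt_trans.
    rewrite {1}/nm big_ord_recl big_ord0 addr0 /nm pair_big /=.
    rewrite (reindex (uncurry (@mxvec_index D n))) /=; last first.
      by have [f fK Kf] := curry_mxvec_bij D n; exists f => x _; [rewrite fK|rewrite Kf].
    by apply: ler_sum => -[i j] _ /=; rewrite mxvecE.
  move=> e e0; have [N' HN'] := pf_cv pQ cA e0; exists N' => k /HN'.
  rewrite /Q !mxvecK -HN//; suff -> : \prod_(z <- fib G (u (phi k))) q z =
    \prod_(i < D) q (row i (A (phi k))) by [].
  rewrite (big_nth 0) big_mkord sD; apply: eq_bigr => i _; congr q.
  by apply/rowP => j; rewrite !mxE.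
exists [seq z_ i | i <- enum 'I_D]; split.
- by rewrite size_map size_enum_ord; exact: size_fib_gt0.
- by move=> y' Py'; rewrite size_map size_enum_ord; exact: (size_fib cov (Pu 0%N) Py').
- move=> w; split=> [Gw|/mapP[i _ ->]//]; apply: contrapT => /negP wz.
  have [|l' Hl'] := @generic_linear [seq z_ i - w | i <- enum 'I_D].
    move=> _ /mapP[i _ ->]; rewrite subr_eq0; apply: contraNneq wz => <-.
    by apply: map_f; rewrite mem_enum.
  pose q (z : V) := \sum_i (z - w) 0 i * l' 0 i.
  have pq : polyfun q.
    apply: pf_sum => i _; apply: pfM; last exact: pf_cst.
    apply: (@pf_ext _ _ (fun z => z 0 i - w 0 i)) => [|z]; last by rewrite !mxE.
    by apply: pfB; [exact: pf_coord|exact: pf_cst].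
  have [N pN HN] := sym_polyfun (symfun_prod pq) hP.
  have : \prod_(i < D) q (z_ i) != 0.
    by apply/prodf_neq0 => i _; apply: Hl'; apply: map_f; rewrite mem_enum.
  rewrite -(prodE q N pq pN HN) => /eqP; apply.
  have [a [aw Pa]] := pf_dense_seq pPG (ex_intro _ _ (projT2 (cid reg_image))) w.
  apply: (cv_const_unique (u := fun k => N (G (a k)))).
    by rewrite -Gw; move=> e e0; exact: (pf_cv pN (pmap_cv pG aw) e0).
  have [m' Hm'] := cvs_bounded (pmap_cv pG aw); have [B' B'0 HB'] := proper_bound cov m'.
  have [L L0 HL] := pf_lip (B' + nm w) pq.
  have qw : q w = 0 by rewrite /q big1// => i _; rewrite subrr mxE mul0r.
  move=> e e0; have den : 0 < L ^+ D.-1 + 1 by rewrite ltr_wpDl// exprn_ge0.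
  have [N' HN'] := pf_cv pq aw (e := e / (L ^+ D.-1 + 1)) ltac:(by rewrite divr_gt0).
  exists N' => k /HN'; rewrite qw !subr0 ltr_pdivlMr// => h; apply: le_lt_trans h.
  have [us sP] := fibP cov (Pa k); have ain : a k \in fib G (G (a k)) by apply/sP.
  rewrite -HN// (perm_big _ (perm_to_rem ain)) big_cons ncM ler_wpM2l ?nc_ge0//.
  apply: ler_wpDr => //; rewrite nc_prod.
  have <- : size (rem (a k) (fib G (G (a k)))) = D.-1.
    by rewrite size_rem// (size_fib cov (Pa k) (Pu 0%N)).
  apply: (@le_trans _ _ (\prod_(z <- rem (a k) (fib G (G (a k)))) L)).
    rewrite !big_seq; apply: ler_prod => z zr; rewrite nc_ge0/=.
    have zb : nm z <= B' + nm w.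
      rewrite (le_trans (HB' z _)) ?lerDl ?nm_ge0//.
      by rewrite (proj1 (sP z) (mem_rem zr)); exact: Hm'.
    exact: (HL z z zb zb).2.
  by rewrite big_const_seq count_predT iter_mulr_1.
- move=> q N pq pN HN; rewrite (prodE q N pq pN HN).
  by rewrite big_map big_enum.
Qed.

(** The [i]-th coordinate of [z] is a root of a polynomial of degree [D] whose coefficients are
    polynomials in [G z]. Evaluated with the coefficients at [G w], this polynomial is small of the
    order of [G z - G w] and is the product of the differences to the [i]-th coordinates of the
    points over [G w]; each of the [D] factors is at least a multiple of [(z - w) 0 i]. *)
Lemma lojasiewicz D : (forall y, P y != 0 -> size (fib G y) = D) ->
  forall w, exists c d : R, [/\ 0 <= c, 0 < d & forall z, nm (z - w) < d ->
    nm (z - w) ^+ D <= c * nm (G z - G w)].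
Proof.
move=> hD w; have [zs [_ szs zsP HN]] := fiber_limit (G w).
have D0 : (0 < D)%N by have [y Py] := hP; rewrite -(hD y Py) size_fib_gt0.
have {szs} szs : size zs = D by have [y Py] := hP; rewrite (szs y Py) hD.
have coordi i : exists c d : R, [/\ 0 <= c, 0 < d & forall z, nm (z - w) < d ->
    nc ((z - w) 0 i) ^+ D <= c * nm (G z - G w)].
  pose x (k : 'I_D.+1) : C := (k : nat)%:R.
  have xi : injective x by move=> k l /eqP; rewrite eqr_nat => /eqP/val_inj.
  have [L HL] := lagrange_interp xi.
  have pq T : polyfun (fun z : V => z 0 i - T) by apply: pfB; [exact: pf_coord|exact: pf_cst].
  have /choice[N HNk] k : exists N, polyfun N /\
      forall y, P y != 0 -> \prod_(z <- fib G y) (z 0 i - x k) = N y.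
    by have [N] := sym_polyfun (symfun_prod (pq (x k))) hP; exists N.
  have interp (s : seq V) T : size s = D ->
      \prod_(z <- s) (z 0 i - T) = \sum_k (\prod_(z <- s) (z 0 i - x k)) * (L k).[T].
    move=> sD; pose p : {poly C} := \prod_(z <- s) ((z 0 i)%:P - 'X).
    have pE t : p.[t] = \prod_(z <- s) (z 0 i - t).
      by rewrite horner_prod; apply: eq_bigr => z _; rewrite !hornerE.
    rewrite -pE HL; first by apply: eq_bigr => k _; rewrite pE.
    rewrite -sD /p; elim: (s) => [|z s' IH]; first by rewrite big_nil size_poly1.
    rewrite big_cons (leq_trans (size_polyMleq _ _))//.
    have : (size (((z 0 i)%:P - 'X)%R : {poly C}) <= 2)%N.
      by rewrite (leq_trans (size_polyD _ _))// size_polyN size_polyX geq_max size_polyC; case: (_ != _).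
    by move=> sb; rewrite -subn1 leq_subLR add1n; have := leq_add sb IH; rewrite add2n.
  (* Up to sign the characteristic polynomial of the [i]-th coordinate on the fibre, written through
     its values at [D + 1] nodes so that its coefficients are polynomial in [y] by [sym_polyfun]. *)
  pose W y T := \sum_k N k y * (L k).[T].
  have W0 z : W (G z) (z 0 i) = 0.
    have pW : polyfun (fun z => W (G z) (z 0 i)).
      apply: pf_sum => k _; apply: pfM; first exact: (pf_comp pG (HNk k).1).
      apply: (@pf_ext _ _ (fun z => \sum_(j < size (L k)) (L k)`_j * z 0 i ^+ j)).
        by apply: pf_sum => j _; apply: pfM; [exact: pf_cst|apply: pfX; exact: pf_coord].
      by move=> z'; rewrite horner_coef.
    have [a [az Pa]] := pf_dense_seq pPG reg_image z.
    apply: (cv_const_unique (u := fun k => W (G (a k)) (a k 0 i))).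
      by move=> e e0; exact: (pf_cv pW az e0).
    move=> e e0; exists 0%N => k _; rewrite subr0.
    have -> : W (G (a k)) (a k 0 i) = 0; last by rewrite nc0.
    rewrite /W; under eq_bigr do rewrite -(HNk _).2//.
    rewrite -interp ?hD// (big_rem (a k))/= ?subrr ?mul0r//.
    by apply/(fibP cov (Pa k)).2.
  have WGw T : W (G w) T = \prod_(z <- zs) (z 0 i - T).
    rewrite interp//; apply: eq_bigr => k _; congr (_ * _).
    by apply: HN => //; [exact: (HNk k).1|exact: (HNk k).2].
  have [g g0 Hg] : exists2 g : R, 0 < g & forall z, z \in zs -> z 0 i = w 0 i \/ g <= nc (z 0 i - w 0 i).
    elim: (zs) => [|z s [g g0 Hg]]; first by exists 1.
    have [zw|zw] := eqVneq (z 0 i) (w 0 i).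
      by exists g => // z'; rewrite inE => /orP[/eqP->|/Hg//]; left.
    exists (Num.min g (nc (z 0 i - w 0 i))); first by rewrite lt_min g0 nc_gt0 subr_eq0.
    move=> z'; rewrite inE => /orP[/eqP->|/Hg[->|gz]]; [right|by left|right].
      by rewrite ge_min lexx orbT.
    by rewrite (le_trans _ gz)// ge_min lexx.
  have [mG mG0 HmG] : exists2 mG, 0 <= mG & forall z, nm (z - w) < 1 -> nm (G z) <= mG.
    have /choice[l Hl] j : exists l, 0 <= l /\ forall z, nm z <= nm w + 1 -> nc (G z 0 j) <= l.
      by have [l l0 H] := pf_lip (nm w + 1) (pG j); exists l; split=> // z zb; exact: (H z z zb zb).2.
    exists (\sum_j l j); first by apply: sumr_ge0 => j _; exact: (Hl j).1.
    move=> z zw; rewrite /nm big_ord_recl big_ord0 addr0; apply: ler_sum => j _.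
    apply: (Hl j).2; have := nmB_ge z w; lra.
  have /choice[l Hl] k : exists l, 0 <= l /\ forall y y', nm y <= mG -> nm y' <= mG ->
      nc (N k y - N k y') <= l * nm (y - y').
    have [l l0 H] := pf_lip mG (HNk k).1; exists l; split=> // y y' h h'.
    exact: (H _ _ h h').1.
  have /choice[b Hb] k : exists b, 0 <= b /\ forall t, nc t <= nc (w 0 i) + 1 -> nc (L k).[t] <= b.
    exists (\sum_(j < size (L k)) nc (L k)`_j * (nc (w 0 i) + 1) ^+ j); split.
      by apply: sumr_ge0 => j _; rewrite mulr_ge0 ?exprn_ge0 ?addr_ge0 ?nc_ge0.
    move=> t tb; rewrite horner_coef (le_trans (nc_sum _ _ _))//; apply: ler_sum => j _.
    by rewrite ncM ncX ler_wpM2l ?nc_ge0// lerXn2r ?nnegrE ?addr_ge0 ?nc_ge0.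
  (* One constant for both kinds of factors: those equal to [|(z - w) 0 i|], and those that stay
     above [g / 2] near [w]. *)
  pose kap := Num.min 1 (g / 2); have kap0 : 0 < kap by rewrite lt_min ltr01 divr_gt0.
  pose c := (\sum_k l k * b k) / kap ^+ D.
  exists c, (Num.min 1 (g / 2)); split=> //.
    rewrite divr_ge0 ?exprn_ge0 ?(ltW kap0)//; apply: sumr_ge0 => k _.
    by rewrite mulr_ge0 ?(Hl k).1 ?(Hb k).1.
  move=> z; rewrite lt_min => /andP[z1 zg].
  have zi1 : nc ((z - w) 0 i) <= nm (z - w) by exact: nm_coord.
  have ziE : (z - w) 0 i = z 0 i - w 0 i by rewrite !mxE.
  have up : \prod_(x0 <- zs) nc (x0 0 i - z 0 i) <= (\sum_k l k * b k) * nm (G z - G w).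
    rewrite -nc_prod -WGw -[W _ _]subr0 -(W0 z) /W -sumrB (le_trans (nc_sum _ _ _))// mulr_suml.
    apply: ler_sum => k _; rewrite -mulrBl ncM [leRHS]mulrAC; apply: ler_pM; rewrite ?nc_ge0//.
      rewrite nmBC; apply: (Hl k).2; last exact: HmG.
      by apply: HmG; rewrite subrr nm0.
    apply: (Hb k).2; have := ncB_ge (z 0 i) (w 0 i); rewrite -ziE; lra.
  have lo : (kap * nc ((z - w) 0 i)) ^+ D <= \prod_(x0 <- zs) nc (x0 0 i - z 0 i).
    have -> : (kap * nc ((z - w) 0 i)) ^+ D = \prod_(x0 <- zs) (kap * nc ((z - w) 0 i)).
      by rewrite big_const_seq count_predT iter_mulr_1 szs.
    rewrite !big_seq; apply: ler_prod => x0 x0s; rewrite mulr_ge0 ?nc_ge0 ?(ltW kap0)//=.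
    have k1 : kap <= 1 by rewrite ge_min lexx.
    have kg : kap <= g / 2 by rewrite ge_min lexx orbT.
    case: (Hg _ x0s) => [->|gx].
      by rewrite ncBC -ziE ler_piMl ?nc_ge0.
    have := nc_tri (z 0 i) (x0 0 i) (w 0 i); rewrite -ziE.
    have := nc_ge0 ((z - w) 0 i); nra.
  rewrite /c mulrAC ler_pdivlMr ?exprn_gt0// -exprMn mulrC.
  exact: le_trans lo up.
have /choice[c /choice[d Hcd]] := coordi.
exists (n%:R ^+ D * \sum_i c i), (\big[Num.min/1]_i d i); split.
- rewrite mulr_ge0 ?exprn_ge0// sumr_ge0// => i _; by case: (Hcd i).
- by elim/big_ind: _ => // [x y x0 y0|i _]; [rewrite lt_min x0|case: (Hcd i)].
move=> z zw; case: (eqVneq n 0%N) => [n0|n0].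
  have F : 'I_n -> False by rewrite n0 => -[].
  have -> : nm (z - w) = 0 by rewrite /nm big_ord_recl big_ord0 addr0 big1// => j; case: (F j).
  rewrite expr0n (gtn_eqF D0) mulr_ge0 ?nm_ge0// mulr_ge0 ?exprn_ge0// sumr_ge0// => i _.
have zwd i : nm (z - w) < d i.
  apply: lt_le_trans zw _; rewrite (bigD1 i)//= ge_min lexx; exact: orTb.
have n1 : 0 < n%:R :> R by rewrite ltr0n lt0n.
have [/existsP[j Hj]|/existsPn Hn] := boolP [exists j, nm (z - w) <= n%:R * nc ((z - w) 0 j)].
  have h : nm (z - w) ^+ D <= n%:R ^+ D * nc ((z - w) 0 j) ^+ D.
    by rewrite -exprMn lerXn2r ?nnegrE ?nm_ge0// mulr_ge0 ?nc_ge0.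
  apply: le_trans h _; rewrite -mulrA ler_wpM2l ?exprn_ge0//.
  have [cj _ Hj'] := Hcd j; apply: le_trans (Hj' z (zwd j)) _.
  rewrite ler_wpM2r ?nm_ge0// (bigD1 j)//= lerDl sumr_ge0// => i _; by case: (Hcd i).
exfalso; have : nm (z - w) < nm (z - w).
  have {1}-> : nm (z - w) = \sum_(j < n) nc ((z - w) 0 j).
    by rewrite /nm big_ord_recl big_ord0 addr0.
  have {1}-> : nm (z - w) = \sum_(j < n) (nm (z - w) / n%:R).
    by rewrite sumr_const card_ord -[_ *+ n]mulr_natr divfK ?lt0r_neq0.
  have [j0] : exists j0 : 'I_n, true by case: (n) n0 => // n' _; exists ord0.
  move=> _; rewrite (bigD1 j0)//= [ltRHS](bigD1 j0)//= ltr_leD//.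
    by rewrite ltr_pdivlMr// mulrC ltNge Hn.
  apply: ler_sum => j _; rewrite ler_pdivlMr// mulrC ltW// ltNge; exact: Hn.
by rewrite ltxx.
Qed.
End Fibers.

(** * Lifting discs through a covering *)

Section DiscLifts.
Variable R : realType.
Local Notation C := R[i].
Variable n : nat.
Local Notation V := 'rV[C]_n.
Variables (G : V -> V) (M : V -> V -> 'M[C]_n) (P : V -> C) (cp : R).
Hypothesis cov : cover_map G M P cp.

(** The Lipschitz clause at scale [eta] is the continuity that singles out one lift; regularity
    inside the disc then follows over [P <> 0]. *)
Definition disc_lift y v (a : C) (rho : R) (g : C -> V) :=
  (forall t, nc (t - a) <= rho -> G (g t) = y + t *: v) /\
  exists B eta : R, 0 < eta /\ forall t t', nc (t - a) <= rho -> nc (t' - a) <= rho ->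
    nc (t - t') < eta -> nm (g t - g t') <= B * nc (t - t').

Lemma disc_lift_sub y v a b (rho rho' : R) g : disc_lift y v a rho g ->
  nc (b - a) + rho' <= rho -> disc_lift y v b rho' g.
Proof.
move=> [Hg [B [eta [e0 H]]]] ab; have h t : nc (t - b) <= rho' -> nc (t - a) <= rho.
  by move=> tb; have := nc_tri b t a; lra.
split=> [t /h|]; first exact: Hg.
by exists B, eta; split=> // t t' /h ? /h ?; exact: H.
Qed.

Lemma disc_lift_nice y v a (rho : R) g : disc_lift y v a rho g ->
  forall t, nc (t - a) < rho -> P (y + t *: v) != 0 -> forall j, nice (fun t => g t 0 j) t.
Proof.
move=> [Hg [B [eta [e0 H]]]] t ta Pt j.
have d0 : 0 < Num.min eta (rho - nc (t - a)) by rewrite lt_min e0; lra.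
apply: (nice_sheet cov d0 (B := B)) Pt j => t'; rewrite lt_min => /andP[t1 t2].
have ta' : nc (t' - a) <= rho by have := nc_tri t t' a; lra.
by split; [exact: Hg|apply: H => //; exact: ltW].
Qed.

Lemma disc_lift_unique y v a (rho : R) g g' t0 : (forall t, nc (t - a) <= rho -> P (y + t *: v) != 0) ->
  disc_lift y v a rho g -> disc_lift y v a rho g' -> nc (t0 - a) <= rho -> g t0 = g' t0 ->
  forall t, nc (t - a) <= rho -> g t = g' t.
Proof.
move=> HP [Hg [B [eta [e0 H]]]] [Hg' [B' [eta' [e0' H']]]] t0a gg t ta.
have [r [B0 [eta0 [[[r0 B00 et0 Be] [Hs _]] _]]]] :=
  @sheets_exist _ _ _ _ _ _ cov y v _ (ccpt_disc a rho) HP 1 ltr01.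
pose x (s : R) : C := t0 + (s%:C)%C * (t - t0).
have xin s : 0 <= s <= 1 -> nc (x s - a) <= rho.
  move=> /andP[s0 s1]; have -> : x s - a = ((1 - s)%:C)%C * (t0 - a) + (s%:C)%C * (t - a).
    by rewrite /x rmorphB rmorph1; ring.
  apply: le_trans (ncD _ _) _; rewrite !ncM !ncR !ger0_norm//; last by lra.
  by nra.
have xx s s' : nc (x s - x s') = `|s - s'| * nc (t - t0).
  have -> : x s - x s' = ((s - s')%:C)%C * (t - t0) by rewrite /x rmorphB; ring.
  by rewrite ncM ncR.
have -> : t = x 1 by rewrite /x rmorph1 mul1r addrC subrK.
apply: (@seg_ind _ (fun s => g (x s) = g' (x s))); last by rewrite /x rmorph0 mul0r addr0.
move=> s s01; pose K := `|B| + `|B'| + 1; have K0 : 0 < K by rewrite ltr_wpDl// addr_ge0.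
pose w := Num.min (Num.min eta eta') (r / K).
have w0 : 0 < w by rewrite !lt_min e0 e0' divr_gt0.
have T0 : 0 < nc (t - t0) + 1 by rewrite ltr_wpDl ?nc_ge0.
exists (w / 2 / (nc (t - t0) + 1)); first by rewrite !divr_gt0.
move=> s' s'' s'01 s''01; rewrite !ltr_pdivlMr// => d1 d2 e.
have d3 : nc (x s'' - x s') < w.
  have : nc (x s'' - x s) + nc (x s - x s') < w.
    rewrite !xx (distrC s s'); have := normr_ge0 (s' - s); have := normr_ge0 (s'' - s); nra.
  by apply: le_lt_trans; exact: nc_tri.
have we : w <= eta by rewrite /w !ge_min lexx.
have we' : w <= eta' by rewrite /w !ge_min lexx orbT.
have wr : w * K <= r by rewrite -ler_pdivlMr// /w !ge_min lexx !orbT.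
have b1 := H _ _ (xin _ s''01) (xin _ s'01) (lt_le_trans d3 we).
have b2 := H' _ _ (xin _ s''01) (xin _ s'01) (lt_le_trans d3 we').
have Br (b : R) : `|b| <= K - 1 -> b * nc (x s'' - x s') < r.
  move=> bK; apply: lt_le_trans wr; have := ler_norm b; have := nc_ge0 (x s'' - x s'); nra.
have bB : `|B| <= K - 1 by rewrite /K addrK lerDl.
have bB' : `|B'| <= K - 1 by rewrite /K addrK lerDr.
have := Hs (g (x s')) (x s') (g (x s'')) (x s'') (g' (x s'')) (x s'') (xin _ s'01)
   (Hg _ (xin _ s'01)) (Hg _ (xin _ s''01)) (Hg' _ (xin _ s''01)) (le_lt_trans b1 (Br _ bB)).
rewrite e => /(_ (le_lt_trans b2 (Br _ bB'))); rewrite subrr nc0 mulr0 => h.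
by apply/eqP; rewrite -subr_eq0 -nm_eq0 eq_le h nm_ge0.
Qed.

(** The lift is extended over concentric discs whose radii grow by [eta / 2]. The value at [t] is
    lifted from the value at [c t], the point contracted towards the centre by [k / (k + 1)], which
    lies in the previous disc at distance at most [eta / 2]. *)
Lemma disc_lift_exists y v a (rho : R) z0 : 0 <= rho -> (forall t, nc (t - a) <= rho -> P (y + t *: v) != 0) ->
  G z0 = y + a *: v -> exists2 g, disc_lift y v a rho g & g a = z0.
Proof.
move=> rho0 HP Gz0.
have [r [B [eta [[[r0 B0 et0 Be] [Hs Hl]] _]]]] :=
  @sheets_exist _ _ _ _ _ _ cov y v _ (ccpt_disc a rho) HP 1 ltr01.
pose e := eta / 2; have e0 : 0 < e by rewrite divr_gt0.
have main k : exists g, [/\ g a = z0,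
   forall t, nc (t - a) <= rho -> nc (t - a) <= k%:R * e -> G (g t) = y + t *: v &
   forall t t', nc (t - a) <= rho -> nc (t - a) <= k%:R * e -> nc (t' - a) <= rho ->
     nc (t' - a) <= k%:R * e -> nc (t - t') < e -> nm (g t - g t') <= B * nc (t - t')].
  elim: k => [|k [g [ga Gg Lg]]].
    exists (fun=> z0); split=> // [t _|t t' _ _ _ _ _].
      by rewrite mul0r => h; suff -> : t = a by []; apply/eqP; rewrite -subr_eq0 -nc_eq0 eq_le h nc_ge0.
    by rewrite subrr nm0 mulr_ge0 ?nc_ge0// ltW.
  pose th := (k%:R / k.+1%:R : R); have k0 : 0 < k.+1%:R :> R by rewrite ltr0n.
  have th0 : 0 <= th by rewrite divr_ge0.
  have th1 : th <= 1 by rewrite ler_pdivrMr// mul1r ler_nat.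
  have thk : th * k.+1%:R = k%:R by rewrite /th mulfVK// lt0r_neq0.
  pose c t := a + (th%:C)%C * (t - a).
  have cc t t' : nc (c t - c t') = th * nc (t - t').
    have -> : c t - c t' = (th%:C)%C * (t - t') by rewrite /c; ring.
    by rewrite ncM ncR ger0_norm.
  have ca t : nc (c t - a) = th * nc (t - a).
    have -> : c t - a = (th%:C)%C * (t - a) by rewrite /c; ring.
    by rewrite ncM ncR ger0_norm.
  have c1 t : nc (t - a) <= rho -> nc (c t - a) <= rho.
    by rewrite ca; have := nc_ge0 (t - a); nra.
  have c2 t : nc (t - a) <= k.+1%:R * e -> nc (c t - a) <= k%:R * e.
    by rewrite ca => h; rewrite -thk -mulrA; apply: ler_wpM2l.
  have c3 t : nc (t - a) <= k.+1%:R * e -> nc (t - c t) <= e.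
    have -> : t - c t = ((1 - th)%:C)%C * (t - a) by rewrite /c rmorphB rmorph1; ring.
    rewrite ncM ncR ger0_norm ?subr_ge0// => h.
    have -> : e = (1 - th) * (k.+1%:R * e) by rewrite mulrA mulrBl thk mul1r -natrB// subSnn mul1r.
    by apply: ler_wpM2l; rewrite ?subr_ge0.
  have /choice[g' Hg'] t : exists z, nc (t - a) <= rho -> nc (t - a) <= k.+1%:R * e ->
      G z = y + t *: v /\ nm (z - g (c t)) <= B * nc (t - c t).
    have [h1|h1] := boolP (nc (t - a) <= rho); last by exists 0.
    have [h2|h2] := boolP (nc (t - a) <= k.+1%:R * e); last by exists 0.
    have [|z [Gz zb]] := Hl (g (c t)) (c t) t (c1 _ h1) (Gg _ (c1 _ h1) (c2 _ h2)); last by exists z.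
    by apply: le_lt_trans (c3 _ h2) _; rewrite /e; lra.
  have near t t' : nc (t - a) <= rho -> nc (t - a) <= k.+1%:R * e -> nc (t' - a) <= rho ->
      nc (t' - a) <= k.+1%:R * e -> nc (t - t') < e -> nm (g' t' - g (c t)) < r.
    move=> h1 h2 h1' h2' tt; have := (Hg' t' h1' h2').2.
    have := nm_tri (g (c t')) (g' t') (g (c t)).
    have ctt : nc (c t' - c t) <= nc (t - t') by rewrite cc (ncBC t'); have := nc_ge0 (t - t'); nra.
    have := Lg _ _ (c1 _ h1') (c2 _ h2') (c1 _ h1) (c2 _ h2) (le_lt_trans ctt tt).
    have := c3 _ h2'; rewrite /e in tt *; have := nc_ge0 (t' - c t').
    have : B * nc (c t' - c t) <= B * e by rewrite ler_pM2l// (le_trans ctt)// ltW.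
    have : B * nc (t' - c t') <= B * e by rewrite ler_pM2l// c3.
    by rewrite /e; nra.
  have Lg' t t' : nc (t - a) <= rho -> nc (t - a) <= k.+1%:R * e -> nc (t' - a) <= rho ->
      nc (t' - a) <= k.+1%:R * e -> nc (t - t') < e -> nm (g' t - g' t') <= B * nc (t - t').
    move=> h1 h2 h1' h2' tt.
    apply: (Hs (g (c t)) (c t)); rewrite ?(Gg _ (c1 _ h1) (c2 _ h2)) ?(Hg' _ h1 h2).1 ?(Hg' _ h1' h2').1 ?c1//.
      by apply: near; rewrite // subrr nc0.
    exact: near.
  exists g'; split=> // [|t h1 h2]; last exact: (Hg' _ h1 h2).1.
  have h1 : nc (a - a) <= rho by rewrite subrr nc0.
  have h2 : nc (a - a) <= k.+1%:R * e by rewrite subrr nc0 mulr_ge0 ?ltW.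
  have ca0 : c a = a by rewrite /c subrr mulr0 addr0.
  have := (Hg' _ h1 h2).2; rewrite ca0 ga subrr nc0 mulr0 => h.
  by apply/eqP; rewrite -subr_eq0 -nm_eq0 eq_le h nm_ge0.
have [g [ga Gg Lg]] := main (Num.Def.archi_bound (rho / e)).
have big : rho <= (Num.Def.archi_bound (rho / e))%:R * e.
  by rewrite -ler_pdivrMr// ltW// archi_boundP// divr_ge0// ltW.
exists g => //; split=> [t h|]; first by apply: Gg => //; apply: le_trans h big.
by exists B, e; split=> // t t' h h'; apply: Lg => //; apply: le_trans big.
Qed.
End DiscLifts.

(** * Labels of the points of a fibre *)

Section Labels.
Variable R : realType.
Local Notation C := R[i].

Lemma seq_radius (T : eqType) (s : seq T) (Q : T -> R -> Prop) :
  (forall z d d', d' <= d -> Q z d -> Q z d') -> (forall z, z \in s -> exists2 d, 0 < d & Q z d) ->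
  exists2 d, 0 < d & forall z, z \in s -> Q z d.
Proof.
move=> Qm; elim: s => [|z s IH] H; first by exists 1.
have [|d d0 Hd] := IH; first by move=> w ws; apply: H; rewrite inE ws orbT.
have [|d' d'0 Hd'] := H z; first by rewrite inE eqxx.
exists (Num.min d d'); first by rewrite lt_min d0.
by move=> w; rewrite inE => /orP[/eqP->|/Hd]; [apply: Qm Hd'|apply: Qm]; rewrite ge_min lexx ?orbT.
Qed.

Variable n : nat.
Local Notation V := 'rV[C]_n.
Variables (G : V -> V) (M : V -> V -> 'M[C]_n) (P : V -> C) (cp : R).
Hypothesis cov : cover_map G M P cp.

Let pG : pmap G. Proof. by case: cov. Qed.

Lemma fib_disc y v a (rho : R) : 0 <= rho -> (forall t, nc (t - a) <= rho -> P (y + t *: v) != 0) ->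
  exists g : V -> C -> V, (forall z, z \in fib G (y + a *: v) -> disc_lift G y v a rho (g z) /\ g z a = z) /\
    forall t, nc (t - a) <= rho -> perm_eq (fib G (y + t *: v)) [seq g z t | z <- fib G (y + a *: v)].
Proof.
move=> rho0 HP; have Pa : P (y + a *: v) != 0 by apply: HP; rewrite subrr nc0.
have [ua fa] := fibP cov Pa.
have /choice[g Hg] z : exists g, z \in fib G (y + a *: v) -> disc_lift G y v a rho g /\ g a = z.
  have [zf|zf] := boolP (z \in fib G (y + a *: v)); last by exists (fun=> 0).
  by have [g gl ga] := disc_lift_exists cov rho0 HP ((fa z).1 zf); exists g.
exists g; split=> // t ta; have [ut ft] := fibP cov (HP t ta).
have inj : {in fib G (y + a *: v) &, injective (fun z => g z t)}.
  move=> z z' /Hg[lz za] /Hg[lz' za'] e; rewrite -za -za'.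
  by apply: (disc_lift_unique cov HP lz lz' ta e); rewrite subrr nc0.
have um : uniq [seq g z t | z <- fib G (y + a *: v)] by rewrite map_inj_in_uniq.
have sub : {subset [seq g z t | z <- fib G (y + a *: v)] <= fib G (y + t *: v)}.
  by move=> _ /mapP[z /Hg[[lz _] _] ->]; apply/ft; exact: lz.
rewrite perm_sym; apply: uniq_perm => //; have [] := uniq_min_size um sub.
  by rewrite size_map (size_fib cov (HP t ta) Pa).
by [].
Qed.

Variables (y : V) (X : seq V).
Hypothesis XP : forall z, z \in X <-> G z = y.

Lemma near_fiber (sg : R) : 0 < sg -> exists2 rho : R, 0 < rho &
  forall z, nm (G z - y) <= rho -> exists2 x, x \in X & nm (z - x) < sg.
Proof.
move=> sg0; apply: contrapT => /forall2NP no.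
have /choice[z Hz] (j : nat) : exists z, nm (G z - y) <= j.+1%:R^-1 /\ forall x, x \in X -> sg <= nm (z - x).
  have [|/existsNP[z /not_implyP[zj nz]]] := no j.+1%:R^-1; first by rewrite invr_gt0 ltr0n.
  by exists z; split=> // x xX; rewrite leNgt; apply/negP => lt; apply: nz; exists x.
have cG : cvs (G \o z) y.
  move=> e /archi_inv[N Ne]; exists N => j Nj; apply: le_lt_trans (Hz j).1 _.
  exact: le_lt_trans (inv_nat_le R Nj) Ne.
have [m Hm] := cvs_bounded cG; have [B _ HB] := proper_bound cov m.
have [phi [hp [l cl]]] := bw (fun j => HB _ (Hm j)).
have Gl : G l = y.
  apply: (cvs_unique (pmap_cv pG cl)); exact: (cvs_sub cG hp).
have [N HN] := cl _ sg0; have := (Hz (phi N)).2 l ((XP l).2 Gl).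
by rewrite leNgt (HN N (leqnn N)).
Qed.

Lemma separation : exists2 sg : R, 0 < sg & forall x x', x \in X -> x' \in X -> nm (x - x') < 4 * sg -> x = x'.
Proof.
elim: X => [|x s [sg sg0 H]]; first by exists 1.
have [d d0 Hd] : exists2 d : R, 0 < d & forall x', x' \in s -> x' = x \/ d <= nm (x - x').
  elim: s {H} => [|x' s [d d0 Hd]]; first by exists 1.
  have [->|xx] := eqVneq x' x.
    by exists d => // w; rewrite inE => /orP[/eqP->|/Hd//]; left.
  exists (Num.min d (nm (x - x'))); first by rewrite lt_min d0 nm_gt0 subr_eq0 eq_sym.
  move=> w; rewrite inE => /orP[/eqP->|/Hd[->|h]]; [right|by left|right].
    by rewrite ge_min lexx orbT.
  by rewrite (le_trans _ h)// ge_min lexx.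
exists (Num.min sg (d / 4)); first by rewrite lt_min sg0 divr_gt0.
have h1 : 4 * Num.min sg (d / 4) <= 4 * sg by rewrite ler_pM2l// ge_min lexx.
have h2 : 4 * Num.min sg (d / 4) <= d by rewrite mulrC -ler_pdivlMr// ge_min lexx orbT.
move=> a b; rewrite !inE => /orP[/eqP->|aS] /orP[/eqP->|bS] h //.
- by case: (Hd _ bS) => // h3; have := le_lt_trans h3 (lt_le_trans h h2); rewrite ltxx.
- case: (Hd _ aS) => // h3; have := le_lt_trans h3 (lt_le_trans _ h2); rewrite nmBC h => /(_ isT).
  by rewrite ltxx.
- exact: H (lt_le_trans h h1).
Qed.

Lemma pf_eps (q : V -> C) w (e : R) : polyfun q -> 0 < e ->
  exists2 d : R, 0 < d & forall w', nm (w' - w) <= d -> nc (q w' - q w) < e.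
Proof.
move=> pq e0; have [L L0 HL] := pf_lip (nm w + 1) pq; have L1 : 0 < L + 1 by lra.
exists (Num.min 1 (e / 2 / (L + 1))); first by rewrite lt_min ltr01 !divr_gt0.
move=> w'; rewrite le_min => /andP[w1]; rewrite ler_pdivlMr// => w2.
have b1 : nm w' <= nm w + 1 by have := nmB_ge w' w; lra.
have b2 : nm w <= nm w + 1 by lra.
have [h _] := HL _ _ b1 b2; have := nm_ge0 (w' - w); nra.
Qed.

Hypotheses (hP : exists y, P y != 0) (hM : exists z, \det (M z z) != 0).

(** The map is open even at ramified points. For an affine [q] that vanishes at [x] and at no other
    point of [X], the norm of [q] vanishes at [y], hence is small at [y']; were no point over [y']
    near [x], all factors would be at least [c / 2]. *)
Lemma near_open (sg : R) : 0 < sg -> exists2 rho : R, 0 < rho & forall x, x \in X ->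
  forall y', P y' != 0 -> nm (y' - y) <= rho -> exists2 z, G z = y' & nm (z - x) < sg.
Proof.
move=> sg0; apply: seq_radius => [x d d' dd H y' Py' yd|x xX]; first by apply: H => //; exact: le_trans dd.
have [|l Hl] := @generic_linear _ _ [seq x' - x | x' <- X & x' != x].
  by move=> _ /mapP[x' + ->]; rewrite mem_filter subr_eq0 => /andP[].
pose q (z : V) := \sum_i (z - x) 0 i * l 0 i.
have pq : polyfun q.
  apply: pf_sum => i _; apply: pfM; last exact: pf_cst.
  by apply: (@pf_ext _ _ (fun z => z 0 i - x 0 i)) => [|z]; [apply: pfB; [exact: pf_coord|exact: pf_cst]|rewrite !mxE].
have qx : q x = 0 by rewrite /q big1// => i _; rewrite subrr mxE mul0r.
have ql x' : x' \in X -> x' != x -> q x' != 0.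
  by move=> x'X xx; apply: Hl; apply: map_f; rewrite mem_filter xx.
clearbody q.
have [c c0 Hc] : exists2 c : R, 0 < c & forall x', x' \in X -> x' != x -> c <= nc (q x').
  apply: seq_radius => [x' d d' dd H x'x|x' x'X]; first by apply: le_trans dd _; exact: H.
  have [->|xx] := eqVneq x' x; first by exists 1.
  exists (nc (q x')); last by [].
  by rewrite nc_gt0; exact: ql.
have [s1 s10 Hs1] : exists2 d : R, 0 < d & forall x', x' \in X -> forall z, nm (z - x') <= d -> nc (q z - q x') < c / 2.
  apply: seq_radius => [x' d d' dd H z zd|x' _]; first by apply: H; exact: le_trans dd.
  by apply: pf_eps => //; rewrite divr_gt0.
have m0 : 0 < Num.min sg s1 by rewrite lt_min sg0.
have [rho rho0 Hrho] := near_fiber m0.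
have [N pN HN] := sym_polyfun cov (symfun_prod pq) hP.
have [y0 Py0] := hP; pose D := size (fib G y0).
have cD : 0 < (c / 2) ^+ D by rewrite exprn_gt0// divr_gt0.
have [d d0 Hd] := pf_eps y pN cD.
have Ny : N y = 0.
  have [zs [_ _ zsP HN']] := fiber_limit cov hP hM y; rewrite (HN' q N pq pN HN).
  rewrite (big_rem x)/=; last by apply/zsP/XP.
  by rewrite qx mul0r.
exists (Num.min rho d); first by rewrite lt_min rho0.
move=> y' Py'; rewrite le_min => /andP[yr yd]; apply: contrapT => /forall2NP no.
have [_ fy] := fibP cov Py'.
have := Hd y' yd; rewrite Ny subr0 -HN// nc_prod => h.
have : (c / 2) ^+ D <= \prod_(z <- fib G y') nc (q z).
  have <- : size (fib G y') = D by exact: (size_fib cov Py' Py0).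
  have -> : (c / 2) ^+ size (fib G y') = \prod_(z <- fib G y') (c / 2).
    by rewrite big_const_seq count_predT iter_mulr_1.
  rewrite !big_seq; apply: ler_prod => z /fy Gz; rewrite divr_ge0 ?(ltW c0)//=.
  have [|x' x'X] := Hrho z; first by rewrite Gz.
  rewrite lt_min => /andP[zx1 zx2].
  have xx : x' != x by apply: contraTneq zx1 => ->; apply/negP => h'; case: (no z).
  have := Hs1 x' x'X z (ltW zx2); have := Hc x' x'X xx; have := nc_tri (q z) (q x') 0.
  rewrite !subr0 (ncBC (q x') (q z)) => h1 h2 h3; rewrite leNgt; apply/negP => h4.
  by have := ltrD h3 h4; rewrite -splitr => h5; have := le_lt_trans (le_trans h2 h1) h5; rewrite ltxx.
by move=> /le_lt_trans/(_ h); rewrite ltxx.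
Qed.

Variables (v : V) (r : R).
Hypotheses (r0 : 0 < r) (reg : forall t, 0 < nc t <= 2 * r -> P (y + t *: v) != 0).

(* A point z over y + t v, 0 < |t| <= r, is labelled by the point of the central
   fibre reached by continuing z radially towards t = 0. *)
Theorem labels : exists lab : C -> V -> V,
  [/\ forall t z, 0 < nc t <= r -> G z = y + t *: v -> lab t z \in X,
      forall t0, 0 < nc t0 <= r -> exists (g : V -> C -> V) (d : R), 0 < d /\
        [/\ forall z t, z \in fib G (y + t0 *: v) -> nc (t - t0) < d -> nc t <= r -> lab t (g z t) = lab t0 z,
            forall z, z \in fib G (y + t0 *: v) -> forall j, nice (fun t => g z t 0 j) t0 &
            forall t, nc (t - t0) < d -> perm_eq (fib G (y + t *: v)) [seq g z t | z <- fib G (y + t0 *: v)]],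
      forall sg : R, 0 < sg -> exists2 rho : R, 0 < rho & forall t z, 0 < nc t <= r -> nc t <= rho ->
        G z = y + t *: v -> nm (z - lab t z) < sg &
      forall t x, 0 < nc t <= r -> x \in X -> exists2 z, G z = y + t *: v & lab t z = x].
Proof.
have lineB t : y + t *: v - y = t *: v by rewrite addrC addKr.
have [sg sg0 sep] := separation.
have [rho1 rho10 Hrho1] := near_fiber sg0; have [rho2 rho20 Hrho2] := near_open sg0.
have v0 : 0 < nm v + 1 by rewrite ltr_wpDl ?nm_ge0.
have [rho [rho0 rhor rv]] : exists rho : R, [/\ 0 < rho, rho <= r / 2 &
    forall t, nc t <= rho -> nm (y + t *: v - y) <= rho1 /\ nm (y + t *: v - y) <= rho2].
  have m0 : 0 < Num.min rho1 rho2 by rewrite lt_min rho10.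
  exists (Num.min (r / 2) (Num.min rho1 rho2 / (nm v + 1))); split.
  - by rewrite lt_min !divr_gt0.
  - by rewrite ge_min lexx.
  move=> t; rewrite le_min => /andP[_]; rewrite ler_pdivlMr// lineB nmZ => h.
  have : nc t * nm v <= Num.min rho1 rho2 by apply: le_trans h; rewrite ler_wpM2l ?nc_ge0//; lra.
  by rewrite le_min => /andP[].
have Hrho t z : nc t <= rho -> G z = y + t *: v -> exists2 x, x \in X & nm (z - x) < sg.
  by move=> tr Gz; apply: Hrho1; rewrite Gz (rv _ tr).1.
(* Multiplication by [k] brings the whole disc of radius [r] into the radius [rho] within which
   being close to a point of [X] already determines it. *)
have [k [k0 k2 kr]] : exists k : R, [/\ 0 < k, k <= 1 / 2 & forall t, nc t <= r -> k * nc t <= rho].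
  exists (rho / r); split; [by rewrite divr_gt0|by rewrite ler_pdivrMr//; lra|move=> t tr].
  by rewrite mulrAC ler_pdivrMr// ler_pM2l.
have /choice[near Hnear] z : exists x, (exists2 x, x \in X & nm (z - x) < sg) -> x \in X /\ nm (z - x) < sg.
  by have [[x xX zx]|h] := pselect (exists2 x, x \in X & nm (z - x) < sg); [exists x|exists 0].
have near_eq z z' : (exists2 x, x \in X & nm (z - x) < sg) -> (exists2 x, x \in X & nm (z' - x) < sg) ->
    nm (z - z') < sg -> near z = near z'.
  move=> /Hnear[h1 h2] /Hnear[h3 h4] zz; apply: sep => //.
  have := nm_tri z (near z) (near z'); have := nm_tri z' z (near z').
  by rewrite (nmBC (near z) z) => q1 q2; have := q1; have := q2; lra.
have lift_at t z : exists g, 0 < nc t <= r -> G z = y + t *: v ->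
    disc_lift G y v t ((1 - k) * nc t) g /\ g t = z.
  have [tr|] := boolP (0 < nc t <= r); last by exists (fun=> 0).
  have [Gz|] := pselect (G z = y + t *: v); last by exists (fun=> 0).
  have rad : 0 <= (1 - k) * nc t by rewrite mulr_ge0 ?nc_ge0//; lra.
  have regt t' : nc (t' - t) <= (1 - k) * nc t -> P (y + t' *: v) != 0.
    move=> h; apply: reg; case/andP: tr => t0 tr; have h1 := nc_tri t t' 0; have h2 := nc_tri t' t 0.
    by rewrite !subr0 (ncBC t) in h1 h2; apply/andP; split; nra.
  by have [g gl ga] := disc_lift_exists cov rad regt Gz; exists g.
have /choice[gg Hgg] t : exists g : V -> C -> V, forall z, 0 < nc t <= r -> G z = y + t *: v ->
    disc_lift G y v t ((1 - k) * nc t) (g z) /\ g z t = z.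
  by have /choice[g Hg] := lift_at t; exists g.
pose kt t : C := (k%:C)%C * t.
have nkt t : nc (kt t) = k * nc t by rewrite ncM ncR gtr0_norm.
have kt_in t : nc (kt t - t) = (1 - k) * nc t.
  have -> : kt t - t = - (((1 - k)%:C)%C * t) by rewrite /kt rmorphB rmorph1; ring.
  by rewrite ncN ncM ncR ger0_norm//; lra.
have ktt t t0 : nc (kt t - kt t0) = k * nc (t - t0).
  by rewrite /kt -mulrBr ncM ncR gtr0_norm.
have ktE t : kt t = (k%:C)%C * t by [].
(* The disc of radius [(1 - k) * nc t] around [t] reaches [k t] without meeting 0, so [z] is
   continued to [k t] in one step, and the nearby point of [X] is read off there. *)
clearbody kt; pose lab t z := near (gg t z (kt t)).
have nearE t z : nc t <= rho -> G z = y + t *: v -> near z \in X /\ nm (z - near z) < sg.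
  by move=> tr Gz; apply: Hnear; exact: Hrho Gz.
have regk t t' : 0 < nc t <= r -> nc (t' - t) <= (1 - k / 2) * nc t -> P (y + t' *: v) != 0.
  move=> /andP[t0 tr] h; apply: reg; have h1 := nc_tri t t' 0; have h2 := nc_tri t' t 0.
  by rewrite !subr0 (ncBC t) in h1 h2; apply/andP; split; nra.
have kk t : (1 - k) * nc t <= (1 - k / 2) * nc t by have := nc_ge0 t; nra.
have labE t z g : 0 < nc t <= r -> G z = y + t *: v ->
    disc_lift G y v t ((1 - k) * nc t) g -> g t = z -> lab t z = near (g (kt t)).
  move=> tr Gz gl gt; have [gl' gt'] := Hgg t z tr Gz; congr near.
  apply: (disc_lift_unique cov _ gl' gl (t0 := t)); rewrite ?gt ?gt' ?subrr ?nc0 ?kt_in//.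
    by move=> t' h; apply: (regk t) => //; exact: le_trans (kk t).
  by rewrite mulr_ge0 ?nc_ge0//; lra.
exists lab; split.
- move=> t z tr Gz; have [[gl _] gt] := Hgg t z tr Gz; case/andP: tr => t0 tr.
  have kr' : nc (kt t) <= rho by rewrite nkt; exact: kr.
  by apply: (nearE (kt t) _ kr' _).1; apply: gl; rewrite kt_in.
- move=> t0 t0r; case/andP: (t0r) => t00 t0r'.
  have [|g [Hg1 Hg2]] := fib_disc (a := t0) (rho := (1 - k / 2) * nc t0) _ (fun t' => regk t0 t' t0r).
    by rewrite mulr_ge0 ?nc_ge0//; lra.
  have regt0 : P (y + t0 *: v) != 0 by apply: (regk t0) => //; rewrite subrr nc0 mulr_ge0 ?nc_ge0//; lra.
  have [d d0 Hd] : exists2 d : R, 0 < d & forall z, z \in fib G (y + t0 *: v) ->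
      forall t, nc (t - t0) < d -> nc (t - t0) < k * nc t0 / 4 -> nc t <= r -> lab t (g z t) = lab t0 z.
    apply: seq_radius => [z d d' dd H t td|z zf]; first by apply: H; exact: lt_le_trans dd.
    have [gl gt] := Hg1 z zf; have [glG [B [eta [eta0 glL]]]] := gl.
    have B0 : 0 < `|B| + 1 by rewrite ltr_wpDl.
    exists (Num.min eta (sg / (`|B| + 1))); first by rewrite lt_min eta0 divr_gt0.
    move=> t; rewrite lt_min => /andP[t1]; rewrite ltr_pdivlMr// => t2 t3 tr.
    have tt := nc_tri t t0 0; have tt' := nc_tri t0 t 0; rewrite !subr0 (ncBC t0) in tt tt'.
    have tpos : 0 < nc t by nra.
    have gl_t : disc_lift G y v t ((1 - k) * nc t) (g z).
      by apply: disc_lift_sub gl _; nra.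
    have gl_t0 : disc_lift G y v t0 ((1 - k) * nc t0) (g z).
      by apply: disc_lift_sub gl _; rewrite subrr nc0 add0r kk.
    have in_t : nc (t - t0) <= (1 - k / 2) * nc t0 by nra.
    have in_kt0 : nc (kt t0 - t0) <= (1 - k / 2) * nc t0 by rewrite kt_in kk.
    have in_kt : nc (kt t - t0) <= (1 - k / 2) * nc t0.
      have := nc_tri (kt t0) (kt t) t0; rewrite ktt kt_in; nra.
    have tr2 : 0 < nc t <= r by rewrite tpos.
    rewrite (labE t _ (g z) tr2 (glG _ in_t) gl_t erefl) (labE t0 z (g z) t0r _ gl_t0 gt); last first.
      by rewrite -gt; apply: glG; rewrite subrr nc0 mulr_ge0 ?nc_ge0//; lra.
    have ktr : nc (kt t) <= rho by rewrite nkt kr.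
    have kt0r : nc (kt t0) <= rho by rewrite nkt kr.
    apply: near_eq; [exact: Hrho ktr (glG _ in_kt)|exact: Hrho kt0r (glG _ in_kt0)|].
    apply: le_lt_trans (glL _ _ in_kt in_kt0 _) _; rewrite ktt.
      by apply: le_lt_trans t1; have := nc_ge0 (t - t0); nra.
    apply: le_lt_trans t2; rewrite mulrC mulrAC.
    have h1 : k * nc (t - t0) <= nc (t - t0) by rewrite ler_piMl ?nc_ge0//; lra.
    have h2 : 0 <= k * nc (t - t0) by rewrite mulr_ge0 ?nc_ge0// ltW.
    rewrite mulrAC; apply: le_trans (ler_wpM2l h2 (_ : B <= `|B| + 1)) _; first by have := ler_norm B; lra.
    by rewrite ler_wpM2r// ltW.
  exists g, (Num.min d (k * nc t0 / 4)); split; first by rewrite lt_min d0 !divr_gt0// mulr_gt0.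
  split.
  + by move=> z t zf; rewrite lt_min => /andP[t1 t2] tr; exact: Hd.
  + move=> z zf j; have [gl _] := Hg1 z zf; apply: (disc_lift_nice cov gl) => //.
    by rewrite subrr nc0 mulr_gt0//; lra.
  + move=> t; rewrite lt_min => /andP[_ t2]; apply: Hg2; nra.
(* For small [t] no continuation is necessary: along the segment from [t] to [k t] the nearby point
   of [X] is locally constant. *)
- have L3 t z : 0 < nc t <= r -> nc t <= rho -> G z = y + t *: v -> lab t z = near z.
    move=> tr trho Gz; have [gl gt] := Hgg t z tr Gz; have [glG [B [eta [eta0 glL]]]] := gl.
    case/andP: (tr) => tpos tr'; set g := gg t z in gl gt glG glL *.
    pose ts (s : R) : C := t + (s%:C)%C * (kt t - t).
    have ts_t s : 0 <= s <= 1 -> nc (ts s - t) <= (1 - k) * nc t.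
      by move=> /andP[s0 s1]; rewrite /ts addrC addKr ncM ncR ger0_norm// kt_in ler_piMl// mulr_ge0 ?nc_ge0//; lra.
    have tsE s : ts s = ((1 - s * (1 - k))%:C)%C * t.
      by rewrite /ts ktE !rmorphB rmorph1 rmorphM rmorphB rmorph1; ring.
    have ts_r s : 0 <= s <= 1 -> nc (ts s) <= rho.
      move=> /andP[s0 s1]; rewrite tsE ncM ncR ger0_norm; last by nra.
      by apply: le_trans trho; rewrite ler_piMl ?nc_ge0//; nra.
    have tss s s' : nc (ts s - ts s') = `|s - s'| * ((1 - k) * nc t).
      have -> : ts s - ts s' = ((s - s')%:C)%C * (kt t - t) by rewrite /ts rmorphB; ring.
      by rewrite ncM ncR kt_in.
    have ts0 : ts 0 = t by rewrite /ts rmorph0 mul0r addr0.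
    have -> : lab t z = near (g (ts 1)) by rewrite /lab -/g /ts rmorph1 mul1r [t + _]addrC subrK.
    apply: (@seg_ind _ (fun s => near (g (ts s)) = near z)); last by rewrite ts0 gt.
    clearbody ts.
    move=> s s01; have B0 : 0 < `|B| + 1 by rewrite ltr_wpDl.
    pose w := Num.min eta (sg / (`|B| + 1)); have w0 : 0 < w by rewrite lt_min eta0 divr_gt0.
    have T0 : 0 < nc t + 1 by rewrite ltr_wpDl ?nc_ge0.
    exists (w / 2 / (nc t + 1)); first by rewrite !divr_gt0.
    move=> s' s'' s'01 s''01; rewrite !ltr_pdivlMr// => d1 d2 <-.
    have dd : nc (ts s'' - ts s') < w.
      rewrite tss; have : `|s'' - s'| <= `|s'' - s| + `|s' - s| by rewrite (distrC s'); exact: ler_distD.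
      have := normr_ge0 (s'' - s'); have := normr_ge0 (s'' - s); have := normr_ge0 (s' - s).
      move=> q1 q2 q3 q4; have : `|s'' - s'| * ((1 - k) * nc t) <= (`|s'' - s| + `|s' - s|) * nc t.
        by apply: ler_pM => //; [rewrite mulr_ge0 ?nc_ge0//; lra|rewrite ler_piMl ?nc_ge0//; lra].
      move=> q5; move: d1 d2 => d1 d2; apply: le_lt_trans q5 _.
      rewrite -ltr_pdivlMr// in d1; rewrite -ltr_pdivlMr// in d2.
      have := ltrD d2 d1; rewrite -splitr; apply: le_lt_trans; rewrite -mulrDl.
      by rewrite ler_wpM2l ?addr_ge0// lerDl.
    apply: near_eq.
    + exact: Hrho (ts_r _ s''01) (glG _ (ts_t _ s''01)).
    + exact: Hrho (ts_r _ s'01) (glG _ (ts_t _ s'01)).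
    move: dd; rewrite lt_min => /andP[dd1]; rewrite ltr_pdivlMr// => dd2.
    apply: le_lt_trans (glL _ _ (ts_t _ s''01) (ts_t _ s'01) dd1) _.
    apply: le_lt_trans dd2; rewrite mulrC ler_wpM2l ?nc_ge0//; have := ler_norm B; lra.
  move=> sg' sg'0; have m0 : 0 < Num.min sg sg' by rewrite lt_min sg0.
  have [q q0 Hq] := near_fiber m0; exists (Num.min rho (q / (nm v + 1))).
    by rewrite lt_min rho0 divr_gt0.
  move=> t z tr; rewrite le_min => /andP[t1]; rewrite ler_pdivlMr// => t2 Gz.
  rewrite (L3 _ _ tr t1 Gz); have [nX nz] := nearE t z t1 Gz.
  have [|x xX] := Hq z; first by rewrite Gz lineB nmZ; have := nc_ge0 t; nra.
  rewrite lt_min => /andP[zx1 zx2]; suff -> : near z = x by [].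
  by apply: sep => //; have := nm_tri z (near z) x; rewrite (nmBC (near z) z); lra.
move=> t x tr xX; case/andP: (tr) => tpos tr'.
have ktr : nc (kt t) <= rho by rewrite nkt kr.
have ktp : 0 < nc (kt t) by rewrite nkt mulr_gt0.
have Pkt : P (y + kt t *: v) != 0 by apply: reg; rewrite ktp /=; lra.
have [w Gw wx] := Hrho2 x xX _ Pkt (rv _ ktr).2.
have [|g [Hg1 Hg2]] := fib_disc (a := t) (rho := (1 - k / 2) * nc t) _ (fun t' => regk t t' tr).
  by rewrite mulr_ge0 ?nc_ge0//; lra.
have kt_t : nc (kt t - t) <= (1 - k / 2) * nc t by rewrite kt_in kk.
have : w \in fib G (y + kt t *: v) by apply/(fibP cov Pkt).2.
rewrite (perm_mem (Hg2 _ kt_t)) => /mapP[z zf wE]; have [gl gt] := Hg1 z zf.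
have Gz : G z = y + t *: v by rewrite -gt; apply: gl.1; rewrite subrr nc0 mulr_ge0 ?nc_ge0//; lra.
exists z => //; rewrite (labE t z (g z) tr Gz _ gt); last first.
  by apply: disc_lift_sub gl _; rewrite subrr nc0 add0r kk.
have [nX nw] := nearE (kt t) w ktr Gw; rewrite -wE; apply: sep => //.
by have := nm_tri w (near w) x; rewrite (nmBC (near w) w); lra.
Qed.
End Labels.

(** * Generic nondegeneracy *)

Section GenericRank.
Variable R : realType.
Local Notation C := R[i].
Variable n : nat.
Local Notation V := 'rV[C]_n.

Lemma expn_flat (u : C -> C) p : expn_at 3 u p -> p`_1 = 0 ->
  exists K d : R, [/\ 0 <= K, 0 < d & forall h, nc h < d -> nc (u h - u 0) <= K * nc h ^+ 2].
Proof.
move=> up p1; have u0 := expn_at0 (isT : (0 < 3)%N) up.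
have [K [d [K0 d0 d1 H]]] := expn_atW up.
have [B B0 HB] := poly_bound (drop_poly 2 p).
exists (K + B), d; split; rewrite ?addr_ge0// => h hd.
have h1 : nc h <= 1 by rewrite (le_trans (ltW hd)).
have pE : p.[h] - p.[0] = (drop_poly 2 p).[h] * h ^+ 2.
  have pE x : p.[x] = (take_poly 2 p).[x] + (drop_poly 2 p).[x] * x ^+ 2.
    by rewrite -{1}[p](poly_take_drop 2) hornerD hornerM hornerXn.
  have tE x : (take_poly 2 p).[x] = p`_0.
    by rewrite /take_poly horner_poly !big_ord_recl big_ord0 /= p1 mul0r !addr0 expr0 mulr1.
  by rewrite !pE !tE; ring.
have := nc_tri p.[h] (u h) (u 0); rewrite u0 pE ncM ncX.
have := H h hd; have := HB h h1; have := nc_ge0 h; rewrite exprS; set x := nc h.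
move=> x0 b k /le_trans -> //; rewrite mulrDl lerD ?ler_wpM2r ?sqr_ge0//.
by rewrite (le_trans k)// ler_wpM2l// ler_piMl ?sqr_ge0.
Qed.

(** Subdivision into [N + 1] steps: each contributes a term of order [1 / (N + 1)^2], so the total
    is [O(1 / (N + 1))]. *)
Lemma quadratic_const (f : C -> V) (c d : R) : 
  (forall h h', nc h < d -> nc h' < d -> nm (f h - f h') <= c * nc (h - h') ^+ 2) ->
  forall h, nc h < d -> f h = f 0.
Proof.
move=> H h hd; apply/eqP; rewrite -subr_eq0 -nm_eq0 eq_le nm_ge0 andbT.
have bound (N : nat) : nm (f h - f 0) <= N.+1%:R^-1 * (c * nc h ^+ 2).
  pose x (k : nat) : C := ((k%:R / N.+1%:R : R)%:C)%C * h.
  have x0 : x 0%N = 0 by rewrite /x mul0r rmorph0 mul0r.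
  have xN : x N.+1 = h by rewrite /x divff ?pnatr_eq0// rmorph1 mul1r.
  have xd k : (k <= N.+1)%N -> nc (x k) < d.
    move=> kN; rewrite /x ncM ncR ger0_norm ?divr_ge0//; apply: le_lt_trans hd.
    by rewrite ler_piMl ?nc_ge0// ler_pdivrMr ?ltr0n// mul1r ler_nat.
  have step k : (k < N.+1)%N -> nm (f (x k.+1) - f (x k)) <= N.+1%:R^-1 ^+ 2 * (c * nc h ^+ 2).
    move=> kN; apply: le_trans (H _ _ (xd _ kN) (xd _ (ltnW kN))) _.
    have -> : x k.+1 - x k = ((N.+1%:R^-1 : R)%:C)%C * h.
      by rewrite /x -mulrBl -rmorphB -mulrBl -natrB// subSnn mul1r.
    by rewrite ncM ncR ger0_norm ?invr_ge0// exprMn mulrCA.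
  have sum k : (k <= N.+1)%N -> nm (f (x k) - f 0) <= k%:R * (N.+1%:R^-1 ^+ 2 * (c * nc h ^+ 2)).
    elim: k => [|k IH] kN; first by rewrite x0 subrr nm0 mul0r.
    apply: le_trans (nm_tri (f (x k)) _ _) _.
    by rewrite -natr1 mulrDl mul1r addrC lerD// ?IH ?step// ltnW.
  have := sum N.+1 (leqnn _); rewrite xN mulrA expr2 mulrA divff ?pnatr_eq0// mul1r.
  by [].
rewrite leNgt; apply/negP => p0.
have c0 : 0 < c * nc h ^+ 2 by have := bound 0%N; rewrite invr1 mul1r; apply: lt_le_trans.
have [N] := archi_inv (divr_gt0 p0 c0); rewrite ltr_pdivlMr// => /lt_le_trans/(_ (bound N)).
by rewrite ltxx.
Qed.

Variables (F : V -> V) (M : V -> V -> 'M[C]_n) (cp : R).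
Hypotheses (pF : pmap F) (FM : bez F M) (Fp : forall z, nm z <= cp * (1 + nm (F z))).

Lemma cpt_fiber y : cpt (fun z => F z = y).
Proof.
split; first by exists (cp * (1 + nm y)) => z <-; exact: Fp.
move=> u l ul Hu; apply: (cvs_unique (pmap_cv pF ul)) => e e0.
by exists 0%N => k _; rewrite /= Hu subrr nm0.
Qed.

(* At a maximum of |D z|^2 + sum_i |D z_i|^2 over a compact fibre, where D
   detects points of maximal rank, the fibre would contain a curve along which
   these functions are holomorphic and not all stationary. *)
Theorem det_generic : exists z, \det (M z z) != 0.
Proof.
have [FM1 FM2] := FM.
have [v0 Hv0] : exists v0, forall z, (\rank (M z z) <= \rank (M v0 v0))%N.
  pose Q j := `[< exists z, \rank (M z z) = j >].
  have exQ : exists j, Q j by exists (\rank (M 0 0)); apply/asboolP; exists 0.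
  have bQ j : Q j -> (j <= n)%N by move/asboolP => [z <-]; exact: rank_leq_row.
  case: (ex_maxnP exQ bQ) => j /asboolP[v0 e] Hj; exists v0 => z; rewrite e; apply: Hj.
  by apply/asboolP; exists z.
have [r_n|r_n] := eqVneq (\rank (M v0 v0)) n.
  by exists v0; have : row_free (M v0 v0) by [rewrite /row_free r_n]; rewrite row_free_unit unitmxE unitfE.
exfalso; set r := \rank (M v0 v0) in Hv0 r_n; have {r_n} rn : (r < n)%N.
  by rewrite ltn_neqAle r_n rank_leq_row.
pose pr : 'M[C]_n := pid_mx r.
(* With [A] and [B] built from the rank normal form at [v0], the map [G] takes its first [r]
   coordinates from [F] and the remaining ones from [z], and it is invertible to first order at
   [v0]. *)
pose A := invmx (row_ebase (M v0 v0)) *m pr : 'M[C]_n.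
pose B := col_ebase (M v0 v0) *m (1%:M - pr).
have pp : pr *m pr = pr by rewrite /pr mul_pid_mx minnn (minn_idPr (ltnW rn)).
have Apid : A *m pr = A by rewrite /A -mulmxA pp.
have Bpid : B *m pr = 0 by rewrite /B -mulmxA mulmxBl mul1mx pp subrr mulmx0.
have Mv0 : \det (M v0 v0 *m A + B) != 0.
  rewrite -unitfE -/(_ \in unitmx).
  have -> : M v0 v0 *m A + B = col_ebase (M v0 v0).
    rewrite -{1}(mulmx_ebase (M v0 v0)) /A /B -/r -/pr mulmxA mulmxK ?row_ebase_unit//.
    by rewrite -mulmxA pp -mulmxDr [pr + _]addrC subrK mulmx1.
  by rewrite -unitmxE col_ebase_unit.
clearbody A B.
pose G z := F z *m A + z *m B; pose MG x y := M x y *m A + B.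
have pMG : pm2 MG.
  move=> i j; apply: (@pf_ext _ _ (fun w : 'rV[C]_(n + n) =>
     \sum_k M (lsubmx w) (rsubmx w) i k * A k j + B i j)) => [|w]; last by rewrite !mxE.
  by apply: pfD; [apply: pf_sum => k _; apply: pfM; [exact: FM1|exact: pf_cst]|exact: pf_cst].
have GM : bez G MG.
  split=> // x y; rewrite /MG mulmxDr mulmxA -FM2 /G mulmxBl mulmxBl.
  by rewrite addrACA opprD.
have pG : pmap G.
  move=> j; apply: (@pf_ext _ _ (fun z => \sum_k F z 0 k * A k j + \sum_k z 0 k * B k j)) => [|w].
    by apply: pfD; apply: pf_sum => k _; apply: pfM; [exact: pF|exact: pf_cst|exact: pf_coord|exact: pf_cst].
  by rewrite !mxE.
pose Dl z := \det (MG z z).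
have pD : polyfun Dl by apply: pf_det; exact: pm2_diag pMG.
have DlE z : Dl z = \det (MG z z) by [].
have Dv0 : Dl v0 != 0 by exact: Mv0.
clearbody Dl.
(* Multiplying the coordinates by [Dl] forces a maximum of the sum of squares over the fibre to be a
   point where [Dl] is nonzero, since the sum is positive at [v0]. *)
pose q (o : option 'I_n) (z : V) := Dl z * (if o is Some i then z 0 i else 1).
have pq o : polyfun (q o).
  by apply: pfM => //; case: o => [i|]; [exact: pf_coord|exact: pf_cst].
have [z0 Fz0 Hz0] : exists2 z, F z = F v0 & forall z', F z' = F v0 ->
    \sum_o nc (q o z') ^+ 2 <= \sum_o nc (q o z) ^+ 2.
  apply: (@evt _ _ _ (fun z => F z = F v0)) => //; [exact: cpt_fiber|by exists v0|].
  move=> u l _ _ ul e e0.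
  have e1 : 0 < e / #|{: option 'I_n}|.+1%:R by rewrite divr_gt0.
  have /(@eventually_forall _ _) [N HN] (o : option 'I_n) : exists N, forall k, (N <= k)%N ->
      `|nc (q o (u k)) ^+ 2 - nc (q o l) ^+ 2| < e / #|{: option 'I_n}|.+1%:R.
    have w0 : 0 < 2 * nc (q o l) + 1 by rewrite ltr_wpDl// mulr_ge0 ?nc_ge0.
    have [|N HN] := pf_cv (pq o) ul (e := Num.min 1 (e / #|{: option 'I_n}|.+1%:R / (2 * nc (q o l) + 1))).
      by rewrite lt_min ltr01 divr_gt0.
    exists N => k /HN; rewrite lt_min => /andP[a1]; rewrite ltr_pdivlMr// => a2.
    have b1 := ncB_ge (q o (u k)) (q o l); have b2 := ncB_ge (q o l) (q o (u k)).
    rewrite (ncBC (q o l)) in b2.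
    have -> : nc (q o (u k)) ^+ 2 - nc (q o l) ^+ 2 =
      (nc (q o (u k)) - nc (q o l)) * (nc (q o (u k)) + nc (q o l)) by ring.
    rewrite normrM; apply: le_lt_trans a2; apply: ler_pM; rewrite ?normr_ge0//.
      by rewrite ler_norml; lra.
    by rewrite ger0_norm ?addr_ge0 ?nc_ge0//; lra.
  exists N => k Nk; rewrite /= -sumrB (le_lt_trans (ler_norm_sum _ _ _))//.
  apply: (@le_lt_trans _ _ (\sum_(o : option 'I_n) e / #|{: option 'I_n}|.+1%:R)).
    by apply: ler_sum => o _; rewrite ltW// HN.
  rewrite sumr_const -[_ *+ _]mulr_natl mulrA -ltr_pdivlMr ?invr_gt0 ?ltr0n//.
  by rewrite invrK mulrC ltr_pM2l// ltr_nat.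
have Dz0 : Dl z0 != 0.
  apply: contraTneq (Hz0 v0 erefl) => D0; rewrite -ltNge [ltLHS]big1; last first.
    by move=> o _; rewrite /q D0 mul0r nc0 expr0n.
  rewrite (bigD1 None)//= ltr_pwDl ?sumr_ge0// => [|o _]; last exact: sqr_ge0.
  by rewrite exprn_gt0// nc_gt0 /q mulr1.
(* A direction killed by [pr]: moving the image of [G] along [w] leaves [F z *m A] fixed. Such a
   direction exists because [r < n]. *)
pose w : V := delta_mx 0 (Ordinal rn).
have wp : w *m pr = 0.
  apply/rowP => j; rewrite !mxE big1// => k _; rewrite /pr !mxE eqxx /=.
  by case: eqP => [->|]; rewrite ?mul0r//= ltnn andbF mulr0.
have w1 : nm w = 1.
  rewrite /nm big_ord_recl big_ord0 addr0 (bigD1 (Ordinal rn))//= big1 ?addr0.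
    by rewrite mxE !eqxx nc1.
  by move=> j jr; rewrite mxE (negbTE jr) andbF nc0.
have cK : cpt (fun z => z = z0).
  split; first by exists (nm z0) => z ->.
  move=> u l ul Hu; apply: (cvs_unique ul) => e e0; exists 0%N => k _.
  by rewrite Hu subrr nm0.
have [|r1 [B1 [eta [r10 B10 eta0 Hinj Hs]]]] := ift pG GM cK; first by move=> z ->; rewrite -DlE.
have /choice[z Hz] h : exists z, nc h < eta -> nm (z - z0) < r1 /\ G z = G z0 + h *: w.
  have [hd|hd] := ltP (nc h) eta; last by exists 0.
  have [|z z1 Gz] := Hs z0 (G z0 + h *: w) erefl; last by exists z.
  by rewrite addrC addKr nmZ w1 mulr1.
have zz h h' : nc h < eta -> nc h' < eta -> nm (z h - z h') <= B1 * nc (h - h').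
  move=> a a'; have := Hinj z0 (z h) (z h') erefl (Hz h a).1 (Hz h' a').1.
  by rewrite (Hz h a).2 (Hz h' a').2 opprD addrACA subrr add0r -scalerBl nmZ w1 mulr1.
have z00 : z 0 = z0.
  have a : nc 0 < eta by rewrite nc0.
  apply/eqP; rewrite -subr_eq0 -nm_eq0 eq_le nm_ge0 andbT.
  apply: le_trans (Hinj z0 _ _ erefl (Hz 0 a).1 _) _; first by rewrite subrr nm0.
  by rewrite (Hz 0 a).2 scale0r addr0 subrr nm0 mulr0.
pose mb := nm z0 + r1.
have zb h : nc h < eta -> nm (z h) <= mb.
  by move=> a; have := (Hz h a).1; have := nmB_ge (z h) z0; rewrite /mb; lra.
have [LD LD0 HLD] := pf_lip mb pD; have [LM LM0 HLM] := pm2_lip mb FM1.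
have [La La0 HLa] := pm2_lip mb (pm2_bez_adj GM).
pose de := nc (Dl z0) / 2; have de0 : 0 < de by rewrite divr_gt0// nc_gt0.
have deE : nc (Dl z0) = de + de by exact: splitr.
clearbody de.
have LB0 : 0 < LD * B1 + 1 by rewrite ltr_wpDl// mulr_ge0// ltW.
pose d := Num.min eta (de / (LD * B1 + 1)).
have d0 : 0 < d by rewrite lt_min eta0 divr_gt0.
have d_eta h : nc h < d -> nc h < eta by rewrite lt_min => /andP[].
have Dzh h : nc h < d -> de <= nc (Dl (z h)).
  move=> hd; have a := d_eta _ hd; have a0 : nc 0 < eta by rewrite nc0.
  have [l1 _] := HLD _ _ (zb _ a) (zb _ a0); have := zz _ _ a a0.
  move: hd l1; rewrite lt_min subr0 z00 => /andP[_]; rewrite ltr_pdivlMr// => hd l1 l2.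
  have l3 : LD * nm (z h - z0) <= de.
    apply: le_trans (ler_wpM2l LD0 l2) _; apply: le_trans (ltW hd).
    by rewrite mulrDr mulr1 [leRHS]addrC (mulrC (nc h)) mulrA lerDr nc_ge0.
  have := le_trans (ncB_ge (Dl z0) (Dl (z h))) _; rewrite ncBC => /(_ _ (le_trans l1 l3)).
  by rewrite deE lerBlDr lerD2l.
have Fconst h : nc h < d -> F (z h) = F z0.
  rewrite -z00; pose c := (LM + LM * (nm A * (La * LM)) / de) * B1 ^+ 2.
  apply: (@quadratic_const (fun h => F (z h)) c) => x x' xd x'd.
  have [a a'] := (d_eta _ xd, d_eta _ x'd).
  set X := z x; set X' := z x'; set xi := X - X'.
  have [bX bX'] := (zb _ a, zb _ a').
  have xiB : nm xi <= B1 * nc (x - x') by exact: zz.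
  have l1 : nm (M X X' - M X X) <= LM * nm xi.
    by have [+ _] := HLM _ _ _ _ bX bX' bX bX; rewrite subrr nm0 add0r nmBC -/xi (nmBC X').
  have xA : xi *m M X X' *m A = 0.
    have : (G X - G X') *m pr = 0.
      rewrite (Hz _ a).2 (Hz _ a').2 opprD addrACA subrr add0r -scalerBl.
      by rewrite -scalemxAl wp scaler0.
    by rewrite GM.2 -mulmxA /MG mulmxDl -mulmxA Apid Bpid addr0 mulmxA.
  pose N := M X X.
  (* Rank [r] is maximal and is already attained by [N *m A], so [N] factors as [N *m A *m Y]. The
     identity shows that a displacement invisible to [A] is invisible to [N] up to second order,
     whence [F] is constant on the curve. *)
  have NW : \det (MG X X) *: N = N *m A *m \adj (MG X X) *m N.
    have uX : MG X X \in unitmx.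
      rewrite unitmxE unitfE -nc_gt0 -DlE; exact: lt_le_trans de0 (Dzh _ xd).
    have e1 : MG X X *m pr = N *m A by rewrite /MG mulmxDl -mulmxA Apid Bpid addr0.
    have e2 : invmx (MG X X) *m (N *m A) = pr by rewrite -e1 mulKmx.
    have e3 : N *m A *m invmx (MG X X) *m (N *m A) = N *m A.
      by rewrite -[LHS]mulmxA e2 -mulmxA Apid.
    have rk : (r <= \rank (N *m A))%N.
      have : (\rank pr <= \rank (N *m A))%N by rewrite -e2 mxrankM_maxr.
      by rewrite rank_pid_mx ?(ltnW rn).
    have [Y HY] : exists Y, N = N *m A *m Y.
      have : (N^T <= (N *m A)^T)%MS.
        have s1 : ((N *m A)^T <= N^T)%MS by rewrite trmx_mul submxMl.
        have := mxrank_leqif_sup s1; rewrite !mxrank_tr => -[_ <-].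
        by rewrite eqn_leq mxrankM_maxl (leq_trans (Hv0 X)).
      case/submxP => D HD; exists D^T.
      by apply: trmx_inj; rewrite HD [in RHS]trmx_mul trmxK.
    have -> : \adj (MG X X) = \det (MG X X) *: invmx (MG X X).
      rewrite /invmx uX scalerA divff ?scale1r// -unitfE -unitmxE//.
    rewrite -scalemxAr -scalemxAl; congr (_ *: _).
    transitivity (N *m A *m invmx (MG X X) *m (N *m A *m Y)); last by rewrite -HY.
    by rewrite [RHS]mulmxA e3 -HY.
  have key : \det (MG X X) *: (F X - F X') =
     \det (MG X X) *: (xi *m (M X X' - N)) + xi *m (N - M X X') *m A *m \adj (MG X X) *m N.
    have -> : xi *m (N - M X X') *m A = xi *m N *m A by rewrite mulmxBr mulmxBl xA subr0.
    have -> : xi *m N *m A *m \adj (MG X X) *m N = xi *m (N *m A *m \adj (MG X X) *m N).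
      by rewrite !mulmxA.
    rewrite -NW -scalemxAr -scalerDr -mulmxDr subrK.
    by rewrite FM2.
  have dX := Dzh _ xd.
  have : nc (Dl X) * nm (F X - F X') <= (nc (Dl X) * LM + LM * (nm A * (La * LM))) * nm xi ^+ 2.
    rewrite -nmZ DlE key -DlE; apply: le_trans (nmD _ _) _; rewrite mulrDl nmZ lerD//.
      rewrite -!mulrA ler_wpM2l ?nc_ge0// (le_trans (nm_mul _ _))// expr2 mulrCA.
      by rewrite ler_wpM2l ?nm_ge0.
    have [_ l2] := HLa _ _ _ _ bX bX bX bX; have [_ l3] := HLM _ _ _ _ bX bX bX bX.
    rewrite -!mulmxA (le_trans (nm_mul _ _))//.
    have -> : LM * (nm A * (La * LM)) * nm xi ^+ 2 = nm xi * ((LM * nm xi) * (nm A * (La * LM))) by ring.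
    rewrite ler_wpM2l ?nm_ge0// (le_trans (nm_mul _ _))// ler_pM ?nm_ge0//; first by rewrite nmBC.
    rewrite (le_trans (nm_mul _ _))// ler_wpM2l ?nm_ge0// (le_trans (nm_mul _ _))// ler_pM ?nm_ge0//.
  have dS : 0 <= LM * (nm A * (La * LM)) by rewrite !mulr_ge0// nm_ge0.
  set S := LM * _ in dS *; move=> h1.
  have h2 : nm (F X - F X') <= (LM + S / de) * nm xi ^+ 2.
    have D0 : 0 < nc (Dl X) by exact: lt_le_trans dX.
    rewrite -(ler_pM2l D0); apply: le_trans h1 _; rewrite [leRHS]mulrA; apply: (ler_wpM2r (sqr_ge0 _)).
    by rewrite mulrDr lerD2l mulrCA; apply: ler_peMr => //; rewrite ler_pdivlMr// mul1r.
  apply: le_trans h2 _; rewrite /c -/S -[leRHS]mulrA -exprMn ler_wpM2l//.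
    by rewrite addr_ge0// divr_ge0// ltW.
  by rewrite lerXn2r ?nnegrE ?nm_ge0// (le_trans _ xiB) ?nm_ge0.
have zF h : nc h < d -> F (z h) = F v0 by move=> /Fconst ->.
have nz i : expn 3 (fun h => z h 0 i).
  apply: (lift_expn (G := G) (w := G z0) (v := w) (B := B1) GM d0) => [h /d_eta a|h hd|].
  - exact: (Hz _ a).2.
  - have a0 : nc 0 < eta by rewrite nc0.
    by have := zz _ _ (d_eta _ hd) a0; rewrite subr0.
  - by rewrite z00 -DlE.
have /choice[p Hp] o : exists p, expn_at 3 (fun h => q o (z h)) p.
  by have [p] := expn_pf (pq o) nz; exists p.
have [/existsP ex|/existsPn no] := boolP [exists o, (p o)`_1 != 0].
  have [h /zF hd] := no_local_max Hp ex d0; rewrite ltNge z00 => /negP; apply.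
  exact: Hz0.
(* If all linear coefficients vanish, [Dl] and its products with the coordinates move by [O(h^2)],
   hence so does [z h]. But [G (z h) - G z0 = h *: w] has norm [|h|]. *)
have /choice[K /choice[dd HK]] o : exists K e : R, [/\ 0 <= K, 0 < e & forall h, nc h < e ->
    nc (q o (z h) - q o (z 0)) <= K * nc h ^+ 2].
  by apply: expn_flat (Hp o) _; apply/eqP; rewrite -[_ == _]negbK no.
pose KK := \sum_o K o; pose e := \big[Num.min/d]_o dd o.
have e0 : 0 < e by rewrite /e; elim/big_ind: _ => // [x y x0 y0|o _]; [rewrite lt_min x0|case: (HK o)].
have Kge0 o : 0 <= K o by case: (HK o).
have KK0 : 0 <= KK by rewrite sumr_ge0.
have HKK o h : nc h < e -> nc (q o (z h) - q o z0) <= KK * nc h ^+ 2.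
  move=> he; have hdo : nc h < dd o.
    apply: lt_le_trans he _; rewrite /e (bigD1 o)//= ge_min lexx; exact: orTb.
  have [_ _ /(_ h hdo)] := HK o; rewrite z00 => /le_trans; apply.
  by rewrite ler_wpM2r ?sqr_ge0// /KK (bigD1 o)//= lerDl sumr_ge0.
have e_d : e <= d.
  by rewrite /e; elim/big_rec: _ => // o x _ xd; rewrite ge_min xd orbT.
have [LG LG0 HLG] : exists2 L, 0 <= L & forall h, nc h < eta -> nm (G (z h) - G z0) <= nm (z h - z0) * L.
  have [L L0 HL] := pm2_lip mb pMG; exists L => // h a; rewrite GM.2 (le_trans (nm_mul _ _))//.
  rewrite ler_wpM2l ?nm_ge0// -z00.
  have a0 : nc 0 < eta by rewrite nc0.
  by have [] := HL _ _ _ _ (zb _ a) (zb _ a0) (zb _ a) (zb _ a0).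
have key h : nc h < e -> nc h <= LG * (n%:R * ((KK + KK * nm z0) / de)) * nc h ^+ 2.
  move=> he; have hd : nc h < d by exact: lt_le_trans he e_d.
  have a := d_eta _ hd.
  have {1}-> : nc h = nm (G (z h) - G z0).
    by rewrite (Hz _ a).2 addrC addKr nmZ w1 mulr1.
  apply: le_trans (HLG h a) _; rewrite mulrC -mulrA ler_wpM2l//.
  rewrite {1}/nm big_ord_recl big_ord0 addr0.
  apply: (@le_trans _ _ (\sum_(i < n) ((KK + KK * nm z0) / de * nc h ^+ 2))); last first.
    by rewrite sumr_const card_ord -[_ *+ n]mulr_natl mulrA.
  apply: ler_sum => i _; rewrite mulrAC ler_pdivlMr// mulrC.
  apply: le_trans (ler_wpM2r (nc_ge0 _) (Dzh h hd)) _; rewrite -ncM.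
  have -> : Dl (z h) * (z h - z0) 0 i = (q (Some i) (z h) - q (Some i) z0) - (q None (z h) - q None z0) * z0 0 i.
    by rewrite /q !mxE; ring.
  apply: le_trans (ncB _ _) _; rewrite [leRHS]mulrDl; apply: lerD; first exact: HKK.
  by rewrite ncM mulrAC; apply: ler_pM; rewrite ?nc_ge0 ?HKK ?nm_coord.
set S := LG * _ in key.
have S0 : 0 <= S by rewrite !mulr_ge0 ?invr_ge0 ?(ltW de0)// addr_ge0// mulr_ge0 ?nm_ge0.
have S1 : 0 < S + 1 by rewrite ltr_wpDl.
pose x := Num.min (e / 2) ((S + 1)^-1).
have x0 : 0 < x by rewrite lt_min divr_gt0// invr_gt0.
have xe : nc (x%:C)%C < e.
  rewrite ncR gtr0_norm//; apply: (@le_lt_trans _ _ (e / 2)); last by lra.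
  by rewrite ge_min lexx.
have xS : x * (S + 1) <= 1 by rewrite -ler_pdivlMr// mul1r /x ge_min lexx orbT.
have := key _ xe; rewrite ncR gtr0_norm// expr2; nra.
Qed.
End GenericRank.

(** * Forms and the ascending chain condition *)

Section Noetherian.
Local Open Scope nat_scope.

Lemma nondecreasing_extraction (u : nat -> nat) : exists2 phi : nat -> nat,
  {homo phi : i j / (i < j)%N} & forall i j, (i <= j)%N -> (u (phi i) <= u (phi j))%N.
Proof.
pose Q n := forall m, (n <= m)%N -> (u n <= u m)%N.
have exQ N : exists2 n, (N <= n)%N & Q n.
  have ex : exists v, `[< exists2 n, (N <= n)%N & u n = v >] by exists (u N); apply/asboolP; exists N.
  case: (ex_minnP ex) => v /asboolP[n Nn un] Hv; exists n => // m nm.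
  by rewrite un; apply: Hv; apply/asboolP; exists m => //; exact: leq_trans nm.
have [phi hphi Qphi] := extraction (fun=> exQ).
exists phi => // i j ij; apply: Qphi; rewrite leq_eqVlt in ij.
by case/orP: ij => [/eqP->//|/hphi/ltnW].
Qed.

Lemma dickson n (s : nat -> multinom n) : exists i j, (i < j)%N /\ forall k, (s i k <= s j k)%N.
Proof.
suff [phi hphi H] : exists2 phi : nat -> nat, {homo phi : i j / (i < j)%N} &
    forall k, k \in enum 'I_n -> forall i j, (i <= j)%N -> (s (phi i) k <= s (phi j) k)%N.
  by exists (phi 0%N), (phi 1%N); split=> [|k]; [exact: hphi|apply: H; rewrite ?mem_enum].
elim: (enum 'I_n) => [|k l [phi hphi H]]; first by exists id.
have [psi hpsi H'] := nondecreasing_extraction (fun i => s (phi i) k).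
exists (phi \o psi) => [i j ij|k']; first exact/hphi/hpsi.
rewrite inE => /orP[/eqP->|k'l] i j ij; first exact: H'.
apply: H => //; rewrite leq_eqVlt in ij.
by case/orP: ij => [/eqP->//|/hpsi/ltnW].
Qed.

(** Were all inclusions strict, one could take in each difference an element [r j] of least leading
    monomial. By Dickson's lemma some leading monomial divides a later one, and subtracting the
    multiple gives an element of the same difference with a smaller leading monomial. *)
Lemma mpoly_acc n (K : fieldType) (I : nat -> mpoly n K -> Prop) :
  (forall j, I j 0%R) -> (forall j p q, I j p -> I j q -> I j (p - q)%R) -> (forall j p q, I j q -> I j (p * q)%R) ->
  (forall j p, I j p -> I j.+1 p) -> exists j, forall p, I j.+1 p -> I j p.
Proof.
move=> I0 IB IM IS; apply: contrapT => /forallNP no.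
have mono i j p : (i <= j)%N -> I i p -> I j p.
  by move=> /subnK <-; elim: (j - i)%N => // k IH /IH; exact: IS.
have /choice[r Hr] j : exists r, [/\ I j.+1 r, ~ I j r &
    forall q, I j.+1 q -> ~ I j q -> (mlead r <= mlead q)%O].
  pose T m := exists p, [/\ I j.+1 p, ~ I j p & mlead p = m].
  have [p0 [Ip0 nIp0]] : exists p, I j.+1 p /\ ~ I j p.
    by apply: contrapT => /forallNP H; apply: (no j) => p Ip; apply: contrapT => nIp; exact: (H p).
  have [m [[p [Ip nIp pm]] Hm]] : exists m, T m /\ forall m', T m' -> (m <= m')%O.
    have : T (mlead p0) by exists p0.
    move: (mlead p0); apply: (well_founded_ind (@ltom_wf n)) => m IH Tm.
    have [ex|no'] := pselect (exists2 m', (m' < m)%O & T m').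
      by case: ex => m' /IH.
    exists m; split=> // m' Tm'; rewrite leNgt; apply/negP => lt; apply: no'; by exists m'.
  exists p; split=> // q Iq nIq; rewrite pm; apply: Hm; by exists q.
have [i [j [ij Hij]]] := dickson (fun j => mlead (r j)).
have [Iri nIri _] := Hr i; have [Irj nIrj Hj] := Hr j.
have Irij : I j (r i) by exact: mono Iri.
have ri0 : r i != 0%R by apply: contra_notN nIri => /eqP ->.
have rj0 : r j != 0%R by apply: contra_notN nIrj => /eqP ->.
pose m := mnm_sub (mlead (r j)) (mlead (r i)).
have mE : mnm_add m (mlead (r i)) = mlead (r j) by rewrite /m submK//; apply/mnm_lepP.
pose c := (mcoeff (mlead (r j)) (r j) / mcoeff (mlead (r i)) (r i))%R.
have c0 : c != 0%R by rewrite mulf_neq0 ?invr_eq0 ?mleadc_eq0.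
pose t : mpoly n K := (c *: mpolyX K m)%R.
have tl : mlead t = m by rewrite /t mleadZ// mleadXm.
have tc : mcoeff (mlead t) t = c by rewrite tl /t mcoeffZ mcoeffX eqxx mulr1.
pose q := (r j - t * r i)%R.
have Iq : I j.+1 q by apply: IB => //; apply: IM; exact: IS.
have nIq : ~ I j q.
  move=> h; apply: nIrj; have -> : r j = (q - (- (t * r i)))%R by rewrite /q opprK subrK.
  by apply: (IB) => //; rewrite -sub0r; apply: IB => //; exact: IM.
have q0 : q != 0%R by apply: contra_notN nIq => /eqP ->.
have t0 : t != 0%R by rewrite -mleadc_eq0 tc.
have le1 : (mlead q <= mlead (r j))%O.
  by rewrite (le_trans (mleadB_le _ _))// mleadM// tl mE leUx !lexx.
have le2 := Hj q Iq nIq; have e : mlead q = mlead (r j) by apply/le_anti; rewrite le1 le2.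
have : mcoeff (mlead q) q = 0%R.
  rewrite e /q mcoeffB -{2}mE -tl mleadcM tc /c divfK ?subrr//.
  by rewrite mleadc_eq0.
by move/eqP; rewrite mleadc_eq0 (negbTE q0).
Qed.
End Noetherian.

Lemma meval_dhomogZ (K : comNzRingType) n e (q : dhomog n K e) c (v : 'rV[K]_n) :
  meval ((c *: v) 0) (mpoly_of_dhomog q) = c ^+ e * meval (v 0) (mpoly_of_dhomog q).
Proof.
rewrite !mevalE mulr_sumr !big_seq; apply: eq_bigr => m mq.
have me : mdeg m = e by apply: (dhomogP _ _ _ (dhomog_is_dhomog q)).
have -> : c ^+ e = \prod_i c ^+ m i by rewrite -me mdegE expr_sum.
rewrite mulrCA; congr (_ * _); rewrite -big_split /=.
by apply: eq_bigr => i _; rewrite mxE exprMn.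
Qed.

Section Forms.
Variable R : realType.
Local Notation C := R[i].
Variable n : nat.
Local Notation V := 'rV[C]_n.

(** Quasi-compactness of an arbitrary set for the Zariski topology. A failure yields points [a k]
    and functions [p k] with [p k (a k) <> 0] and [p i (a k) = 0] for [i < k]; the ideals of the
    tails of the sequence of points would then increase strictly. *)
Lemma polyfun_qcompact (S : (V -> C) -> Prop) (T : V -> Prop) : (forall q, S q -> polyfun q) ->
  (forall a, T a -> exists2 q, S q & q a != 0) ->
  exists m (q : nat -> V -> C), (forall i, (i < m)%N -> S (q i)) /\
    forall a, T a -> exists2 i, (i < m)%N & q i a != 0.
Proof.
move=> Spf TS; apply: contrapT => /forallNP no.
have [[a0 q0] [Ta0 Sq0 qa0]] : exists x : V * (V -> C), [/\ T x.1, S x.2 & x.2 x.1 != 0].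
  apply: contrapT => /forallNP H; apply: (no 0%N); exists (fun _ _ => 0); split=> // a Ta.
  by have [q Sq qa] := TS a Ta; case: (H (a, q)).
pose G (s : seq (V * (V -> C))) := forall i, (i < size s)%N -> S (nth (a0, q0) s i).2.
have /choice[step Hstep] s : exists x : V * (V -> C), G s ->
    [/\ T x.1, S x.2, x.2 x.1 != 0 & forall i, (i < size s)%N -> (nth (a0, q0) s i).2 x.1 = 0].
  have [Gs|nG] := pselect (G s); last by exists (a0, q0).
  apply: contrapT => /forallNP H; apply: (no (size s)).
  exists (fun i => (nth (a0, q0) s i).2); split=> // a Ta; apply: contrapT => no'.
  have [q Sq qa] := TS a Ta; apply: (H (a, q)) => _; split=> // i si; apply/eqP.
  by rewrite -[_ == _]negbK; apply/negP => h; apply: no'; exists i.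
pose L := fix L k := if k is k'.+1 then rcons (L k') (step (L k')) else [::].
have sL k : size (L k) = k by elim: k => //= k IH; rewrite size_rcons IH.
have GL k : G (L k).
  elim: k => // k IH i; rewrite /= size_rcons sL ltnS nth_rcons sL leq_eqVlt.
  case: (ltngtP i k) => //= [ik _|_ _]; first by apply: IH; rewrite sL.
  by case: (Hstep _ IH).
have nL k i : (i < k)%N -> nth (a0, q0) (L k) i = step (L i).
  elim: k => // k IH; rewrite ltnS /= nth_rcons sL leq_eqVlt.
  by case: (ltngtP i k) => //= [ik _|->]; [exact: IH|].
pose a k := (step (L k)).1; pose p k := (step (L k)).2.
have ha k : p k (a k) != 0 by case: (Hstep _ (GL k)).
have hz i k : (i < k)%N -> p i (a k) = 0.
  by move=> ik; case: (Hstep _ (GL k)) => _ _ _ /(_ i); rewrite sL nL// => /(_ ik).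
have /choice[mp Hmp] k : polyfun (p k) by apply: Spf; case: (Hstep _ (GL k)).
pose I j (f : mpoly n C) := forall l, (j <= l)%N -> meval (a l 0) f = 0.
have [||||j Hj] := @mpoly_acc n C I.
- by move=> j l _; rewrite meval0.
- by move=> j f g hf hg l jl; rewrite mevalB hf ?hg ?subrr.
- by move=> j f g hg l jl; rewrite mevalM hg ?mulr0.
- by move=> j f hf l jl; rewrite hf// ltnW.
have /Hj /(_ j (leqnn j)) : I j.+1 (mp j) by move=> l jl; rewrite -Hmp hz.
by rewrite -Hmp => /eqP; rewrite (negbTE (ha j)).
Qed.

Definition hform e (q : V -> C) := polyfun q /\ forall c v, q (c *: v) = c ^+ e * q v.

Lemma hformM e e' p q : hform e p -> hform e' q -> hform (e + e') (fun v => p v * q v).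
Proof.
move=> [pp hp] [pq hq]; split=> [|c v]; first exact: pfM.
by rewrite hp hq exprD mulrACA.
Qed.

Lemma hformZ e a p : hform e p -> hform e (fun v => a * p v).
Proof.
move=> [pp hp]; split=> [|c v]; first by apply: pfM => //; exact: pf_cst.
by rewrite hp mulrCA.
Qed.

Lemma hformX e p k : hform e p -> hform (k * e) (fun v => p v ^+ k).
Proof.
move=> [pp hp]; split=> [|c v]; first exact: pfX.
by rewrite hp exprMn mulnC exprM.
Qed.

Lemma hform_sum (I : Type) (r : seq I) (P : pred I) e (F : I -> V -> C) :
  (forall i, P i -> hform e (F i)) -> hform e (fun v => \sum_(i <- r | P i) F i v).
Proof.
move=> H; split=> [|c v]; first by apply: pf_sum => i /H[].
by rewrite mulr_sumr; apply: eq_bigr => i /H[_ ->].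
Qed.

Lemma hform_coord i : hform 1 (fun v : V => v 0 i).
Proof. by split=> [|c v]; [exact: pf_coord|rewrite mxE]. Qed.

Lemma hform_dhomog e (q : dhomog n C e) : hform e (fun v => meval (v 0) (mpoly_of_dhomog q)).
Proof. by split=> [|c v]; [exists (mpoly_of_dhomog q)|exact: meval_dhomogZ]. Qed.

Lemma form_decomp q : polyfun q -> exists N (p : forall e, dhomog n C e),
  forall v, q v = \sum_(e < N) meval (v 0) (mpoly_of_dhomog (p e)).
Proof.
move=> [f Hf]; exists (msize f).
exists (fun e => DHomog (pihomogP mdeg e f)) => v.
by rewrite Hf {1}(pihomog_partitionE (leqnn (msize f))) raddf_sum.
Qed.

Lemma poly_zero (p : {poly C}) : (forall c, c != 0 -> p.[c] = 0) -> p = 0.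
Proof.
move=> H; apply: contrapT => /eqP p0; have [t [t0 _ /eqP]] := nonroot_near 0 p0 ltr01.
by apply; apply: H; rewrite -nc_gt0 -[t]subr0.
Qed.

(** Along the rays of a cone the homogeneous components of [q] are the coefficients of a polynomial
    in the scaling factor, so each of them vanishes on the cone. *)
Lemma form_sep (T : V -> Prop) q : polyfun q -> (forall v c, T v -> c != 0 -> T (c *: v)) ->
  (forall v, T v -> q v = 0) -> forall w, q w != 0 ->
  exists e, exists2 p, hform e p & (forall v, T v -> p v = 0) /\ p w != 0.
Proof.
move=> pq Tc Tq w qw; have [N [p Hp]] := form_decomp pq.
pose h e (v : V) := meval (v 0) (mpoly_of_dhomog (p e)).
have Th v e : (e < N)%N -> T v -> h e v = 0.
  move=> eN Tv; pose P : {poly C} := \poly_(e < N) h e v.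
  suff P0 : P = 0 by have := coef_poly N (fun e => h e v) e; rewrite -/P P0 coef0 eN.
  apply: poly_zero => c c0; rewrite horner_poly -[RHS](Tq _ (Tc _ _ Tv c0)) Hp.
  by apply: eq_bigr => i _; rewrite [RHS](hform_dhomog (p i)).2 mulrC.
have [e he] : exists e : 'I_N, h e w != 0.
  apply/existsP; apply: contraNT qw => /existsPn H; rewrite Hp big1// => e _.
  by apply/eqP; rewrite -[_ == _]negbK H.
by exists e, (h e); [exact: hform_dhomog|split=> // v; exact: Th].
Qed.

Lemma hform_to_dhomog e q : hform e q -> exists p : dhomog n C e,
  forall v, q v = meval (v 0) (mpoly_of_dhomog p).
Proof.
move=> [pq hq]; have [N [p Hp]] := form_decomp pq.
pose h e (v : V) := meval (v 0) (mpoly_of_dhomog (p e)).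
have H v i : (if (i < N)%N then h i v else 0) = if i == e then q v else 0.
  pose P : {poly C} := \poly_(i < N) h i v - (q v)%:P * 'X^e.
  have P0 : P = 0.
    apply: poly_zero => c c0; rewrite /P !hornerE horner_poly mulrC -hq Hp.
    apply/eqP; rewrite subr_eq0; apply/eqP; apply: eq_bigr => j _.
    by rewrite [RHS](hform_dhomog (p j)).2 mulrC.
  have := coefB (\poly_(i < N) h i v) ((q v)%:P * 'X^e) i.
  rewrite -/P P0 coef0 coef_poly coefCM coefXn => /esym/eqP; rewrite subr_eq0 => /eqP ->.
  by case: (i == e); rewrite ?mulr1 ?mulr0.
have [eN|Ne] := ltnP e N.
  by exists (p e) => v; have := H v e; rewrite eqxx eN => <-.
exists 0 => v; have := H v e; rewrite eqxx ltnNge Ne /= => <-.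
by rewrite [RHS]meval0.
Qed.
End Forms.

(** * Traces on a cone of lines *)

Section ConeCoefficients.
Variable R : realType.
Local Notation C := R[i].

Lemma nc_sum_le (T : eqType) (s : seq T) (F : T -> C) (c : R) : (forall z, z \in s -> nc (F z) <= c) ->
  nc (\sum_(z <- s) F z) <= (size s)%:R * c.
Proof.
elim: s => [|z s IH] H; first by rewrite big_nil nc0 mul0r.
rewrite big_cons /= -natr1 mulrDl mul1r addrC; apply: le_trans (ncD _ _) _; apply: lerD.
  by apply: IH => w ws; apply: H; rewrite inE ws orbT.
by apply: H; rewrite inE eqxx.
Qed.
Variable n : nat.
Local Notation V := 'rV[C]_n.

(** The coefficient of [t^l] in [B (y + t *: (v + a *: u))] is a polynomial in [a] whose coefficient
    of [a^l] is the wanted [p_l]. Two Cauchy estimates, in [t] and then in [a], carry bounds known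
    on the lines of the cone over to the direction [u], where nothing is assumed about zeros of
    [P]. *)
Lemma cone_coef (B : V -> C) (A : C -> C -> C) (p : {poly C}) (y v u : V) (L : nat) (r eta K : R) :
  0 < r -> 0 < eta -> 0 <= K -> polyfun B -> (forall s, B (y + s *: u) = p.[s]) ->
  (forall a t, nc a <= eta -> 0 < nc t <= r -> nice (A a) t /\ nc (A a t) <= K) ->
  (forall a, nc a <= eta -> exists c d : R, 0 < d /\ forall t, 0 < nc t < d ->
     nc (A a t - B (y + t *: (v + a *: u))) <= c * nc t ^+ L.+1) ->
  forall l, (l <= L)%N -> nc p`_l <= K * (2 / r) ^+ l * (2 / eta) ^+ l.
Proof.
move=> r0 e0 K0 pB Bp HA HB l lL; have [Q HQ] := pf_plane y v u pB.
pose m := (size Q).+1; have mQ : (size Q <= m)%N by rewrite leqnSn.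
pose W (a : C) : {poly C} := \sum_(i < m) 'X^i * \poly_(j < size Q`_i) (Q`_i`_j * a ^+ j).
have WE a t : B (y + t *: (v + a *: u)) = (W a).[t].
  rewrite scalerDr addrA scalerA HQ (horner_coef_wide _ mQ) /W !horner_sum.
  apply: eq_bigr => i _; rewrite -rmorphXn /= !hornerM hornerC hornerXn mulrC; congr (_ * _).
  rewrite horner_poly horner_coef; apply: eq_bigr => j _; rewrite exprMn mulrCA mulrA -mulrA mulrC.
  by rewrite mulrC mulrCA mulrA mulrC mulrA mulrC.
pose q l : {poly C} := \sum_(i < m) (if (i <= l)%N then Q`_i`_(l - i) *: 'X^(l - i) else 0).
have qE l' a : (W a)`_l' = (q l').[a].
  rewrite /W coef_sum /q horner_sum; apply: eq_bigr => i _; rewrite coefXnM ltnNge.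
  case: leqP => il /=; last by rewrite horner0.
  rewrite coef_poly hornerZ hornerXn; case: ltnP => // h.
  by rewrite nth_default ?mul0r.
have pQ : p = Q`_0.
  apply/eqP; rewrite -subr_eq0; apply/eqP; apply: poly_zero => s _.
  have := HQ 0 s; rewrite scale0r addr0 polyC0 horner_coef0 Bp => h.
  by rewrite hornerD hornerN h subrr.
have ql : (q l)`_l = p`_l.
  rewrite pQ /q coef_sum (bigD1 ord0)//= subn0 coefZ coefXn eqxx mulr1 big1 ?addr0// => i i0.
  case: leqP => il; last by rewrite coef0.
  rewrite coefZ coefXn; suff /negPf-> : (l != l - i)%N by rewrite mulr0.
  by apply: contraNneq i0 => h; apply/eqP/val_inj => /=; rewrite -(subKn il) -h subnn.
rewrite -ql; apply: (@cauchy_coef _ (fun a => (q l).[a]) (q l) l eta) => //.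
- move=> a /andP[_ ae]; split; first exact: nice_poly.
  rewrite -qE; apply: (@cauchy_coef _ (A a) (W a) L r) => //.
    by move=> t tr; exact: HA.
  by have [c [d [d0 Hd]]] := HB a ae; exists c, d; split=> // t td; rewrite -WE; exact: Hd.
- by exists 0, 1; split=> // t _; rewrite subrr nc0 mul0r.
Qed.
End ConeCoefficients.

(** * Sums over labelled points as approximations of a trace *)

Section LabelledCone.
Variable R : realType.
Local Notation C := R[i].
Variable n : nat.
Local Notation V := 'rV[C]_n.
Variables (G : V -> V) (M : V -> V -> 'M[C]_n) (P : V -> C) (cp : R).
Hypotheses (cov : cover_map G M P cp) (hP : exists y, P y != 0) (hM : exists z, \det (M z z) != 0).
Variables (y : V) (X : seq V).
Hypothesis XP : forall z, z \in X <-> G z = y.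
Variable N : nat.
Hypotheses (hN : forall w, G w = y -> exists c d : R, [/\ 0 <= c, 0 < d &
  forall z, nm (z - w) < d -> nm (z - w) ^+ N <= c * nm (G z - G w)]).

Lemma loja_fiber : exists2 d : R, 0 < d & forall x, x \in X -> forall z, nm (z - x) < d ->
  d * nm (z - x) ^+ N <= nm (G z - y).
Proof.
apply: seq_radius => [x d d' dd H z zd|x /XP Gx].
  apply: le_trans (H z (lt_le_trans zd dd)); by rewrite ler_wpM2r// exprn_ge0// nm_ge0.
have [c [d [c0 d0 Hd]]] := hN Gx; have c1 : 0 < c + 1 by lra.
exists (Num.min d (c + 1)^-1); first by rewrite lt_min d0 invr_gt0.
move=> z; rewrite lt_min => /andP[zd _]; have := Hd z zd; rewrite Gx => h.
apply: (@le_trans _ _ ((c + 1)^-1 * nm (z - x) ^+ N)).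
  by rewrite ler_wpM2r ?exprn_ge0 ?nm_ge0// ge_min lexx orbT.
by rewrite mulrC ler_pdivrMr// mulrC; apply: le_trans h _; have := nm_ge0 (G z - y); nra.
Qed.

Definition labelling (v : V) (r : R) (lab : C -> V -> V) :=
  [/\ forall t z, 0 < nc t <= r -> G z = y + t *: v -> lab t z \in X,
      forall t0, 0 < nc t0 <= r -> exists (g : V -> C -> V) (d : R), 0 < d /\
        [/\ forall z t, z \in fib G (y + t0 *: v) -> nc (t - t0) < d -> nc t <= r -> lab t (g z t) = lab t0 z,
            forall z, z \in fib G (y + t0 *: v) -> forall j, nice (fun t => g z t 0 j) t0 &
            forall t, nc (t - t0) < d -> perm_eq (fib G (y + t *: v)) [seq g z t | z <- fib G (y + t0 *: v)]],
      forall sg : R, 0 < sg -> exists2 rho : R, 0 < rho & forall t z, 0 < nc t <= r -> nc t <= rho ->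
        G z = y + t *: v -> nm (z - lab t z) < sg &
      forall t x, 0 < nc t <= r -> x \in X -> exists2 z, G z = y + t *: v & lab t z = x].

Section OneLine.
Variables (v : V) (r : R) (lab : C -> V -> V).
Hypotheses (r0 : 0 < r) (reg : forall t, 0 < nc t <= 2 * r -> P (y + t *: v) != 0) (Hlab : labelling v r lab).

Lemma lab_loja : exists c d : R, [/\ 0 <= c, 0 < d & forall t z, 0 < nc t <= r -> nc t < d ->
  G z = y + t *: v -> nm (z - lab t z) ^+ N <= c * nc t].
Proof.
have [d d0 Hd] := loja_fiber; have [L1 _ L3 _] := Hlab; have [rho rho0 Hrho] := L3 _ d0.
exists (nm v / d), rho; split=> //; first by rewrite divr_ge0 ?nm_ge0 ?ltW.
move=> t z tr trho Gz; have := Hd _ (L1 t z tr Gz) z (Hrho t z tr (ltW trho) Gz).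
have -> : G z - y = t *: v by rewrite Gz addrC addKr.
by rewrite nmZ mulrAC ler_pdivlMr// mulrC [nm v * _]mulrC.
Qed.

Variable Rb : R.
Hypothesis hRb : forall t z, nc t <= r -> G z = y + t *: v -> nm z <= Rb.

(** Schwarz lemma for a multivalued function: the branches of [((z - lab t z) 0 j) ^+ N / t] are
    bounded near 0 by [lab_loja], with an uncontrolled constant that the maximum principle discards.
    What remains is the bound on the circle of radius [r], which involves [Rb], [N] and [r]
    alone. *)
Lemma lab_bound t z j : 0 < nc t <= r -> G z = y + t *: v ->
  nc ((z - lab t z) 0 j) ^+ N <= (2 * Rb) ^+ N / r * nc t.
Proof.
move=> tr Gz; have [L1 L2 _ _] := Hlab; have [c [d [c0 d0 Hd]]] := lab_loja.
have XRb x : x \in X -> nm x <= Rb by move/XP => Gx; apply: (@hRb 0); rewrite ?nc0 ?(ltW r0)// scale0r addr0.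
have diff t' z' : 0 < nc t' <= r -> G z' = y + t' *: v -> nc ((z' - lab t' z') 0 j) ^+ N <= (2 * Rb) ^+ N.
  move=> t'r Gz'; apply: lerXn2r; rewrite ?nnegrE ?nc_ge0//.
    by have := XRb _ (L1 _ _ t'r Gz'); have := nm_ge0 (lab t' z'); lra.
  apply: le_trans (nm_coord _ _ _) _; have := XRb _ (L1 _ _ t'r Gz').
  have := nmB z' (lab t' z'); case/andP: t'r => _ t'r; have := hRb t'r Gz'; lra.
have K0 : 0 <= (2 * Rb) ^+ N by apply: le_trans (diff t z tr Gz); rewrite exprn_ge0// nc_ge0.
have RP t' : 0 < nc t' <= r -> P (y + t' *: v) != 0.
  by move=> /andP[h1 h2]; apply: reg; rewrite h1; lra.
case/andP: (tr) => t0 tr'.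
suff : nc (((z - lab t z) 0 j) ^+ N / t) <= (2 * Rb) ^+ N / r.
  by rewrite ncM ncV ncX ler_pdivrMr.
pose s t := [seq ((z - lab t z) 0 j) ^+ N / t | z <- fib G (y + t *: v)].
apply: (@mmp _ (fun t => nc t <= r) (fun t => nc t = r) s 'X _ (c + (2 * Rb) ^+ N / d)
  (size (fib G (y + t *: v)))) (tr') _ _ _ => //.
- apply: ccptP; first by exists r.
  by move=> t' H; apply/ler_addgt0Pr => e /H[t'' h1 h2]; have := ncB_ge t' t''; rewrite ncBC; lra.
- move=> t' t'r /eqP n1; have h1 : nc t' < r by rewrite lt_neqAle n1.
  exists (r - nc t'); first by rewrite subr_gt0.
  by move=> h hr; have := ncD t' h; lra.
- move=> t' t'r; rewrite hornerX -nc_gt0 => t'0; have t'r' : 0 < nc t' <= r by rewrite t'0.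
  have [g [dd [dd0 [H1 H2 H3]]]] := L2 t' t'r'; pose s0 := fib G (y + t' *: v).
  exists (size s0), (fun i h => ((g (tnth (in_tuple s0) i) (t' + h) - lab t' (tnth (in_tuple s0) i)) 0 j) ^+ N / (t' + h)).
  split=> [i|].
    suff : nice (fun t => ((g (tnth (in_tuple s0) i) t - lab t' (tnth (in_tuple s0) i)) 0 j) ^+ N / t) t' by [].
    apply: niceM; last by apply: nice_inv (nice_id _) _; rewrite -nc_gt0.
    apply: niceX; have zi : tnth (in_tuple s0) i \in s0 by exact: (mem_tnth i (in_tuple s0)).
    apply: nice_ext (niceD (H2 _ zi j) (nice_cst (- lab t' (tnth (in_tuple s0) i) 0 j) t')) _.
    by exists 1 => // t'' _; rewrite !mxE.
  exists (Num.min dd (nc t')) => [|h]; first by rewrite lt_min dd0.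
  rewrite lt_min => /andP[h1 h2] hr; have h1' : nc (t' + h - t') < dd by rewrite addrC addKr.
  rewrite /s; apply: perm_trans (perm_map _ (H3 _ h1')) _; rewrite -map_comp.
  pose psi z := ((g z (t' + h) - lab t' z) 0 j) ^+ N / (t' + h).
  have -> : [seq psi (tnth (in_tuple s0) i) | i <- enum 'I_(size s0)] = map psi s0.
    by rewrite -[RHS]/(map psi (in_tuple s0)) -[in RHS](map_tnth_enum (in_tuple s0)) -map_comp.
  rewrite -/s0; have /eq_in_map -> : {in s0, (fun z => (z - lab (t' + h) z) 0 j ^+ N / (t' + h)) \o g^~ (t' + h) =1 psi}.
    by move=> z' z's /=; rewrite H1.
  exact: perm_refl.
- move=> t' t'r; rewrite hornerX -nc_gt0 => t'0; have t'r' : 0 < nc t' <= r by rewrite t'0.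
  split; first by rewrite size_map (size_fib cov (RP _ t'r') (RP _ tr)).
  move=> _ /mapP[z' /(fibP cov (RP _ t'r')).2 Gz' ->]; rewrite ncM ncV ler_pdivrMr// mulrDl.
  have [t'd|t'd] := ltP (nc t') d.
    apply: (@le_trans _ _ (c * nc t')); last by rewrite lerDl mulr_ge0 ?divr_ge0// ltW.
    apply: le_trans (Hd t' z' t'r' t'd Gz'); rewrite ncX.
    by apply: lerXn2r; rewrite ?nnegrE ?nc_ge0 ?nm_ge0// nm_coord.
  rewrite ncX; apply: le_trans (diff _ _ t'r' Gz') _; apply: (@le_trans _ _ ((2 * Rb) ^+ N / d * nc t')).
    by rewrite mulrAC ler_pdivlMr// ler_wpM2l.
  by rewrite lerDr mulr_ge0// ltW.
- move=> t' t'r tb; rewrite hornerX -nc_gt0 => t'0; have t'r' : 0 < nc t' <= r by rewrite t'0.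
  move=> _ /mapP[z' /(fibP cov (RP _ t'r')).2 Gz' ->]; rewrite ncM ncV tb ler_pM2r ?invr_gt0// ncX; exact: diff.
- by rewrite divr_ge0// ltW.
- by rewrite hornerX -nc_gt0.
- by apply: (map_f (fun z => ((z - lab t z) 0 j) ^+ N / t)); apply/(fibP cov (RP _ tr)).2.
Qed.
End OneLine.

Lemma sum_label_nice (v : V) (r : R) (lab : C -> V -> V) (phi : V -> C) (a : V -> C) t0 :
  labelling v r lab -> polyfun phi -> 0 < nc t0 < r -> P (y + t0 *: v) != 0 ->
  nice (fun t => \sum_(z <- fib G (y + t *: v)) a (lab t z) * phi z) t0.
Proof.
move=> [_ L2 _ _] pphi /andP[t0p t0r] P0; have t0r' : 0 < nc t0 <= r by rewrite t0p ltW.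
have [g [d [d0 [H1 H2 H3]]]] := L2 t0 t0r'; set s0 := fib G (y + t0 *: v) in H1 H2 H3.
pose F z t := if z \in s0 then a (lab t0 z) * phi (g z t) else 0.
have nF : nice (fun t => \sum_(z <- s0) F z t) t0.
  apply: (@nice_sum _ _ s0 F) => z; case zs: (z \in s0); rewrite /F zs; last exact: nice_cst.
  by apply: niceM; [exact: nice_cst|apply: (nice_pf pphi) => j; exact: H2].
apply: nice_ext nF _; exists (Num.min d (r - nc t0)); first by rewrite lt_min d0 subr_gt0.
move=> t; rewrite lt_min => /andP[td tr]; rewrite (perm_big _ (H3 t td)) big_map big_seq [RHS]big_seq.
apply: eq_bigr => z zs; rewrite /F zs H1//.
by have := nc_tri t0 t 0; rewrite !subr0; lra.
Qed.

Variables (v u : V) (eta r : R).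
Hypotheses (eta0 : 0 < eta) (r0 : 0 < r).
Hypothesis reg : forall a t, nc a <= eta -> 0 < nc t <= 2 * r -> P (y + t *: (v + a *: u)) != 0.
Variable Rb : R.
Hypothesis hRb : forall a t z, nc a <= eta -> nc t <= r -> G z = y + t *: (v + a *: u) -> nm z <= Rb.

Lemma labellings : exists lab : C -> C -> V -> V, forall a, nc a <= eta -> labelling (v + a *: u) r (lab a).
Proof.
suff /choice[lab Hlab] : forall a, exists lab, nc a <= eta -> labelling (v + a *: u) r lab by exists lab.
move=> a; have [ae|] := boolP (nc a <= eta); last by exists (fun _ _ => 0).
have [lab Hlab] := labels cov XP hP hM r0 (fun t => @reg a t ae).
by exists lab.
Qed.

Variable lab : C -> C -> V -> V.
Hypothesis Hlab : forall a, nc a <= eta -> labelling (v + a *: u) r (lab a).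
Variable D : nat.
Hypothesis hD : forall y, P y != 0 -> size (fib G y) = D.

(** If [chi] agrees with [al] to order [N * (L + 1)] at the points of [X], then by [lab_loja]
    replacing [chi z] by the value of [al] at the label changes the trace by [O(t^(L + 1))]. The
    coefficients up to [L] thus obey the bounds of the labelled sum. *)
Lemma approx_coef (phi chi B : V -> C) (al : V -> C) (p : {poly C}) (L : nat) (r1 K : R) :
  0 < r1 < r -> 0 <= K -> polyfun phi -> polyfun chi -> polyfun B ->
  (forall y, P y != 0 -> \sum_(z <- fib G y) phi z * chi z = B y) -> (forall s, B (y + s *: u) = p.[s]) ->
  (forall a t z, nc a <= eta -> 0 < nc t <= r1 -> G z = y + t *: (v + a *: u) -> nc (al (lab a t z) * phi z) <= K) ->
  (forall x, x \in X -> exists c d : R, [/\ 0 <= c, 0 < d & forall z, nm (z - x) < d ->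
     nc (chi z - al x) <= c * nm (z - x) ^+ (N * L.+1)]) ->
  forall l, (l <= L)%N -> nc p`_l <= D%:R * K * (2 / r1) ^+ l * (2 / eta) ^+ l.
Proof.
move=> /andP[r10 r1r] K0 pphi pchi pB TB Bp HK Hchi.
have RP a t : nc a <= eta -> 0 < nc t <= r -> P (y + t *: (v + a *: u)) != 0.
  by move=> ae /andP[h1 h2]; apply: reg => //; rewrite h1; lra.
have inr t : 0 < nc t <= r1 -> 0 < nc t <= r by move=> /andP[-> h]; lra.
apply: (@cone_coef _ _ B (fun a t => \sum_(z <- fib G (y + t *: (v + a *: u))) al (lab a t z) * phi z) p y v) => //.
- by rewrite mulr_ge0 ?ler0n.
- move=> a t ae tr; have Pt := RP a t ae (inr t tr); split.
    by apply: sum_label_nice (Hlab ae) _ _ _ => //; case/andP: tr => -> h; lra.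
  rewrite -(hD Pt); apply: nc_sum_le => z /(fibP cov Pt).2; exact: HK.
move=> a ae; have [c' [d' [c'0 d'0 Hd']]] := lab_loja (Hlab ae).
have [d1 d10 Hd1] : exists2 d : R, 0 < d & forall x, x \in X -> forall z, nm (z - x) < d ->
   d * nc (chi z - al x) <= nm (z - x) ^+ (N * L.+1).
  apply: seq_radius => [x e e' ee H z zd|x xX].
    by apply: le_trans (H z (lt_le_trans zd ee)); rewrite ler_wpM2r ?nc_ge0.
  have [c [e [c0 e0 He]]] := Hchi x xX; have c1 : 0 < c + 1 by lra.
  exists (Num.min e (c + 1)^-1); first by rewrite lt_min e0 invr_gt0.
  move=> z; rewrite lt_min => /andP[ze _]; apply: (@le_trans _ _ ((c + 1)^-1 * nc (chi z - al x))).
    by rewrite ler_wpM2r ?nc_ge0// ge_min lexx orbT.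
  have nn : 0 <= nm (z - x) ^+ (N * L.+1) by rewrite exprn_ge0// nm_ge0.
  by rewrite mulrC ler_pdivrMr// mulrC; apply: le_trans (He z ze) _; rewrite ler_wpM2r//; lra.
have [c1 c10 Hc1] := pf_lip Rb pphi.
have [_ _ L3 _] := Hlab ae; have [rho rho0 Hrho] := L3 _ d10.
exists (D%:R * (c1 * (c' ^+ L.+1 / d1))), (Num.min r (Num.min rho d')); split.
  by rewrite !lt_min r0 rho0.
move=> t /andP[t0]; rewrite !lt_min => /and3P[tr trho td'].
have tr' : 0 < nc t <= r by rewrite t0 ltW.
have Pt := RP a t ae tr'; rewrite -(TB _ Pt) -sumrB -(hD Pt) -!mulrA.
apply: nc_sum_le => z /(fibP cov Pt).2 Gz; set x := lab a t z.
have xX : x \in X by have [L1 _ _ _] := Hlab ae; exact: L1.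
have -> : al x * phi z - phi z * chi z = - (phi z * (chi z - al x)) by ring.
rewrite ncN ncM; have zb : nm z <= Rb by apply: (hRb ae (ltW tr) Gz).
apply: ler_pM; rewrite ?nc_ge0//; first by have [] := Hc1 z z zb zb.
have zx := Hrho t z tr' (ltW trho) Gz; have := Hd1 x xX z zx.
rewrite mulrC -ler_pdivlMr// => h; apply: le_trans h _; rewrite -/x in zx *.
rewrite mulrC [X in _ <= X]mulrCA ler_pM2l ?invr_gt0// -exprMn.
rewrite exprM; apply: lerXn2r; rewrite ?nnegrE ?exprn_ge0 ?nm_ge0//; last exact: Hd'.
by rewrite mulr_ge0 ?nc_ge0.
Qed.
End LabelledCone.

(** * Polynomial indicators of the points of a finite set *)

Section Jets.
Variable R : realType.
Local Notation C := R[i].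
Variable n : nat.
Local Notation V := 'rV[C]_n.

Definition flat (p : nat) (x : V) (g : V -> C) := exists c d : R, [/\ 0 <= c, 0 < d & forall z, nm (z - x) < d ->
  nc (g z) <= c * nm (z - x) ^+ p].

Lemma flat_ext p x g h : flat p x g -> (forall z, h z = g z) -> flat p x h.
Proof. by move=> [c [d [c0 d0 H]]] e; exists c, d; split=> // z; rewrite e; exact: H. Qed.

Lemma flat_sum (T : Type) p x (s : seq T) (g : T -> V -> C) : (forall i, flat p x (g i)) ->
  flat p x (fun z => \sum_(i <- s) g i z).
Proof.
move=> H; elim: s => [|i s [c [d [c0 d0 Hc]]]].
  by exists 0, 1; split=> // z _; rewrite big_nil nc0 mul0r.
have [c' [d' [c'0 d'0 Hc']]] := H i; exists (c' + c), (Num.min d' d); split.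
- by rewrite addr_ge0.
- by rewrite lt_min d'0.
move=> z; rewrite lt_min big_cons mulrDl => /andP[/Hc' h1 /Hc h2].
by apply: le_trans (ncD _ _) _; exact: lerD.
Qed.

Lemma flatM p x g h : flat p x g -> polyfun h -> flat p x (fun z => g z * h z).
Proof.
move=> [c [d [c0 d0 H]]] ph; have [K K0 HK] := pf_lip (nm x + 1) ph.
exists (c * K), (Num.min d 1); split; [by rewrite mulr_ge0|by rewrite lt_min d0 ltr01|].
move=> z; rewrite lt_min => /andP[/H h1 z1]; rewrite ncM mulrAC; apply: ler_pM; rewrite ?nc_ge0//.
have zb : nm z <= nm x + 1 by have := nmB_ge z x; lra.
by have [] := HK z z zb zb.
Qed.

Lemma flatX p x g : polyfun g -> g x = 0 -> flat p x (fun z => g z ^+ p).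
Proof.
move=> pg g0; have [K K0 HK] := pf_lip (nm x + 1) pg.
exists (K ^+ p), 1; split=> //; first by rewrite exprn_ge0.
move=> z z1; rewrite ncX -exprMn; apply: lerXn2r; rewrite ?nnegrE ?nc_ge0 ?mulr_ge0 ?nm_ge0//.
have zb : nm z <= nm x + 1 by have := nmB_ge z x; lra.
have xb : nm x <= nm x + 1 by lra.
by have [] := HK z x zb xb; rewrite g0 subr0.
Qed.

(** Let [th] be 1 at [x'] and 0 at the other points. Then [th ^+ p] is flat at the latter, and
    [1 - (1 - th ^+ p) ^+ p] is in addition equal to 1 to order [p] at [x']. *)
Lemma jet_exists (p : nat) (X : seq V) x' : x' \in X -> exists2 psi : V -> C, polyfun psi &
  forall x, x \in X -> flat p x (fun z => psi z - (x == x')%:R).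
Proof.
move=> x'X; have [|l Hl] := @generic_linear _ _ [seq x - x' | x <- X & x != x'].
  by move=> _ /mapP[x + ->]; rewrite mem_filter subr_eq0 => /andP[].
pose q (x z : V) := \sum_i (z - x) 0 i * l 0 i.
have pq x : polyfun (q x).
  apply: pf_sum => i _; apply: pfM; last exact: pf_cst.
  by apply: (@pf_ext _ _ (fun z => z 0 i - x 0 i)) => [|z]; [apply: pfB; [exact: pf_coord|exact: pf_cst]|rewrite !mxE].
have qx x : q x x = 0 by rewrite /q big1// => i _; rewrite subrr mxE mul0r.
have ql x : x \in X -> x != x' -> q x x' != 0.
  move=> xX xx; have -> : q x x' = - \sum_i (x - x') 0 i * l 0 i.
    by rewrite -sumrN; apply: eq_bigr => i _; rewrite !mxE; ring.
  by rewrite oppr_eq0; apply: Hl; apply: map_f; rewrite mem_filter xx.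
clearbody q; pose th z := \prod_(x <- X | x != x') (q x z / q x x').
have pth : polyfun th by apply: pf_prod => x _; apply: pfM => //; exact: pf_cst.
have th1 : th x' = 1.
  rewrite /th big_seq_cond big1// => x /andP[xX xx]; rewrite divff//; exact: ql.
have th0 x : x \in X -> x != x' -> th x = 0.
  by move=> xX xx; rewrite /th (big_rem x)//= xx qx !mul0r.
clearbody th; exists (fun z => 1 - (1 - th z ^+ p) ^+ p).
  by apply: pfB; [exact: pf_cst|apply: pfX; apply: pfB; [exact: pf_cst|exact: pfX]].
move=> x xX; have [->|xx] := eqVneq x x'.
  have [||c [d [c0 d0 H]]] := @flatX p x' (fun z => 1 - th z ^+ p) _ _.
  - by apply: pfB; [exact: pf_cst|exact: pfX].
  - by rewrite th1 expr1n subrr.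
  exists c, d; split=> // z /H; rewrite (_ : 1 - (1 - th z ^+ p) ^+ p - 1%:R = - (1 - th z ^+ p) ^+ p) ?ncN//.
  by rewrite addrAC subrr add0r.
have h : flat p x (fun z => th z ^+ p * \sum_(i < p) (1 - th z ^+ p) ^+ i).
  apply: flatM; first by apply: flatX => //; exact: th0.
  by apply: pf_sum => i _; apply: pfX; apply: pfB; [exact: pf_cst|exact: pfX].
apply: flat_ext h _ => z; rewrite subr0.
have := subrX1 (1 - th z ^+ p) p; rewrite -opprB => e; rewrite -[LHS]opprK opprB.
by apply: oppr_inj; rewrite opprB e -mulNr; congr (_ * _); ring.
Qed.
End Jets.

(** * The part of a trace carried by one label *)

Section ConeNear.
Variable R : realType.
Local Notation C := R[i].
Variable n : nat.
Local Notation V := 'rV[C]_n.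
Variables (G : V -> V) (M : V -> V -> 'M[C]_n) (P : V -> C) (cp : R).
Hypotheses (cov : cover_map G M P cp) (hP : exists y, P y != 0) (hM : exists z, \det (M z z) != 0).
Variables (y : V) (X : seq V).
Hypotheses (uX : uniq X) (XP : forall z, z \in X <-> G z = y).
Variable N : nat.
Hypotheses (N0 : (0 < N)%N) (hN : forall w, G w = y -> exists c d : R, [/\ 0 <= c, 0 < d &
  forall z, nm (z - w) < d -> nm (z - w) ^+ N <= c * nm (G z - G w)]).
Variables (v u : V) (eta r : R).
Hypotheses (eta0 : 0 < eta) (r0 : 0 < r).
Hypothesis reg : forall a t, nc a <= eta -> 0 < nc t <= 2 * r -> P (y + t *: (v + a *: u)) != 0.
Variable Rb : R.
Hypothesis hRb : forall a t z, nc a <= eta -> nc t <= r -> G z = y + t *: (v + a *: u) -> nm z <= Rb.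
Variable lab : C -> C -> V -> V.
Hypothesis Hlab : forall a, nc a <= eta -> labelling G y X (v + a *: u) r (lab a).
Variable D : nat.
Hypothesis hD : forall y, P y != 0 -> size (fib G y) = D.
Variables (eps1 r1 : R) (s0 : C) (x : V).
Hypotheses (eps10 : 0 < eps1) (r1r : 0 < r1 < r) (hr1 : (2 * Rb) ^+ N * r1 <= r * eps1 ^+ N)
  (hs0 : nc s0 <= r1 * eta / 8) (Ps0 : P (y + s0 *: u) != 0) (Gx : G x = y + s0 *: u).

Let pG : pmap G. Proof. by case: cov. Qed.
Let GM : bez G M. Proof. by case: cov. Qed.

Lemma trace_poly : exists T : (V -> C) -> {poly C}, forall phi, polyfun phi -> exists B, [/\ polyfun B,
  forall y, P y != 0 -> \sum_(z <- fib G y) phi z = B y & forall s, B (y + s *: u) = (T phi).[s]].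
Proof.
suff /choice[T HT] : forall phi, exists q : {poly C}, polyfun phi -> exists B, [/\ polyfun B,
  forall y, P y != 0 -> \sum_(z <- fib G y) phi z = B y & forall s, B (y + s *: u) = q.[s]] by exists T.
move=> phi; have [pphi|] := pselect (polyfun phi); last by exists 0.
have [B pB HB] := sym_polyfun cov (symfun_sum pphi) hP.
by have [q Hq] := pf_line y u pB; exists q => _; exists B.
Qed.

Variable T : (V -> C) -> {poly C}.
Hypothesis HT : forall phi, polyfun phi -> exists B, [/\ polyfun B,
  forall y, P y != 0 -> \sum_(z <- fib G y) phi z = B y & forall s, B (y + s *: u) = (T phi).[s]].

Lemma traceE phi s : polyfun phi -> P (y + s *: u) != 0 -> (T phi).[s] = \sum_(z <- fib G (y + s *: u)) phi z.
Proof. by move=> /HT[B [pB H1 H2]] Ps; rewrite H1// H2. Qed.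

Lemma trace_uniq phi (q : {poly C}) : polyfun phi ->
  (forall s, P (y + s *: u) != 0 -> \sum_(z <- fib G (y + s *: u)) phi z = q.[s]) -> T phi = q.
Proof.
move=> pphi H; have [_ _ _ pP _] := cov; have [w Hw] := pf_line y u pP.
have w0 : w != 0 by apply: contraNneq Ps0 => e; rewrite Hw e horner0.
apply/eqP; rewrite -subr_eq0 -(mulIr_eq0 _ (mulIf w0)); apply/eqP; apply: poly_zero => s _.
rewrite hornerM; have [ws|ws] := eqVneq w.[s] 0; first by rewrite ws mulr0.
by rewrite hornerD hornerN (traceE pphi) ?Hw// H ?Hw// subrr mul0r.
Qed.

Lemma trace_ext phi psi : polyfun phi -> (forall z, psi z = phi z) -> T psi = T phi.
Proof.
move=> pphi e; apply: trace_uniq; first exact: pf_ext pphi e.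
by move=> s Ps; rewrite (traceE pphi Ps); apply: eq_bigr => z _; exact: e.
Qed.

Lemma trace_sum (I : Type) (s : seq I) (g : I -> V -> C) : (forall i, polyfun (g i)) ->
  T (fun z => \sum_(i <- s) g i z) = \sum_(i <- s) T (g i).
Proof.
move=> pg; apply: trace_uniq; first by apply: pf_sum.
move=> t Pt; rewrite exchange_big horner_sum; apply: eq_bigr => i _.
by rewrite traceE.
Qed.

(** The Taylor polynomial of the trace at [y], truncated at order [L] and evaluated at [s0].
    Truncation matters because the indicators of the labels are correct to finite order only. *)
Definition Lam (L : nat) phi := \sum_(l < L.+1) s0 ^+ l * (T phi)`_l.

Lemma Lam_sum (I : Type) L (s : seq I) (g : I -> V -> C) : (forall i, polyfun (g i)) ->
  Lam L (fun z => \sum_(i <- s) g i z) = \sum_(i <- s) Lam L (g i).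
Proof.
move=> pg; rewrite /Lam trace_sum// exchange_big; apply: eq_bigr => l _.
by rewrite coef_sum mulr_sumr.
Qed.

Lemma Lam_full L phi : (size (T phi) <= L)%N -> Lam L phi = (T phi).[s0].
Proof. by move=> sL; rewrite (horner_coef_wide _ (leqW sL)); apply: eq_bigr => l _; rewrite mulrC. Qed.

Lemma coef_small phi psi al (L : nat) (K : R) : 0 <= K -> polyfun phi -> polyfun psi ->
  (forall a t z, nc a <= eta -> 0 < nc t <= r1 -> G z = y + t *: (v + a *: u) -> nc (al (lab a t z) * phi z) <= K) ->
  (forall x, x \in X -> flat (N * L.+1) x (fun z => psi z - al x)) ->
  forall l, (l <= L)%N -> nc (s0 ^+ l * (T (fun z => phi z * psi z))`_l) <= D%:R * K * (1 / 2) ^+ l.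
Proof.
move=> K0 pphi ppsi HK Hf l lL; have [B [pB HB Bs]] := HT (pfM pphi ppsi).
have := approx_coef cov XP hN eta0 r0 reg hRb Hlab hD r1r K0 pphi ppsi pB HB Bs HK Hf lL.
have r10 : 0 < r1 by case/andP: r1r.
have DK : 0 <= D%:R * K by rewrite mulr_ge0 ?ler0n.
rewrite ncM ncX -mulrA -exprMn => h; apply: le_trans (ler_wpM2l (exprn_ge0 _ (nc_ge0 _)) h) _.
rewrite mulrCA -exprMn ler_wpM2l//; apply: lerXn2r; rewrite ?nnegrE ?divr_ge0 ?ler01//.
  by rewrite !mulr_ge0 ?nc_ge0// invr_ge0 ltW.
have re : 0 < r1 * eta by rewrite mulr_gt0.
(* The two Cauchy estimates cost [(2 / r1) * (2 / eta)] per degree; the 8 in [hs0] leaves a ratio of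
   at most 1/2. *)
have -> : nc s0 * (2 / r1 * (2 / eta)) = nc s0 * 4 / (r1 * eta).
  by field; rewrite ?(lt0r_neq0 r10) ?(lt0r_neq0 eta0).
rewrite ler_pdivrMr//; move: hs0; set w := r1 * eta; lra.
Qed.

Lemma geom_half (L : nat) : \sum_(l < L) (1 / 2 : R) ^+ l <= 2.
Proof.
suff : \sum_(l < L) (1 / 2 : R) ^+ l = 2 - 2 * (1 / 2) ^+ L.
  by move=> ->; rewrite lerBlDr lerDl mulr_ge0// exprn_ge0// divr_ge0.
elim: L => [|L IH]; first by rewrite big_ord0 expr0; lra.
rewrite big_ord_recr /= IH exprS; lra.
Qed.

Lemma Lam_bound phi psi al (L : nat) (K : R) : 0 <= K -> polyfun phi -> polyfun psi ->
  (forall a t z, nc a <= eta -> 0 < nc t <= r1 -> G z = y + t *: (v + a *: u) -> nc (al (lab a t z) * phi z) <= K) ->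
  (forall x, x \in X -> flat (N * L.+1) x (fun z => psi z - al x)) ->
  nc (Lam L (fun z => phi z * psi z)) <= 2 * D%:R * K.
Proof.
move=> K0 pphi ppsi HK Hf; apply: le_trans (nc_sum _ _ _) _.
apply: (@le_trans _ _ (\sum_(l < L.+1) D%:R * K * (1 / 2) ^+ l)).
  by apply: ler_sum => l _; apply: (coef_small K0 pphi ppsi HK Hf); rewrite -ltnS.
by rewrite -mulr_sumr mulrC -mulrA ler_wpM2r ?mulr_ge0 ?ler0n ?geom_half.
Qed.

(** The sum of the indicators minus 1 is flat at every point of [X], so [coef_small] applies to it
    with [al = 0] and [K = 0]: its coefficients up to [L] vanish. *)
Lemma Lam_partition L phi psi : polyfun phi -> (forall x', polyfun (psi x')) ->
  (forall x', x' \in X -> forall x, x \in X -> flat (N * L.+1) x (fun z => psi x' z - (x == x')%:R)) ->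
  \sum_(x' <- X) Lam L (fun z => phi z * psi x' z) = Lam L phi.
Proof.
move=> pphi ppsi Hf; pose chi z := \sum_(x' <- X) psi x' z - 1.
have pchi : polyfun chi by apply: pfB; [exact: pf_sum|exact: pf_cst].
have fchi w : w \in X -> flat (N * L.+1) w (fun z => chi z - 0).
  move=> wX; pose g x' z := if x' \in X then psi x' z - (w == x')%:R else 0.
  have fg x' : flat (N * L.+1) w (g x').
    rewrite /g; case: (boolP (x' \in X)) => [x'X|_]; first exact: Hf.
    by exists 0, 1; split=> // z _; rewrite nc0 mul0r.
  apply: flat_ext (flat_sum X fg) _ => z; rewrite /chi subr0.
  have -> : \sum_(i <- X) g i z = \sum_(i <- X) (psi i z - (w == i)%:R).
    by rewrite big_seq [RHS]big_seq; apply: eq_bigr => x' x'X; rewrite /g x'X.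
  rewrite sumrB; congr (_ - _); rewrite (bigD1_seq w)//= eqxx big1 ?addr0// => i iw.
  by rewrite eq_sym (negPf iw).
have z0 l : (l <= L)%N -> nc (s0 ^+ l * (T (fun z => phi z * chi z))`_l) <= D%:R * 0 * (1 / 2) ^+ l.
  by apply: (@coef_small phi chi (fun=> 0)) => // a t z _ _ _; rewrite mul0r nc0.
have : Lam L (fun z => phi z * chi z) = 0.
  rewrite /Lam big1// => l _; apply/eqP; rewrite -nc_eq0 eq_le nc_ge0 andbT.
  by have := z0 l; rewrite -ltnS ltn_ord mulr0 mul0r => /(_ isT).
pose g (i : option V) z := if i is Some x' then phi z * psi x' z else - phi z.
have pg i : polyfun (g i) by case: i => [x'|]; [exact: pfM|exact: pfN].
have -> : Lam L (fun z => phi z * chi z) = Lam L (fun z => \sum_(i <- None :: map Some X) g i z).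
  rewrite /Lam (@trace_ext (fun z => \sum_(i <- None :: map Some X) g i z))//; first exact: pf_sum.
  by move=> z; rewrite big_cons big_map /= /chi mulrBr mulr1 mulr_sumr addrC.
rewrite Lam_sum// big_cons big_map /= => /eqP; rewrite addrC addr_eq0 => /eqP->.
rewrite -[Lam L phi]opprK; congr (- _); rewrite /Lam.
have -> : T (g None) = - T phi; last first.
  by rewrite -sumrN; apply: eq_bigr => l _; rewrite coefN mulrN.
apply: trace_uniq; first exact: pfN.
by move=> s Ps; rewrite hornerN (traceE pphi Ps) sumrN.
Qed.

(** On the fibre over [y + s *: u] the factor [G z - G x] equals [(s - s0) *: u], so the trace is
    multiplied by [u 0 a *: ('X - s0%:P)]. Evaluated at [s0], the truncated series telescopes to its
    top coefficient, which carries the factor [(1 / 2) ^+ L]. *)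
Lemma Lam_telescope L h psi (a : 'I_n) (K : R) : 0 <= K -> polyfun h -> polyfun psi ->
  (forall z, nm z <= Rb -> nc (h z) <= K) -> (exists2 x', x' \in X & forall x, x \in X ->
    flat (N * L.+1) x (fun z => psi z - (x == x')%:R)) ->
  nc (Lam L (fun z => h z * (G z 0 a - G x 0 a) * psi z)) <= nc (s0 * u 0 a) * D%:R * K * (1 / 2) ^+ L.
Proof.
move=> K0 ph ppsi HK [x' x'X Hf]; pose q := T (fun z => h z * psi z).
have pGa : polyfun (fun z => G z 0 a - G x 0 a) by apply: pfB; [exact: pG|exact: pf_cst].
rewrite /Lam; have -> : T (fun z => h z * (G z 0 a - G x 0 a) * psi z) = (u 0 a) *: (q * ('X - s0%:P)).
  apply: trace_uniq; first by apply: pfM => //; exact: pfM.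
  move=> s Ps; have e : q.[s] = _ := traceE (pfM ph ppsi) Ps; rewrite hornerZ hornerM hornerXsubC e mulrCA mulr_suml.
  rewrite big_seq [RHS]big_seq; apply: eq_bigr => z /(fibP cov Ps).2 ->; rewrite Gx !mxE; ring.
have -> : \sum_(l < L.+1) s0 ^+ l * (u 0 a *: (q * ('X - s0%:P)))`_l = - (u 0 a * s0 ^+ L.+1 * q`_L).
  elim: L {Hf} => [|L IH]; first by rewrite big_ord1 coefZ mulrBr coefB coefMX coefMC /=; ring.
  rewrite big_ord_recr IH /= coefZ mulrBr coefB coefMX coefMC /= !exprS; ring.
have -> : - (u 0 a * s0 ^+ L.+1 * q`_L) = - ((s0 * u 0 a) * (s0 ^+ L * q`_L)) by rewrite exprS; ring.
rewrite ncN ncM -!mulrA ler_wpM2l ?nc_ge0// mulrA.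
apply: (@coef_small h psi (fun x => (x == x')%:R) L K) => // b t z be /andP[t0 tr1] Gz.
rewrite ncM nc_nat; apply: le_trans (HK z _).
  by case: (_ == _); rewrite ?mul1r ?mul0r ?nc_ge0.
by apply: (hRb be _ Gz); case/andP: r1r => _ h1; exact: ltW (le_lt_trans tr1 h1).
Qed.

(* The functional [Lam] is the part of the trace at [y + s0 u] carried by the
   label [x']; the kernel [det (M z x)] and a power of an affine function equal to
   1 at [x] and small near [x'] show that it cannot see a far away [x]. *)
Lemma Lam_far x' (i : 'I_n) (de : R) : x' \in X -> 2 * eps1 <= nc ((x - x') 0 i) -> 0 < de ->
  exists L0 : nat, forall L psi, (L0 <= L)%N -> polyfun psi ->
    (forall x, x \in X -> flat (N * L.+1) x (fun z => psi z - (x == x')%:R)) ->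
    nc (Lam L (fun z => \det (M z x) * psi z)) <= de.
Proof.
move=> x'X far de0; pose b := (x - x') 0 i.
have b0 : b != 0 by rewrite -nc_gt0; apply: lt_le_trans far; rewrite mulr_gt0.
pose q (z : V) := (z - x') 0 i / b.
have pq : polyfun q.
  apply: pfM; last exact: pf_cst.
  by apply: (@pf_ext _ _ (fun z => z 0 i - x' 0 i)) => [|z]; [apply: pfB; [exact: pf_coord|exact: pf_cst]|rewrite !mxE].
pose e z := \det (M z x).
have pe : polyfun e by have := pf_bez_det GM => h; apply: (pf2_row h); [exact: pmap_id|exact: pmap_cst].
have [E E0 HE] := pf_lip Rb pe.
have [p Hp] : exists p : nat, (2 * D%:R * E) * (1 / 2) ^+ p <= de / 2.
  by apply: pow_small; [apply/andP; split; lra|rewrite divr_gt0].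
pose h (a : 'I_n) z := - (\adj (M z x)) a i / b * \sum_(k < p) q z ^+ k.
have ph a : polyfun (h a).
  apply: pfM; last by apply: pf_sum => k _; exact: pfX.
  apply: pfM; last exact: pf_cst.
  by apply: pfN; apply: (pf2_row (pm2_bez_adj GM a i)); [exact: pmap_id|exact: pmap_cst].
(* As [1 - q ^+ p] contains the factor [1 - q], a multiple of [(z - x) 0 i], the cofactor identity
   writes [e * (1 - q ^+ p)] as a combination of the coordinates of [G z - G x]. *)
have key z : e z = e z * q z ^+ p + \sum_a h a z * (G z 0 a - G x 0 a).
  have /rowP/(_ i) := bez_adj GM z x; rewrite !mxE => e1.
  have -> : \sum_a h a z * (G z 0 a - G x 0 a) = - (\sum_a (G z - G x) 0 a * (\adj (M z x)) a i) / b * \sum_(k < p) q z ^+ k.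
    rewrite !mulNr mulr_suml mulr_suml -sumrN; apply: eq_bigr => a _; rewrite /h !mxE; ring.
  rewrite -e1 -/(e z).
  have -> : z 0 i - x 0 i = b * (q z - 1).
    by rewrite /q mulrBr mulrCA divff// /b !mxE; ring.
  have -> : - (e z * (b * (q z - 1))) / b = - (e z * (q z - 1)) by field.
  by rewrite mulNr -mulrA -subrX1; ring.
have [H H0 HH] : exists2 H : R, 0 <= H & forall a z, nm z <= Rb -> nc (h a z) <= H.
  have /choice[Ha HHa] a : exists H : R, 0 <= H /\ forall z, nm z <= Rb -> nc (h a z) <= H.
    by have [H H0 HH] := pf_lip Rb (ph a); exists H; split=> // z zb; have [] := HH z z zb zb.
  exists (\sum_a Ha a); first by apply: sumr_ge0 => a _; exact: (HHa a).1.
  move=> a z zb; apply: le_trans ((HHa a).2 z zb) _; rewrite (bigD1 a)//= lerDl.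
  by apply: sumr_ge0 => a' _; exact: (HHa a').1.
have [L0 HL0] : exists L0 : nat, (n%:R * (nc s0 * nm u * D%:R * H)) * (1 / 2) ^+ L0 <= de / 2.
  by apply: pow_small; [apply/andP; split; lra|rewrite divr_gt0].
exists L0 => L psi LL ppsi Hf.
pose g (j : option 'I_n) z := if j is Some a then h a z * (G z 0 a - G x 0 a) * psi z else e z * q z ^+ p * psi z.
have pg j : polyfun (g j).
  case: j => [a|]; last by do 2! apply: pfM => //; exact: pfX.
  by do 2! apply: pfM => //; apply: pfB; [exact: pG|exact: pf_cst].
have -> : Lam L (fun z => e z * psi z) = Lam L (fun z => \sum_(j <- None :: map Some (index_enum 'I_n)) g j z).
  rewrite /Lam (@trace_ext (fun z => \sum_(j <- None :: map Some (index_enum 'I_n)) g j z))//; first exact: pf_sum.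
  by move=> z; rewrite big_cons big_map {1}key mulrDl; congr (_ + _); rewrite mulr_suml; apply: eq_bigr.
rewrite Lam_sum// big_cons big_map /=; apply: le_trans (ncD _ _) _; rewrite [leRHS]splitr; apply: lerD.
  have pK : 0 <= E * (1 / 2) ^+ p by rewrite mulr_ge0// exprn_ge0// divr_ge0.
  have := @Lam_bound (fun z => e z * q z ^+ p) psi (fun w => (w == x')%:R) L _ pK (pfM pe (pfX p pq)) ppsi _ Hf.
  rewrite mulrA => h1; apply: le_trans (h1 _) Hp => a t z ae tr1 Gz.
  case/andP: (tr1) => t0 t1; case/andP: (r1r) => r10 r1r'.
  have tr : 0 < nc t <= r by rewrite t0; exact: ltW (le_lt_trans t1 r1r').
  have zb : nm z <= Rb by case/andP: tr => _ tr; exact: hRb tr Gz.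
  have [lx|lx] := eqVneq (lab a t z) x'; last by rewrite mul0r nc0.
  have -> : true%:R * (e z * q z ^+ p) = e z * q z ^+ p by rewrite mul1r.
  rewrite ncM ncX; apply: ler_pM; rewrite ?exprn_ge0 ?nc_ge0//; first by have [] := HE z z zb zb.
  apply: lerXn2r; rewrite ?nnegrE ?nc_ge0 ?divr_ge0//.
  have := lab_bound cov XP hN r0 (fun t => @reg a t ae) (Hlab ae) (fun t z => @hRb a t z ae) i tr Gz.
  rewrite lx => h2; have : nc ((z - x') 0 i) ^+ N <= eps1 ^+ N.
    apply: le_trans h2 _; rewrite mulrAC ler_pdivrMr//.
    have K0 : 0 <= (2 * Rb) ^+ N by rewrite exprn_ge0// mulr_ge0//; apply: le_trans zb; exact: nm_ge0.
    apply: le_trans (ler_wpM2l K0 t1) _; rewrite mulrC [X in _ <= X]mulrC [_ * (2 * Rb) ^+ N]mulrC; exact: hr1.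
  rewrite ler_pXn2r ?nnegrE ?nc_ge0 ?(ltW eps10)// => h3.
  rewrite /q ncM ncV ler_pdivrMr ?nc_gt0//; rewrite -/b in far; lra.
apply: le_trans (nc_sum _ _ _) _; apply: le_trans HL0.
apply: (@le_trans _ _ (\sum_(a < n) (nc s0 * nm u * D%:R * H) * (1 / 2) ^+ L0)); last first.
  by rewrite sumr_const card_ord -[_ *+ n]mulr_natl !mulrA.
apply: ler_sum => a _; have := Lam_telescope a H0 (ph a) ppsi (HH a) (ex_intro2 _ _ x' x'X Hf).
move/le_trans; apply; apply: ler_pM.
  by rewrite !mulr_ge0 ?nc_ge0 ?ler0n.
  by rewrite exprn_ge0// divr_ge0.
  by rewrite ler_wpM2r// ler_wpM2r ?ler0n// ncM ler_wpM2l ?nc_ge0// nm_coord.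
by apply: ler_wiXn2l => //; lra.
Qed.

(** The kernel [e z = \det (M z x)] vanishes at the points of the fibre of [x] other than [x], so
    its trace at [y + s0 *: u] is exactly [e x], which is nonzero. It is also the sum of the
    contributions of the labels; if [x] were far from all of [X], each would be at most
    [nc (e x) / (size X + 1)] by [Lam_far], too little in total. *)
Lemma cone_near : exists2 x', x' \in X & forall i, nc ((x - x') 0 i) < 2 * eps1.
Proof.
apply: contrapT => /forall2NP no.
have ex0 : \det (M x x) != 0 by have [_ _ _ _ H] := cov; apply: H; rewrite Gx.
have e0 : 0 < nc (\det (M x x)) by rewrite nc_gt0.
pose de := nc (\det (M x x)) / (size X).+1%:R.
have de0 : 0 < de by rewrite divr_gt0 ?ltr0n.
pose e z := \det (M z x).
have pe : polyfun e by have := pf_bez_det GM => h; apply: (pf2_row h); [exact: pmap_id|exact: pmap_cst].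
have [L0 HL0] : exists L0 : nat, forall x', x' \in X -> forall L psi, (L0 <= L)%N -> polyfun psi ->
    (forall x, x \in X -> flat (N * L.+1) x (fun z => psi z - (x == x')%:R)) ->
    nc (Lam L (fun z => e z * psi z)) <= de.
  have : {subset X <= X} by [].
  elim: {1 3}X => [|x' s IH] sX; first by exists 0.
  have [|L0 HL0] := IH; first by move=> w ws; apply: sX; rewrite inE ws orbT.
  have x'X : x' \in X by apply: sX; rewrite inE eqxx.
  have [i far] : exists i, 2 * eps1 <= nc ((x - x') 0 i).
    apply: contrapT => /forallNP h; case: (no x') => [|nx]; first by rewrite x'X.
    by apply: nx => i; rewrite ltNge; apply/negP.
  have [L1 HL1] := Lam_far x'X far de0.
  exists (maxn L0 L1) => w; rewrite inE => /orP[/eqP->|/HL0 H] L psi; rewrite geq_max => /andP[h0 h1].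
    exact: HL1.
  exact: H.
pose L := maxn L0 (size (T e)).
have /choice[psi Hpsi] x' : exists psi : V -> C, polyfun psi /\ (x' \in X ->
    forall w, w \in X -> flat (N * L.+1) w (fun z => psi z - (w == x')%:R)).
  have [/(jet_exists (N * L.+1))[psi ppsi H]|] := boolP (x' \in X); first by exists psi.
  by exists (fun=> 0); split=> //; exact: pf_cst.
have := Lam_partition pe (fun x' => (Hpsi x').1) (fun x' => (Hpsi x').2).
rewrite (Lam_full (leq_maxr _ _)) (traceE pe Ps0) => sumE.
have te : \sum_(z <- fib G (y + s0 *: u)) e z = \det (M x x).
  have [us us'] := fibP cov Ps0; have xs : x \in fib G (y + s0 *: u) by apply/us'.
  rewrite (bigD1_seq x)//= big_seq_cond big1 ?addr0// => z /andP[/us' Gz zx].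
  apply/eqP; apply: contraNT zx => dz; rewrite -subr_eq0.
  have := bez_adj GM z x; rewrite Gz Gx subrr mul0mx => /eqP.
  by rewrite scaler_eq0 (negPf dz).
have : nc (\sum_(x' <- X) Lam L (fun z => e z * psi x' z)) <= (size X)%:R * de.
  apply: nc_sum_le => x' x'X; apply: (HL0 x' x'X); first exact: leq_maxl.
    exact: (Hpsi x').1.
  exact: (Hpsi x').2.
rewrite sumE te /de mulrA ler_pdivlMr ?ltr0n// mulrC ler_pM2r//.
by rewrite ler_nat ltnn.
Qed.
End ConeNear.

(** * Algebraic sets and codimension *)

Section Algebraic.
Local Open Scope classical_set_scope.
Variables (R : realType) (k : nat).
Local Notation C := R[i].
Local Notation P := (proj_space C k).
Local Notation V := 'rV[C]_k.+1.
Implicit Types (A B L : set P) (q : V -> C).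

Definition van q A := forall p : P, A p -> q (hcoord p) = 0.

Lemma hform_line e q (v : V) (v0 : v != 0) : hform e q ->
  exists2 a : C, a != 0 & q (hcoord (line v0)) = a * q v.
Proof.
move=> [_ hq]; have := hcoordK (line v0) => /line_eq[a a0 ->].
by exists (a ^+ e); rewrite ?expf_neq0.
Qed.

Lemma hform_line_eq0 e q (v : V) (v0 : v != 0) : hform e q ->
  (q (hcoord (line v0)) == 0) = (q v == 0).
Proof. by move=> /(hform_line v0)[a a0 ->]; rewrite mulf_eq0 (negbTE a0). Qed.

Lemma van_cone A q : polyfun q -> (forall v (v0 : v != 0), A (line v0) -> q v = 0) ->
  forall p, q (hcoord p) != 0 -> exists e, exists2 g, hform e g & van g A /\ g (hcoord p) != 0.
Proof.
move=> pq Aq p qp.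
have [||e [g hg [gA gp]]] := @form_sep _ _ (fun v => exists v0 : v != 0, A (line v0)) q pq _ _ _ qp.
- move=> v c [v0 Av] c0; have cv0 : c *: v != 0 by rewrite scaler_eq0 negb_or c0.
  by exists cv0; suff -> : line cv0 = line v0 by []; apply/line_eq; exists c.
- by move=> v [v0 Av]; exact: Aq Av.
exists e, g => //; split=> // p' Ap'; apply: gA; exists (hcoord_neq0 p').
by rewrite hcoordK.
Qed.

(** Separating the outside points one by one requires a family of equations that may be infinite;
    quasi-compactness extracts finitely many. *)
Lemma algebraicP A : algebraic A <->
  forall p, ~ A p -> exists e, exists2 q, hform e q & van q A /\ q (hcoord p) != 0.
Proof.
split=> [[m [d [q AE]]] p|H].
  rewrite AE /= => /existsNP[i /eqP qi]; exists (d i), (heval (q i)); first exact: hform_dhomog.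
  by split=> // p'; rewrite AE => /(_ i).
pose S q := exists2 e, hform e q & van q A.
have [||m [q [Sq Tq]]] := @polyfun_qcompact _ _ S (fun v => exists p, ~ A p /\ v = hcoord p).
- by move=> q [e [pq _] _].
- by move=> _ [p [nAp ->]]; have [e [q hq [qA qp]]] := H p nAp; exists q => //; exists e.
have /choice[x Hx] i : exists x : {d & dhomog k.+1 C d}, (i < m)%N ->
    forall v, heval (tagged x) v = q i v.
  have [im|im] := ltnP i m; last by exists (Tagged (fun d => dhomog k.+1 C d) (0 : dhomog k.+1 C 0)).
  have [e hq _] := Sq i im; have [y Hy] := hform_to_dhomog hq.
  by exists (Tagged (fun d => dhomog k.+1 C d) y) => _ v; rewrite Hy.
exists m, (fun i : 'I_m => tag (x i)), (fun i : 'I_m => tagged (x i)).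
apply/seteqP; split=> p /=.
  by move=> Ap i; rewrite Hx//; have [e _] := Sq i (ltn_ord i); apply.
move=> Hp; apply: contrapT => nAp; have [|i im /eqP] := Tq (hcoord p); first by exists p.
by apply; rewrite -(Hx i im); exact: (Hp (Ordinal im)).
Qed.

Lemma algebraicI A B : algebraic A -> algebraic B -> algebraic (A `&` B).
Proof.
move=> /algebraicP aA /algebraicP aB; apply/algebraicP => p /not_andP[/aA|/aB] [e [q hq [qv qp]]];
  by exists e, q => //; split=> // p' []; auto.
Qed.

Lemma algebraic_zero e q : hform e q -> algebraic [set p : P | q (hcoord p) = 0].
Proof. by move=> hq; apply/algebraicP => p /eqP qp; exists e, q; [exact: hq|split]. Qed.

Lemma algebraicT : algebraic [set: P].
Proof. by apply/algebraicP => p; case. Qed.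

Lemma algebraic_stationary (A : nat -> set P) : (forall j, algebraic (A j)) ->
  (forall j, A j.+1 `<=` A j) -> exists j, forall i, A j `<=` A i.
Proof.
move=> aA dA; pose S q := exists j e, hform e q /\ van q (A j).
have mono i j : (i <= j)%N -> A j `<=` A i.
  move=> /subnK <-; elim: (j - i)%N => // l IH; apply: subset_trans IH; exact: dA.
have [||m [q [Sq Tq]]] := @polyfun_qcompact _ _ S (fun v => exists p i, ~ A i p /\ v = hcoord p).
- by move=> q [j [e [[pq _] _]]].
- move=> _ [p [i [nAp ->]]]; have [e [q hq [qv qp]]] := (algebraicP _).1 (aA i) p nAp.
  by exists q => //; exists i, e.
have /choice[j Hj] i : exists j, (i < m)%N -> van (q i) (A j).
  have [im|im] := ltnP i m; last by exists 0%N.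
  by have [j [e [_ qv]]] := Sq i im; exists j.
exists (\max_(i < m) j i)%N => i p Ap; apply: contrapT => nAp.
have [|i' im /eqP] := Tq (hcoord p); first by exists p, i.
apply; apply: (Hj i' im); apply: mono Ap.
exact: (leq_bigmax (F := fun i : 'I_m => j i) (Ordinal im)).
Qed.

(* Noetherian induction, in the form: among the algebraic subsets of A having
   property T there is a minimal one. *)
Lemma algebraic_minimal (T : set P -> Prop) A : algebraic A -> T A ->
  exists L, [/\ algebraic L, T L, L `<=` A & forall L', algebraic L' -> T L' -> L' `<=` L -> L' = L].
Proof.
move=> aA TA; apply: contrapT => /forallNP no.
have /choice[f Hf] B : exists B', algebraic B -> T B -> B `<=` A ->
    [/\ algebraic B', T B', B' `<=` B & ~ B `<=` B'].
  have [[aB TB BA]|h] := pselect [/\ algebraic B, T B & B `<=` A]; last first.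
    by exists B => aB TB BA; case: h.
  apply: contrapT => /forallNP H; apply: (no B); split=> // L' aL' TL' L'B.
  by apply/seteqP; split=> // ; apply: contrapT => BL'; apply: (H L').
pose S j := iter j f A.
have HS j : [/\ algebraic (S j), T (S j) & S j `<=` A].
  elim: j => [|j [a b c]]; first by split.
  by have [a' b' c' _] := Hf _ a b c; split=> //; exact: subset_trans c' c.
have [|j|j Hj] := @algebraic_stationary S; first by move=> j; case: (HS j).
  by have [a b c] := HS j; have [] := Hf _ a b c.
by have [a b c] := HS j; have [_ _ _] := Hf _ a b c; apply; exact: (Hj j.+1).
Qed.

(** [T] is to be thought of as being small. A minimal algebraic subset that is not small is
    irreducible: if it is covered by two algebraic sets and its trace on neither were all of it,
    both traces would be small, hence also their union. *)
Lemma minimal_irreducible (T : set P -> Prop) A : algebraic A -> ~ T A -> T set0 ->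
  (forall A B, T A -> T B -> T (A `|` B)) -> (forall A B, A `<=` B -> T B -> T A) ->
  exists L, [/\ irreducible L, L `<=` A & ~ T L].
Proof.
move=> aA nTA T0 TU TS; have [L [aL nTL LA minL]] := algebraic_minimal (T := fun A => ~ T A) aA nTA.
exists L; split=> //; split=> //.
  by apply/set0P; apply: contra_notN nTL => /eqP ->.
move=> A1 A2 a1 a2 LA12.
have [T1|nT1] := pselect (T (L `&` A1)); last first.
  by left; have <- := minL _ (algebraicI aL a1) nT1 (@subIsetl _ _ _); exact: subIsetr.
have [T2|nT2] := pselect (T (L `&` A2)); last first.
  by right; have <- := minL _ (algebraicI aL a2) nT2 (@subIsetl _ _ _); exact: subIsetr.
exfalso; apply: nTL; apply: TS (TU _ _ T1 T2) => p Lp.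
by case: (LA12 p Lp); [left|right].
Qed.

Lemma irreducible_prime L e e' q q' : irreducible L -> hform e q -> hform e' q' ->
  van (fun v => q v * q' v) L -> van q L \/ van q' L.
Proof.
move=> [_ _ irrL] hq hq' qq.
have [p /= Lp|H|H] := irrL _ _ (algebraic_zero hq) (algebraic_zero hq'); [|by left|by right].
by have /eqP := qq p Lp; rewrite mulf_eq0 => /orP[] /eqP; [left|right].
Qed.
End Algebraic.

(** * Codimension through the growth of the Hilbert function *)

Section HilbertFunction.
Local Open Scope classical_set_scope.
Variables (R : realType) (k : nat).
Local Notation C := R[i].
Local Notation P := (proj_space C k).
Local Notation V := 'rV[C]_k.+1.
Implicit Types (A B L M : set P) (q : V -> C).

Lemma subspace_matrix r (N : 'rV[C]_r -> Prop) : N 0 -> (forall a x y, N x -> N y -> N (a *: x + y)) ->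
  exists K : 'M[C]_r, forall x, N x <-> (x <= K)%MS.
Proof.
move=> N0 Nlin; pose T j := `[< exists K : 'M[C]_r, (forall i, N (row i K)) /\ \rank K = j >].
have Nsub m (K : 'M[C]_(m, r)) x : (forall i, N (row i K)) -> (x <= K)%MS -> N x.
  move=> NK /submxP[D ->]; rewrite mulmx_sum_row; elim/big_ind: _ => // [a b Na Nb|i _].
    by rewrite -[a]scale1r; exact: Nlin.
  by rewrite -[_ *: _]addr0; exact: Nlin.
have exT : exists j, T j.
  exists 0%N; apply/asboolP; exists 0; split; last exact: mxrank0.
  by move=> i; rewrite row0.
have bT j : T j -> (j <= r)%N by move/asboolP => [K [_ <-]]; exact: rank_leq_row.
case: (ex_maxnP exT bT) => j /asboolP[K [NK rK]] maxj; exists K => x.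
split=> [Nx|]; last exact: Nsub.
have NKx : forall i, N (row i (K + x)%MS).
  move=> i; have /sub_addsmxP[u ->] := row_sub i (K + x)%MS.
  have N1 : N (u.1 *m K) by apply: (Nsub _ K) => //; exact: submxMl.
  have N2 : N (u.2 *m x) by apply: (Nsub _ x); [move=> i'; rewrite row_id|exact: submxMl].
  by rewrite -[u.1 *m K]scale1r; exact: Nlin.
have le : (\rank (K + x)%MS <= \rank K)%N by rewrite rK; apply: maxj; apply/asboolP; exists (K + x)%MS.
have := mxrank_leqif_sup (addsmxSl K x) => -[_ e].
have : (K + x <= K)%MS by rewrite -e eqn_leq le mxrankS ?addsmxSl.
by apply: submx_trans; exact: addsmxSr.
Qed.

(* Codimension is measured by the Hilbert function: on a set of codimension [c]
   the forms of degree [n] span a space of dimension O(n^(k - c)). *)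
Definition indep A n r := exists u : 'I_r -> V -> C, (forall i, hform n (u i)) /\
  forall c : 'rV[C]_r, van (fun v => \sum_i c 0 i * u i v) A -> c = 0.

Lemma indepS A B n r : A `<=` B -> indep A n r -> indep B n r.
Proof. by move=> AB [u [hu Hu]]; exists u; split=> // c cB; apply: Hu => p /AB; exact: cB. Qed.

Lemma indep_lin A n r s (u : 'I_r -> V -> C) (K : 'M[C]_(s, r)) : (forall i, hform n (u i)) ->
  (forall d : 'rV_s, van (fun v => \sum_i (d *m K) 0 i * u i v) A -> d = 0) -> indep A n s.
Proof.
move=> hu H; exists (fun i v => \sum_j K i j * u j v); split=> [i|d dA].
  by apply: hform_sum => j _; exact: hformZ.
apply: H => p Ap; rewrite -[RHS](dA p Ap) (eq_bigr (fun j => \sum_i d 0 i * (K i j * u j (hcoord p)))).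
  by rewrite exchange_big /=; apply: eq_bigr => i _; rewrite mulr_sumr.
by move=> j _; rewrite !mxE mulr_suml; apply: eq_bigr => i _; rewrite mulrA.
Qed.

(** Let [K] be the space of combinations vanishing on [A]. A complement of [K] remains independent
    on [A], and [K] remains independent on [B]. *)
Lemma indepU A B n r : indep (A `|` B) n r ->
  exists r1 r2, [/\ (r1 + r2)%N = r, indep A n r1 & indep B n r2].
Proof.
move=> [u [hu Hu]]; pose N (c : 'rV[C]_r) := van (fun v => \sum_i c 0 i * u i v) A.
have [||K HK] := @subspace_matrix _ N.
- by move=> p _; rewrite big1// => i _; rewrite mxE mul0r.
- move=> a x y Nx Ny p Ap; rewrite (eq_bigr (fun i => a * (x 0 i * u i (hcoord p)) + y 0 i * u i (hcoord p))).
    by rewrite big_split /= -mulr_sumr Nx// Ny// mulr0 addr0.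
  by move=> i _; rewrite !mxE mulrDl mulrA.
have free0 m (D : 'M[C]_(m, r)) (d : 'rV_m) : row_free D -> d *m D = 0 -> d = 0.
  by move=> fD /eqP; rewrite mulmx_free_eq0// => /eqP.
exists (\rank K^C%MS), (\rank K); split.
- by rewrite mxrank_compl subnK// rank_leq_row.
- apply: (indep_lin (K := row_base K^C%MS) hu) => d dA; apply: (free0 _ (row_base K^C%MS)).
    exact: row_base_free.
  have h1 : (d *m row_base K^C <= K)%MS by apply/HK.
  have h2 : (d *m row_base K^C <= K^C)%MS by rewrite (submx_trans (submxMl _ _))// eq_row_base.
  have : (d *m row_base K^C <= K :&: K^C)%MS by rewrite sub_capmx h1.
  by rewrite capmx_compl submx0 => /eqP.
- apply: (indep_lin (K := row_base K) hu) => d dB; apply: (free0 _ (row_base K)).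
    exact: row_base_free.
  have h1 : N (d *m row_base K) by apply/HK; rewrite (submx_trans (submxMl _ _))// eq_row_base.
  by apply: Hu => p [Ap|Bp]; [exact: h1|exact: dB].
Qed.

Lemma indep_pt A n : A !=set0 -> indep A n 1.
Proof.
move=> [a Aa]; have [i ai] : exists i, hcoord a 0 i != 0.
  apply/existsP; apply: contraNT (hcoord_neq0 a) => /existsPn H; apply/eqP/rowP => i.
  by apply/eqP; rewrite mxE -[_ == _]negbK H.
exists (fun _ v => v 0 i ^+ n); split=> [_|c cA].
  by have := hformX n (hform_coord R i); rewrite muln1.
apply/rowP => j; rewrite ord1 mxE; have /eqP := cA a Aa.
by rewrite big_ord_recl big_ord0 addr0 mulf_eq0 expf_eq0 (negbTE ai) andbF orbF => /eqP.
Qed.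

(** Independence is already visible on finitely many points of [A]; multiplying by a power of a
    linear form without zeros among them preserves it. *)
Lemma indep_mono A n r m : indep A n r -> indep A (n + m) r.
Proof.
move=> [u [hu Hu]].
pose S (q : 'rV[C]_r -> C) := exists2 p, A p & forall c, q c = \sum_i c 0 i * u i (hcoord p).
have [||N [q [Sq Tq]]] := @polyfun_qcompact _ _ S (fun c => c <> 0).
- move=> q [p Ap Hq]; apply: (@pf_ext _ _ (fun c => \sum_i c 0 i * u i (hcoord p))) => //.
  by apply: pf_sum => i _; apply: pfM; [exact: pf_coord|exact: pf_cst].
- move=> c c0; have /existsNP[p /not_implyP[Ap /eqP cp]] : ~ van (fun v => \sum_i c 0 i * u i v) A.
    by move=> /Hu.
  by exists (fun c => \sum_i c 0 i * u i (hcoord p)) => //; exists p.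
have /choice[p Hp] (i : 'I_N) : exists p, A p /\ forall c, q i c = \sum_j c 0 j * u j (hcoord p).
  by have [p Ap Hq] := Sq i (ltn_ord i); exists p.
have [|l Hl] := @generic_linear _ _ [seq hcoord (p i) | i <- enum 'I_N].
  by move=> _ /mapP[i _ ->]; exact: hcoord_neq0.
exists (fun i v => u i v * (\sum_j v 0 j * l 0 j) ^+ m); split=> [i|c cA].
  apply: hformM (hu i) _; rewrite -[X in hform X]muln1; apply: (@hformX _ _ 1); apply: hform_sum => j _.
  split=> [|a v]; first by apply: pfM; [exact: pf_coord|exact: pf_cst].
  by rewrite mxE mulrA expr1.
apply: contrapT => c0; have [i iN /eqP] := Tq c c0; apply; have [Ap Hq] := Hp (Ordinal iN).
have := cA _ Ap; rewrite (eq_bigr (fun j => (c 0 j * u j (hcoord (p (Ordinal iN)))) * (\sum_j hcoord (p (Ordinal iN)) 0 j * l 0 j) ^+ m)).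
  rewrite -mulr_suml -Hq => /eqP; rewrite mulf_eq0 expf_eq0 => /orP[/eqP//|/andP[_]].
  by rewrite (negbTE (Hl _ _))//; apply: map_f; rewrite mem_enum.
by move=> j _; rewrite mulrA.
Qed.

(** Multiples of [q] vanish on [M], so a relation restricts to the [u b] there and kills their
    coefficients; on [L], being irreducible, [q] can then be cancelled. *)
Lemma indep_extend L M n e q m r : irreducible L -> M `<=` L -> hform e q -> van q M -> ~ van q L ->
  indep L n m -> indep M (n + e) r -> indep L (n + e) (m + r).
Proof.
move=> irrL ML hq qM qL [w [hw Hw]] [u [hu Hu]].
exists (fun i : 'I_(m + r) => match fintype.split i with inl a => (fun v => w a v * q v) | inr b => u b end); split=> [i|c cL].
  by case: (fintype.split i) => [a|b] //; exact: hformM.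
have cE v : \sum_i c 0 i * (match fintype.split i with inl a => (fun v => w a v * q v) | inr b => u b end) v =
    (\sum_a c 0 (lshift r a) * w a v) * q v + \sum_b c 0 (rshift m b) * u b v.
  rewrite big_split_ord /=; congr (_ + _).
    by rewrite mulr_suml; apply: eq_bigr => a _; rewrite (unsplitK (inl a)) mulrA.
  by apply: eq_bigr => b _; rewrite (unsplitK (inr b)).
have cr : rsubmx c = 0.
  apply: Hu => p Mp; have := cL p (ML p Mp); rewrite cE qM// mulr0 add0r => h.
  by rewrite -[RHS]h; apply: eq_bigr => b _; rewrite mxE.
have cr0 b : c 0 (rshift m b) = 0 by have /rowP/(_ b) := cr; rewrite !mxE.
have cl : lsubmx c = 0.
  apply: Hw; have hs : hform n (fun v => \sum_a lsubmx c 0 a * w a v).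
    by apply: hform_sum => a _; exact: hformZ.
  case: (irreducible_prime irrL hs hq) => // p Lp; have := cL p Lp; rewrite cE.
  rewrite [X in _ + X]big1 ?addr0 => [h|b _]; last by rewrite cr0 mul0r.
  by rewrite -[RHS]h; congr (_ * _); apply: eq_bigr => a _; rewrite mxE.
by rewrite -[c]hsubmxK cr cl row_mx0.
Qed.

Definition codim_ge c A := exists K : nat, forall n r, indep A n r -> (r * n.+1 ^ c <= K * n.+1 ^ k)%N.

Lemma codim_geS c A B : A `<=` B -> codim_ge c B -> codim_ge c A.
Proof. by move=> AB [K H]; exists K => n r /(indepS AB)/H. Qed.

Lemma codim_geU c A B : codim_ge c A -> codim_ge c B -> codim_ge c (A `|` B).
Proof.
move=> [K H] [K' H']; exists (K + K')%N => n r /indepU[r1 [r2 [<- /H h /H' h']]].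
by rewrite !mulnDl leq_add.
Qed.

Lemma codim_ge0set c : codim_ge c (set0 : set P).
Proof.
exists 0%N => n [|r] [u [hu Hu]]; first by rewrite mul0n.
have /rowP/(_ ord0) := Hu (const_mx 1) (fun p (pF : set0 p) => False_ind _ pF).
by rewrite !mxE => /eqP; rewrite oner_eq0.
Qed.

Lemma codim_ge_empty A : codim_ge k.+1 A -> A = set0.
Proof.
move=> [K H]; apply/eqP; apply: contraT => /set0P A0.
have := H K 1%N (indep_pt K A0); rewrite mul1n expnS leq_pmul2r ?expn_gt0//.
by rewrite ltnn.
Qed.

(** The drop in dimension: applying [indep_extend] [n] times turns [r] independent forms of degree
    [n] on [M] into [(n + 1) * r] on [L] in degree [n + n * e], that is, gains one factor [n + 1].
    The constant [e.+1 ^ k] compensates for the change of degree. *)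
Lemma codim_ge_strict c L M e q : irreducible L -> M `<=` L -> hform e q -> van q M -> ~ van q L ->
  codim_ge c L -> codim_ge c.+1 M.
Proof.
move=> irrL ML hq qM qL [K H]; exists (K * e.+1 ^ k)%N => n r iM.
have iL s : indep L (n + s * e) (s.+1 * r).
  elim: s => [|s IH]; first by rewrite mul0n addn0 mul1n; exact: indepS iM.
  have -> : (s.+2 * r)%N = (s.+1 * r + r)%N by rewrite mulSn addnC.
  have -> : (n + s.+1 * e)%N = (n + s * e + e)%N by rewrite mulSn (addnC e) addnA.
  have iM' : indep M (n + s * e + e) r by rewrite -addnA; exact: indep_mono.
  exact: (indep_extend irrL ML hq qM qL IH iM').
have := H _ _ (iL n); set N := (n + n * e).+1 => h.
have N1 : (n.+1 <= N)%N by rewrite ltnS leq_addr.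
have N2 : (N <= n.+1 * e.+1)%N by rewrite /N mulnS mulSn -addSn leq_add2l leq_addl.
apply: (@leq_trans (n.+1 * r * N ^ c)).
  by rewrite expnS mulnCA mulnA leq_mul2l; apply/orP; right; case: (c) => // c'; rewrite leq_exp2r.
apply: leq_trans h _.
by rewrite -mulnA leq_mul2l -expnMn mulnC; apply/orP; right; case: (k) => // k'; rewrite leq_exp2r.
Qed.
End HilbertFunction.

(** * A Nullstellensatz with countably many inequations *)

Section CountableNullstellensatz.
Local Open Scope classical_set_scope.
Variable R : realType.
Local Notation C := R[i].

(** Uncountability of the reals, read off from Lebesgue measure: if all fibres were finite the line
    would be countable, hence null, while an interval of length 1 is not. *)
Lemma real_pigeonhole (T : countType) (f : R -> T) : exists t, infinite_set (f @^-1` [set t]).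
Proof.
apply: contrapT => /forallNP H.
have : countable (\bigcup_(t in [set: T]) f @^-1` [set t]).
  apply: bigcup_countable => // t _; apply: finite_set_countable.
  by apply: contrapT; exact: H.
have -> : \bigcup_(t in [set: T]) f @^-1` [set t] = [set: R].
  by apply/seteqP; split=> // x _; exists (f x).
move=> /countable_lebesgue_measure0.
have := @lebesgue_measure_itv R (Interval (BRight 0) (BLeft 1)); rewrite /= lte_fin ltr01 oppr0 adde0 => h1 h0.
have : (lebesgue_measure [set` Interval (BRight (0%R : R)) (BLeft 1%R)] <= lebesgue_measure [set: R])%E.
  by apply: le_measure; rewrite ?inE.
by rewrite h0 h1 lee_fin ler10.
Qed.

Variable n : nat.
Local Notation Pol := (mpoly n C).
Implicit Types (I J : Pol -> Prop).

Definition mideal J := [/\ J 0, forall p q, J p -> J q -> J (p - q) & forall p q, J q -> J (p * q)].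

Lemma midealD J p q : mideal J -> J p -> J q -> J (p + q).
Proof. by move=> [J0 JB JM] Jp Jq; rewrite -[q]opprK; apply: (JB) => //; rewrite -sub0r; exact: JB. Qed.

Lemma mideal_sum J (A : Type) (r : seq A) (Q : pred A) F : mideal J -> (forall i, Q i -> J (F i)) ->
  J (\sum_(i <- r | Q i) F i).
Proof.
move=> iJ JF; elim/big_ind: _ => //; first by case: iJ.
by move=> p q; exact: midealD.
Qed.

Lemma mideal_maximal I (S : Pol -> Prop) : mideal I -> (forall p, S p -> ~ I p) ->
  exists J, [/\ mideal J, forall p, I p -> J p, forall p, S p -> ~ J p &
    forall f, ~ J f -> exists s g, S s /\ J (s - g * f)].
Proof.
move=> iI SI; apply: contrapT => /forallNP no.
pose Good J := [/\ mideal J, forall p, I p -> J p & forall p, S p -> ~ J p].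
pose ext J f : Pol -> Prop := fun p => exists g, J (p - g * f).
have /choice[next Hnext] J : exists f, Good J -> ~ J f /\ Good (ext J f).
  have [[iJ IJ SJ]|h] := pselect (Good J); last by exists 0 => /h.
  apply: contrapT => /forallNP H; apply: (no J); split=> // f nJf.
  apply: contrapT => no'; apply: (H f) => _; split=> //; have [J0 JB JM] := iJ; split.
  - split; first by exists 0; rewrite mul0r subrr.
      move=> p q [g Jg] [g' Jg']; exists (g - g'); rewrite mulrBl opprD addrACA.
      by rewrite -[X in _ + X]opprD; exact: JB.
    by move=> p q [g Jg]; exists (p * g); rewrite -mulrA -mulrBr; exact: JM.
  - by move=> p /IJ Jp; exists 0; rewrite mul0r subr0.
  - by move=> s Ss [g Jg]; apply: no'; exists s, g.
pose K j := iter j (fun J => ext J (next J)) I.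
have GK j : Good (K j).
  by elim: j => [|j IH] /=; [split|case: (Hnext _ IH)].
have [||||j Hj] := @mpoly_acc n C K.
- by move=> j; case: (GK j) => -[].
- by move=> j p q; case: (GK j) => -[_ H _] _ _; exact: H.
- by move=> j p q; case: (GK j) => -[_ _ H] _ _; exact: H.
- by move=> j p Kp; exists 0; rewrite mul0r subr0.
have [nK _] := Hnext _ (GK j); apply/nK/Hj; exists 1.
by rewrite mul1r subrr; case: (GK j) => -[].
Qed.

Lemma mpoly_dependent (N : nat) : exists d, forall g : 'I_d -> Pol, (forall i, (msize (g i) <= N)%N) ->
  exists2 c : 'I_d -> C, (exists i, c i != 0) & \sum_i c i *: g i = 0.
Proof.
pose M := #|{: bmultinom n N}|; exists M.+1 => g Hg.
pose U := \matrix_(i < M.+1, j < M) mcoeff (bmnm (enum_val j)) (g i).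
have : kermx U != 0.
  by rewrite kermx_eq0 /row_free neq_ltn ltnS rank_leq_col.
case/rowV0Pn => c /sub_kermxP cU c0; exists (fun i => c 0 i).
  by apply/existsP; apply: contraNT c0 => /existsPn H; apply/eqP/rowP => i; rewrite mxE; apply/eqP; rewrite -[_ == _]negbK H.
apply/mpolyP => m; rewrite mcoeff0 raddf_sum /=.
have [mN|Nm] := ltnP (mdeg m) N.
  have /rowP/(_ (enum_rank (BMultinom mN))) := cU; rewrite !mxE => h.
  rewrite -[RHS]h; apply: eq_bigr => i _; rewrite mcoeffZ mxE; congr (_ * _).
  by rewrite enum_rankK.
rewrite big1// => i _; rewrite mcoeffZ memN_msupp_eq0 ?mulr0//.
by apply: msize_mdeg_ge; exact: leq_trans (Hg i) Nm.
Qed.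

(** If [x] were congruent to no constant, every [x - a] with [a] real would divide an element of [S]
    modulo [J]. [S] being countable, infinitely many [a] share the same element of [S] and the same
    degree of cofactor; a linear relation between these cofactors gives a nonzero one-variable
    polynomial [r] with [r(x)] in [J]. It splits into linear factors, and [J] is prime. *)
Lemma prime_constant (S : Pol -> Prop) (s : seq nat -> Pol) J x : (forall p, S p -> exists l, p = s l) -> S 1 ->
  mideal J -> (forall p, S p -> ~ J p) -> (forall p q, J (p * q) -> J p \/ J q) ->
  (forall f, ~ J f -> exists s g, S s /\ J (s - g * f)) -> exists a : C, J (x - mpolyC n a).
Proof.
move=> Ss S1 iJ SJ pJ mJ; have [J0 JB JM] := iJ; apply: contrapT => /forallNP no.
pose la (a : R) : C := (a%:C)%C.
have /choice[lg Hlg] a : exists lg : seq nat * Pol, S (s lg.1) /\ J (s lg.1 - lg.2 * (x - mpolyC n (la a))).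
  by have [p [g [Sp Jp]]] := mJ _ (no (la a)); have [l pl] := Ss _ Sp; exists (l, g); rewrite -pl.
have [[l N] inf] := real_pigeonhole (fun a => ((lg a).1, msize (lg a).2)).
have [d Hd] := mpoly_dependent N.
have [B BT dB] := infinite_set_fset d inf.
pose a (i : 'I_d) : R := nth 0 (finmap.enum_fset B) i.
have ai (i : 'I_d) : (lg (a i)).1 = l /\ msize (lg (a i)).2 = N.
  have h : a i \in finmap.enum_fset B by apply: mem_nth; apply: leq_trans (ltn_ord i) dB.
  by have := BT (a i) h; case.
have a_inj (i j : 'I_d) : i != j -> la (a i) - la (a j) != 0.
  apply: contraNN; rewrite subr_eq0 => /eqP[] /eqP; rewrite nth_uniq ?finmap.fset_uniq//.
  - exact: leq_trans (ltn_ord i) dB.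
  - exact: leq_trans (ltn_ord j) dB.
have [c [i0 ci0] cg] := Hd (fun i => (lg (a i)).2) (fun i => eq_leq (ai i).2).
pose X i : Pol := x - mpolyC n (la (a i)).
have Jk i : J (s l * \prod_(j | j != i) X j - (lg (a i)).2 * \prod_j X j).
  have [_ h] := Hlg (a i); rewrite (ai i).1 in h.
  by rewrite [X in _ - _ * X](bigD1 i)//= mulrA -mulrBl mulrC; exact: JM.
pose r : {poly C} := \sum_i c i *: \prod_(j | j != i) ('X - (la (a j))%:P).
have r0 : r != 0.
  apply/eqP => r0; have : r.[la (a i0)] = 0 by rewrite r0 horner0.
  rewrite /r horner_sum (bigD1 i0)//= [X in _ + X]big1 ?addr0 => [|i ii0]; last first.
    by rewrite hornerZ horner_prod (bigD1 i0) 1?eq_sym//= hornerXsubC subrr mul0r mulr0.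
  move=> /eqP; rewrite hornerZ mulf_eq0 (negbTE ci0) horner_prod /= => /prodf_eq0[j ji].
  by rewrite hornerXsubC (negbTE (a_inj _ _ _))// eq_sym.
pose ev (p : {poly C}) : Pol := (map_poly (@mpolyC n C) p).[x].
have evM p q : ev (p * q) = ev p * ev q by rewrite /ev rmorphM hornerM.
have evX b : ev ('X - b%:P) = x - mpolyC n b by rewrite /ev rmorphB /= map_polyX map_polyC hornerXsubC.
have evr : ev r = \sum_i c i *: \prod_(j | j != i) X j.
  rewrite /ev rmorph_sum horner_sum; apply: eq_bigr => i _.
  rewrite -mul_polyC rmorphM /= map_polyC hornerCM -mul_mpolyC; congr (_ * _).
  by rewrite rmorph_prod horner_prod; apply: eq_bigr => j _; exact: evX.
have sl : S (s l) by have := (Hlg (a i0)).1; rewrite (ai i0).1.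
have Jr : J (ev r).
  have : J (s l * ev r).
    have -> : s l * ev r = \sum_i mpolyC n (c i) * (s l * \prod_(j | j != i) X j - (lg (a i)).2 * \prod_j X j).
      rewrite (eq_bigr (fun i => s l * (c i *: \prod_(j | j != i) X j) - (c i *: (lg (a i)).2) * \prod_j X j)).
        by rewrite sumrB -mulr_suml cg mul0r subr0 -mulr_sumr -evr.
      by move=> i _; rewrite -!mul_mpolyC; ring.
    by apply: mideal_sum => // i _; exact: JM.
  by case/pJ => // /(SJ _ sl).
have [z Hz] := closed_field_poly_normal r.
have : J (\prod_(b <- z) (x - mpolyC n b)).
  have ez w : ev (\prod_(b <- w) ('X - b%:P)) = \prod_(b <- w) (x - mpolyC n b).
    elim: w => [|b w IH]; first by rewrite !big_nil /ev rmorph1 hornerC.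
    by rewrite !big_cons evM evX IH.
  have e : \prod_(b <- z) (x - mpolyC n b) = mpolyC n (lead_coef r)^-1 * ev r.
    rewrite Hz /ev -mul_polyC rmorphM /= map_polyC hornerCM mulrA -rmorphM /=.
    rewrite lead_coefM lead_coefC (monicP (monic_prod_XsubC _ _ _)) mulr1 mulVf ?lead_coef_eq0// rmorph1 mul1r.
    by rewrite -ez.
  by rewrite e; exact: JM.
elim: z {Hz} => [|b z IH]; first by rewrite big_nil; exact: SJ.
by rewrite big_cons => /pJ[/no//|].
Qed.

(** Take an ideal maximal among those that contain [I] and avoid all products of the [q i]. It is
    prime, and by [prime_constant] each variable is congruent to a constant modulo it; these
    constants are the coordinates of the point. *)
Theorem countable_nullstellensatz I (q : nat -> Pol) : mideal I ->
  (forall l : seq nat, ~ I (\prod_(i <- l) q i)) ->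
  exists v : 'rV[C]_n, (forall p, I p -> meval (v 0) p = 0) /\ forall i, meval (v 0) (q i) != 0.
Proof.
move=> iI Iq; pose s l := \prod_(i <- l) q i; pose S p := exists l, p = s l.
have [|J [iJ IJ SJ mJ]] := mideal_maximal (S := S) iI; first by move=> _ [l ->]; exact: Iq.
have [J0 JB JM] := iJ.
have S1 : S 1 by exists [::]; rewrite /s big_nil.
have SM p p' : S p -> S p' -> S (p * p') by move=> [l ->] [l' ->]; exists (l ++ l'); rewrite /s big_cat.
have pJ p p' : J (p * p') -> J p \/ J p'.
  move=> Jpp; apply: contrapT => /not_orP[/mJ[a [g [Sa Ja]]] /mJ[b [h [Sb Jb]]]].
  apply: (SJ _ (SM _ _ Sa Sb)).
  have -> : a * b = b * (a - g * p) + (g * p) * (b - h * p') + (g * h) * (p * p') by ring.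
  by rewrite addrC; apply: midealD => //; [exact: JM|apply: midealD => //; exact: JM].
have /choice[v Hv] i : exists a, J (mpolyX C (mnm1 i) - mpolyC n a).
  by apply: (prime_constant _ (S := S) (s := s)).
pose w : 'rV[C]_n := \row_i v i.
have wE p : J (p - mpolyC n (meval (w 0) p)).
  pose T p := J (p - mpolyC n (meval (w 0) p)).
  have TM a b : T a -> T b -> T (a * b).
    rewrite /T => Ta Tb; rewrite mevalM rmorphM /=; set a' := mpolyC n _; set b' := mpolyC n _.
    have -> : a * b - a' * b' = b * (a - a') + a' * (b - b') by ring.
    by apply: midealD => //; exact: JM.
  have TC c : T (mpolyC n c) by rewrite /T mevalC subrr.
  have TX i : T (mpolyX C (mnm1 i)) by rewrite /T mevalXU mxE.
  have TXX i m : T (mpolyX C (mnm1 i) ^+ m).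
    by elim: m => [|m IH]; [rewrite expr0 -[1]mpolyC1; exact: TC|rewrite exprS; exact: TM].
  have Tm m : T (mpolyX C m).
    rewrite mpolyXE_id; elim/big_ind: _ => //; first by rewrite -[1]mpolyC1; exact: TC.
  have TD a b : T a -> T b -> T (a + b).
    by rewrite /T mevalD rmorphD /= opprD addrACA; exact: midealD.
  elim/mpolyind: p => [|c m p _ _ IH]; first by rewrite -[0]mpolyC0; exact: TC.
  by apply: TD => //; rewrite -mul_mpolyC; exact: TM.
have J1 c : J (mpolyC n c) -> c = 0.
  move=> Jc; apply: contrapT => /eqP c0; apply: (SJ _ S1).
  by rewrite -[1]mpolyC1 -(mulVf c0) rmorphM; exact: JM.
exists w; split=> [p /IJ Jp|i].
  by apply: J1; have := JB _ _ Jp (wE p); rewrite opprB addrC subrK.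
apply: contra_notN (SJ (q i) _) => [/eqP e|]; last by exists [:: i]; rewrite /s big_seq1.
by have := wE (q i); rewrite e mpolyC0 subr0.
Qed.
End CountableNullstellensatz.

(** * Linear subspaces, the codimension of the whole space and countable covers *)

Section IrreducibleSets.
Local Open Scope classical_set_scope.
Variables (R : realType) (k : nat).
Local Notation C := R[i].
Local Notation P := (proj_space C k).
Local Notation V := 'rV[C]_k.+1.
Implicit Types (A B L M : set P) (q : V -> C).

(** A monomial of degree [n] in [k + 1] variables is determined by [k] exponents, each at most [n];
    there are thus at most [(n + 1)^k] independent forms. *)
Lemma codim_ge0 A : codim_ge 0 A.
Proof.
exists 1%N => n r [u [hu Hu]]; rewrite expn0 muln1 mul1n leqNgt; apply/negP => lt.
have /choice[p Hp] i : exists p : dhomog k.+1 C n, forall v, u i v = meval (v 0) (mpoly_of_dhomog p).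
  exact: hform_to_dhomog (hu i).
pose I := {ffun 'I_k -> 'I_n.+1}; pose N := #|{: I}|.
pose mon (m : I) : multinom k.+1 :=
  Multinom (mktuple (fun i => if unlift ord0 i is Some j then m j : nat else (n - \sum_j m j)%N)).
pose U := \matrix_(i < r, j < N) mcoeff (mon (enum_val j)) (mpoly_of_dhomog (p i)).
have : kermx U != 0.
  rewrite kermx_eq0 /row_free neq_ltn; apply/orP; left; apply: leq_ltn_trans (rank_leq_col _) _.
  by rewrite /N card_ffun !card_ord.
case/rowV0Pn => c /sub_kermxP cU /eqP; apply; apply: Hu => a _.
pose g := \sum_i c 0 i *: mpoly_of_dhomog (p i).
have -> : \sum_i c 0 i * u i (hcoord a) = meval (hcoord a 0) g.
  by rewrite raddf_sum; apply: eq_bigr => i _; rewrite /= mevalZ Hp.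
suff -> : g = 0 by rewrite meval0.
apply/mpolyP => m; rewrite mcoeff0 raddf_sum /=.
have [mn|mn] := eqVneq (mdeg m) n; last first.
  by rewrite big1// => i _; rewrite mcoeffZ (dhomog_nemf_coeff (dhomog_is_dhomog (p i)))// mulr0.
have sm : (\sum_(j < k) m (lift ord0 j) + m ord0)%N = n by rewrite -mn mdegE big_ord_recl addnC.
have mj j : (m (lift ord0 j) < n.+1)%N.
  by rewrite ltnS -sm (bigD1 j)//= -addnA leq_addr.
pose f : I := [ffun j => Ordinal (mj j)].
have -> : m = mon f.
  apply/mnmP => i; rewrite multinomE tnth_mktuple; case: unliftP => [j ->|->]; first by rewrite ffunE.
  rewrite -[in LHS](addKn (\sum_(j < k) m (lift ord0 j)) (m ord0)) sm; congr (_ - _)%N.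
  by apply: eq_bigr => j _; rewrite ffunE.
have /rowP/(_ (enum_rank f)) := cU; rewrite !mxE => h; rewrite -[RHS]h.
by apply: eq_bigr => i _; rewrite mcoeffZ mxE enum_rankK.
Qed.

Lemma van_line q e L (v : V) (v0 : v != 0) : hform e q -> van q L -> L (line v0) -> q v = 0.
Proof. by move=> hq qL Lv; apply/eqP; rewrite -(hform_line_eq0 v0 hq) qL. Qed.

Lemma linear_irreducible (i : 'I_k.+1) :
  irreducible [set p : P | forall j : 'I_k.+1, (j < i)%N -> hcoord p 0 j = 0].
Proof.
set L := [set p | _]; have lineL (v : V) (v0 : v != 0) : L (line v0) <-> forall j : 'I_k.+1, (j < i)%N -> v 0 j = 0.
  have h j := hform_line_eq0 v0 (hform_coord R j).
  by split=> H j ji; apply/eqP; [rewrite -h H|rewrite h H].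
split.
- apply/algebraicP => p /existsNP[j /not_implyP[ji /eqP pj]].
  by exists 1%N, (fun v => v 0 j); [exact: hform_coord|split=> // p'; apply].
- have d0 : delta_mx 0 i != 0 :> V by apply/eqP => /rowP/(_ i)/eqP; rewrite !mxE !eqxx oner_eq0.
  exists (line d0); apply/lineL => j ji; rewrite mxE eqxx /=; case: eqP ji => // ->.
  by rewrite ltnn.
move=> A1 A2 a1 a2 LA; apply: contrapT => /not_orP[/existsNP[p1 /not_implyP[L1 n1]] /existsNP[p2 /not_implyP[L2 n2]]].
have [e1 [q1 hq1 [v1 q1p]]] := (algebraicP _).1 a1 p1 n1.
have [e2 [q2 hq2 [v2 q2p]]] := (algebraicP _).1 a2 p2 n2.
set x1 := hcoord p1; set x2 := hcoord p2.
have [r1 Hr1] := pf_line x1 (x2 - x1) hq1.1; have [r2 Hr2] := pf_line x1 (x2 - x1) hq2.1.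
have pi0 j : exists2 r : {poly C}, (forall t, (x1 + t *: (x2 - x1)) 0 j = r.[t]) & (x1 0 j != 0 -> r != 0).
  have [r Hr] := pf_line x1 (x2 - x1) (pf_coord R j); exists r => //.
  by apply: contraNneq => r0; have := Hr 0; rewrite scale0r addr0 r0 horner0 => ->.
have [j xj] : exists j, x1 0 j != 0.
  apply/existsP; apply: contraNT (hcoord_neq0 p1) => /existsPn H; apply/eqP/rowP => j.
  by apply/eqP; rewrite mxE -[_ == _]negbK H.
have [r Hr /(_ xj) r0] := pi0 j.
have r10 : r1 != 0 by apply: contraNneq q1p => r0'; have := Hr1 0; rewrite scale0r addr0 r0' horner0 => ->.
have r20 : r2 != 0.
  by apply: contraNneq q2p => r0'; have := Hr2 1; rewrite scale1r addrC subrK r0' horner0 => ->.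
have [|t [_ _]] := nonroot_near 0 (w := r * (r1 * r2)) _ ltr01; first by rewrite !mulf_neq0.
rewrite !hornerM !mulf_eq0 !negb_or => /andP[rt /andP[rt1 rt2]].
set x := x1 + t *: (x2 - x1).
have x0 : x != 0 by apply: contraNneq rt => x0; rewrite -Hr -/x x0 mxE.
have : L (line x0).
  by apply/lineL => l li; rewrite !mxE (L1 l li) (L2 l li) subrr mulr0 addr0.
by case/LA => [A1x|A2x]; [have := van_line hq1 v1 A1x|have := van_line hq2 v2 A2x];
  rewrite /x ?Hr1 ?Hr2 => /eqP; apply/negP.
Qed.

Lemma setT_irreducible : irreducible [set: P].
Proof.
suff -> : [set: P] = [set p : P | forall j : 'I_k.+1, (j < @ord0 k)%N -> hcoord p 0 j = 0].
  exact: linear_irreducible.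
by apply/seteqP; split.
Qed.

Lemma codim_ge1_zero e q : hform e q -> (exists p : P, q (hcoord p) != 0) ->
  codim_ge 1 [set p : P | q (hcoord p) = 0].
Proof.
move=> hq [p qp]; apply: (codim_ge_strict setT_irreducible _ hq) (codim_ge0 _) => //.
by move=> /(_ p I) /eqP; rewrite (negbTE qp).
Qed.

(** Otherwise, descending along a flag of coordinate subspaces, each step adding one to the
    codimension, would give a point codimension [k + 1], which only the empty set has. *)
Lemma codim_setT : ~ codim_ge 1 [set: P].
Proof.
move=> c1; pose L i := [set p : P | forall j : 'I_k.+1, (j < i)%N -> hcoord p 0 j = 0].
have main i : (i <= k)%N -> codim_ge i.+1 (L i).
  elim: i => [_|i IH ik]; first by apply: codim_geS c1.
  have ik' : (i < k.+1)%N by exact: ltnW.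
  apply: (codim_ge_strict (linear_irreducible (Ordinal ik')) (e := 1) (q := fun v => v 0 (Ordinal ik'))) => //=.
  - by move=> p Lp j ji; apply: Lp; exact: ltnW.
  - exact: hform_coord.
  - by move=> p; apply; rewrite /= ltnSn.
  - have d0 : delta_mx 0 (Ordinal ik') != 0 :> V.
      by apply/eqP => /rowP/(_ (Ordinal ik'))/eqP; rewrite !mxE !eqxx oner_eq0.
    have hc j := hform_line_eq0 d0 (hform_coord R j).
    move=> h; suff /h/eqP : L i (line d0) by rewrite hc mxE !eqxx oner_eq0.
    move=> j ji; apply/eqP; rewrite hc mxE eqxx /=.
    have /negbTE -> : j != Ordinal ik' by apply: contraTneq ji => ->; rewrite /= ltnn.
    by rewrite eqxx.
  - exact: IH (ltnW ik).
have := codim_ge_empty (main k (leqnn k)); apply/eqP/set0P.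
by have [_ + _] := linear_irreducible (@ord_max k).
Qed.

(** If [L] is in none of the [A j], there are forms vanishing on [A j] but not on [L]. Their
    products do not vanish on [L], so the Nullstellensatz finds a point of [L] where none of them
    vanishes, outside every [A j]. *)
Lemma irreducible_countable L (A : nat -> set P) : irreducible L -> (forall j, algebraic (A j)) ->
  L `<=` \bigcup_j A j -> exists j, L `<=` A j.
Proof.
move=> irrL aA LA; apply: contrapT => /forallNP no.
have /choice[x Hx] j : exists x : nat * (V -> C), [/\ hform x.1 x.2, van x.2 (A j) & ~ van x.2 L].
  have /existsNP[p /not_implyP[Lp nAp]] := no j.
  have [e [q hq [qA qp]]] := (algebraicP _).1 (aA j) p nAp.
  by exists (e, q); split=> // /(_ p Lp) /eqP; rewrite (negbTE qp).
have [_ [p0 Lp0] _] := irrL.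
have [j0 pj0] : exists j, hcoord p0 0 j != 0.
  apply/existsP; apply: contraNT (hcoord_neq0 p0) => /existsPn H; apply/eqP/rowP => j.
  by apply/eqP; rewrite mxE -[_ == _]negbK H.
(* A coordinate that is not identically zero on [L] heads the list, so that the vector found is
   nonzero and defines a point. *)
pose y (j : nat) : nat * (V -> C) := if j is j'.+1 then x j' else (1%N, fun v : V => v 0 j0).
have Hy j : hform (y j).1 (y j).2 /\ ~ van (y j).2 L.
  case: j => [|j]; last by case: (Hx j).
  by split=> [|/(_ p0 Lp0) /eqP]; [exact: hform_coord|rewrite /= (negbTE pj0)].
have /choice[m Hm] j : polyfun (y j).2 by case: (Hy j) => -[].
pose I (p : mpoly k.+1 C) := forall v : V, (forall q e, hform e q -> van q L -> q v = 0) -> meval (v 0) p = 0.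
have [||v [Iv vm]] := @countable_nullstellensatz R k.+1 I m.
- split; first by move=> v _; rewrite meval0.
  + by move=> p q Ip Iq v Hv; rewrite mevalB Ip// Iq// subrr.
  + by move=> p q Iq v Hv; rewrite mevalM Iq// mulr0.
- move=> l Il; have prodE : forall v : V, meval (v 0) (\prod_(i <- l) m i) = \prod_(i <- l) (y i).2 v.
    by move=> v; rewrite rmorph_prod; apply: eq_bigr => i _; rewrite Hm.
  have hl : exists e, hform e (fun v : V => \prod_(i <- l) (y i).2 v) /\ ~ van (fun v : V => \prod_(i <- l) (y i).2 v) L.
    elim: (l) => [|j l' [e [he ne]]].
      exists 0%N; split=> [|/(_ p0 Lp0)/eqP]; last by rewrite big_nil oner_eq0.
      split=> [|c v]; last by rewrite !big_nil expr0 mulr1.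
      by apply: (@pf_ext _ _ (fun=> 1)) => [|v]; [exact: pf_cst|rewrite big_nil].
    exists ((y j).1 + e)%N; have [hj nj] := Hy j.
    have E : (fun v : V => \prod_(i <- j :: l') (y i).2 v) = (fun v : V => (y j).2 v * \prod_(i <- l') (y i).2 v).
      by apply/funext => v; rewrite big_cons.
    by rewrite E; split=> [|/(irreducible_prime irrL hj he)[]//]; exact: hformM.
  have [e [he ne]] := hl; apply: ne => p Lp; rewrite -prodE; apply: Il => q e' hq qL; exact: qL.
have v0 : v != 0 by apply: contraNneq (vm 0%N) => v0; rewrite -Hm v0 /= mxE.
have Lv : L (line v0).
  apply: contrapT => nLv; have [aL _ _] := irrL.
  have [e [q hq [qL]]] := (algebraicP _).1 aL _ nLv; rewrite (hform_line_eq0 v0 hq) => /eqP; apply.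
  have [mq Hmq] := hq.1; rewrite Hmq; apply: Iv => w Hw; rewrite -Hmq; exact: (Hw q e).
have [j _ Aj] := LA _ Lv; have [hj vj _] := Hx j.
have := vm j.+1; rewrite -Hm /= (van_line hj vj Aj).
by rewrite eqxx.
Qed.
End IrreducibleSets.

(** * Homogeneous maps and their iterates *)

Section HomogeneousMaps.
Variable R : realType.
Local Notation C := R[i].
Variable n d : nat.
Local Notation V := 'rV[C]_n.+1.
Variable F : V -> V.
Hypotheses (hF : forall j, hform d (fun v => F v 0 j)) (Fn0 : forall v, v != 0 -> F v != 0) (d1 : (1 < d)%N).

Let d0 : (0 < d)%N. Proof. exact: ltnW. Qed.

Lemma homZ c v : F (c *: v) = c ^+ d *: F v.
Proof. by apply/rowP => j; rewrite mxE; exact: (hF j).2. Qed.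

Lemma hom_pmap : pmap F. Proof. by move=> j; exact: (hF j).1. Qed.

Lemma hom0 : F 0 = 0.
Proof. by have := homZ 0 0; rewrite scale0r expr0n (gtn_eqF d0) scale0r. Qed.

Lemma nm_scale1 (v : V) : v != 0 -> nm (((nm v)^-1)%:C%C *: v) = 1.
Proof.
by move=> v0; rewrite nmZ ncR ger0_norm ?invr_ge0 ?nm_ge0// mulVf// nm_eq0.
Qed.

Lemma hom_bounds : exists c : R, 0 < c /\ forall v, nm v ^+ d <= c * nm (F v) /\ nm (F v) <= c * nm v ^+ d.
Proof.
pose S (v : V) := nm v = 1.
have cS : cpt S.
  split; first by exists 1 => v ->.
  move=> u l ul Hu; have := nm_cv ul; rewrite /S => h.
  apply/eqP; rewrite -subr_eq0 -normr_le0; apply/ler_addgt0Pr => e e0.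
  by have [N /(_ N (leqnn N))] := h e e0; rewrite Hu add0r distrC => /ltW.
have sc : scont S (fun v => nm (F v)) by move=> u l _ _ ul; exact: nm_cv (pmap_cv hom_pmap ul).
have scN : scont S (fun v => - nm (F v)).
  move=> u l _ _ ul e e0; have [N HN] := nm_cv (pmap_cv hom_pmap ul) e0.
  by exists N => k /HN; rewrite /= -opprD normrN.
have exS : exists v, S v.
  exists (delta_mx 0 ord0); rewrite /S /nm big_ord_recl big_ord0 addr0 (bigD1 ord0)//= big1 ?addr0.
    by rewrite mxE !eqxx nc1.
  by move=> j j0; rewrite mxE (negbTE j0) andbF nc0.
have [x Sx Hx] := evt cS exS sc; have [y Sy Hy] := evt cS exS scN.
have y0 : y != 0 by apply: contra_eqN Sy => /eqP ->; rewrite nm0 eq_sym oner_eq0.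
have Fy : 0 < nm (F y) by rewrite nm_gt0 Fn0.
exists (nm (F x) + (nm (F y))^-1); split; first by rewrite ltr_wpDl ?nm_ge0// invr_gt0.
move=> v; have [->|v0] := eqVneq v 0; first by rewrite hom0 !nm0 expr0n (gtn_eqF d0) !mulr0.
have vp : 0 < nm v by rewrite nm_gt0.
have := nm_scale1 v0; set w := _ *: v => w1.
have vE : v = ((nm v)%:C)%C *: w by rewrite /w scalerA -rmorphM divff ?lt0r_neq0// rmorph1 scale1r.
have FE : nm (F v) = nm v ^+ d * nm (F w) by rewrite {1}vE homZ nmZ ncX ncR gtr0_norm.
have vd : 0 < nm v ^+ d by rewrite exprn_gt0.
have := Hx w w1; have := Hy w w1; rewrite lerN2 => h1 h2; rewrite FE; split.
  rewrite mulrCA ler_peMr ?(ltW vd)// mulrDl.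
  have : 1 <= (nm (F y))^-1 * nm (F w) by rewrite ler_pdivlMl// mulr1.
  by have : 0 <= nm (F x) * nm (F w) by [rewrite mulr_ge0 ?nm_ge0]; lra.
rewrite mulrC ler_pM2r// (le_trans h2)// lerDl invr_ge0 nm_ge0.
by [].
Qed.

Lemma hom_proper : exists cp : R, forall z, nm z <= cp * (1 + nm (F z)).
Proof.
have [c [c0 Hc]] := hom_bounds; exists (1 + c) => z.
have [z1|z1] := leP (nm z) 1.
  apply: le_trans z1 _; have := nm_ge0 (F z); nra.
have h : nm z <= nm z ^+ d by rewrite -[leLHS]expr1 ler_weXn2l ?(ltW z1).
have [h1 _] := Hc z; have := nm_ge0 (F z); nra.
Qed.

Variable M : V -> V -> 'M[C]_n.+1.
Hypothesis FM : bez F M.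

Lemma poly_eq0 (p q : {poly C}) : (forall t, t != 0 -> p.[t] = q.[t]) -> p.[0] = q.[0].
Proof.
move=> H; suff /eqP : p - q = 0 by rewrite subr_eq0 => /eqP ->.
by apply: poly_zero => t t0; rewrite !hornerE H// subrr.
Qed.

Lemma bez_row_poly (w y x : V) j : exists p : {poly C}, forall t, (w *m M (y + t *: x) y) 0 j = p.[t].
Proof.
have pf : polyfun (fun v => (w *m M v y) 0 j).
  apply: (@pf_ext _ _ (fun v => \sum_k w 0 k * M v y k j)) => [|v]; last by rewrite mxE.
  by apply: pf_sum => k _; apply: pfM; [exact: pf_cst|exact: pm2_fix FM.1 _ _].
exact: (pf_line y x pf).
Qed.

(** Divided differences are not unique and [M] need not be homogeneous off the diagonal. On it, [M]
    is the Jacobian: both sides are compared along lines at [t <> 0], where they are determined by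
    [F], and the polynomial identity is extended to [t = 0]. *)
Lemma bez_diagZ c z : c != 0 -> M (c *: z) (c *: z) = c ^+ d.-1 *: M z z.
Proof.
move=> c0; apply/row_matrixP => i; apply/rowP => j; rewrite !rowE.
set w := delta_mx 0 i.
have [p Hp] := bez_row_poly w (c *: z) (c *: w) j; have [q Hq] := bez_row_poly w z w j.
have : p.[0] = (c ^+ d.-1 *: q).[0].
  apply: poly_eq0 => t t0; rewrite hornerZ -Hp -Hq.
  have h : F (c *: z + t *: (c *: w)) - F (c *: z) = c ^+ d *: (F (z + t *: w) - F z).
    by rewrite scalerBr -!homZ scalerDr !scalerA (mulrC c).
  have e1 : c *: z + t *: (c *: w) - c *: z = (t * c) *: w by rewrite addrC addKr scalerA.
  have e2 : z + t *: w - z = t *: w by rewrite addrC addKr.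
  have tc0 : t * c != 0 by rewrite mulf_neq0.
  have -> : w *m M (c *: z + t *: (c *: w)) (c *: z) = c ^+ d.-1 *: (w *m M (z + t *: w) z).
    apply: (scalerI tc0); move: h; rewrite !FM.2 e1 e2 -!scalemxAl => ->.
    by rewrite !scalerA; congr (_ *: _); rewrite -[in LHS](prednK d0) exprS; ring.
  by rewrite mxE.
by rewrite hornerZ -Hp -Hq !scale0r !addr0 => ->; rewrite -scalemxAr [RHS]mxE.
Qed.

Lemma euler z : z *m M z z = d%:R *: F z.
Proof.
apply/rowP => j; have [p Hp] := bez_row_poly z z z j.
have E t : t != 0 -> p.[t] = (F z 0 j *: \sum_(i < d) (1 + 'X) ^+ i).[t].
  move=> t0; have := FM.2 (z + t *: z) z; rewrite [z + _ - _]addrC addKr -scalemxAl => /rowP/(_ j).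
  rewrite mxE [RHS]mxE Hp -[z + _]/(z + _) -{1}[z]scale1r -scalerDl homZ !mxE => e.
  apply: (mulfI t0); rewrite -e hornerZ horner_sum.
  rewrite (eq_bigr (fun i : 'I_d => (1 + t) ^+ i)) => [|i _]; last by rewrite horner_exp !hornerE.
  have := subrX1 (1 + t) d; rewrite [1 + t - 1]addrC addKr => e2.
  by rewrite mulrCA -e2; ring.
have := poly_eq0 E; rewrite -Hp scale0r addr0 mxE => ->.
rewrite hornerZ horner_sum (eq_bigr (fun=> 1)) => [|i _]; last by rewrite horner_exp !hornerE expr1n.
by rewrite sumr_const card_ord mulrC mxE.
Qed.

Definition jac z := \det (M z z).

Lemma hform_jac : hform (n.+1 * d.-1) jac.
Proof.
have pJ : polyfun jac by apply: pf_det; exact: pm2_diag FM.1.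
split=> // c v; have [p Hp] := pf_line 0 v pJ.
have E t : t != 0 -> jac (t *: v) = t ^+ (n.+1 * d.-1) * jac v.
  by move=> t0; rewrite /jac bez_diagZ// detZ -exprM mulnC.
have [->|] := eqVneq c 0; last exact: E.
have := @poly_eq0 p ((jac v) *: 'X^(n.+1 * d.-1)) _.
rewrite -Hp hornerZ hornerXn !add0r mulrC; apply=> t t0.
by rewrite hornerZ hornerXn -Hp add0r E// mulrC.
Qed.

Lemma jac_neq0 : exists z, jac z != 0.
Proof. by have [cp Hcp] := hom_proper; exact: det_generic hom_pmap FM Hcp. Qed.

(** On the affine line [a + t *: b] the form either has a root or is a nonzero constant, and in the
    latter case it vanishes at the point at infinity [b]. *)
Lemma hform_zero e q : (0 < n)%N -> (0 < e)%N -> hform e q -> exists2 v : V, v != 0 & q v = 0.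
Proof.
move=> n0 e0 [pq hq]; pose i0 : 'I_n.+1 := ord0; pose i1 : 'I_n.+1 := Ordinal (n0 : (1 < n.+1)%N).
pose a : V := delta_mx 0 i0; pose b : V := delta_mx 0 i1.
have i01 : i1 != i0 by [].
have [p Hp] := pf_line a b pq; have [sp|sp] := eqVneq (size p) 1%N.
  exists b; first by apply/eqP => /rowP/(_ i1)/eqP; rewrite !mxE !eqxx oner_eq0.
  have [c _ pE] := size_poly1P _ (introT eqP sp).
  have [r Hr] := pf_line b a pq.
  have E s : s != 0 -> r.[s] = (c *: 'X^e).[s].
    move=> s0; rewrite -Hr hornerZ hornerXn; have -> : b + s *: a = s *: (a + s^-1 *: b).
      by rewrite scalerDr scalerA mulfV// scale1r addrC.
    by rewrite hq Hp pE hornerC mulrC.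
  have := poly_eq0 E; rewrite -Hr scale0r addr0 => ->.
  by rewrite hornerZ hornerXn expr0n (gtn_eqF e0) mulr0.
have [x /rootP px] := closed_rootP _ sp.
exists (a + x *: b); last by rewrite Hp.
apply/eqP => /rowP/(_ i0)/eqP; rewrite !mxE !eqxx (_ : i0 == i1 = false)//.
by rewrite mulr0 addr0 oner_eq0.
Qed.
End HomogeneousMaps.

(** * A cone of lines along which a polynomial does not vanish *)

Section ConeExists.
Variable R : realType.
Local Notation C := R[i].
Variable n : nat.
Local Notation V := 'rV[C]_n.

Lemma pmap_eps (G : V -> V) z (e : R) : pmap G -> 0 < e ->
  exists2 r : R, 0 < r & forall w, nm (w - z) < r -> nm (G w - G z) < e.
Proof.
move=> pG e0; apply: contrapT => /forall2NP no.
have /choice[w Hw] (j : nat) : exists w, nm (w - z) < j.+1%:R^-1 /\ e <= nm (G w - G z).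
  have [|/existsNP[w /not_implyP[wj nw]]] := no j.+1%:R^-1; first by rewrite invr_gt0 ltr0n.
  by exists w; split=> //; rewrite leNgt; apply/negP.
have wz : cvs w z.
  move=> a /archi_inv[N Na]; exists N => j Nj; apply: lt_trans (Hw j).1 _.
  exact: le_lt_trans (inv_nat_le R Nj) Na.
have [N HN] := pmap_cv pG wz e0; have := HN N (leqnn N).
by rewrite ltNge (Hw N).2.
Qed.

Lemma cone_exists (Q : V -> C) (y : V) : polyfun Q -> (exists z, Q z != 0) ->
  exists (v : V) (eta r : R), [/\ 0 < eta, 0 < r & forall w t, nm (w - v) <= eta -> 0 < nc t <= 2 * r ->
    Q (y + t *: w) != 0].
Proof.
move=> pQ [z Qz]; have pq : polyfun (fun w => Q (y + w)).
  by apply: (pf_comp _ pQ) => j; apply: (@pf_ext _ _ (fun w : V => y 0 j + w 0 j)) => [|w]; [apply: pfD; [exact: pf_cst|exact: pf_coord]|rewrite mxE].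
have [N [p Hp]] := form_decomp pq; pose pe (e : 'I_N) (w : V) := meval (w 0) (mpoly_of_dhomog (p e)).
have hpe (e : 'I_N) : hform e (pe e) by exact: hform_dhomog.
have ex : exists m : nat, [exists e : 'I_N, (e == m :> nat) && `[< exists w, pe e w != 0 >]].
  apply: contrapT => /forallNP no; case/eqP: Qz.
  have -> : z = y + (z - y) by rewrite addrC subrK.
  rewrite Hp big1// => e _; apply/eqP/negPn/negP => nz; apply: (no e).
  by apply/existsP; exists e; rewrite eqxx; apply/asboolP; exists (z - y).
case: (ex_minnP ex) => m /existsP[e0 /andP[/eqP e0E /asboolP[v pv]]] minm.
have low (e : 'I_N) w : (e < e0)%N -> pe e w = 0.
  move=> ee; apply/eqP/negPn/negP => nz; have : (m <= e)%N; last by rewrite -e0E leqNgt ee.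
  by apply: minm; apply/existsP; exists e; rewrite eqxx; apply/asboolP; exists w.
have k0 : 0 < nc (pe e0 v) by rewrite nc_gt0.
have [eta eta0 Heta] := pf_eps v (hpe e0).1 (divr_gt0 k0 (ltr0n _ 2)).
have [K K0 HK] : exists2 K : R, 0 <= K & forall w, nm w <= nm v + eta -> forall e : 'I_N, nc (pe e w) <= K.
  have /choice[k Hk] e : exists k : R, 0 <= k /\ forall w, nm w <= nm v + eta -> nc (pe e w) <= k.
    by have [k kk H] := pf_lip (nm v + eta) (hpe e).1; exists k; split=> // w wb; have [] := H w w wb wb.
  exists (\sum_e k e); first by apply: sumr_ge0 => e _; exact: (Hk e).1.
  move=> w wb e; apply: le_trans ((Hk e).2 w wb) _; rewrite (bigD1 e)//= lerDl.
  by apply: sumr_ge0 => e' _; exact: (Hk e').1.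
have NK : 0 < N%:R * K + 1 by rewrite ltr_wpDl ?mulr_ge0 ?ler0n.
pose r := Num.min (1 / 2) (nc (pe e0 v) / 4 / (N%:R * K + 1)).
exists v, eta, r; split=> //; first by rewrite lt_min !divr_gt0.
move=> w t wv /andP[t0 tr].
have wb : nm w <= nm v + eta by have := nmB_ge w v; lra.
have t1 : nc t <= 1 by apply: le_trans tr _; rewrite mulrC -ler_pdivlMr// ge_min lexx.
have t2 : nc t * (N%:R * K + 1) <= nc (pe e0 v) / 2.
  rewrite -ler_pdivlMr//; apply: le_trans tr _; rewrite mulrC -ler_pdivlMr// ge_min; apply/orP; right.
  by rewrite [in leRHS]mulrAC -[nc (pe e0 v) / 2 / 2]mulrA -invfM -natrM.
have low' : 1 / 2 * nc (pe e0 v) < nc (pe e0 w).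
  have := Heta w wv; have := nc_tri (pe e0 w) (pe e0 v) 0; rewrite !subr0 ncBC; lra.
have pt e : pe e (t *: w) = t ^+ e * pe e w by exact: (hpe e).2.
have -> : Q (y + t *: w) = t ^+ e0 * (pe e0 w + t * \sum_(e < N | (e0 < e)%N) t ^+ (e - e0.+1) * pe e w).
  rewrite Hp (bigD1 e0)//= -/(pe e0 _) pt mulrDr; congr (_ + _).
  rewrite (bigID (fun e : 'I_N => (e0 < e)%N))/= [X in _ + X]big1 ?addr0; last first.
    move=> e /andP[ee]; rewrite -leqNgt leq_eqVlt (negPf (ee : (e : nat) != e0))/= => h.
    by rewrite -/(pe e _) pt low// mulr0.
  rewrite mulrA -exprSr mulr_sumr; apply: eq_big => [e|e /andP[_ h]].
    by case: ltnP => h; rewrite ?andbF// andbT; apply/eqP => h'; move: h; rewrite h' ltnn.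
  by rewrite -/(pe e _) pt mulrA -exprD subnKC.
rewrite mulf_neq0// ?expf_neq0 -?nc_gt0//.
set S := \sum_(e < N | _) _.
have SK : nc S <= N%:R * K.
  apply: le_trans (nc_sum _ _ _) _; apply: (@le_trans _ _ (\sum_(e < N) K)).
    rewrite big_mkcond; apply: ler_sum => e _; case: ifP => // _; rewrite ncM ncX -[leRHS]mul1r.
    by apply: ler_pM; rewrite ?exprn_ge0 ?nc_ge0//; [apply: exprn_ile1; rewrite ?nc_ge0|exact: HK].
  by rewrite sumr_const card_ord -[_ *+ N]mulr_natl.
have := ncB_ge (pe e0 w) (- (t * S)); rewrite opprK ncN ncM => h.
have : nc t * nc S <= nc t * (N%:R * K) by rewrite ler_wpM2l ?nc_ge0.
move: t2; rewrite mulrDr mulr1; lra.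
Qed.
End ConeExists.

(** * Estimates uniform in the iterate *)

Section Iterates.
Variable R : realType.
Local Notation C := R[i].
Variable n d : nat.
Local Notation V := 'rV[C]_n.+1.
Variables (F : V -> V) (M : V -> V -> 'M[C]_n.+1).
Hypotheses (hF : forall j, hform d (fun v => F v 0 j)) (Fn0 : forall v, v != 0 -> F v != 0) (d1 : (1 < d)%N)
  (FM : bez F M).

Fixpoint Mit m (x y : V) : 'M[C]_n.+1 :=
  if m is m'.+1 then Mit m' x y *m M (iter m' F x) (iter m' F y) else 1%:M.

Lemma pmap_iter m : pmap (iter m F).
Proof.
elim: m => [|m IH]; first exact: pmap_id.
by move=> j; apply: (pf_comp _ (hom_pmap hF j)); exact: IH.
Qed.

Lemma bez_iter m : bez (iter m F) (Mit m).
Proof.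
elim: m => [|m IH]; last exact: (bez_comp (pmap_iter m) IH FM).
by split=> [i j|x y]; [exact: pf_cst|rewrite mulmx1].
Qed.

Lemma det_iter m z : \det (Mit m z z) = \prod_(i < m) jac M (iter i F z).
Proof.
elim: m => [|m IH]; first by rewrite big_ord0 det1.
by rewrite big_ord_recr -IH /= det_mulmx.
Qed.

Lemma iter_neq0 m v : v != 0 -> iter m F v != 0.
Proof. by move=> v0; elim: m => // m; exact: Fn0. Qed.

(** Since [d >= 2], [F] increases the norm outside the radius [max 1 c] and decreases it inside the
    radius [min 1 c^-1]. These comparisons survive iteration without loss, so both constants serve
    all [m]. *)
Lemma iter_bounds : exists cp b : R, [/\ 1 <= cp, 0 < b,
  forall m z, nm z <= cp * (1 + nm (iter m F z)) & forall m z, Num.min b (nm (iter m F z)) <= nm z].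
Proof.
have [c [c0 Hc]] := hom_bounds hF Fn0 d1.
have B1 : 1 <= Num.max 1 c by rewrite le_max lexx.
have b0 : 0 < Num.min 1 c^-1 by rewrite lt_min ltr01 invr_gt0.
have d2 : d = (d - 2).+2 by rewrite -[LHS](subnKC d1).
have H1 z : nm z <= Num.max (Num.max 1 c) (nm (F z)).
  rewrite le_max; case: (leP (nm z) (Num.max 1 c)) => //=; rewrite gt_max => /andP[z1 zc].
  have [h _] := Hc z; rewrite -(ler_pM2l c0); apply: le_trans h; rewrite d2 exprS exprS.
  apply: ler_pM; rewrite ?nm_ge0 ?(ltW c0) ?(ltW zc)//.
  by rewrite -[leLHS]mulr1 ler_wpM2l ?nm_ge0// exprn_ege1// ltW.
have H2 z : Num.min (Num.min 1 c^-1) (nm (F z)) <= nm z.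
  rewrite ge_min; case: (leP (Num.min 1 c^-1) (nm z)) => //=; rewrite lt_min => /andP[z1 zc].
  have [_ h] := Hc z; apply: le_trans h _; rewrite d2 exprS mulrA.
  have zc' : c * nm z <= 1 by rewrite mulrC -ler_pdivlMr// div1r ltW.
  rewrite -[leRHS]mul1r; apply: ler_pM => //.
  - by rewrite mulr_ge0 ?nm_ge0 ?(ltW c0).
  - by rewrite exprn_ge0 ?nm_ge0.
  - by rewrite exprS -[leRHS]mulr1 ler_wpM2l ?nm_ge0// exprn_ile1 ?nm_ge0// ltW.
exists (Num.max 1 c), (Num.min 1 c^-1); split=> //.
  move=> m z; apply: (@le_trans _ _ (Num.max (Num.max 1 c) (nm (iter m F z)))).
    elim: m => [|m IH]; first by rewrite le_max lexx orbT.
    apply: le_trans IH _; rewrite ge_max; apply/andP; split; first by rewrite le_max lexx.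
    exact: H1.
  set K := Num.max 1 c in B1 *; have := nm_ge0 (iter m F z) => g.
  rewrite ge_max mulrDr mulr1; apply/andP; split; first by rewrite lerDl mulr_ge0//; lra.
  have : 1 * nm (iter m F z) <= K * nm (iter m F z) by rewrite ler_wpM2r.
  lra.
elim=> [|m IH] z; first by rewrite ge_min lexx orbT.
apply: le_trans (IH z); rewrite le_min; apply/andP; split; first by rewrite ge_min lexx.
exact: H2.
Qed.

Variables (e : nat) (P : V -> C).
Hypotheses (hPf : hform e P) (e0 : (0 < e)%N) (P0 : exists c, P c != 0)
  (Pcrit : forall i z, z != 0 -> jac M z = 0 -> P (iter i.+1 F z) = 0).

Lemma form0 : P 0 = 0.
Proof. by have := hPf.2 0 0; rewrite scale0r expr0n (gtn_eqF e0) mul0r. Qed.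

Lemma iter0 m : iter m F 0 = 0.
Proof. by elim: m => //= m ->; exact: (hom0 hF d1). Qed.

Lemma reg_jac i z : P (iter i.+1 F z) != 0 -> jac M z != 0.
Proof.
move=> Pz; apply: contraNneq Pz => Jz; have [->|z0] := eqVneq z 0; last by rewrite Pcrit.
by rewrite iter0 form0.
Qed.

Variable cp : R.
Hypothesis hcp : forall m z, nm z <= cp * (1 + nm (iter m F z)).

Lemma cover_iter m : cover_map (iter m F) (Mit m) P cp.
Proof.
split; [exact: pmap_iter|exact: bez_iter|exact: hcp|exact: hPf.1|].
move=> z Pz; rewrite det_iter; apply/prodf_neq0 => i _; apply: (@reg_jac (m - i.+1)).
suff -> : iter (m - i.+1).+1 F (iter i F z) = iter m F z by [].
by rewrite -iterD subnSK ?ltn_ord// subnK// ltnW.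
Qed.

Let hM1 : exists z, \det (M z z) != 0.
Proof. exact: (jac_neq0 hF Fn0 d1 FM). Qed.

Let cov1 : cover_map F M P cp.
Proof.
split; [exact: hom_pmap hF|exact: FM|exact: (hcp 1)|exact: hPf.1|].
by move=> z Pz; exact: (@reg_jac 0).
Qed.

(** Exponents multiply under composition. A step at a noncritical point contributes 1 by the inverse
    function theorem, and a step at a critical point contributes the number of sheets of [F]. *)
Lemma loja_iter : exists2 D : nat, (0 < D)%N & forall m z, exists c r : R, [/\ 0 <= c, 0 < r &
  forall w, nm (w - z) < r -> nm (w - z) ^+ (D ^ (\sum_(i < m) ((jac M (iter i F z) == 0)%R : nat))) <=
    c * nm (iter m F w - iter m F z)].
Proof.
have [y0 Py0] := P0; pose D := size (fib F y0).
have hD y : P y != 0 -> size (fib F y) = D by move=> Py; exact: (size_fib cov1).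
have one z : exists c r : R, [/\ 0 <= c, 0 < r & forall w, nm (w - z) < r ->
    nm (w - z) ^+ (D ^ ((jac M z == 0)%R : nat)) <= c * nm (F w - F z)].
  have [Jz|Jz] := eqVneq (jac M z) 0; first by rewrite expn1; exact: (lojasiewicz cov1 P0 hM1 hD z).
  have [|r [B [r0 B0 H]]] := @ift_inj _ _ F M FM (fun z' => nm (z' - z) <= 0) (cpt_ball z 0).
    move=> z' zz; suff -> : z' = z by [].
    by apply/eqP; rewrite -subr_eq0 -nm_eq0 eq_le zz nm_ge0.
  exists B, r; split; [exact: ltW|by []|move=> w wr; rewrite expn0 expr1].
  by have [] := H z w z _ wr; rewrite ?subrr ?nm0.
exists D; first exact: (size_fib_gt0 cov1 P0 hM1 Py0).
elim=> [|m IH] z.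
  by exists 1, 1; split=> // w _; rewrite big_ord0 expn0 expr1 mul1r.
have [c [r [c0 r0 H]]] := IH z; have [c' [r' [c'0 r'0 H']]] := one (iter m F z).
have [r2 r20 Hr2] : exists2 r2 : R, 0 < r2 & forall w, nm (w - z) < r2 -> nm (iter m F w - iter m F z) < r'.
  exact: pmap_eps (pmap_iter m) r'0.
set D' := (D ^ ((jac M (iter m F z) == 0)%R : nat))%N in H'.
exists (c ^+ D' * c'), (Num.min r r2); split; first by rewrite mulr_ge0// exprn_ge0.
  by rewrite lt_min r0.
move=> w; rewrite lt_min => /andP[w1 w2]; rewrite big_ord_recr ssrnat.expnD -/D' exprM.
apply: (@le_trans _ _ ((c * nm (iter m F w - iter m F z)) ^+ D')).
  apply: lerXn2r; rewrite ?nnegrE ?exprn_ge0 ?mulr_ge0 ?nm_ge0//; exact: H.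
rewrite exprMn -mulrA ler_wpM2l ?exprn_ge0//; exact: H' (Hr2 w w2).
Qed.

Variables (Nh : nat) (Q : V -> C) (y : V).
Hypotheses (hits : forall z m, z != 0 -> (\sum_(i < m) ((jac M (iter i F z) == 0)%R : nat) <= Nh)%N)
  (pQ : polyfun Q) (Q0 : exists z, Q z != 0) (QP : forall z, Q z != 0 -> P z != 0) (y0 : y != 0).

(** Choose [u] so that [y' = y + s *: u]. By [cone_near] the point [x] is close to some [x'] over
    [y]; as every label occurs over [q], some point over [q] carries the label [x'], and [lab_bound]
    puts it close to [x']. *)
Theorem uniform_preimages (eps : R) : 0 < eps -> exists (q : V) (de : R), [/\ Q q != 0, 0 < de &
  forall m y' x, P y' != 0 -> nm (y' - y) < de -> iter m F x = y' ->
    exists2 x', iter m F x' = q & nm (x' - x) < eps].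
Proof.
move=> eps0; have [D D0 HD] := loja_iter; pose N := (D ^ Nh)%N.
have N0 : (0 < N)%N by rewrite expn_gt0 D0.
have [v [eta [r [eta0 r0 cone]]]] := cone_exists y pQ Q0.
pose m0 := nm y + r * (nm v + eta); pose Rb := cp * (1 + m0).
have cpp : 0 <= cp by have := hcp 0 0; rewrite /= nm0 addr0 mulr1.
pose eps1 := eps / 4 / n.+1%:R; have eps10 : 0 < eps1 by rewrite !divr_gt0 ?ltr0n.
have m00 : 0 <= m0 by rewrite addr_ge0 ?nm_ge0// mulr_ge0 ?addr_ge0 ?nm_ge0 ?ltW.
have Rb0 : 0 <= Rb by rewrite mulr_ge0// addr_ge0.
have RbN : 0 < (2 * Rb) ^+ N + 1 by apply: ltr_wpDl => //; rewrite exprn_ge0// mulr_ge0.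
(* Small enough for [lab_bound] to give distance [eps1] at radius [r1]. The constants [Rb], [eps1]
   and [r1], hence [q] and [de], are fixed before the iterate [m]. *)
pose r1 := Num.min (r / 2) (r * eps1 ^+ N / ((2 * Rb) ^+ N + 1)).
have r10 : 0 < r1 by rewrite lt_min !divr_gt0// mulr_gt0 ?exprn_gt0.
have r1r : 0 < r1 < r by rewrite r10 gt_min; apply/orP; left; lra.
have hr1 : (2 * Rb) ^+ N * r1 <= r * eps1 ^+ N.
  have : r1 * ((2 * Rb) ^+ N + 1) <= r * eps1 ^+ N by rewrite -ler_pdivlMr// ge_min lexx orbT.
  by rewrite mulrDr mulr1 mulrC; move: (ltW r10); lra.
have r1C : nc (r1%:C)%C = r1 by rewrite ncR gtr0_norm.
exists (y + (r1%:C)%C *: v), (r1 * eta / 8); split.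
- by apply: cone; [rewrite subrr nm0 ltW|rewrite r1C; case/andP: r1r => -> h; lra].
- by rewrite divr_gt0// mulr_gt0.
move=> m y' x Py' yde Gx; have cov := cover_iter m.
have hM : exists z, \det (Mit m z z) != 0.
  by exists x; have [_ _ _ _] := cov; apply; rewrite Gx.
have [zs [_ _ zsP _]] := fiber_limit cov P0 hM y.
have XP z : z \in undup zs <-> iter m F z = y by rewrite mem_undup; split => /zsP.
have hN w : iter m F w = y -> exists c r : R, [/\ 0 <= c, 0 < r & forall z, nm (z - w) < r ->
    nm (z - w) ^+ N <= c * nm (iter m F z - iter m F w)].
  move=> Gw; have [c [rr [c0 rr0 H]]] := HD m w; exists c, (Num.min rr 1); split=> //.
    by rewrite lt_min rr0 ltr01.
  move=> z; rewrite lt_min => /andP[z1 z2]; apply: le_trans (H z z1).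
  have w0 : w != 0 by apply: contraNneq y0 => w0; rewrite -Gw w0 iter0.
  by apply: ler_wiXn2l; rewrite ?nm_ge0 ?(ltW z2)// leq_pexp2l// hits.
pose s := nm (y' - y); pose u := ((s^-1)%:C)%C *: (y' - y).
have y'E : y' = y + (s%:C)%C *: u.
  have [s0|s0] := eqVneq s 0.
    by rewrite /u s0 rmorph0 scale0r addr0; apply/eqP; rewrite -subr_eq0 -nm_eq0; apply/eqP.
  by rewrite /u scalerA -rmorphM divff// rmorph1 scale1r addrC subrK.
have u1 : nm u <= 1.
  rewrite /u nmZ ncR normfV ger0_norm ?nm_ge0// -/s; have [->|s0] := eqVneq s 0; first by rewrite mulr0.
  by rewrite mulVf.
have sE : nc (s%:C)%C = s by rewrite ncR ger0_norm ?nm_ge0.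
clearbody u.
have vu a : nc a <= eta -> nm (v + a *: u - v) <= eta.
  move=> ae; have -> : v + a *: u - v = a *: u by rewrite addrC addKr.
  by rewrite nmZ -[leRHS]mulr1; apply: ler_pM; rewrite ?nc_ge0 ?nm_ge0.
have reg a t : nc a <= eta -> 0 < nc t <= 2 * r -> P (y + t *: (v + a *: u)) != 0.
  by move=> ae tr; apply: QP; apply: cone => //; exact: vu.
have hRb a t z : nc a <= eta -> nc t <= r -> iter m F z = y + t *: (v + a *: u) -> nm z <= Rb.
  move=> ae tr Gz; apply: le_trans (hcp m z) _; rewrite ler_wpM2l// lerD2l Gz.
  apply: le_trans (nmD _ _) _; rewrite lerD2l nmZ; apply: ler_pM; rewrite ?nc_ge0 ?nm_ge0//.
  by apply: le_trans (nmD _ _) _; rewrite lerD2l; have := vu a ae; rewrite addrC addKr.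
have [lab Hlab] := labellings cov P0 hM XP r0 reg.
have hD z : P z != 0 -> size (fib (iter m F) z) = size (fib (iter m F) y') by move=> Pz; exact: (size_fib cov).
have Ps0 : P (y + (s%:C)%C *: u) != 0 by rewrite -y'E.
have Gx' : iter m F x = y + (s%:C)%C *: u by rewrite -y'E.
have hs0 : nc (s%:C)%C <= r1 * eta / 8 by rewrite sE ltW.
have [T HT] := trace_poly cov P0 y u.
have [x' x'X xx'] := cone_near cov (undup_uniq _) XP N0 hN eta0 r0 reg hRb Hlab hD eps10 r1r hr1 hs0 Ps0 Gx' HT.
have e0' : nc (0 : C) <= eta by rewrite nc0 ltW.
have [_ _ _ L4] := Hlab 0 e0'.
have tr : 0 < nc (r1%:C)%C <= r by rewrite r1C; case/andP: r1r => -> /ltW.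
have [z Gz lz] := L4 _ x' tr x'X.
exists z; first by rewrite Gz scale0r addr0.
have zx' j : nc ((z - x') 0 j) <= eps1.
  have := lab_bound cov XP hN r0 (fun t => @reg 0 t e0') (Hlab 0 e0') (fun t z => @hRb 0 t z e0') j tr Gz.
  rewrite lz r1C => h; have : nc ((z - x') 0 j) ^+ N <= eps1 ^+ N.
    by apply: le_trans h _; rewrite mulrAC ler_pdivrMr// [eps1 ^+ N * r]mulrC.
  by rewrite ler_pXn2r ?nnegrE ?nc_ge0 ?(ltW eps10).
have : nm (z - x) <= n.+1%:R * (3 * eps1).
  apply: nm_lt_coord => [|j]; first by rewrite mulr_gt0.
  have -> : (z - x) 0 j = (z - x') 0 j - (x - x') 0 j by rewrite !mxE; ring.
  by apply: le_lt_trans (ncB _ _) _; have := zx' j; have := xx' j; lra.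
move=> h; apply: le_lt_trans h _; rewrite /eps1 mulrCA mulrA mulrACA mulfV ?pnatr_eq0// mulr1; lra.
Qed.
End Iterates.

(** * Lifts shadowing a line *)

Section Propagate.
Variable R : realType.
Local Notation C := R[i].
Variable n d : nat.
Local Notation V := 'rV[C]_n.+1.
Variables (F : V -> V) (M : V -> V -> 'M[C]_n.+1).
Hypotheses (hF : forall j, hform d (fun v => F v 0 j)) (Fn0 : forall v, v != 0 -> F v != 0) (d1 : (1 < d)%N)
  (FM : bez F M).
Variables (e : nat) (P : V -> C).
Hypotheses (hPf : hform e P) (e0 : (0 < e)%N) (P0 : exists c, P c != 0)
  (Pcrit : forall i z, z != 0 -> jac M z = 0 -> P (iter i.+1 F z) = 0).
Variables (cp bb : R).
Hypotheses (hcp : forall m z, nm z <= cp * (1 + nm (iter m F z)))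
  (bb0 : 0 < bb) (hbb : forall m z, Num.min bb (nm (iter m F z)) <= nm z).
Variables (q v : V).

(** The 2 by 2 minors serve as an unnormalised projective distance: they vanish for collinear
    vectors and are polynomial, so maximum principles apply to them. *)
Definition minor (x y : V) a b := x 0 a * y 0 b - x 0 b * y 0 a.

Lemma nm_minor (x y : V) b (om : R) : 0 < om -> (forall a, nc (minor x y a b) <= om) ->
  nm (y 0 b *: x - x 0 b *: y) <= n.+1%:R * (2 * om).
Proof.
move=> om0 H; apply: nm_lt_coord => [|a]; first by rewrite mulr_gt0.
rewrite !mxE (_ : _ - _ = minor x y a b); last by rewrite /minor; ring.
by apply: le_lt_trans (H a) _; lra.
Qed.

Lemma minor_bound (x y : V) a b : nc (minor x y a b) <= 2 * (nm x * nm y).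
Proof.
apply: le_trans (ncB _ _) _; rewrite !ncM mulr2n mulrDl mul1r; apply: lerD.
  by apply: ler_pM; rewrite ?nc_ge0 ?nm_coord.
by apply: ler_pM; rewrite ?nc_ge0 ?nm_coord.
Qed.

(* The lifts of the line by [F^m], [m] large, follow the line itself projectively. *)
Definition shadowed (t : C) := exists2 rho : R, 0 < rho & forall om : R, 0 < om -> exists m g,
  disc_lift (iter m.+1 F) q v t rho g /\
  forall t', nc (t' - t) <= rho -> forall a b, nc (minor (g t') (q + t' *: v) a b) <= om.

Let cov m := cover_iter hF d1 FM hPf e0 Pcrit hcp m.

Lemma cp_ge0 : 0 <= cp.
Proof. by have := hcp 0 0; rewrite /= nm0 addr0 mulr1. Qed.

Lemma line_bound (t : C) (r : R) : nc t <= r -> nm (q + t *: v) <= nm q + r * nm v.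
Proof. by move=> tr; apply: le_trans (nmD _ _) _; rewrite lerD2l nmZ ler_wpM2r ?nm_ge0. Qed.

Lemma minor_nice m t0 (rho : R) g t a b : disc_lift (iter m F) q v t0 rho g -> nc (t - t0) < rho ->
  P (q + t *: v) != 0 -> nice (fun t => minor (g t) (q + t *: v) a b) t.
Proof.
move=> gl tr Pt; have ng := disc_lift_nice (cov m) gl tr Pt.
have nl j : nice (fun t => (q + t *: v) 0 j) t.
  have := niceD (nice_cst (q 0 j) t) (niceM (nice_id t) (nice_cst (v 0 j) t)) => h.
  by apply: nice_ext h _; exists 1 => // t' _; rewrite !mxE.
have h := niceD (niceM (ng a) (nl b)) (niceM (nice_cst (-1) t) (niceM (ng b) (nl a))).
by apply: nice_ext h _; exists 1 => // t' _; rewrite /minor mulN1r.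
Qed.

(** The lift is continued from the small disc where it shadows the line to a disc of size comparable
    to the distance [D] to the zeros of [P]. Its minors stay bounded there by a constant free of
    [m], so [propagation] passes their smallness on to radius [D / 8] around any nearby point. *)
Lemma shadowed_near t0 : P (q + t0 *: v) != 0 -> exists2 de : R, 0 < de & forall t' t'',
  nc (t' - t0) < de -> nc (t'' - t0) < de -> shadowed t' -> shadowed t''.
Proof.
move=> Pt0; have [D D0 HD] := reg_near (cov 0) Pt0.
exists (D / 8); first by rewrite divr_gt0.
move=> t' t'' t't0 t''t0 [rho0 rho00 H0].
pose rho := Num.min rho0 (D / 8); have rho_0 : 0 < rho by rewrite lt_min rho00 divr_gt0.
exists (D / 8); first by rewrite divr_gt0.
move=> om om0.
pose Y := nm q + (nc t0 + D) * nm v; pose K := 2 * (cp * (1 + Y) * Y).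
have Y0 : 0 <= Y by rewrite addr_ge0 ?nm_ge0// mulr_ge0 ?nm_ge0// addr_ge0 ?nc_ge0 ?ltW.
have K0 : 0 <= K by have h := cp_ge0; do 3! apply: mulr_ge0 => //; exact: addr_ge0.
have r'r : 0 <= 3 * D / 8 < 7 * D / 16 by apply/andP; split; lra.
have [ep [ep0 Hep]] := propagation rho_0 r'r K0 om0.
have [m [g [gl gm]]] := H0 ep ep0; exists m.
have inD t : nc (t - t') <= D / 2 -> nc (t - t0) <= D.
  by move=> h; have := nc_tri t' t t0; lra.
have HP t : nc (t - t') <= D / 2 -> P (q + t *: v) != 0 by move/inD; exact: HD.
have Gg : iter m.+1 F (g t') = q + t' *: v by apply: gl.1; rewrite subrr nc0 ltW.
have D20 : 0 <= D / 2 by rewrite divr_ge0// ltW.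
have [g2 g2l g2t'] := disc_lift_exists (cov m.+1) D20 HP Gg.
exists g2; split.
  by apply: disc_lift_sub g2l _; have := nc_tri t0 t'' t'; rewrite (ncBC t0 t'); lra.
have same t : nc (t - t') <= rho -> g2 t = g t.
  have HP' t1 : nc (t1 - t') <= rho -> P (q + t1 *: v) != 0.
    by rewrite le_min => /andP[_ h]; apply: HP; lra.
  apply: (disc_lift_unique (cov m.+1) HP' _ _ (t0 := t')).
  - by apply: disc_lift_sub g2l _; rewrite subrr nc0 add0r ge_min; apply/orP; right; lra.
  - by apply: disc_lift_sub gl _; rewrite subrr nc0 add0r ge_min lexx.
  - by rewrite subrr nc0 ltW.
  - by rewrite g2t'.
move=> t tt'' a b; pose u (t1 : C) := minor (g2 (t' + t1)) (q + (t' + t1) *: v) a b.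
have cc (t1 : C) : t' + t1 - t' = t1 by rewrite addrC addKr.
have -> : minor (g2 t) (q + t *: v) a b = u (t - t') by rewrite /u [t' + _]addrC subrK.
apply: Hep.
- move=> t1 t1r; have in1 : nc (t' + t1 - t') <= D / 2 by rewrite cc; lra.
  split.
    have := @minor_nice m.+1 t' (D / 2) g2 (t' + t1) a b g2l _ (HP _ in1); rewrite cc.
    move=> /(_ (le_lt_trans t1r _)) h; have {}h := h ltac:(lra); move: h => [p hp]; exists p.
    by apply: expn_ext hp _; exists 1 => // h _; rewrite /u addrA.
  apply: le_trans (minor_bound _ _ _ _) _; rewrite ler_wpM2l//.
  have yb : nm (q + (t' + t1) *: v) <= Y.
    by apply: line_bound; have := nc_tri t0 (t' + t1) 0; rewrite !subr0; have := inD _ in1; lra.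
  apply: ler_pM; rewrite ?nm_ge0//; apply: le_trans (hcp m.+1 _) _; rewrite ler_wpM2l ?cp_ge0// lerD2l.
  by rewrite (g2l.1 _ in1).
- move=> t1 t1r; rewrite /u; have in1 : nc (t' + t1 - t') <= rho by rewrite cc.
  by rewrite same//; apply: gm; move: in1; rewrite le_min => /andP[].
- by have := nc_tri t'' t t'; have := nc_tri t0 t'' t'; rewrite (ncBC t0 t'); lra.
Qed.

Hypotheses (Pq : P q != 0) (c : V) (vE : v = c - q) (Pc : P c != 0).

Lemma shadowed_path : shadowed 0 -> shadowed 1.
Proof.
have [w Hw] := pf_line q v hPf.1; apply: (path_ind (w := w)).
- by rewrite -Hw scale0r addr0.
- by rewrite -Hw scale1r vE addrC subrK.
by move=> t; rewrite -Hw => Pt; have [de de0 H] := shadowed_near Pt; exists de.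
Qed.

Lemma nice_bounded (u : C -> C) (r : R) : 0 <= r -> (forall t, nc t <= r -> nice u t) ->
  exists K : R, forall t, nc t <= r -> nc (u t) <= K.
Proof.
move=> r0 nu; have cT : ccpt (fun t : C => nc t <= r).
  apply: ccptP; first by exists r.
  by move=> t H; apply/ler_addgt0Pr => ep /H[t' h1 h2]; have := ncB_ge t t'; rewrite ncBC; lra.
have [||t _ Ht] := @evtC _ _ (fun t => nc (u t)) cT; last by exists (nc (u t)).
  by exists 0; rewrite nc0.
move=> t tr ep ep0; have [L [de [L0 de0 H]]] := nice_lip (nu t tr).
have L1 : 0 < L + 1 by lra.
exists (Num.min de (ep / (L + 1))); first by rewrite lt_min de0 divr_gt0.
move=> t' _; rewrite lt_min ltr_pdivlMr// => /andP[/H h1 h2].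
have := nc_ge0 (t' - t); have := ncB_ge (u t') (u t); have := ncB_ge (u t) (u t'); rewrite (ncBC (u t)) => g1 g2 g3.
by rewrite ltr_norml; apply/andP; split; nra.
Qed.

Hypotheses (Jc : jac M c = 0) (Jq : jac M q != 0).

(* At [t = 1] the line meets the critical cone while it is not contained in it;
   [1 / J (g t)] would have an interior maximum. *)
Lemma shadowed_crit : ~ shadowed 1.
Proof.
move=> [rho0 rho00 H0].
have cE : q + 1 *: v = c by rewrite scale1r vE addrC subrK.
have c0 : c != 0 by apply: contraNneq Pc => ->; rewrite (form0 hPf e0).
have [b cb] : exists b, c 0 b != 0.
  apply: contrapT => /forallNP h; case/eqP: c0; apply/rowP => b; rewrite mxE; apply/eqP/negPn/negP; exact: h.
have Pl1 : P (q + 1 *: v) != 0 by rewrite cE.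
have [D D0 HD] := reg_near (cov 0) Pl1.
have hJ := hform_jac hF d1 FM; set E := (n.+1 * d.-1)%N in hJ.
have [w Hw] := pf_line q v hJ.1.
have w0 : w != 0 by apply: contraNneq Jq => w0; have := Hw 0; rewrite scale0r addr0 w0 horner0 => ->.
have [k [w1 w11 wE]] := multiplicity_XsubC w 1.
rewrite w0 /= in w11.
have k1 : 0 < nc w1.[1] by rewrite nc_gt0.
pose kb := nc (c 0 b); have kb0 : 0 < kb by rewrite nc_gt0.
have [L1 [de1 [L10 de10 Hw1]]] := nice_lip (nice_poly w1 1).
pose rho := Num.min (Num.min (Num.min rho0 D / 2) (kb / 2 / (nm v + 1))) (Num.min (de1 / 2) (nc w1.[1] / 2 / (L1 + 1))).
have vp : 0 < nm v + 1 by rewrite ltr_wpDl ?nm_ge0.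
have L1p : 0 < L1 + 1 by lra.
have rho_0 : 0 < rho by rewrite !lt_min !divr_gt0 ?lt_min ?rho00 ?D0.
have [ra rb rc rd re] : [/\ rho <= rho0 / 2, rho <= D / 2, rho * (nm v + 1) <= kb / 2, rho <= de1 / 2 &
    rho * (L1 + 1) <= nc w1.[1] / 2].
  have hmin : Num.min rho0 D <= rho0 /\ Num.min rho0 D <= D by rewrite !ge_min !lexx orbT.
  have : rho <= rho by []; rewrite {2}/rho !le_min => /andP[/andP[h1 h2] /andP[h3 h4]].
  by move: h2 h4; rewrite !ler_pdivlMr// => h2 h4; case: hmin => m1 m2; split=> //; lra.
have yb t : nc (t - 1) <= rho -> kb / 2 <= nc ((q + t *: v) 0 b).
  move=> tr; have -> : (q + t *: v) = c - (1 - t) *: v by rewrite vE; apply/rowP => j; rewrite !mxE; ring.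
  rewrite !mxE; have := ncB_ge (c 0 b) ((1 - t) * v 0 b); rewrite ncM -/kb (ncBC 1).
  have : nc (t - 1) * nc (v 0 b) <= rho * (nm v + 1).
    by apply: ler_pM; rewrite ?nc_ge0//; have := nm_coord v 0 b; lra.
  lra.
have Jlow t : nc (t - 1) = rho -> nc w1.[1] / 2 * rho ^+ k <= nc (jac M (q + t *: v)).
  move=> tr; rewrite Hw wE hornerM ncM horner_exp hornerXsubC ncX tr ler_wpM2r ?exprn_ge0 ?(ltW rho_0)//.
  have := Hw1 t; rewrite tr => /(_ (le_lt_trans rd _)) h.
  have {}h := h ltac:(lra); have := ncB_ge w1.[1] w1.[t]; rewrite ncBC.
  by have : L1 * rho <= rho * (L1 + 1) by [rewrite mulrC ler_pM2l//; lra]; lra.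
pose Y := nm q + (1 + rho) * nm v + 1.
have Y1 : 1 <= Y by rewrite /Y lerDr addr_ge0 ?nm_ge0// mulr_ge0 ?nm_ge0//; lra.
have Yp : 0 < Y by lra.
have yY t : nc (t - 1) <= rho -> nm (q + t *: v) <= Y.
  move=> tr; have := @line_bound t (1 + rho); have := nc_tri 1 t 0; rewrite !subr0 nc1 => h1 h2.
  by apply: le_trans (h2 _) _; rewrite /Y ?lerDl//; lra.
pose be := Num.min bb (kb / 2); have be0 : 0 < be by rewrite lt_min bb0 divr_gt0.
pose Rg := cp * (1 + Y); have Rg0 : 0 <= Rg by rewrite mulr_ge0 ?cp_ge0// addr_ge0// ltW.
have [L L0 HL] := pf_lip (Y * Rg) hJ.1.
(* [mu] bounds the [b]-th coordinate of the lift from below, [ka] the product of its [E]-th power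
   with the Jacobian along the line on the circle, and [nu] the resulting value of the Jacobian
   along the lift there. [om2] keeps the defect of projective closeness below half of what each
   estimate needs, including [nu] at the centre. *)
pose mu := kb / 2 * be / 2 / Y; have mu0 : 0 < mu by rewrite !divr_gt0// mulr_gt0// divr_gt0.
pose ka := mu ^+ E * (nc w1.[1] / 2 * rho ^+ k).
have ka0 : 0 < ka by rewrite !mulr_gt0 ?exprn_gt0// invr_gt0.
have Np : (0 : R) < n.+1%:R by rewrite ltr0n.
pose nu := ka / 2 / Y ^+ E; have YE : 0 < Y ^+ E by rewrite exprn_gt0.
have nu0 : 0 < nu by rewrite !divr_gt0.
have kbE : 0 < kb ^+ E by rewrite exprn_gt0.
pose om2 := Num.min (kb / 2 * be / 2) (Num.min (ka / 2) (nu * kb ^+ E / 2) / (L + 1)).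
have L1' : 0 < L + 1 by lra.
have om20 : 0 < om2.
  have p1 : 0 < kb / 2 * be / 2 by rewrite divr_gt0// mulr_gt0// divr_gt0.
  have p2 : 0 < ka / 2 by rewrite divr_gt0.
  have p3 : 0 < nu * kb ^+ E / 2 by rewrite divr_gt0// mulr_gt0.
  by rewrite lt_min p1 divr_gt0// lt_min p2.
pose om := om2 / (2 * n.+1%:R); have om0 : 0 < om by rewrite divr_gt0// mulr_gt0.
have omE : n.+1%:R * (2 * om) = om2.
  by rewrite mulrA [_ * 2]mulrC /om mulrCA mulfV ?mulr1// lt0r_neq0// mulr_gt0.
have [oma omb omc] : [/\ om2 <= kb / 2 * be / 2, L * om2 <= ka / 2 & L * om2 <= nu * kb ^+ E / 2].
  have hm : om2 * (L + 1) <= Num.min (ka / 2) (nu * kb ^+ E / 2).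
    by rewrite -ler_pdivlMr// ge_min lexx orbT.
  move: hm; rewrite le_min mulrDr mulr1 mulrC => /andP[h1 h2].
  split; [by rewrite ge_min lexx|by move: (ltW om20) h1; lra|by move: (ltW om20) h2; lra].
have [m [g [gl gm]]] := H0 om om0.
have in0 t : nc (t - 1) <= rho -> nc (t - 1) <= rho0 by lra.
have Gg t : nc (t - 1) <= rho -> iter m.+1 F (g t) = q + t *: v by move/in0; exact: gl.1.
have gR t : nc (t - 1) <= rho -> nm (g t) <= Rg.
  by move=> tr; apply: le_trans (hcp m.+1 _) _; rewrite ler_wpM2l ?cp_ge0// lerD2l Gg// yY.
have glow t : nc (t - 1) <= rho -> be <= nm (g t).
  move=> tr; apply: le_trans (hbb m.+1 (g t)); rewrite Gg// le_min ge_min lexx /= ge_min; apply/orP; right.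
  by apply: le_trans (yb t tr) _; exact: nm_coord.
have vec t : nc (t - 1) <= rho -> nm ((q + t *: v) 0 b *: g t - g t 0 b *: (q + t *: v)) <= om2.
  by move=> tr; rewrite -omE; apply: nm_minor => // a; apply: gm; exact: in0.
(* Multiplying each vector by the [b]-th coordinate of the other makes the two nearly equal, with
   difference a row of minors; homogeneity of the Jacobian turns the scalars into the powers [E]. *)
have Jdiff t : nc (t - 1) <= rho ->
    nc ((q + t *: v) 0 b ^+ E * jac M (g t) - g t 0 b ^+ E * jac M (q + t *: v)) <= L * om2.
  move=> tr; rewrite -!hJ.2; set x := _ *: g t; set y := _ *: (q + _).
  have xb : nm x <= Y * Rg.
    rewrite nmZ; apply: ler_pM; rewrite ?nc_ge0 ?nm_ge0 ?gR//.
    by apply: le_trans (nm_coord _ _ _) (yY t tr).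
  have yb' : nm y <= Y * Rg.
    rewrite nmZ mulrC; apply: ler_pM; rewrite ?nc_ge0 ?nm_ge0 ?yY//.
    by apply: le_trans (nm_coord _ _ _) (gR t tr).
  by have [h _] := HL x y xb yb'; apply: le_trans h _; rewrite ler_wpM2l// vec.
have gb t : nc (t - 1) <= rho -> mu <= nc (g t 0 b).
  move=> tr; rewrite /mu ler_pdivrMr//; have := vec t tr.
  have := nmB_ge ((q + t *: v) 0 b *: g t) (g t 0 b *: (q + t *: v)); rewrite !nmZ => h1 h2.
  have h3 : kb / 2 * be <= nc ((q + t *: v) 0 b) * nm (g t).
    by apply: ler_pM; rewrite ?yb ?glow ?(ltW be0)// divr_ge0// ltW.
  have h4 : nc (g t 0 b) * nm (q + t *: v) <= nc (g t 0 b) * Y by rewrite ler_wpM2l ?nc_ge0// yY.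
  move: h1 h2 h3 h4 oma; lra.
have circ t : nc (t - 1) = rho -> nu <= nc (jac M (g t)).
  move=> tr; have tr' : nc (t - 1) <= rho by rewrite tr.
  have := Jdiff t tr'; have := ncB_ge (g t 0 b ^+ E * jac M (q + t *: v)) ((q + t *: v) 0 b ^+ E * jac M (g t)).
  rewrite [in X in X -> _ -> _]ncBC !ncM !ncX => h1 h2.
  have h3 : ka <= nc (g t 0 b) ^+ E * nc (jac M (q + t *: v)).
    apply: ler_pM; rewrite ?exprn_ge0 ?(ltW mu0)//; last exact: Jlow.
      by rewrite mulr_ge0 ?exprn_ge0 ?(ltW rho_0)// divr_ge0// ltW.
    by apply: lerXn2r; rewrite ?nnegrE ?nc_ge0 ?(ltW mu0)// gb.
  have h4 : nc ((q + t *: v) 0 b) ^+ E * nc (jac M (g t)) <= Y ^+ E * nc (jac M (g t)).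
    rewrite ler_wpM2r ?nc_ge0//; apply: lerXn2r; rewrite ?nnegrE ?nc_ge0 ?(ltW Yp)//.
    by apply: le_trans (nm_coord _ _ _) (yY t tr').
  rewrite /nu ler_pdivrMr// [leRHS]mulrC; move: h1 h2 h3 h4 omb; lra.
have r1 : nc (1 - 1 : C) <= rho by rewrite subrr nc0 ltW.
have center : nc (jac M (g 1)) < nu.
  have := Jdiff 1 r1; rewrite cE Jc mulr0 subr0 ncM ncX -/kb => h.
  rewrite -(ltr_pM2l kbE); apply: le_lt_trans h _; apply: le_lt_trans omc _.
  rewrite [kb ^+ E * _]mulrC; have := mulr_gt0 nu0 kbE; lra.
have Jg0 t : nc (t - 1) <= rho -> jac M (g t) != 0.
  move=> tr; apply: (reg_jac hF d1 hPf e0 Pcrit (i := m)); rewrite Gg//.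
  by apply: HD; lra.
pose u (t : C) := (jac M (g (1 + t)))^-1.
have cc (t : C) : 1 + t - 1 = t by rewrite addrC addKr.
have nu' t : nc t <= rho -> nice u t.
  move=> tr; have tr' : nc (1 + t - 1) <= rho by rewrite cc.
  apply: (@nice_inv _ (fun t => jac M (g (1 + t)))); last exact: Jg0.
  apply: (@nice_pf _ _ (jac M) (fun t => g (1 + t)) t hJ.1) => i.
  have [||p hp] := disc_lift_nice (cov m.+1) gl (t := 1 + t) _ _ i.
  - by rewrite cc; lra.
  - by apply: HD; lra.
  by exists p; apply: expn_ext hp _; exists 1 => // h _; rewrite addrA.
have [Kb HKb] := nice_bounded (ltW rho_0) nu'.
have : nc (u 0) <= nu^-1.
  apply: (@disc_mp _ u 1 rho nu^-1 Kb).
  - by rewrite invr_ge0 ltW.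
  - by move=> t tr _; split; [exact: nu'|exact: HKb].
  - move=> t tr _; rewrite /u ncV lef_pV2 ?posrE// ?circ ?cc//.
    by rewrite nc_gt0 Jg0// cc tr.
  - by rewrite nc0 ltW.
  - by rewrite hornerC oner_eq0.
rewrite /u addr0 ncV lef_pV2 ?posrE// ?nc_gt0 ?Jg0// => h.
by have := lt_le_trans center h; rewrite ltxx.
Qed.
End Propagate.

(** * No subsequence of iterates is projectively Cauchy on an open set *)

Section NoCauchy.
Variable R : realType.
Local Notation C := R[i].
Variable n d : nat.
Local Notation V := 'rV[C]_n.+1.

Lemma pmap_lip m (G : 'rV[C]_m -> 'rV[C]_m) (r : R) : pmap G -> exists2 L : R, 0 <= L &
  forall x y, nm x <= r -> nm y <= r -> nm (G x - G y) <= L * nm (x - y).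
Proof.
move=> pG; have /choice[L HL] j : exists L : R, 0 <= L /\ forall x y, nm x <= r -> nm y <= r ->
    nc (G x 0 j - G y 0 j) <= L * nm (x - y).
  by have [L L0 H] := pf_lip r (pG j); exists L; split=> // x y xr yr; have [] := H x y xr yr.
exists (\sum_j L j); first by apply: sumr_ge0 => j _; exact: (HL j).1.
move=> x y xr yr; rewrite {1}/nm big_ord_recl big_ord0 addr0 mulr_suml; apply: ler_sum => j _.
by rewrite !mxE; exact: (HL j).2.
Qed.

Variables (F : V -> V) (M : V -> V -> 'M[C]_n.+1).
Hypotheses (hF : forall j, hform d (fun v => F v 0 j)) (Fn0 : forall v, v != 0 -> F v != 0) (d1 : (1 < d)%N)
  (FM : bez F M).
Variables (e : nat) (P : V -> C) (c : V).
Hypotheses (hPf : hform e P) (e0 : (0 < e)%N) (Pc : P c != 0) (Jc : jac M c = 0)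
  (Pcrit : forall i z, z != 0 -> jac M z = 0 -> P (iter i.+1 F z) = 0).
Variable Nh : nat.
Hypothesis hits : forall z m, z != 0 -> (\sum_(i < m) ((jac M (iter i F z) == 0)%R : nat) <= Nh)%N.

Lemma iter_homZ m (a : C) (z : V) : iter m F (a *: z) = a ^+ (d ^ m) *: iter m F z.
Proof.
elim: m => [|m IH]; first by rewrite expr1.
by rewrite /= IH (homZ hF) -exprM -ssrnat.expnSr.
Qed.

Lemma normalize_iter m (z : V) : z != 0 -> exists a, a != 0 /\ nm (iter m F (a *: z)) = 1.
Proof.
move=> z0; have t0 : 0 < nm (iter m F z) by rewrite nm_gt0 iter_neq0.
set t := nm (iter m F z) in t0; have dm : (0 < d ^ m)%N by rewrite expn_gt0 ltnW.
exists ((d ^ m).-root (t^-1)%:C%C)%R.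
have aE : (((d ^ m).-root (t^-1)%:C%C)%R : C) ^+ (d ^ m) = (t^-1)%:C%C by exact: rootCK.
have t0' : nc ((t^-1)%:C%C : C) = t^-1 by rewrite ncR gtr0_norm// invr_gt0.
split; last by rewrite iter_homZ aE nmZ t0' mulVf// lt0r_neq0.
apply/eqP => a0; have := t0'; rewrite -aE a0 expr0n (gtn_eqF dm) nc0 => /esym/eqP.
by rewrite invr_eq0 (gt_eqF t0).
Qed.

Lemma minorZ (a b : C) (x y : V) i j : minor (a *: x) (b *: y) i j = a * b * minor x y i j.
Proof. by rewrite /minor !mxE; ring. Qed.

Variables (nj : nat -> nat) (x0 : V) (de0 : R).
Hypotheses (hnj : {homo nj : i j / (i < j)%N}) (x00 : x0 != 0) (de00 : 0 < de0).
Hypothesis HC : forall om : R, 0 < om -> exists J, forall i j, (J <= i)%N -> (J <= j)%N ->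
  forall z, nm (z - x0) < de0 -> forall a b,
    nc (minor (iter (nj i) F z) (iter (nj j) F z) a b) <= om * (nm (iter (nj i) F z) * nm (iter (nj j) F z)).

(** Through [shadowed_path] and [shadowed_crit] it suffices to shadow the line near [q]. A lift [g]
    by a late iterate starting near a multiple of [x0] is such that an earlier iterate of it is
    projectively close to the late one, which is the line itself. *)
Theorem no_cauchy : False.
Proof.
have P0 : exists c, P c != 0 by exists c.
have [cp [bb [cp1 bb0 hcp hbb]]] := iter_bounds hF Fn0 d1.
have cov m := cover_iter hF d1 FM hPf e0 Pcrit hcp m.
have hJ := hform_jac hF d1 FM; have [zJ JzJ] := jac_neq0 hF Fn0 d1 FM.
have regI m : exists z, P (iter m F z) != 0.
  elim: m => [|m [z Pz]]; first exact: P0.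
  have cF : cover_map F M (fun z => P (iter m F z)) cp.
    split; [exact: hom_pmap hF|exact: FM|exact: (hcp 1)|exact: (pf_comp (pmap_iter hF m) hPf.1)|].
    by move=> w; rewrite -iterSr; exact: (reg_jac hF d1 hPf e0 Pcrit).
  have [|w Pw] := reg_image cF _ (ex_intro _ zJ JzJ); first by exists z.
  by exists w; rewrite iterSr.
(* With the Jacobian as a factor, the point [q] in the cone is also noncritical, so the line from
   [q] to [c] is not contained in the critical cone. *)
pose Q z := P z * jac M z; have pQ : polyfun Q by apply: pfM; [exact: hPf.1|exact: hJ.1].
have Q0 : exists z, Q z != 0.
  have Jp : 0 < nc (jac M zJ) by rewrite nc_gt0.
  have [r r0 Hr] := pf_eps zJ hJ.1 Jp; have [z zr Pz] := pf_dense hPf.1 P0 zJ r0.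
  exists z; rewrite mulf_neq0//; have := Hr z (ltW zr); apply: contraTneq => ->.
  by rewrite sub0r ncN ltxx.
have QP z : Q z != 0 -> P z != 0 by rewrite mulf_eq0 negb_or => /andP[].
have /choice[a Ha] j := normalize_iter (nj j) x00.
pose z j := a j *: x0.
have [|phi [hphi [y cy]]] := @bw _ _ _ (fun j => iter (nj j) F (z j)) 1; first by move=> j; rewrite (Ha j).2.
have y0 : y != 0.
  apply/eqP => y0; have [N /(_ N (leqnn N))] := cy 1 ltr01.
  by rewrite y0 subr0 /= (Ha _).2 ltxx.
have x0p : 0 < nm x0 by rewrite nm_gt0.
pose be := Num.min bb 1; have be0 : 0 < be by rewrite lt_min bb0 ltr01.
pose ep := de0 * (be / nm x0) / 3; have ep0 : 0 < ep by rewrite divr_gt0// mulr_gt0// divr_gt0.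
have epE : 3 * ep = de0 * (be / nm x0) by rewrite /ep mulrC divfK ?pnatr_eq0.
have alow j : be / nm x0 <= nc (a j).
  by rewrite ler_pdivrMr// -nmZ; have := hbb (nj j) (z j); rewrite (Ha j).2.
clearbody ep.
(* The hypothesis is invariant under scaling. As all scalars [a k] are bounded below, the balls of
   radius [3 * ep] around the points [z k] shrink back into the ball of radius [de0] around [x0];
   the three [ep] are spent on [x], [x''] and the variation of [g]. *)
have HC' om : 0 < om -> exists J, forall i j, (J <= i)%N -> (J <= j)%N ->
    forall k w, nm (w - z k) < 3 * ep -> forall a b,
    nc (minor (iter (nj i) F w) (iter (nj j) F w) a b) <= om * (nm (iter (nj i) F w) * nm (iter (nj j) F w)).
  move=> om0; have [J HJ] := HC om0; exists J => i j Ji Jj k w wz b b'.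
  have [ak _] := Ha k; have akp : 0 < nc (a k) by rewrite nc_gt0.
  pose w' := (a k)^-1 *: w; have wE : w = a k *: w' by rewrite /w' scalerA mulfV// scale1r.
  have w'x : nm (w' - x0) < de0.
    rewrite -(ltr_pM2l akp) -nmZ scalerBr -wE -/(z k); apply: lt_le_trans wz _.
    by rewrite epE mulrC ler_wpM2r// ltW.
  clearbody w'; have := HJ i j Ji Jj w' w'x b b'; rewrite wE !iter_homZ minorZ !nmZ !ncM => h.
  set A := nc _; set B := nc (a k ^+ _); have AB : 0 <= A * B by rewrite mulr_ge0 ?nc_ge0.
  apply: le_trans (ler_wpM2l AB h) _.
  by rewrite (_ : A * B * _ = om * (A * nm (iter (nj i) F w') * (B * nm (iter (nj j) F w'))))//; ring.
have [q [de [Qq de1 Hq]]] := uniform_preimages hF Fn0 d1 FM hPf e0 P0 Pcrit hcp hits pQ Q0 QP y0 ep0.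
have Pq := QP q Qq; have Jq : jac M q != 0 by move: Qq; rewrite mulf_eq0 negb_or => /andP[].
pose v := c - q.
apply: (shadowed_crit hF d1 FM hPf e0 Pcrit hcp bb0 hbb (erefl v) Pc Jc Jq).
apply: (shadowed_path hF d1 FM hPf e0 Pcrit hcp Pq (erefl v) Pc).
have Pq0 : P (q + 0 *: v) != 0 by rewrite scale0r addr0.
have [rho rho0 Hrho] := reg_near (cov 0) Pq0.
have cp0 : 0 <= cp by lra.
pose Y := nm q + rho * nm v; have Y0 : 0 <= Y by rewrite addr_ge0 ?nm_ge0// mulr_ge0 ?nm_ge0// ltW.
pose Rg := cp * (1 + Y); have Rg0 : 0 <= Rg by rewrite mulr_ge0// addr_ge0.
have yY (t : C) : nc t <= rho -> nm (q + t *: v) <= Y by exact: line_bound.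
have Np : (0 : R) < n.+1%:R by rewrite ltr0n.
pose S := 2 * Rg / (rho / 2) + 1; have S0 : 0 < S by apply: ltr_wpDl => //; apply: divr_ge0; [rewrite mulr_ge0|rewrite divr_ge0// ltW].
pose s := Num.min (rho / 2) (ep / 2 / n.+1%:R / S).
have s0 : 0 < s by rewrite lt_min !divr_gt0.
have srho : s <= rho / 2 by rewrite ge_min lexx.
have sS : S * s <= ep / 2 / n.+1%:R by rewrite mulrC -ler_pdivlMr// ge_min lexx orbT.
exists s => // om om0.
have RY : 0 < Rg * Y + 1 by apply: ltr_wpDl => //; exact: mulr_ge0.
have [J HJ] := HC' _ (divr_gt0 om0 RY).
have de2 : 0 < de / 2 by rewrite divr_gt0.
have [N HN] := cy _ de2; pose k := maxn N J.+1; pose j := phi k.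
have jJ : (J < j)%N by apply: leq_trans (leq_maxr N J.+1) _; exact: homo_ge.
have yj : nm (iter (nj j) F (z j) - y) < de / 2 by exact: (HN k (leq_maxl _ _)).
clearbody j.
have njJ : (nj J < nj j)%N by exact: hnj.
(* Applying the iterate of order [nj J] to a lift by the iterate of order [nj j] leaves a lift by
   the remaining [m + 1] steps. *)
pose m := (nj j - nj J).-1; have mE : (m.+1 + nj J)%N = nj j by rewrite prednK ?subn_gt0// subnK// ltnW.
clearbody m.
have [r r0 Hr] := pmap_eps (z j) (pmap_iter hF (nj j)) de2.
have pPF : polyfun (fun w => P (iter (nj j) F w)) by exact: (pf_comp (pmap_iter hF (nj j)) hPf.1).
have m0 : 0 < Num.min ep r by rewrite lt_min ep0.
(* [uniform_preimages] accepts preimages of regular values only, hence a small move away from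
   [z j]. *)
have [x] := pf_dense pPF (regI (nj j)) (z j) m0.
rewrite lt_min => /andP[xep xr] Px.
have xy : nm (iter (nj j) F x - y) < de.
  have := nm_tri (iter (nj j) F (z j)) (iter (nj j) F x) y; have := Hr x xr => h1 h2.
  by apply: le_lt_trans h2 _; rewrite [de]splitr ltrD.
have [x'' Fx'' x''x] := Hq (nj j) _ x Px xy erefl.
have x''z : nm (x'' - z j) < 2 * ep by have := nm_tri x x'' (z j); lra.
have rho0' : 0 <= rho by exact: ltW.
have Fx0 : iter (nj j) F x'' = q + 0 *: v by rewrite scale0r addr0.
have [g gl g0] := disc_lift_exists (cov (nj j)) rho0' Hrho Fx0.
have Gg t : nc t <= rho -> iter (nj j) F (g t) = q + t *: v by move=> tr; apply: gl.1; rewrite subr0.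
have gR t : nc t <= rho -> nm (g t) <= Rg.
  by move=> tr; apply: le_trans (hcp (nj j) _) _; rewrite ler_wpM2l// lerD2l Gg// yY.
have gx t : nc t <= s -> nm (g t - x'') < ep.
  move=> ts; have [->|t0] := eqVneq t 0; first by rewrite g0 subrr nm0.
  have tp : 0 < nc t by rewrite nc_gt0.
  apply: (@le_lt_trans _ _ (n.+1%:R * (ep / 2 / n.+1%:R))); last first.
    by rewrite mulrC divfK ?lt0r_neq0//; lra.
  apply: nm_lt_coord => [|b]; first by rewrite !divr_gt0.
  rewrite !mxE; have r2 : 0 < rho / 2 by rewrite divr_gt0.
  have K0 : 0 <= 2 * Rg by rewrite mulr_ge0.
  have := @schwarz_div _ (fun t => g t 0 b - x'' 0 b) (rho / 2) (2 * Rg) r2 K0 _ _ t.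
  move=> h; apply: (@le_lt_trans _ _ (2 * Rg / (rho / 2) * nc t)).
    apply: h; last by rewrite tp (le_trans ts).
    - move=> t1 /andP[t1p t1r]; have t1r' : nc t1 <= rho by lra.
      split.
        have ng := disc_lift_nice (cov (nj j)) gl (t := t1) _ _ b.
        apply: nice_ext (niceD (ng _ _) (nice_cst (- x'' 0 b) t1)) _; rewrite ?subr0.
        + lra.
        + by apply: Hrho; rewrite subr0.
        + by exists 1 => // t' _.
      apply: le_trans (ncB _ _) _; rewrite mulr2n mulrDl mul1r; apply: lerD.
        by apply: le_trans (nm_coord _ _ _) (gR _ t1r').
      apply: le_trans (nm_coord _ _ _) _; rewrite -g0; apply: gR; rewrite nc0; exact: ltW.
    - have [_ [B [eta [eta0 HB]]]] := gl; exists B, (Num.min eta rho); split; first by rewrite lt_min eta0.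
      move=> t1; rewrite lt_min => /andP[t1p /andP[t1e t1r]].
      have := HB t1 0; rewrite !subr0 nc0 g0 => /(_ (ltW t1r) rho0' t1e); apply: le_trans.
      by have := nm_coord (g t1 - x'') 0 b; rewrite !mxE.
  apply: lt_le_trans sS; apply: (@lt_le_trans _ _ (S * nc t)); last by rewrite ler_pM2l.
  by rewrite ltr_pM2r// ltrDl.
have gz t : nc t <= s -> nm (g t - z j) < 3 * ep.
  by move=> ts; have := gx t ts; have := nm_tri x'' (g t) (z j); lra.
have tsr (t : C) : nc t <= s -> nc t <= rho by lra.
exists m, (fun t => iter (nj J) F (g t)); split.
  split; first by move=> t; rewrite subr0 -iterD mE => ts; apply: Gg; exact: tsr.
  have [L L0 HL] := pmap_lip Rg (pmap_iter hF (nj J)).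
  have [_ [B [eta [eta0 HB]]]] := gl; exists (L * B), eta; split=> // t t'; rewrite !subr0 => ts t's tt'.
  apply: le_trans (HL _ _ (gR _ (tsr _ ts)) (gR _ (tsr _ t's))) _; rewrite -mulrA ler_wpM2l//.
  by apply: HB; rewrite ?subr0 ?tsr.
move=> t; rewrite subr0 => ts b b'; have := HJ J j (leqnn J) (ltnW jJ) j (g t) (gz t ts) b b'.
rewrite (Gg t (tsr _ ts)); move/le_trans; apply; rewrite mulrAC ler_pdivrMr//.
rewrite ler_wpM2l ?(ltW om0)//; apply: (@le_trans _ _ (Rg * Y)); last by rewrite lerDl.
apply: ler_pM; rewrite ?nm_ge0 ?yY ?tsr//.
apply: le_trans (hcp m.+1 _) _; rewrite ler_wpM2l// lerD2l -iterD mE Gg ?yY//; exact: tsr.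
Qed.
End NoCauchy.

(** * Critical sets *)

Section DeriveCharts.
Local Open Scope classical_set_scope.
Import numFieldNormedType.Exports.
Variables (C : numClosedFieldType) (k : nat).
Local Notation P := (proj_space C k).
Local Notation V := 'rV[C]_k.+1.
Variables (f : P -> P) (F : V -> V).
Hypotheses (hol : holomorphic f)
  (fF : forall (v : V) (v0 : v != 0), exists Fv0 : F v != 0, f (line v0) = line Fv0).

Lemma horner_cvg (K : numFieldType) (p : {poly K}) : continuous (horner p).
Proof.
elim/poly_ind: p => [|p c IH] x.
  have -> : horner (0 : {poly K}) = fun=> 0 by apply/funext => h; rewrite horner0.
  exact: cst_continuous.
have -> : horner (p * 'X + c%:P) = (fun h => p.[h] * h + c).
  by apply/funext => h; rewrite hornerMXaddC.
exact: (cvgD (cvgM (IH x) cvg_id) (cvg_cst c)).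
Qed.

Lemma chart_dom_line i (v : V) (v0 : v != 0) : chart_dom i (line v0) <-> v 0 i != 0.
Proof.
have := hcoordK (line v0) => /line_eq[a a0 E].
by rewrite /chart_dom /= E mxE mulf_eq0 (negbTE a0).
Qed.

Lemma chart_line i (v : V) (v0 : v != 0) : v 0 i != 0 ->
  chart i (line v0) = \row_l (v 0 (lift i l) / v 0 i).
Proof.
move=> vi; have := hcoordK (line v0) => /line_eq[a a0 E].
apply/rowP => l; rewrite !mxE E !mxE invfM mulrACA divff// mul1r.
by [].
Qed.

(** Quotient rule: along the line the chart expression is a quotient of polynomials in [h], and the
    [(q l).[0]] are the directional derivatives of [F]. Holomorphy of [f] provides the
    differentiability that makes the Jacobian compute directional derivatives. *)
Lemma derive_in_charts i j p (w : 'rV[C]_k) l (q : 'I_k.+1 -> {poly C}) :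
  chart_dom i p -> chart_dom j (f p) ->
  let x := chart_inv_vec i (chart i p) in let eta : V := \row_l oapp (w 0) 0 (unlift i l) in
  (forall h l, F (x + h *: eta) 0 l = F x 0 l + h * (q l).[h]) ->
  (w *m jacobian (in_charts i j f) (chart i p)) 0 l =
    ((q (lift j l)).[0] * F x 0 j - F x 0 (lift j l) * (q j).[0]) / (F x 0 j) ^+ 2.
Proof.
move=> pi fpj x eta Fh; set z := chart i p; set phi := in_charts i j f.
have df : differentiable phi z by exact: hol.2.
have xE (h : C) : chart_inv_vec i (h *: w + z) = x + h *: eta.
  by apply/rowP => l'; rewrite !mxE; case: (unlift i l') => [l''|] /=; rewrite ?mxE ?mulr0 ?addr0// addrC.
have phiE (h : C) : F (x + h *: eta) 0 j != 0 ->
    phi (h *: w + z) 0 l = F (x + h *: eta) 0 (lift j l) / F (x + h *: eta) 0 j.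
  move=> Fj; rewrite /phi /in_charts /= /chart_inv; have [Fv0 ->] := fF (chart_inv_vec_neq0 i (h *: w + z)).
  by rewrite chart_line ?mxE xE.
have pE : p = line (chart_inv_vec_neq0 i z).
  rewrite -[LHS]hcoordK; apply/line_eq; exists (hcoord p 0 i) => //.
  apply/rowP => l'; rewrite !mxE; case: unliftP => [l'' ->|->] /=; last by rewrite mulr1.
  by rewrite mxE mulrCA divff ?mulr1.
have Fxj : F x 0 j != 0.
  move: fpj; rewrite pE; have [Fv0 ->] := fF (chart_inv_vec_neq0 i z).
  by move/chart_dom_line.
rewrite -deriveEjacobian//.
have cv : (fun h : C => (h^-1 *: ((phi \o shift z) (h *: w) - phi z)) 0 l) @ 0^' --> ('D_w phi z) 0 l.
  apply: (cvg_comp (fun h : C => h^-1 *: ((phi \o shift z) (h *: w) - phi z))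
     (fun y : 'rV[C]_k => y 0 l)); last exact: coord_continuous.
  exact: diff_derivable.
have ch (r : {poly C}) : (fun h : C => r.[h]) @ (0 : C)^' --> r.[0].
  by apply: cvg_within_filter; exact: horner_cvg.
pose N := q (lift j l) * (F x 0 j)%:P - (F x 0 (lift j l))%:P * q j.
pose D := (F x 0 j)%:P + 'X * q j.
have NE h : N.[h] = (q (lift j l)).[h] * F x 0 j - F x 0 (lift j l) * (q j).[h] by rewrite !hornerE.
have DE h : D.[h] = F x 0 j + h * (q j).[h] by rewrite !hornerE.
have D0 : D.[0] = F x 0 j by rewrite DE mul0r addr0.
have nF : F x 0 j * D.[0] != 0 by rewrite D0 mulf_neq0.
have cg : (fun h : C => N.[h] / (F x 0 j * D.[h])) @ (0 : C)^' -->
    ((q (lift j l)).[0] * F x 0 j - F x 0 (lift j l) * (q j).[0]) / (F x 0 j) ^+ 2.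
  have -> : F x 0 j ^+ 2 = F x 0 j * D.[0] by rewrite D0 expr2.
  by rewrite -NE; exact: (cvgM (ch N) (cvgV nF (cvgM (cvg_cst _) (ch D)))).
apply: (@cvg_unique _ (@norm_hausdorff _ C) _ _ _ _ cv).
apply: cvg_trans cg; apply: near_eq_cvg.
have nz : \forall h \near (0 : C)^', D.[h] != 0.
  have := ch D [set y | y != 0]; apply; rewrite D0; apply: open_nbhs_nbhs; split=> //.
  suff -> : [set y : C | y != 0] = ~` [set 0].
    exact/closed_openC/accessible_closed_set1/hausdorff_accessible/norm_hausdorff.
  by apply/seteqP; split=> y /= /eqP.
near=> h.
have h0 : h != 0 by near: h; exact: nbhs_dnbhs_neq.
have Dh : D.[h] != 0 by near: h.
have Fhj : F (x + h *: eta) 0 j != 0 by rewrite Fh -DE.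
have phi0 : phi z 0 l = F x 0 (lift j l) / F x 0 j.
  by have := phiE 0; rewrite !scale0r !addr0 add0r => ->.
rewrite mxE [X in _ = _ * X]mxE [X in _ = _ * (_ + X)]mxE /= phiE// phi0 NE !Fh; rewrite DE in Dh *.
by field; rewrite h0 Dh Fxj.
Unshelve. all: by end_near. Qed.

End DeriveCharts.

(** * The critical set as the zero set of the Jacobian determinant of the lift *)

Section CriticalSet.
Local Open Scope classical_set_scope.
Import numFieldNormedType.Exports.
Variables (R : realType) (k d : nat).
Local Notation C := R[i].
Local Notation P := (proj_space C k).
Local Notation V := 'rV[C]_k.+1.
Variables (f : P -> P) (F : V -> V) (M : V -> V -> 'M[C]_k.+1).
Hypotheses (hF : forall j, hform d (fun v => F v 0 j)) (d1 : (1 < d)%N) (FM : bez F M) (hol : holomorphic f)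
  (fF : forall (v : V) (v0 : v != 0), exists Fv0 : F v != 0, f (line v0) = line Fv0).

(** A chart vector in the kernel of the Jacobian of [f] is one whose image under the Jacobian of [F]
    is collinear to [F x]. By Euler's relation [x *m M x x = d%:R *: F x], subtracting a multiple of
    [x] makes it a kernel vector of [M x x]; conversely, the [i]-th coordinate of a kernel vector is
    removed by subtracting a multiple of [x]. *)
Lemma critical_setE p : critical_set f p <-> \det (M (hcoord p) (hcoord p)) = 0.
Proof.
have chartE i j : chart_dom i p -> chart_dom j (f p) ->
    (\rank (jacobian (in_charts i j f) (chart i p)) < k)%N <-> \det (M (hcoord p) (hcoord p)) = 0.
  move=> pi fpj; set x := chart_inv_vec i (chart i p).
  have xi : x 0 i = 1 by rewrite mxE unlift_none.
  have hE : hcoord p = hcoord p 0 i *: x.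
    apply/rowP => l; rewrite !mxE; case: unliftP => [l' ->|->] /=; last by rewrite mulr1.
    by rewrite mxE mulrCA divff ?mulr1.
  have -> : \det (M (hcoord p) (hcoord p)) = 0 <-> \det (M x x) = 0.
    rewrite hE (bez_diagZ hF d1 FM)// detZ; split=> [/eqP|->]; last by rewrite mulr0.
    by rewrite mulf_eq0 !expf_eq0 (negbTE pi) !andbF => /eqP.
  have x0 : x != 0 by apply: contra_eqN xi => /eqP ->; rewrite mxE eq_sym oner_eq0.
  have Fx0 : F x != 0 by have [] := fF x0.
  have dn0 : d%:R != 0 :> C by rewrite pnatr_eq0 -lt0n ltnW.
  have xM : x *m M x x = d%:R *: F x by exact: (euler hF FM x).
  have Fxj : F x 0 j != 0.
    move: fpj; have -> : p = line x0.
      by rewrite -[LHS]hcoordK; apply/line_eq; exists (hcoord p 0 i).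
    by have [Fv0 ->] := fF x0; move/chart_dom_line.
  pose eta (w : 'rV[C]_k) : V := \row_l oapp (w 0) 0 (unlift i l).
  have etai w : eta w 0 i = 0 by rewrite mxE unlift_none.
  have -> : (\rank (jacobian (in_charts i j f) (chart i p)) < k)%N <->
      exists2 w : 'rV[C]_k, w != 0 & forall l, (eta w *m M x x) 0 (lift j l) * F x 0 j =
         F x 0 (lift j l) * (eta w *m M x x) 0 j.
    have der w l : (w *m jacobian (in_charts i j f) (chart i p)) 0 l =
        ((eta w *m M x x) 0 (lift j l) * F x 0 j - F x 0 (lift j l) * (eta w *m M x x) 0 j) / (F x 0 j) ^+ 2.
      have /choice[q Hq] l' : exists q : {poly C}, forall h, (eta w *m M (x + h *: eta w) x) 0 l' = q.[h].
        exact: (bez_row_poly FM (eta w) x (eta w) l').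
      have uE l' : (eta w *m M x x) 0 l' = (q l').[0] by rewrite -Hq scale0r addr0.
      rewrite !uE; apply: (derive_in_charts hol fF) => // h l'; rewrite -/x -/(eta w).
      have := FM.2 (x + h *: eta w) x; rewrite [x + _ - _]addrC addKr -scalemxAl => /rowP/(_ l').
      rewrite [in X in X = _ -> _]mxE [in X in _ + X = _ -> _]mxE [in X in _ = X -> _]mxE Hq => <-.
      by rewrite [RHS]addrC subrK.
    split=> [rk|[w w0 Hw]].
      have : kermx (jacobian (in_charts i j f) (chart i p)) != 0.
        by rewrite kermx_eq0 /row_free neq_ltn rk.
      case/rowV0Pn => w /sub_kermxP wJ w0; exists w => // l.
      have := der w l; rewrite wJ mxE => /esym/eqP; rewrite mulf_eq0 invr_eq0 expf_eq0 (negbTE Fxj) orbF.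
      by rewrite subr_eq0 => /eqP.
    rewrite ltn_neqAle rank_leq_row andbT; apply: contra w0 => /eqP rk.
    have : row_free (jacobian (in_charts i j f) (chart i p)) by rewrite /row_free rk.
    move/mulmx_free_eq0 => <-; apply/eqP/rowP => l; rewrite der Hw subrr mul0r mxE.
    by [].
  split=> [[w w0 Hw]|/eqP/det0P[v v0 vM]].
    apply/eqP/det0P; set u := eta w *m M x x in Hw.
    have uE : u = (u 0 j / F x 0 j) *: F x.
      apply/rowP => l; rewrite [RHS]mxE; case: (unliftP j l) => [l' ->|->]; last by rewrite divfK.
      by apply: (mulIf Fxj); rewrite Hw mulrAC divfK// mulrC.
    exists (eta w - (u 0 j / F x 0 j / d%:R) *: x).
      apply: contra w0; rewrite subr_eq0 => /eqP E.
      have s0 : u 0 j / F x 0 j / d%:R = 0 by have /rowP/(_ i) := E; rewrite etai mxE xi mulr1.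
      apply/eqP/rowP => l; have /rowP/(_ (lift i l)) := E; rewrite s0 scale0r !mxE liftK.
      by [].
    by rewrite mulmxBl -scalemxAl xM scalerA divfK// -uE subrr.
  pose h := v - v 0 i *: x; pose w : 'rV[C]_k := \row_l h 0 (lift i l).
  have hi : h 0 i = 0 by rewrite !mxE unlift_none mulr1 subrr.
  have ew : eta w = h.
    by apply/rowP => l; rewrite mxE; case: unliftP => [l' ->|->] /=; [rewrite !mxE|rewrite hi].
  exists w.
    apply: contra v0 => /eqP w0; have h0 : h = 0 by rewrite -ew w0; apply/rowP => l; rewrite !mxE; case: unlift => //= ?; rewrite mxE.
    have vE : v = v 0 i *: x by apply/eqP; rewrite -subr_eq0 -/h h0.
    have : v 0 i *: (d%:R *: F x) == 0 by rewrite -xM scalemxAl -vE vM.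
    rewrite !scaler_eq0 (negbTE dn0) (negbTE Fx0) !orbF => /eqP vi.
    by rewrite vE vi scale0r.
  move=> l; rewrite ew /h mulmxBl vM sub0r -scalemxAl xM !mxE; ring.
split=> [[i [j [pi fpj /(chartE i j pi fpj)]]] //|J0].
have ex (v : V) : v != 0 -> exists i, v 0 i != 0.
  move=> v0; apply/existsP; apply: contraNT v0 => /existsPn H; apply/eqP/rowP => i.
  by apply/eqP; rewrite mxE -[_ == _]negbK H.
have [i pi] := ex _ (hcoord_neq0 p); have [j fj] := ex _ (hcoord_neq0 (f p)).
by exists i, j; split=> //; apply/chartE.
Qed.
End CriticalSet.

(** * Critically finite maps *)

Section AlgebraicClosed.
Local Open Scope classical_set_scope.
Import numFieldNormedType.Exports.
Variables (C : numClosedFieldType) (k : nat).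

Lemma monomial_continuous (s : seq 'I_k.+1) (m : multinom k.+1) :
  continuous (fun v : 'rV[C]_k.+1 => \prod_(i <- s) v 0 i ^+ m i).
Proof.
elim: s => [|i s IH] v.
  by under eq_fun do rewrite big_nil; exact: cst_continuous.
under eq_fun do rewrite big_cons.
have ci (j : nat) : (fun v : 'rV[C]_k.+1 => v 0 i ^+ j) @ v --> v 0 i ^+ j.
  elim: j => [|j IHj]; first by under eq_fun do rewrite expr0; exact: cst_continuous.
  by under eq_fun do rewrite exprS; rewrite exprS; exact: (cvgM (@coord_continuous _ _ _ 0 i v) IHj).
exact: (cvgM (ci _) (IH v)).
Qed.

Lemma meval_continuous (p : mpoly k.+1 C) : continuous (fun v : 'rV[C]_k.+1 => meval (v 0) p).
Proof.
elim/mpolyind: p => [|c m p _ _ IH] v.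
  by under eq_fun do rewrite meval0; exact: cst_continuous.
under eq_fun do rewrite mevalD mevalZ mevalX.
exact: (cvgD (cvgM (cvg_cst c) (@monomial_continuous _ m v)) (IH v)).
Qed.

Lemma algebraic_closed (A : set (proj_space C k)) : algebraic A -> closed A.
Proof.
move=> [m [d [q AE]]]; rewrite -[A]setCK; apply: open_closedC; apply/open_proj_spaceE.
rewrite openE => v [v0 nA].
have hE (w : 'rV[C]_k.+1) (w0 : w != 0) i : (heval (q i) (hcoord (line w0)) == 0) = (heval (q i) w == 0).
  have := hcoordK (line w0) => /line_eq[a a0 ->].
  by rewrite /heval meval_dhomogZ mulf_eq0 expf_eq0 (negbTE a0) andbF.
have [i qi] : exists i, heval (q i) v != 0.
  apply: contrapT => /forallNP H; apply: nA; rewrite AE /= => i; apply/eqP; rewrite hE.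
  by apply: contrapT => /negP; exact: H.
have nzE (T : topologicalType) (g : T -> C) x : g @ x --> g x -> g x != 0 -> \forall y \near x, g y != 0.
  move=> gx gx0; have := gx [set y | y != 0]; apply; apply: open_nbhs_nbhs; split=> //.
  suff -> : [set y : C | y != 0] = ~` [set 0].
    exact/closed_openC/accessible_closed_set1/hausdorff_accessible/norm_hausdorff.
  by apply/seteqP; split=> y /= /eqP.
have nq := nzE _ _ _ (@meval_continuous (mpoly_of_dhomog (q i)) v) qi.
have nv : \forall w \near v, w != 0.
  have o0 : open [set~ (0 : 'rV[C]_k.+1)].
    exact/closed_openC/accessible_closed_set1/hausdorff_accessible/norm_hausdorff.
  apply: (filterS _ (open_nbhs_nbhs (conj o0 _))) => [w /eqP//|].
  exact/eqP.
rewrite /interior; near=> w.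
have w0 : w != 0 by near: w.
exists w0; rewrite AE => /(_ i)/eqP; rewrite hE; apply/negP; near: w.
exact: nq.
Unshelve. all: by end_near. Qed.
End AlgebraicClosed.

(** * Images of algebraic sets and their codimension *)

Section ProjectiveDynamics.
Local Open Scope classical_set_scope.
Import numFieldNormedType.Exports.
Variables (R : realType) (k d : nat).
Local Notation C := R[i].
Local Notation P := (proj_space C k).
Local Notation V := 'rV[C]_k.+1.
Variables (f : P -> P) (F : V -> V) (M : V -> V -> 'M[C]_k.+1).
Hypotheses (hF : forall j, hform d (fun v => F v 0 j)) (Fn0 : forall v, v != 0 -> F v != 0)
  (k0 : (0 < k)%N) (d1 : (1 < d)%N) (FM : bez F M)
  (fF : forall (v : V) (v0 : v != 0), exists Fv0 : F v != 0, f (line v0) = line Fv0)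
  (critE : forall p, critical_set f p <-> jac M (hcoord p) = 0).
Implicit Types A B L : set P.
Local Notation C1 := (critical_set f).
Local Notation eJ := (k.+1 * d.-1)%N.

Lemma hform_f e q p : hform e q -> (q (hcoord (f p)) == 0) = (q (F (hcoord p)) == 0).
Proof.
move=> hq; rewrite -{1}[p]hcoordK; have [Fv0 ->] := fF (hcoord_neq0 p).
exact: (hform_line_eq0 Fv0 hq).
Qed.

Lemma hform_comp e q : hform e q -> hform (d * e) (fun v => q (F v)).
Proof.
move=> [pq hq]; split=> [|c v]; first exact: (pf_comp (hom_pmap hF)).
by rewrite (homZ hF) hq exprM.
Qed.

(** Forms of degree [n] independent on the image become, composed with [F], forms of degree [d * n]
    independent on [A]; the change of degree costs the factor [d ^ k]. *)
Lemma codim_ge_image c A : codim_ge c A -> codim_ge c (f @` A).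
Proof.
move=> [K H]; exists (K * d ^ k)%N => n r [u [hu Hu]].
have /H h : indep A (d * n) r.
  exists (fun i v => u i (F v)); split=> [i|a aA]; first exact: hform_comp.
  apply: Hu => _ [p Ap <-]; apply/eqP.
  have ha : hform n (fun v => \sum_i a 0 i * u i v) by apply: hform_sum => i _; exact: hformZ.
  by rewrite (hform_f _ ha) aA.
have dn : (n.+1 <= (d * n).+1)%N by rewrite ltnS leq_pmull// ltnW.
apply: (@leq_trans (r * (d * n).+1 ^ c)).
  by rewrite leq_mul2l; apply/orP; right; case: (c) => // c'; rewrite leq_exp2r.
apply: leq_trans h _; rewrite -mulnA leq_mul2l -expnMn; apply/orP; right.
by rewrite leq_exp2r// mulnS -add1n leq_add2r ltnW.
Qed.

Lemma jac_form : hform eJ (jac M). Proof. exact: (hform_jac hF d1 FM). Qed.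

Lemma eJ_gt0 : (0 < eJ)%N. Proof. by rewrite muln_gt0 /= -ltnS prednK// ltnW. Qed.

Lemma jac_pt : exists p : P, jac M (hcoord p) != 0.
Proof.
have [z Jz] := jac_neq0 hF Fn0 d1 FM.
have z0 : z != 0.
  by apply: contraNneq Jz => ->; rewrite -(scale0r 0) jac_form.2 expr0n (gtn_eqF eJ_gt0) mul0r.
by exists (line z0); rewrite (hform_line_eq0 z0 jac_form).
Qed.

Lemma crit_algebraic : algebraic C1.
Proof.
suff -> : C1 = [set p : P | jac M (hcoord p) = 0] by exact: algebraic_zero jac_form.
by apply/seteqP; split=> p /critE.
Qed.

Lemma codim_crit : codim_ge 1 C1.
Proof.
apply: codim_geS (codim_ge1_zero jac_form jac_pt) => p; exact: (critE p).1.
Qed.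

Lemma crit_nonempty : C1 !=set0.
Proof.
have [v v0 Jv] := hform_zero k0 eJ_gt0 jac_form.
by exists (line v0); apply/critE/eqP; rewrite (hform_line_eq0 v0 jac_form) Jv.
Qed.

Lemma hform0 e q : (0 < e)%N -> hform e q -> q (0 : V) = 0.
Proof. by move=> e0 [_ hq]; rewrite -(scale0r 0) hq expr0n (gtn_eqF e0) mul0r. Qed.

Lemma cover_map_of e q : (0 < e)%N -> hform e q -> van q (f @` C1) -> exists cp, cover_map F M q cp.
Proof.
move=> e0 hq qv; have [cp Hcp] := hom_proper hF Fn0 d1; exists cp.
split=> //; [exact: hom_pmap|exact: hq.1|move=> z].
have [->|z0] := eqVneq z 0; first by rewrite (hom0 hF d1) (hform0 e0 hq) eqxx.
apply: contraNneq => Jz; rewrite -(hform_line_eq0 _ hq); first exact: Fn0.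
move=> Fz0; have [Fz1 E] := fF z0.
have -> : line Fz0 = f (line z0) by rewrite E; apply/line_eq; exists 1; rewrite ?oner_eq0 ?scale1r.
apply/eqP/qv; exists (line z0) => //; apply/critE/eqP.
by rewrite (hform_line_eq0 z0 jac_form) /jac Jz.
Qed.

(** If every form vanishing on the image of the critical set vanished everywhere, forms independent
    on the whole space would remain so on that image, which has codimension at least 1, against
    [codim_setT]. The extra coordinate makes the degree positive, as [cover_map_of] needs at the
    origin. *)
Lemma regular_cover : exists q cp, cover_map F M q cp /\ exists y, q y != 0.
Proof.
have [e [q hq [qv [p qp]]]] : exists e, exists2 q, hform e q & van q (f @` C1) /\ exists p : P, q (hcoord p) != 0.
  apply: contrapT => no; apply: (@codim_setT R k); have [K H] := codim_ge_image codim_crit.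
  exists K => n r [u [hu Hu]]; apply: H; exists u; split=> // c cv; apply: Hu => p _; apply/eqP.
  apply: contrapT => /negP h; apply: no; exists n, (fun v => \sum_i c 0 i * u i v).
    by apply: hform_sum => i _; exact: hformZ.
  by split=> //; exists p.
have [i pi] : exists i, hcoord p 0 i != 0.
  apply/existsP; apply: contraNT (hcoord_neq0 p) => /existsPn H; apply/eqP/rowP => j.
  by apply/eqP; rewrite mxE -[_ == _]negbK H.
have [|cp Hcp] := @cover_map_of (1 + e) (fun v : V => v 0 i * q v) isT (hformM (hform_coord R i) hq).
  by move=> p' /qv ->; rewrite mulr0.
by exists (fun v : V => v 0 i * q v), cp; split=> //; exists (hcoord p); rewrite mulf_neq0.
Qed.

(** Elimination by norms. The equations of [A] are combined with powers of a generic [tau] into one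
    polynomial [g] that is nonzero at all points over [p]. The norm of [g] vanishes on the cone over
    the image of [A], since a [d]-th root rescales preimages within the cone over [A], and it does
    not vanish at [p]. Components of different degrees are separated by [van_cone]. *)
Lemma algebraic_image A : algebraic A -> algebraic (f @` A).
Proof.
move=> [m [e [q AE]]]; apply/algebraicP => p nAp; set y := hcoord p.
have [Q [cp [cov hQ]]] := regular_cover; have hM : exists z, \det (M z z) != 0 by exact: (jac_neq0 hF Fn0 d1 FM).
have [zs [_ _ zsP HN]] := fiber_limit cov hQ hM y.
pose r z : {poly C} := \sum_i (heval (q i) z)%:P * 'X^i.
have r0 z : z \in zs -> r z != 0.
  move=> /zsP Fz; have z0 : z != 0.
    by apply: contraNneq (hcoord_neq0 p) => z0; rewrite -/y -Fz z0 (hom0 hF d1).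
  have nAz : ~ A (line z0).
    move=> Az; apply: nAp; exists (line z0) => //; have [Fv0 ->] := fF z0.
    by rewrite -[RHS]hcoordK; apply/line_eq; exists 1; rewrite ?oner_eq0 ?scale1r.
  have [i qi] : exists i, heval (q i) z != 0.
    apply: contrapT => /forallNP H; apply: nAz; rewrite AE /= => i; apply/eqP.
    by rewrite (hform_line_eq0 z0 (hform_dhomog (q i))); apply: contrapT => /negP h; apply: (H i).
  apply: contraNneq qi => rz; have : (r z)`_i = 0 by rewrite rz coef0.
  rewrite coef_sum (bigD1 i)//= coefCM coefXn eqxx mulr1 big1 ?addr0 => [->//|j ji].
  by rewrite coefCM coefXn eq_sym -(inj_eq val_inj) in ji *; rewrite (negbTE ji) mulr0.
have [tau [_ _ Htau]] := nonroot_near 0 (w := \prod_(z <- zs) r z) ltac:(rewrite prodf_seq_neq0; apply/allP => z; exact: r0) (@ltr01 R).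
pose g (v : V) := (r v).[tau].
have gE v : g v = \sum_i heval (q i) v * tau ^+ i.
  by rewrite /g /r horner_sum; apply: eq_bigr => i _; rewrite !hornerE.
have pg : polyfun g.
  apply: (@pf_ext _ _ (fun v => \sum_i heval (q i) v * tau ^+ i)) => //.
  by apply: pf_sum => i _; apply: pfM; [exact: (hform_dhomog (q i)).1|exact: pf_cst].
have [N pN HNg] := sym_polyfun cov (symfun_prod pg) hQ.
apply: (van_cone pN) => [v v0 [a Aa fa]|]; last first.
  rewrite -/y (HN g N pg pN HNg); apply: contraNneq Htau => h0.
  by rewrite horner_prod; apply/eqP.
have [c c0 vE] : exists2 c : C, c != 0 & v = c *: F (hcoord a).
  move: fa; rewrite -{1}[a]hcoordK; have [Fv0 ->] := fF (hcoord_neq0 a).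
  by move/esym/line_eq.
pose c' := d.-root c; have c'd : c' ^+ d = c by rewrite rootCK// ltnW.
pose z' := c' *: hcoord a; have Fz' : F z' = v by rewrite (homZ hF) c'd.
have [zs' [_ _ zsP' HN']] := fiber_limit cov hQ hM v.
rewrite (HN' g N pg pN HNg) (big_rem z')/=; last exact/zsP'.
rewrite gE big1 ?mul0r// => i _; rewrite /heval /z' meval_dhomogZ.
by move: Aa; rewrite AE /= => /(_ i); rewrite /heval => ->; rewrite mulr0 mul0r.
Qed.

Lemma algebraic_iter_image j A : algebraic A -> algebraic (iter j f @` A).
Proof.
move=> aA; elim: j => [|j IH]; first by rewrite /= image_id.
have -> : iter j.+1 f @` A = f @` (iter j f @` A) by rewrite image_comp.
exact: algebraic_image.
Qed.

Lemma codim_ge_iter_image c j A : codim_ge c A -> codim_ge c (iter j f @` A).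
Proof.
move=> cA; elim: j => [|j IH]; first by rewrite /= image_id.
have -> : iter j.+1 f @` A = f @` (iter j f @` A) by rewrite image_comp.
exact: codim_ge_image.
Qed.

Lemma post_orbit_image A : f @` post_orbit f A `<=` post_orbit f A.
Proof. by move=> _ [_ [j j0 [a Aa <-]] <-]; exists j.+1 => //; exists a. Qed.

(** Each iterated image has codimension at least [c], but with no uniform constant. An irreducible
    piece violating the bound lies in the countable union of these images, hence in one of them. *)
Lemma post_orbit_codim c A : algebraic A -> algebraic (post_orbit f A) -> codim_ge c A ->
  codim_ge c (post_orbit f A).
Proof.
move=> aA aD cA; apply: contrapT => nD.
have [L [irrL LD nL]] := minimal_irreducible aD nD (codim_ge0set _ _ _) (@codim_geU _ _ c) (@codim_geS _ _ c).
have [||j Lj] := @irreducible_countable _ _ L (fun j => iter j.+1 f @` A) irrL.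
- by move=> j; exact: algebraic_iter_image.
- by move=> p /LD[j j0 Aj]; exists j.-1 => //; rewrite prednK.
by apply: nL; apply: codim_geS Lj _; exact: codim_ge_iter_image.
Qed.

(** An irreducible set in the intersection that is too large to have codimension [c + 1] is maximal
    in both: strictly inside a larger irreducible set of codimension at least [c] it would have
    codimension [c + 1]. *)
Lemma common_component c A B : algebraic A -> algebraic B -> codim_ge c A -> codim_ge c B ->
  ~ codim_ge c.+1 (A `&` B) -> exists L, [/\ irr_component L A, irr_component L B & L `<=` A `&` B].
Proof.
move=> aA aB cA cB nAB.
have [L [irrL LAB nL]] := minimal_irreducible (algebraicI aA aB) nAB (codim_ge0set _ _ _) (@codim_geU _ _ c.+1) (@codim_geS _ _ c.+1).
have comp B' : codim_ge c B' -> L `<=` B' -> irr_component L B'.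
  move=> cB' LB'; split=> // L' irrL' L'B LL'; apply/seteqP; split=> // p L'p.
  apply: contrapT => nLp; apply: nL; have [aL _ _] := irrL.
  have [e [q hq [qL qp]]] := (algebraicP _).1 aL p nLp.
  apply: (codim_ge_strict irrL' LL' hq qL); last exact: codim_geS L'B cB'.
  by move=> /(_ p L'p)/eqP; rewrite (negbTE qp).
by exists L; split=> //; apply: comp => // p /LAB[].
Qed.
End ProjectiveDynamics.

(** * Orbits and the critical set of a critically finite map *)

Section CriticallyFinite.
Local Open Scope classical_set_scope.
Variables (R : realType) (k d : nat).
Local Notation C := R[i].
Local Notation P := (proj_space C k).
Local Notation V := 'rV[C]_k.+1.
Variables (f : P -> P) (F : V -> V) (M : V -> V -> 'M[C]_k.+1).
Hypotheses (hF : forall j, hform d (fun v => F v 0 j)) (Fn0 : forall v, v != 0 -> F v != 0)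
  (k0 : (0 < k)%N) (d1 : (1 < d)%N) (FM : bez F M)
  (fF : forall (v : V) (v0 : v != 0), exists Fv0 : F v != 0, f (line v0) = line Fv0)
  (critE : forall p, critical_set f p <-> jac M (hcoord p) = 0) (hcf : n_crit_finite f k).
Local Notation C1 := (critical_set f).

Lemma n_crit_finiteW n m : (m <= n)%N -> n_crit_finite f n -> n_crit_finite f m.
Proof.
move=> /subnK <-; elim: (n - m)%N => // j IH; rewrite addSn => H; apply: IH; move: H.
by case: (j + m)%N => [//|i] [].
Qed.

Lemma algebraic_D n : (0 < n <= k)%N -> algebraic (D_ f n).
Proof.
case: n => // n /= nk; have := n_crit_finiteW nk hcf.
by case: n nk => [|n] nk; [case=> -[]|case=> _ []].
Qed.

(** [D_ f n.+1] is algebraic, hence closed, and is mapped into itself; its successive images form a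
    decreasing sequence of algebraic sets, which is stationary. The index [j0.+1] is positive, as
    the definition of the intersection asks. *)
Lemma E_spec n : (n < k)%N -> exists j0, (forall j, (j0 <= j)%N -> iter j f @` D_ f n.+1 `<=` E_ f n.+1) /\
  E_ f n.+1 = iter j0.+1 f @` D_ f n.+1.
Proof.
move=> nk; have aD : algebraic (D_ f n.+1) by exact: algebraic_D.
pose X j := iter j f @` D_ f n.+1.
have XS j : X j.+1 `<=` X j.
  by move=> _ [_ [i i0 [a Ca <-]] <-]; exists (iter i.+1 f a); [exists i.+1 => //; exists a|rewrite /= -iterSr].
have [|j0 Hj] := algebraic_stationary (A := X) _ XS.
  by move=> j; exact: (algebraic_iter_image hF Fn0 k0 d1 FM fF critE).
have EE : E_ f n.+1 = \bigcap_(j in [set j | (0 < j)%N]) X j.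
  by rewrite /= /omega_limit -(closure_id _).1//; exact: algebraic_closed.
have mono i j : (i <= j)%N -> X j `<=` X i.
  by move=> /subnK <-; elim: (j - i)%N => // l IH; apply: subset_trans IH; exact: XS.
exists j0; split=> [j jj|].
  by rewrite EE => p Xp i _; apply: Hj; exact: (mono _ _ jj).
rewrite EE; apply/seteqP; split=> [p|p Xp i _]; first by apply.
by apply: Hj; exact: (XS j0).
Qed.

Lemma E_forward n p : (n <= k)%N -> E_ f n p -> E_ f n (f p).
Proof.
case: n => // n nk; have [j0 [_ ->]] := E_spec nk; case=> a Da <-.
by exists (f a); [apply: post_orbit_image; exists a|rewrite -iterSr].
Qed.

(** If the critical points of [E_ f n.+1] did not have one more codimension, [common_component]
    would produce a component of [E_ f n.+1] inside the critical set: a component shared with the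
    critical set when [n = 0], and one contained in it otherwise, both excluded. *)
Lemma E_codim n : (n <= k)%N ->
  [/\ algebraic (E_ f n), codim_ge n (E_ f n) & codim_ge n.+1 (C1 `&` E_ f n)].
Proof.
have aC := crit_algebraic hF d1 FM critE; have cC := codim_crit hF Fn0 d1 FM critE.
elim: n => [_|n IH nk].
  by split; [exact: algebraicT|exact: codim_ge0|apply: codim_geS cC => p []].
have [aE cE cCE] := IH (ltnW nk); have aD : algebraic (D_ f n.+1) by exact: algebraic_D.
have [j0 [_ EE]] := E_spec nk.
have aE' : algebraic (E_ f n.+1) by rewrite EE; exact: (algebraic_iter_image hF Fn0 k0 d1 FM fF critE).
have cE' : codim_ge n.+1 (E_ f n.+1).
  rewrite EE; apply: (codim_ge_iter_image hF k0 d1 fF).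
  by apply: (post_orbit_codim hF Fn0 k0 d1 FM fF critE) => //; exact: algebraicI.
split=> //; apply: contrapT => no; have := n_crit_finiteW nk hcf; case: n {IH} nk aE cE cCE aD EE aE' cE' no.
  move=> _ _ _ _ _ _ aE' cE' no [_]; apply.
  have [L [LC LE _]] := common_component aC aE' cC cE' no.
  exists L; split; last exact: LE.
  by have -> : C_ f 1 = C1 by rewrite /C_ setIT.
move=> n nk _ _ _ _ _ aE' cE' no [_ _]; apply.
have [||L [_ LE LCE]] := common_component (algebraicI aC aE') aE' _ cE' _.
- by apply: codim_geS cE' => p [].
- by rewrite -setIA setIid.
by exists L; split=> // p /LCE[[]].
Qed.

Lemma crit_E_empty : C1 `&` E_ f k = set0.
Proof. by apply: codim_ge_empty; case: (E_codim (leqnn k)). Qed.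

Definition hits p m := (\sum_(i < m) `[< C1 (iter i f p) >])%N.

Lemma hits_shift p a m : (hits p m <= a + hits (iter a f p) m)%N.
Proof.
pose h i : nat := `[< C1 (iter i f p) >].
have -> : hits (iter a f p) m = (\sum_(i < m) h (a + i))%N.
  by apply: eq_bigr => i _; rewrite /h addnC iterD.
have e : (\sum_(i < a + m) h i = \sum_(i < a) h i + \sum_(i < m) h (a + i))%N by rewrite big_split_ord.
apply: (@leq_trans (\sum_(i < a + m) h i)%N).
  by rewrite addnC big_split_ord leq_addr.
rewrite e leq_add2r; apply: (@leq_trans (\sum_(i < a) 1)%N); last by rewrite sum1_card card_ord.
by apply: leq_sum => i _; exact: leq_b1.
Qed.

(** Descending through the [E_ f n]: an orbit in [E_ f n] stays there, and once it meets the
    critical set it enters [E_ f n.+1] after [j0.+1] further steps, a number that depends on [n]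
    alone. In [E_ f k] there is nothing left to meet. *)
Lemma hits_bound : exists N, forall p m, (hits p m <= N)%N.
Proof.
suff H i : (i <= k)%N -> exists N, forall p m, E_ f (k - i) p -> (hits p m <= N)%N.
  by have [N HN] := H k (leqnn k); exists N => p m; apply: HN; rewrite subnn.
elim: i => [_|i IH ik].
  exists 0%N => p m; rewrite subn0 => Ep; rewrite leqn0 sum_nat_eq0; apply/forallP => j; rewrite eqb0.
  apply/asboolPn => Cj; have : (C1 `&` E_ f k) (iter j f p).
    by split=> //; elim: (j : nat) => // j' IHj; exact: E_forward.
  by rewrite crit_E_empty.
have [N HN] := IH (ltnW ik); set n := (k - i.+1)%N.
have n1 : (k - i)%N = n.+1 by rewrite /n -subSn// subSS.
have nk : (n < k)%N by rewrite -n1 leq_subr.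
have [j0 [Hj _]] := E_spec nk; exists (j0.+1 + N)%N => p m; elim: m p => [|m IHm] p Ep.
  by rewrite /hits big_ord0.
have [Cp|nCp] := pselect (C1 p).
  apply: leq_trans (hits_shift _ j0.+1 _) _; rewrite leq_add2l; apply: HN; rewrite n1.
  apply: (Hj j0 (leqnn _)); exists (f p); last by rewrite iterSr.
  by exists 1%N => //; exists p.
suff -> : hits p m.+1 = hits (f p) m by exact: IHm (E_forward (ltnW nk) Ep).
pose h (i : nat) : bool := `[< C1 (iter i f p) >].
have E : hits p m.+1 = (\sum_(i < m.+1) h i)%N by [].
have h0 : h 0%N = false by exact: asboolF.
have hS j : h j.+1 = `[< C1 (iter j f (f p)) >] by rewrite /h iterSr.
rewrite E; clearbody h; rewrite big_ord_recl h0 add0n.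
by apply: eq_bigr => j _; rewrite hS.
Qed.

(** If every critical point were postcritical, each point of [D_ f 1] would have arbitrarily long
    backward orbits in [D_ f 1]. All [D_ f n] would then coincide and all [E_ f n] would contain the
    critical set, which is nonempty and disjoint from [E_ f k]. *)
Lemma crit_not_post : exists2 c, C1 c & ~ D_ f 1 c.
Proof.
apply: contrapT => no; have CD : C1 `<=` D_ f 1.
  by move=> c Cc; apply: contrapT => nD; apply: no; exists c.
have D1E : D_ f 1 = post_orbit f C1 by rewrite /D_ /C_ /= setIT.
have CE n : (n <= k)%N -> C1 `<=` E_ f n.
  elim: n => // n IH nk; have [j0 [_ ->]] := E_spec nk.
  have -> : D_ f n.+1 = D_ f 1.
    by rewrite D1E /D_ /C_ /= setIidl//; exact: IH (ltnW nk).
  apply: subset_trans (CD) _; elim: j0.+1 => [|j IHj]; first by rewrite /= image_id.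
  apply: subset_trans IHj _ => _ [a + <-]; rewrite D1E => -[i i0 [b Cb <-]].
  have i1 : i = i.-1.+1 by rewrite prednK.
  exists (iter i.-1 f b); last by rewrite iterSr -iterS -i1.
  have [->|/prednK i2] := posnP i.-1; first by rewrite -D1E; exact: CD.
  by exists i.-1; [rewrite /= -i2|exists b].
have [c Cc] := crit_nonempty hF k0 d1 FM critE.
have : (C1 `&` E_ f k) c by split=> //; exact: (CE k).
by rewrite crit_E_empty.
Qed.

(** Any form that vanishes on [D_ f 1] and not at [c] will do; the coordinate factor ensures a
    positive degree, so that the form also vanishes at the origin. *)
Lemma post_critical_form : exists e q (c : V), [/\ hform e q, (0 < e)%N, c != 0, jac M c = 0 & q c != 0 /\
  forall i z, z != 0 -> jac M z = 0 -> q (iter i.+1 F z) = 0].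
Proof.
have [c Cc nD] := crit_not_post; have aD := @algebraic_D 1 k0.
have [e [q hq [qv qc]]] := (algebraicP _).1 aD c nD.
have [i ci] : exists i, hcoord c 0 i != 0.
  apply/existsP; apply: contraNT (hcoord_neq0 c) => /existsPn H; apply/eqP/rowP => j.
  by apply/eqP; rewrite mxE -[_ == _]negbK H.
exists (1 + e)%N, (fun v : V => v 0 i * q v), (hcoord c); split=> //.
- by apply: hformM => //; exact: hform_coord.
- exact: hcoord_neq0.
- by apply/critE.
split; first by rewrite mulf_neq0.
move=> j z z0 Jz; suff -> : q (iter j.+1 F z) = 0 by rewrite mulr0.
have Fj l : iter l F z != 0 by elim: l => //= l; exact: Fn0.
have fj l : iter l f (line z0) = line (Fj l).
  elim: l => [|l IH]; first by apply/line_eq; exists 1; rewrite ?oner_eq0 ?scale1r.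
  rewrite /= IH; have [Fv0 ->] := fF (Fj l).
  by apply/line_eq; exists 1; rewrite ?oner_eq0 ?scale1r.
have : D_ f 1 (line (Fj j.+1)).
  rewrite -fj; exists j.+1; first exact: isT.
  exists (line z0); last exact: erefl.
  split; last exact: I.
  by apply/critE/eqP; rewrite (hform_line_eq0 z0 (jac_form hF d1 FM)) Jz.
exact: (van_line hq qv).
Qed.
End CriticallyFinite.

(** * Normal families *)

Section NormalFamilies.
Local Open Scope classical_set_scope.
Import numFieldNormedType.Exports.
Variables (C : numClosedFieldType) (k : nat).
Local Notation P := (proj_space C k).

Lemma compact_seq (T : topologicalType) (u : nat -> T) l : u @ \oo --> l -> compact ([set l] `|` range u).
Proof.
move=> ul F PF FK; have [cl|ncl] := pselect (cluster F l); first by exists l; split=> //; left.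
have [A [N [FA Nl AN]]] : exists A N, [/\ F A, nbhs l N & A `&` N = set0].
  apply: contrapT => h; apply: ncl => A B FA NB; apply/set0P/eqP => AB0.
  by apply: h; exists A, B.
have [m _ Hm] : \forall j \near \oo, N (u j) by exact: ul Nl.
pose S := [set u j | j in `I_m].
have cS : compact S by apply: finite_compact; exact: finite_image.
have FS : F S.
  apply: filterS (filterI FA FK) => x [Ax]; case=> [xl|[j _ jx]].
    rewrite xl in Ax; have : (A `&` N) l by split=> //; exact: nbhs_singleton.
    by rewrite AN.
  rewrite -jx in Ax *; exists j => //=; rewrite ltnNge; apply/negP => mj.
  have : (A `&` N) (u j) by split=> //; exact: Hm.
  by rewrite AN.
by have [x [[j jm jx] cx]] := cS F PF FS; exists x; split=> //; right; exists j.
Qed.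

Lemma open_line_ball (U : set P) (v : 'rV[C]_k.+1) (v0 : v != 0) : open U -> U (line v0) ->
  exists2 e : C, 0 < e & forall w : 'rV[C]_k.+1, (forall j, `|w 0 j - v 0 j| < e) -> exists w0 : w != 0, U (line w0).
Proof.
move=> /open_proj_spaceE oV Uv; have : nbhs v [set v : 'rV[C]_k.+1 | exists v0 : v != 0, U (line v0)].
  by apply: open_nbhs_nbhs; split=> //; exists v0.
move=> /nbhs_ballP[e /= e0 H]; exists e => // w wv; apply: H; split=> // i j.
by rewrite -ball_normE /= (ord1 i) distrC.
Qed.

Lemma cvg_line (u : nat -> 'rV[C]_k.+1) (u0 : forall n, u n != 0) (v : 'rV[C]_k.+1) (v0 : v != 0) :
  (forall e : C, 0 < e -> exists N, forall n, (N <= n)%N -> forall j, `|u n 0 j - v 0 j| < e) ->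
  (fun n => line (u0 n)) @ \oo --> line v0.
Proof.
move=> uv A /=; rewrite nbhsE /= => -[B [oB Bv] BA].
have [e e0 He] := open_line_ball oB Bv; have [N HN] := uv e e0.
exists N => // n Nn; apply: BA; have [w0 Uw] := He _ (HN n Nn).
by rewrite (_ : u0 n = w0)//; exact: bool_irrelevance.
Qed.

Lemma uniform_orthoproj (K : set P) (s : nat -> P -> P) (g : P -> P) (e : C) : 0 < e ->
  {uniform K, s @ \oo --> g} -> exists N, forall n, (N <= n)%N -> forall p, K p -> forall i j,
    `|orthoproj (hcoord (g p)) i j - orthoproj (hcoord (s n p)) i j| < e.
Proof.
move=> e0 sg; pose Phi (p : P) := orthoproj (hcoord p).
pose E := [set pq : P * P | ball (Phi pq.1) e (Phi pq.2)].
have entE : entourage E.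
  exists [set xy : 'M[C]_k.+1 * 'M[C]_k.+1 | ball xy.1 e xy.2] => //.
  by have := @entourage_ball _ 'M[C]_k.+1 (PosNum e0).
have : nbhs (g : {uniform` K -> P}) [set h | forall p, K p -> E (g p, h p)].
  by apply/uniform_nbhs; exists E; split.
move=> /sg[N _ HN]; exists N => n Nn p Kp i j.
by have := (HN n Nn p Kp).2 i j; rewrite -ball_normE.
Qed.
End NormalFamilies.

(** * From a Fatou point to a locally uniform projective Cauchy property *)

Section FatouCauchy.
Local Open Scope classical_set_scope.
Import numFieldNormedType.Exports.
Variables (R : realType) (k : nat).
Local Notation C := R[i].
Local Notation P := (proj_space C k).
Local Notation V := 'rV[C]_k.+1.
Variables (f : P -> P) (F : V -> V).
Hypothesis fF : forall (v : V) (v0 : v != 0), exists Fv0 : F v != 0, f (line v0) = line Fv0.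

Lemma iter_line m (v : V) (v0 : v != 0) : exists v0' : iter m F v != 0, iter m f (line v0) = line v0'.
Proof.
elim: m => [|m [v0' IH]]; first by exists v0.
by have [v1 e] := fF v0'; exists v1; rewrite /= IH.
Qed.

Lemma nc_lt (z : C) (e : R) : (`|z| < e%:C%C) = (nc z < e).
Proof. by rewrite ncE ltcR. Qed.

Lemma posC (e : C) : 0 < e -> exists2 r : R, 0 < r & e = r%:C%C.
Proof. by move=> e0; exists (nc e); [rewrite nc_gt0 lt0r_neq0|rewrite -ncE gtr0_norm]. Qed.

(** Applying both projections to [x] writes it as a multiple of [y] plus an error bounded by the
    distance of the projections; only the error contributes to the minors. *)
Lemma minor_orthoproj (x y : V) (e : R) : x != 0 ->
  (forall i j, nc (orthoproj x i j - orthoproj y i j) <= e) ->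
  forall a b, nc (minor x y a b) <= 2 * e * (nm x * nm y).
Proof.
move=> x0 H a b; set t := (\sum_i x 0 i * (y 0 i)^*) / \sum_l `|y 0 l| ^+ 2.
have xE : x = x *m (orthoproj x - orthoproj y) + t *: y.
  by rewrite mulmxBr mulmx_orthoproj_id// mulmx_orthoproj subrK.
set z := x *m (orthoproj x - orthoproj y) in xE.
have zb j : nc (z 0 j) <= e * nm x.
  rewrite /z mxE; apply: le_trans (nc_sum _ _ _) _.
  have -> : nm x = \sum_l nc (x 0 l) by rewrite /nm big_ord_recl big_ord0 addr0.
  rewrite mulr_sumr.
  apply: ler_sum => l _; rewrite ncM mulrC ler_wpM2r ?nc_ge0//.
  by have := H l j; rewrite !mxE.
have -> : minor x y a b = z 0 a * y 0 b - z 0 b * y 0 a.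
  by rewrite /minor [in LHS]xE !mxE; ring.
apply: le_trans (ncB _ _) _; rewrite !ncM.
have h i j : nc (z 0 i) * nc (y 0 j) <= e * nm x * nm y.
  by apply: ler_pM; rewrite ?nc_ge0 ?nm_coord.
by have := h a b; have := h b a; rewrite -!mulrA; lra.
Qed.

(** Normality speaks of compact sets. Were the Cauchy property false, counterexamples would
    accumulate at a point of the domain, and uniform convergence on the compact set made of a
    convergent sequence of them and its limit already contradicts their choice. *)
Lemma fatou_cauchy : fatou_set f !=set0 -> exists (nj : nat -> nat) (x0 : V) (de0 : R),
  [/\ {homo nj : i j / (i < j)%N}, x0 != 0, 0 < de0 &
  forall om : R, 0 < om -> exists J, forall i j, (J <= i)%N -> (J <= j)%N ->
  forall z, nm (z - x0) < de0 -> forall a b,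
    nc (minor (iter (nj i) F z) (iter (nj j) F z) a b) <= om * (nm (iter (nj i) F z) * nm (iter (nj j) F z))].
Proof.
move=> [p [U [oU nU] Up]]; have [|phi hphi [g Hg]] := nU (fun n => iter n.+1 f); first by move=> n; exists n.+1.
pose x0 := hcoord p; have x00 : x0 != 0 by exact: hcoord_neq0.
have Ux0 : U (line x00).
  by rewrite (_ : x00 = hcoord_neq0 p) ?hcoordK//; exact: bool_irrelevance.
have [e e0 He] := open_line_ball oU Ux0; have [r r0 re] := posC e0.
have Hr z : nm (z - x0) <= r / 2 -> exists z0 : z != 0, U (line z0).
  move=> zr; apply: He => j; rewrite re nc_lt; apply: le_lt_trans (_ : r / 2 < r); last by lra.
  by apply: le_trans zr; have := nm_coord (z - x0) 0 j; rewrite !mxE.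
exists (fun j => (phi j).+1), x0, (r / 2); split.
- by move=> i j ij; exact: hphi.
- exact: x00.
- by rewrite divr_gt0.
move=> om om0; have e4 : om / 2 = om / 4 + om / 4 by lra.
have om2E : 2 * (om / 2) = om by lra.
apply: contrapT => /forallNP no.
have /choice[t Ht] J : exists t : nat * nat * V * 'I_k.+1 * 'I_k.+1, let: (i, j, z, a, b) := t in
    [/\ (J <= i)%N, (J <= j)%N, nm (z - x0) < r / 2 &
     om * (nm (iter (phi i).+1 F z) * nm (iter (phi j).+1 F z)) < nc (minor (iter (phi i).+1 F z) (iter (phi j).+1 F z) a b)].
  apply: contrapT => /forallNP h; apply: (no J) => i j Ji Jj z zr a b; rewrite leNgt; apply/negP => lt.
  by apply: (h (i, j, z, a, b)).
pose z J := (t J).1.1.2.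
have zr J : nm (z J - x0) < r / 2 by rewrite /z; move: (Ht J); case: (t J) => [[[[i j] w] a] b] [].
have [|ps [hps [w cw]]] := @bw _ _ _ z (nm x0 + r / 2).
  by move=> J; have := zr J; have := nmB_ge (z J) x0; lra.
have wr : nm (w - x0) <= r / 2.
  have cn := nm_cv (cvsB x0 cw); apply: cvr_le cn _ => J; exact: ltW (zr _).
have [w0 Uw] := Hr w wr.
have zn J : z (ps J) != 0 by have [] := Hr (z (ps J)) (ltW (zr _)).
have Uz J : U (line (zn J)).
  by have [z0 Uz] := Hr (z (ps J)) (ltW (zr _)); rewrite (_ : zn J = z0)//; exact: bool_irrelevance.
have cl : (fun J => line (zn J)) @ \oo --> line w0.
  apply: cvg_line => e' e'0; have [r' r'0 ->] := posC e'0; have [N HN] := cw r' r'0.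
  exists N => J NJ j; rewrite nc_lt; apply: le_lt_trans (HN J NJ).
  by have := nm_coord (z (ps J) - w) 0 j; rewrite !mxE.
have cK := compact_seq cl; set K := _ `|` _ in cK.
have KU : K `<=` U by move=> q [->//|[J _ <-]].
have om4 : 0 < om / 4 by rewrite divr_gt0.
have om4C : 0 < (om / 4)%:C%C :> C by rewrite ltcR.
have [N HN] := uniform_orthoproj om4C (Hg K cK KU).
have NJ : (N <= ps N)%N by exact: homo_ge.
have := Ht (ps N); have := zn N; have := HN; rewrite /z.
have Kz : K (line (zn N)) by right; exists N.
move: (zn N) Kz; rewrite /z; case: (t (ps N)) => [[[[i j] u] a] b] /= u0 Ku HN' _ [Ji Jj ur].
apply/negP; rewrite -leNgt.
have close m : (N <= m)%N -> forall i j, nc (orthoproj (hcoord (g (line u0))) i j - orthoproj (iter (phi m).+1 F u) i j) <= om / 4.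
  move=> Nm i' j'; have := HN' m Nm _ Ku i' j'; rewrite nc_lt.
  have [v1 ev] := iter_line (phi m).+1 u0; rewrite -[f _]/(iter (phi m).+1 f (line u0)) ev orthoproj_line.
  exact: ltW.
have ui : iter (phi i).+1 F u != 0 by have [] := iter_line (phi i).+1 u0.
rewrite -[X in X * _]om2E; apply: minor_orthoproj => // i' j'.
have h1 := close i (leq_trans NJ Ji) i' j'; have h2 := close j (leq_trans NJ Jj) i' j'.
apply: le_trans (nc_tri (orthoproj (hcoord (g (line u0))) i' j') _ _) _.
by rewrite ncBC e4; apply: lerD; [exact: h1|exact: h2].
Qed.
End FatouCauchy.

Local Open Scope classical_set_scope.

Theorem theorem1p2 (R : realType) (k : nat) (d : nat)
    (f : proj_space R[i] k -> proj_space R[i] k)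
    (hk : (1 <= k)%N) (hf : holomorphic f)
    (hd : has_algebraic_degree f d) (hd1 : (1 < d)%N)
    (hcf : n_crit_finite f k) :
  fatou_set f = set0.
Proof.
apply/eqP/negPn/negP => /set0P nF.
have [q fq] := hd; pose F (v : 'rV[R[i]]_k.+1) := \row_i heval (q i) v.
have hF j : hform d (fun v => F v 0 j).
  have [h1 h2] := hform_dhomog (q j).
  by split=> [|c v]; [apply: pf_ext h1 _ => v|]; rewrite !mxE; last exact: h2.
have Fn0 v : v != 0 -> F v != 0 by move=> v0; have [] := fq v v0.
have [M FM] := bez_exists (hom_pmap hF).
have critE p : critical_set f p <-> jac M (hcoord p) = 0 by exact: (critical_setE hF hd1 FM hf fq).
have [e [P [c [hP e0 _ Jc [Pc Pcrit]]]]] := post_critical_form hF Fn0 hk hd1 FM fq critE hcf.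
have [N HN] := hits_bound hF Fn0 hk hd1 FM fq critE hcf.
have hits z m : z != 0 -> (\sum_(i < m) ((jac M (iter i F z) == 0)%R : nat) <= N)%N.
  move=> z0; apply: leq_trans (HN (line z0) m); apply: eq_leq; apply: eq_bigr => i _.
  have [v0 ->] := iter_line fq i z0; have [a a0 aE] := (line_eq _ _).1 (hcoordK (line v0)).
  congr (nat_of_bool _); apply/eqP/asboolP => [J0|/critE].
    by apply/critE; rewrite aE (hform_jac hF hd1 FM).2 J0 mulr0.
  by rewrite aE (hform_jac hF hd1 FM).2 => /eqP; rewrite mulf_eq0 expf_eq0 (negPf a0) andbF => /eqP.
have [nj [x0 [de0 [hnj x00 de00 HC]]]] := fatou_cauchy fq nF.
exact: (no_cauchy hF Fn0 hd1 FM hP e0 Pc Jc Pcrit hits hnj x00 de00 HC).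
Qed.
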